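(* Let $n,m\ge1$ be integers, let $\frac{n+m}{4}+\frac{n+m}{2(n+m+2)}<s<\frac{n+m}2$, let $1\le\alpha'<2$, and let $\gamma_0\in\mathfrak S^{\alpha',s}(L^2(\mathbb R^n\times\mathbb T^m))$ be self-adjoint. Put $\gamma(t)=e^{it\Delta}\gamma_0e^{-it\Delta}$. Then the densities $\rho_{\gamma_0}$ and $\rho_{\gamma(t)}$ are well defined, and $$\lim_{t\to0}\rho_{\gamma(t)}(x,y)=\rho_{\gamma_0}(x,y)\qquad\text{for a.e. }(x,y)\in\mathbb R^n\times\mathbb T^m.$$
   Context: $\mathbb T=\mathbb R/\mathbb Z$ and $\mathcal M=\mathbb R^n\times\mathbb T^m$. With $\widehat f(\xi,k)=\int f(x,y)e^{-2\pi i(x\cdot\xi+y\cdot k)}dx\,dy$, $(\xi,k)\in\mathbb R^n\times\mathbb Z^m$, the operators $\langle\nabla\rangle^{\sigma}$ and $e^{it\Delta}$ are the Fourier multipliers with symbols $(1+|\xi|^2+|k|^2)^{\sigma/2}$ and $e^{2\pi it(|\xi|^2+|k|^2)}$. $H^{\sigma}(\mathcal M)=\langle\nabla\rangle^{-\sigma}L^2(\mathcal M)$. Schatten spaces: $\mathfrak S^{\alpha}(\mathcal H)$ is the set of compact operators $A$ on the Hilbert space $\mathcal H$ with $\|A\|_{\mathfrak S^\alpha}=(\operatorname{Tr}|A|^\alpha)^{1/\alpha}<\infty$. Sobolev–Schatten space: $\mathfrak S^{\alpha',s}(L^2(\mathcal M))$ is the set of compact operators $\gamma:H^{-s}(\mathcal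 M)\to H^{s}(\mathcal M)$ with $\|\langle\nabla\rangle^s\gamma\langle\nabla\rangle^s\|_{\mathfrak S^{\alpha'}(L^2(\mathcal M))}<\infty$. The function $\gamma(t)=e^{it\Delta}\gamma_0e^{-it\Delta}$ is the solution of $i\partial_t\gamma=[-\Delta,\gamma]$, $\gamma|_{t=0}=\gamma_0$. Densities: a self-adjoint $\gamma_0\in\mathfrak S^{\alpha',s}$ can be written $\gamma_0=\sum_j\lambda_j\langle\nabla\rangle^{-s}|f_j\rangle\langle f_j|\langle\nabla\rangle^{-s}$ with $(\lambda_j)_j\in\ell^{\alpha'}$ real and $(f_j)_j$ orthonormal in $L^2(\mathcal M)$, where $|f\rangle\langle g|$ is the operator $h\mapsto\langle g,h\rangle f$. Then $\rho_{\gamma_0}=\sum_j\lambda_j|\langle\nabla\rangle^{-s}f_j|^2$ and $\rho_{\gamma(t)}=\sum_j\lambda_j|e^{it\Delta}\langle\nabla\rangle^{-s}f_j|^2$; ''well defined'' means that for each $t$ the partial sums converge in $L^2(B^n(x_0,1)\times\mathbb T^m)$ for every unit ball $B^n(x_0,1)\subset\mathbb R^n$. Pointwise values of $\rho_{\gamma(t)}$ are the sums of this series at the given point, where pointwise values of $e^{it\Delta}g$ for $g\in H^s$ are $\lim_{N\to\infty}\sum_{k}\int\eta((\xi,k)/N)e^{2\pi i(x\cdot\xi+y\cdot k+t(|\xi|^2+|k|^2))}\widehat g(\xi,k)\,d\xi$ over dyadic $N$, with $\eta(\zeta)=\prod_{i=1}^{n+m}\eta_1(\zeta_i)$ and $\eta_1:\mathbb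 R\to[0,1]$ smooth, even, equal to $1$ on $[-1,1]$ and $0$ outside $(-2,2)$. *)

(* Defs.v *)
From HB Require Import structures.
From mathcomp Require Import all_boot all_order all_algebra.
From mathcomp Require Import all_classical all_reals all_analysis.
From mathcomp Require Import measurable_realfun complex ring lra.

Set Implicit Arguments.
Unset Strict Implicit.
Unset Printing Implicit Defensive.
Import Order.TTheory GRing.Theory Num.Theory.
Import numFieldNormedType.Exports.
Local Open Scope classical_set_scope.
Local Open Scope complex_scope.
Local Open Scope ring_scope.

Local Notation Re := complex.Re.
Local Notation Im := complex.Im.

Section SquareModulus.
Context {R : realType}.
Implicit Types z w a : R[i].

Definition sqmod z : R := Re z ^+ 2 + Im z ^+ 2.

Lemma sqmod_ge0 z : 0 <= sqmod z.
Proof. by rewrite addr_ge0 ?sqr_ge0. Qed.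

Lemma sqmod_eq0 z : sqmod z = 0 -> z = 0.
Proof.
case: z => x y; rewrite /sqmod/= => /eqP.
by rewrite paddr_eq0 ?sqr_ge0// !sqrf_eq0 => /andP[/eqP -> /eqP ->].
Qed.

Lemma sqmodM z w : sqmod (z * w) = sqmod z * sqmod w.
Proof. by case: z w => [a b] [x y]; rewrite /sqmod/=; ring. Qed.

Lemma sqmodD_le z w : sqmod (z + w) <= 2 * (sqmod z + sqmod w).
Proof.
case: z w => [a b] [x y]; rewrite /sqmod/= -subr_ge0.
have -> : 2 * (a ^+ 2 + b ^+ 2 + (x ^+ 2 + y ^+ 2)) -
  ((a + x) ^+ 2 + (b + y) ^+ 2) = (a - x) ^+ 2 + (b - y) ^+ 2 by ring.
by rewrite addr_ge0 ?sqr_ge0.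
Qed.

Lemma ReconjM_le z w : `|Re (z^* * w)| <= sqmod z + sqmod w.
Proof.
case: z w => [a b] [x y]; rewrite /sqmod/= ler_norml.
have := sqr_ge0 (a - x); have := sqr_ge0 (b - y).
have := sqr_ge0 (a + x); have := sqr_ge0 (b + y).
have := sqr_ge0 a; have := sqr_ge0 b; have := sqr_ge0 x; have := sqr_ge0 y.
by move=> *; apply/andP; split; nra.
Qed.

Lemma ImconjM_le z w : `|Im (z^* * w)| <= sqmod z + sqmod w.
Proof.
case: z w => [a b] [x y]; rewrite /sqmod/= ler_norml.
have := sqr_ge0 (a - y); have := sqr_ge0 (b - x).
have := sqr_ge0 (a + y); have := sqr_ge0 (b + x).
have := sqr_ge0 a; have := sqr_ge0 b; have := sqr_ge0 x; have := sqr_ge0 y.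
by move=> *; apply/andP; split; nra.
Qed.

End SquareModulus.

Section ComplexFunctions.
Context {d} {T : measurableType d} {R : realType}.
Implicit Types f g : T -> R[i].

Definition cmeasurable f : Prop :=
  measurable_fun setT (fun x => Re (f x)) /\
  measurable_fun setT (fun x => Im (f x)).

Lemma cmeasurable_cst (c : R[i]) : cmeasurable (cst c).
Proof. by split; exact: measurable_cst. Qed.

Lemma cmeasurableD f g : cmeasurable f -> cmeasurable g ->
  cmeasurable (fun x => f x + g x).
Proof.
move=> [fr fi] [gr gi]; split.
  rewrite (_ : (fun x => _) = (fun x => Re (f x)) \+ (fun x => Re (g x))).
    exact: measurable_funD.
  by apply/funext => x /=; case: (f x) (g x) => ? ? [].
rewrite (_ : (fun x => _) = (fun x => Im (f x)) \+ (fun x => Im (g x))).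
  exact: measurable_funD.
by apply/funext => x /=; case: (f x) (g x) => ? ? [].
Qed.

Lemma cmeasurableM f g : cmeasurable f -> cmeasurable g ->
  cmeasurable (fun x => f x * g x).
Proof.
move=> [fr fi] [gr gi]; split.
  rewrite (_ : (fun x => _) =
    ((fun x => Re (f x)) \* (fun x => Re (g x))) \-
    ((fun x => Im (f x)) \* (fun x => Im (g x)))).
    by apply: measurable_funB; exact: measurable_funM.
  by apply/funext => x /=; case: (f x) (g x) => ? ? [].
rewrite (_ : (fun x => _) =
  ((fun x => Re (f x)) \* (fun x => Im (g x))) \+
  ((fun x => Im (f x)) \* (fun x => Re (g x)))).
  by apply: measurable_funD; exact: measurable_funM.
by apply/funext => x /=; case: (f x) (g x) => ? ? [].
Qed.

Lemma cmeasurable_conj f : cmeasurable f -> cmeasurable (fun x => (f x)^*).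
Proof.
move=> [fr fi]; split.
  by rewrite (_ : (fun x => _) = (fun x => Re (f x)))//;
    apply/funext => x; case: (f x).
rewrite (_ : (fun x => _) = \- (fun x => Im (f x))).
  exact: measurableT_comp.
by apply/funext => x /=; case: (f x).
Qed.

Lemma measurable_sqmod f : cmeasurable f ->
  measurable_fun setT (fun x => sqmod (f x)).
Proof.
by move=> [fr fi]; apply: measurable_funD; exact: measurable_funX.
Qed.

Variable mu : {measure set T -> \bar R}.

Definition cintegral f : R[i] :=
  (\int[mu]_x Re (f x)) +i* (\int[mu]_x Im (f x)).

Definition square_integrable f : Prop :=
  cmeasurable f /\ (\int[mu]_x (sqmod (f x))%:E < +oo)%E.

Definition sqint : {pred T -> R[i]^o} :=
  fun f => `[< square_integrable f >].

Lemma sqint_submod_closed : submod_closed sqint.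
Proof.
split=> [|a f g]; rewrite !unfold_in.
  apply/asboolP; split; first exact: cmeasurable_cst.
  rewrite (eq_integral (cst 0%E)) ?integral0//.
  by move=> x _ /=; rewrite /sqmod/= expr0n addr0.
move=> /asboolP[mf lf] /asboolP[mg lg]; apply/asboolP.
have ma : cmeasurable (fun x => a * f x).
  by apply: cmeasurableM => //; exact: cmeasurable_cst.
split; first exact: (cmeasurableD ma mg).
have int h : cmeasurable h -> (\int[mu]_x (sqmod (h x))%:E < +oo)%E ->
    forall c : R, 0 <= c -> (\int[mu]_x (c * sqmod (h x))%:E < +oo)%E.
  move=> mh lh c c0.
  under eq_integral do rewrite EFinM.
  rewrite ge0_integralZl//=.
  - by rewrite lte_mul_pinfty ?lee_fin.
  - exact/measurable_EFinP/measurable_sqmod.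
  - by move=> x _; rewrite lee_fin sqmod_ge0.
apply: (@le_lt_trans _ _
    (\int[mu]_x (2 * sqmod a * sqmod (f x) + 2 * sqmod (g x))%:E)%E).
  apply: ge0_le_integral => //=.
  - by move=> x _; rewrite lee_fin sqmod_ge0.
  - exact/measurable_EFinP/measurable_sqmod/(cmeasurableD ma mg).
  - apply/measurable_EFinP/measurable_funD; apply: measurable_funM => //;
      exact: measurable_sqmod.
  - move=> x _; rewrite lee_fin -mulrA -mulrDr -sqmodM; exact: sqmodD_le.
under eq_integral do rewrite EFinD.
rewrite ge0_integralD//=.
- by rewrite lte_add_pinfty// int// mulr_ge0// sqmod_ge0.
- by move=> x _; rewrite lee_fin !mulr_ge0// sqmod_ge0.
- by apply/measurable_EFinP/measurable_funM => //; exact: measurable_sqmod.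
- by move=> x _; rewrite lee_fin mulr_ge0// sqmod_ge0.
- by apply/measurable_EFinP/measurable_funM => //; exact: measurable_sqmod.
Qed.

HB.instance Definition _ := GRing.isSubmodClosed.Build R[i] (T -> R[i]^o) sqint
  sqint_submod_closed.

Record sqfun := SqFun { sqval :> T -> R[i]^o ; sqvalP : sqval \in sqint }.

HB.instance Definition _ := [isSub for sqval].
HB.instance Definition _ := [Choice of sqfun by <:].
HB.instance Definition _ := [SubChoice_isSubLmodule of sqfun by <:].

End ComplexFunctions.

Section L2.
Local Open Scope quotient_scope.
Context {d} {T : measurableType d} {R : realType}.
Variable mu : {measure set T -> \bar R}.
Implicit Types f g : sqfun mu.

Lemma sqfun_cmeasurable f : cmeasurable f.
Proof. by case: f => f /=; rewrite unfold_in => /asboolP[]. Qed.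

Lemma sqfun_lty f : (\int[mu]_x (sqmod (f x))%:E < +oo)%E.
Proof. by case: f => f /=; rewrite unfold_in => /asboolP[]. Qed.

Definition sqnull : {pred sqfun mu} :=
  fun f => `[< {ae mu, forall x, sqval f x = 0} >].

Lemma sqnull_zmod_closed : zmod_closed sqnull.
Proof.
split=> [|f g]; rewrite !unfold_in; first by apply/asboolP; exact: aeW.
move=> /asboolP f0 /asboolP g0; apply/asboolP.
apply: filterS2 f0 g0 => x /=.
by move=> fx gx; change (sqval f x - sqval g x = 0); rewrite fx gx subrr.
Qed.

HB.instance Definition _ := GRing.isZmodClosed.Build (sqfun mu) sqnull
  sqnull_zmod_closed.

Definition L2 : Type := Quotient.quot sqnull.

HB.instance Definition _ := GRing.Zmodule.on L2.

Definition L2class (f : sqfun mu) : L2 := \pi_(Quotient.quot sqnull) f.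
Definition L2repr (u : L2) : sqfun mu := repr (u : Quotient.quot sqnull).

Lemma L2reprK : cancel L2repr L2class.
Proof. exact: reprK. Qed.

Lemma L2classE f g :
  L2class f = L2class g <-> {ae mu, forall x, f x = g x}.
Proof.
split.
  move=> /eqmodP; rewrite /= /Quotient.equiv unfold_in => /asboolP.
  apply: filterS => x fgx.
  by have /subr0_eq : sqval f x - sqval g x = 0 by exact: fgx.
move=> fg; apply/eqmodP; rewrite /= /Quotient.equiv unfold_in; apply/asboolP.
apply: filterS fg => x fgx; change (sqval f x - sqval g x = 0).
by rewrite fgx subrr.
Qed.

Lemma L2repr_class f : {ae mu, forall x, L2repr (L2class f) x = f x}.
Proof. by apply/L2classE; rewrite L2reprK. Qed.

Lemma L2classD f g : L2class (f + g) = L2class f + L2class g.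
Proof. by rewrite /L2class [LHS]raddfD. Qed.

Lemma L2class0 : L2class 0 = 0.
Proof. by rewrite /L2class [LHS]raddf0. Qed.

Definition L2scale (a : R[i]) (u : L2) : L2 := L2class (a *: L2repr u).

Lemma L2scale_class (a : R[i]) f : L2scale a (L2class f) = L2class (a *: f).
Proof.
apply/L2classE; apply: filterS (L2repr_class f) => x fx.
by change (a * sqval (L2repr (L2class f)) x = a * sqval f x); rewrite fx.
Qed.

Let L2scaleA a b u : L2scale a (L2scale b u) = L2scale (a * b) u.
Proof. by rewrite -[u]L2reprK !L2scale_class scalerA. Qed.

Let L2scale1 : left_id 1 L2scale.
Proof. by move=> u; rewrite -[u]L2reprK L2scale_class scale1r. Qed.

Let L2scaleDr : right_distributive L2scale +%R.
Proof.
move=> a u v; rewrite -[u]L2reprK -[v]L2reprK -L2classD !L2scale_class.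
by rewrite scalerDr L2classD.
Qed.

Let L2scaleDl u : {morph L2scale^~ u : a b / a + b}.
Proof.
by move=> a b; rewrite -[u]L2reprK !L2scale_class scalerDl L2classD.
Qed.

HB.instance Definition _ := GRing.Zmodule_isLmodule.Build R[i] L2
  L2scaleA L2scale1 L2scaleDr L2scaleDl.

End L2.

HB.mixin Record Lmodule_hasInner (R : realType) H & GRing.Lmodule R[i] H := {
  inner : H -> H -> R[i];
  innerDr : forall u v w, inner u (v + w) = inner u v + inner u w;
  innerZr : forall a u v, inner u (a *: v) = a * inner u v;
  inner_conj : forall u v, inner v u = (inner u v)^*;
  inner_ge0 : forall u, 0 <= inner u u;
  inner_eq0 : forall u, inner u u = 0 -> u = 0
}.

#[short(type="prehilbertType")]
HB.structure Definition PreHilbert (R : realType) :=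
  { H of GRing.Lmodule R[i] H & Lmodule_hasInner R H }.

Section L2inner.
Context {d} {T : measurableType d} {R : realType}.
Variable mu : {measure set T -> \bar R}.
Implicit Types (u v w : L2 mu) (f g : T -> R[i]).

Let cintegrable f := mu.-integrable setT (fun x => (Re (f x))%:E) /\
  mu.-integrable setT (fun x => (Im (f x))%:E).

Let cintegralD f g : cintegrable f -> cintegrable g ->
  cintegral mu (fun x => f x + g x) = cintegral mu f + cintegral mu g.
Proof.
move=> [fr fi] [gr gi]; rewrite /cintegral; apply/eqP; rewrite eq_complex /=.
rewrite -!RintegralD//; apply/andP; split; apply/eqP; congr Rintegral;
  by apply/funext => x; case: (f x) (g x) => ? ? [].
Qed.

Let cintegralZ (a : R[i]) f : cintegrable f ->
  cintegral mu (fun x => a * f x) = a * cintegral mu f.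
Proof.
case: a => a b [fr fi]; rewrite /cintegral; apply/eqP.
have iZ k h : mu.-integrable setT (fun x => (h x)%:E) ->
    mu.-integrable setT (EFin \o (fun x => k * h x)).
  by move=> hi; apply: eq_integrable (integrableZl _ k hi).
rewrite eq_complex /= -!RintegralZl// -RintegralB//; try exact: iZ.
rewrite -RintegralD//; try exact: iZ.
apply/andP; split; apply/eqP; congr Rintegral;
  by apply/funext => x; case: (f x).
Qed.

Let cintegral_conj f : cintegrable f ->
  cintegral mu (fun x => (f x)^*) = (cintegral mu f)^*.
Proof.
move=> [fr fi]; rewrite /cintegral; apply/eqP; rewrite eq_complex /=.
rewrite -[- Rintegral _ _ _]mulN1r -RintegralZl//.
apply/andP; split; apply/eqP; congr Rintegral;
  by apply/funext => x; case: (f x) => ? ?; rewrite /= ?mulN1r.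
Qed.

Let ae_cintegral f g : cmeasurable f -> cmeasurable g ->
  {ae mu, forall x, f x = g x} -> cintegral mu f = cintegral mu g.
Proof.
move=> [fr fi] [gr gi] fg; rewrite /cintegral; congr Complex; congr fine;
  (apply: ae_eq_integral => //; try exact/measurable_EFinP);
  by apply: filterS fg => x /= ->.
Qed.

Let cmeasurableIM u v :
  cmeasurable (fun x => (L2repr u x)^* * L2repr v x).
Proof.
apply: cmeasurableM; last exact: sqfun_cmeasurable.
by apply: cmeasurable_conj; exact: sqfun_cmeasurable.
Qed.

Let cintegrableIM u v :
  cintegrable (fun x => (L2repr u x)^* * L2repr v x).
Proof.
have [mr mi] := cmeasurableIM u v.
have int_sq w : mu.-integrable setT (fun x => (sqmod (L2repr w x))%:E).
  apply/integrableP; split.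
    exact/measurable_EFinP/measurable_sqmod/sqfun_cmeasurable.
  apply: le_lt_trans (sqfun_lty (L2repr w)); apply: ge0_le_integral => //=.
  - apply/measurable_EFinP; apply: measurableT_comp => //.
    exact/measurable_sqmod/sqfun_cmeasurable.
  - exact/measurable_EFinP/measurable_sqmod/sqfun_cmeasurable.
  - by move=> x _; rewrite lee_fin ger0_norm// sqmod_ge0.
have int_sqD := integrableD measurableT (int_sq u) (int_sq v).
split.
  apply: (le_integrable measurableT _ _ int_sqD); first exact/measurable_EFinP.
  move=> x _; have := ReconjM_le (L2repr u x) (L2repr v x).
  by rewrite -lee_fin => /le_trans; apply; rewrite lee_fin ler_norm.
apply: (le_integrable measurableT _ _ int_sqD); first exact/measurable_EFinP.
move=> x _; have := ImconjM_le (L2repr u x) (L2repr v x).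
by rewrite -lee_fin => /le_trans; apply; rewrite lee_fin ler_norm.
Qed.

Definition L2inner u v : R[i] :=
  cintegral mu (fun x => (L2repr u x)^* * L2repr v x).

Let L2innerDr u v w : L2inner u (v + w) = L2inner u v + L2inner u w.
Proof.
rewrite -cintegralD; [|exact: cintegrableIM..].
apply: ae_cintegral; first exact: cmeasurableIM.
  by apply: cmeasurableD; exact: cmeasurableIM.
have : L2class (L2repr (v + w)) = L2class (L2repr v + L2repr w).
  by rewrite L2classD !L2reprK.
move=> /L2classE; apply: filterS => x ->.
by rewrite -mulrDr; congr (_ * _).
Qed.

Let L2innerZr a u v : L2inner u (a *: v) = a * L2inner u v.
Proof.
rewrite -cintegralZ; last exact: cintegrableIM.
apply: ae_cintegral; first exact: cmeasurableIM.
  by apply: cmeasurableM; [exact: cmeasurable_cst|exact: cmeasurableIM].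
have := L2repr_class (a *: L2repr v); apply: filterS => x.
rewrite -[a *: v]/(L2class (a *: L2repr v)) => ->.
by rewrite mulrCA; congr (_ * _).
Qed.

Let L2inner_conj u v : L2inner v u = (L2inner u v)^*.
Proof.
rewrite -cintegral_conj; last exact: cintegrableIM.
by congr cintegral; apply/funext => x; rewrite rmorphM/= conjCK mulrC.
Qed.

Let L2inner_self u : L2inner u u = (\int[mu]_x sqmod (L2repr u x))%:C.
Proof.
rewrite /L2inner /cintegral; congr Complex.
  congr Rintegral; apply/funext => x.
  by case: (L2repr u x) => a b; rewrite /sqmod/=; ring.
rewrite (_ : (fun x => _) = cst 0); first by rewrite Rintegral_cst// mul0r.
by apply/funext => x; case: (L2repr u x) => a b /=; ring.
Qed.

Let L2inner_ge0 u : 0 <= L2inner u u.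
Proof.
rewrite L2inner_self ler0c; apply: Rintegral_ge0 => x _; exact: sqmod_ge0.
Qed.

Let L2inner_eq0 u : L2inner u u = 0 -> u = 0.
Proof.
rewrite L2inner_self => -[]; rewrite /Rintegral => u0.
have : (\int[mu]_x (sqmod (L2repr u x))%:E = 0)%E.
  rewrite -[LHS]fineK ?u0// ge0_fin_numE ?sqfun_lty//.
  by apply: integral_ge0 => x _; rewrite lee_fin sqmod_ge0.
move=> iu0; rewrite -[u]L2reprK -L2class0.
apply/L2classE.
have /ae_eq_integral_abs : measurable_fun setT (fun x => (sqmod (L2repr u x))%:E).
  exact/measurable_EFinP/measurable_sqmod/sqfun_cmeasurable.
move=> /(_ mu measurableT)[+ _].
under eq_integral do rewrite gee0_abs ?lee_fin ?sqmod_ge0//.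
move=> /(_ iu0); apply: filterS => x /(_ Logic.I)/= [].
exact: sqmod_eq0.
Qed.

HB.instance Definition _ := Lmodule_hasInner.Build R (L2 mu)
  L2innerDr L2innerZr L2inner_conj L2inner_ge0 L2inner_eq0.

End L2inner.

Section MeasurePower.
Context {d} {T : measurableType d} {R : realType}.
Variable mu : {sigma_finite_measure set T -> \bar R}.

Definition tcons n (p : T * n.-tuple T) : n.+1.-tuple T :=
  [tuple of p.1 :: p.2].

Lemma measurable_tcons n : measurable_fun setT (@tcons n).
Proof. exact: measurable_cons. Qed.

Section Step.
Variables (n : nat) (nu : {sigma_finite_measure set (n.-tuple T) -> \bar R}).

Definition mcons : set (n.+1.-tuple T) -> \bar R :=
  pushforward (mu \x nu)%E (@tcons n).

Let mtcons A : measurable A -> measurable (@tcons n @^-1` A).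
Proof. by move=> mA; rewrite -[X in measurable X]setTI; exact: measurable_tcons. Qed.

Let mcons0 : mcons set0 = 0%E.
Proof. by rewrite /mcons /pushforward preimage_set0 measure0. Qed.

Let mcons_ge0 A : (0 <= mcons A)%E.
Proof. by apply: integral_ge0 => x _; exact: measure_ge0. Qed.

Let mcons_sigma_additive : semi_sigma_additive mcons.
Proof.
move=> F mF tF mUF; rewrite /mcons /pushforward preimage_bigcup.
apply: measure_semi_sigma_additive.
- by move=> k; exact: mtcons.
- apply/trivIsetP => /= i j _ _ ij; rewrite -preimage_setI.
  by move/trivIsetP : tF => /(_ _ _ _ _ ij) ->//; rewrite preimage_set0.
- by rewrite -preimage_bigcup; exact: mtcons.
Qed.

HB.instance Definition _ := isMeasure.Build _ _ _ mcons
  mcons0 mcons_ge0 mcons_sigma_additive.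

Let mcons_sigma_finite : sigma_finite setT mcons.
Proof.
have /sigma_finiteP[F [TF ndF Foo]] := sigma_finiteT mu.
have /sigma_finiteP[G [TG ndG Goo]] := sigma_finiteT nu.
pose uncons (t : n.+1.-tuple T) : T * n.-tuple T :=
  (thead t, [tuple of behead t]).
exists (fun i => uncons @^-1` (F i `*` G i)).
  apply/esym/seteqP; split => // t _.
  have [i _ Fi] : (\bigcup_i F i) (uncons t).1 by rewrite -TF.
  have [k _ Gk] : (\bigcup_i G i) (uncons t).2 by rewrite -TG.
  exists (maxn i k) => //; split.
    by move: Fi; exact/subsetPset/ndF/leq_maxl.
  by move: Gk; exact/subsetPset/ndG/leq_maxr.
move=> i; have [mFi Fi] := Foo i; have [mGi Gi] := Goo i; split.
  rewrite -[X in measurable X]setTI; apply: measurable_fun_pair => //.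
  - exact: measurable_tnth.
  - exact: measurable_behead.
  - exact: measurableX.
rewrite /mcons /pushforward (_ : _ @^-1` _ = F i `*` G i).
  by rewrite product_measure1E// lte_mul_pinfty// ge0_fin_numE.
have consK p : uncons (tcons p) = p.
  by case: p => x t; congr pair; exact: val_inj.
by apply/seteqP; split => p; rewrite /preimage /mkset consK.
Qed.

HB.instance Definition _ := Measure_isSigmaFinite.Build _ _ _ mcons
  mcons_sigma_finite.

End Step.

Let dirac_nil : {sigma_finite_measure set (0.-tuple T) -> \bar R} :=
  \d_([tuple] : 0.-tuple T).

Fixpoint mpower n : {sigma_finite_measure set (n.-tuple T) -> \bar R} :=
  if n is n'.+1 then mcons (mpower n') else dirac_nil.

End MeasurePower.

Section WeightedMeasure.
Context {d} {T : measurableType d} {R : realType}.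
Variables (mu : {measure set T -> \bar R}) (w : T -> R).

Definition mweight (w0 : forall x, 0 <= w x) (mw : measurable_fun setT w)
  (A : set T) : \bar R := (\int[mu]_(x in A) (w x)%:E)%E.

Hypotheses (w0 : forall x, 0 <= w x) (mw : measurable_fun setT w).

Let mweight0 : mweight w0 mw set0 = 0%E.
Proof. exact: integral_set0. Qed.

Let mweight_ge0 A : (0 <= mweight w0 mw A)%E.
Proof. by apply: integral_ge0 => x _; rewrite lee_fin. Qed.

Let mweight_sigma_additive : semi_sigma_additive (mweight w0 mw).
Proof.
move=> F mF tF mUF; rewrite /mweight ge0_integral_bigcup//.
- by apply: is_cvg_ereal_nneg_natsum => k _; exact: mweight_ge0.
- by apply/measurable_EFinP; exact: measurable_funS mw.
- by move=> x _; rewrite lee_fin.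
Qed.

HB.instance Definition _ := isMeasure.Build _ _ _ (mweight w0 mw)
  mweight0 mweight_ge0 mweight_sigma_additive.

End WeightedMeasure.

HB.instance Definition _ := isPointed.Build int 0.
HB.instance Definition _ := @isMeasurable.Build default_measure_display
  int discrete_measurable discrete_measurable0
  discrete_measurableC discrete_measurableU.

Section BaseMeasures.
Variable R : realType.

Definition circle_measure : set (measurableTypeR R) -> \bar R :=
  mrestr lebesgue_measure (measurable_itv `[0%R, 1%R[).

HB.instance Definition _ := Measure.on circle_measure.

Let circle_fin_num : fin_num_fun circle_measure.
Proof.
move=> A mA; rewrite ge0_fin_numE ?measure_ge0//.
apply: (@le_lt_trans _ _ (lebesgue_measure `[0%R, 1%R[)); last first.
  by rewrite lebesgue_measure_itv/= lte01 ltry.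
by apply: le_measure; rewrite ?inE//; exact: measurableI.
Qed.

HB.instance Definition _ := Measure_isFinite.Build _ _ _ circle_measure
  circle_fin_num.

Definition counting_int : set int -> \bar R := counting.

HB.instance Definition _ := Measure.on counting_int.

Let counting_int_sigma_finite : sigma_finite setT counting_int.
Proof.
exists (fun k => [set i : int | (absz i <= k)%N]).
  by apply/seteqP; split => // i _; exists (absz i) => /=.
move=> k; split=> //; rewrite /counting_int /counting asboolT ?ltry//.
apply: (@sub_finite_set _ _ ((fun i : nat => Posz i) @` `I_k.+1 `|`
  (fun i : nat => Negz i) @` `I_k.+1)).
  move=> [i|i] /= ik; [left; exists i|right; exists i] => //=.
  exact: leqW.
by rewrite finite_setU; split; exact: finite_image.
Qed.

HB.instance Definition _ := Measure_isSigmaFinite.Build _ _ _ counting_int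
  counting_int_sigma_finite.

End BaseMeasures.

Section Operators.
Context {R : realType}.
Implicit Types H K : prehilbertType R.

Definition hnorm H (u : H) : R := Num.sqrt (Re (inner u u)).

Definition hcvg H (u : nat -> H) (l : H) : Prop :=
  hnorm (u k - l) @[k --> \oo] --> (0 : R).

Definition orthonormal_seq H (e : nat -> H) : Prop :=
  forall i j, inner (e i) (e j) = (i == j)%:R.

(* Totality is expressed by the triviality of the orthogonal complement, which
   is the usual notion because the spaces [L2 mu] are complete. *)
Definition orthonormal_basis H (e : nat -> H) : Prop :=
  orthonormal_seq e /\ forall u, (forall j, inner (e j) u = 0) -> u = 0.

Definition bounded_operator H K (A : H -> K) : Prop :=
  linear A /\ exists c : R, forall u, hnorm (A u) <= c * hnorm u.

Definition compact_operator H K (A : H -> K) : Prop :=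
  linear A /\ forall u : nat -> H, (forall k, hnorm (u k) <= 1) ->
    exists (phi : nat -> nat) (l : K),
      {homo phi : i j / (i < j)%N} /\ hcvg (fun k => A (u (phi k))) l.

Definition adjoint_of H K (A : H -> K) (A' : K -> H) : Prop :=
  forall u v, inner (A u) v = inner u (A' v).

(* The order of [R[i]] makes [0 <= z] say that [z] is real and nonnegative. *)
Definition positive_operator H (B : H -> H) : Prop :=
  bounded_operator B /\ forall u, 0 <= inner u (B u).

Definition absolute_value H K (A : H -> K) (B : H -> H) : Prop :=
  positive_operator B /\
  exists A' : K -> H, adjoint_of A A' /\ forall u, B (B u) = A' (A u).

Definition diagonal_in H (e : nat -> H) (mu : nat -> R) (B : H -> H) : Prop :=
  forall u,
    hcvg (fun J => \sum_(j < J) (mu j)%:C *: (inner (e j) u *: e j)) (B u).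

(* [P] is the power [B ^ alpha] of the positive compact operator [B] (on an
   infinite-dimensional space, with [0 < alpha]), given by the functional
   calculus: [B] is diagonal in an orthonormal system [e], with eigenvalues [mu],
   and [P] is diagonal in the same system, with eigenvalues [mu ^ alpha]. *)
Definition operator_power H (alpha : R) (B P : H -> H) : Prop :=
  exists (e : nat -> H) (mu : nat -> R),
    [/\ orthonormal_seq e, forall j, 0 <= mu j, diagonal_in e mu B &
        diagonal_in e (fun j => mu j `^ alpha) P].

Definition trace_in H (b : nat -> H) (P : H -> H) : \bar R :=
  (\sum_(j <oo) (Re (inner (b j) (P (b j))))%:E)%E.

(* [nu] is [(Tr |A| ^ alpha) ^ (1 / alpha)], the trace being computed in some
   orthonormal basis. *)
Definition schatten_norm H (alpha : R) (A : H -> H) (nu : \bar R) : Prop :=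
  exists (B P : H -> H) (b : nat -> H),
    [/\ absolute_value A B, operator_power alpha B P, orthonormal_basis b &
        nu = (trace_in b P `^ alpha^-1)%E].

Definition schatten H (alpha : R) (A : H -> H) : Prop :=
  compact_operator A /\ exists2 nu, schatten_norm alpha A nu & (nu < +oo)%E.

End Operators.

Definition L2of d (T : measurableType d) (R : realType)
    (mu : {measure set T -> \bar R}) (f : T -> R[i]) : L2 mu :=
  if (insub (f : T -> R[i]^o) : option (sqfun mu)) is Some g
  then L2class g else 0.

Definition cis (R : realType) (theta : R) : R[i] :=
  cos (2 * pi * theta) +i* sin (2 * pi * theta).

Section Spaces.
Variables (R : realType) (n m : nat).

(* A point of R^n x T^m, where a point of T = R/Z is given by its representative
   in [0, 1[, the interval on which [circle_measure] is concentrated. *)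
Definition position : Type :=
  (n.-tuple (measurableTypeR R) * m.-tuple (measurableTypeR R))%type.
HB.instance Definition _ := Measurable.on position.

Definition frequency : Type :=
  (n.-tuple (measurableTypeR R) * m.-tuple int)%type.
HB.instance Definition _ := Measurable.on frequency.

Definition position_measure : {measure set position -> \bar R} :=
  (mpower (@lebesgue_measure R) n \x mpower (@circle_measure R) m)%E.

Definition frequency_measure : {measure set frequency -> \bar R} :=
  (mpower (@lebesgue_measure R) n \x mpower (@counting_int R) m)%E.

Definition frequency_sq (zeta : frequency) : R :=
  \sum_(i < n) tnth zeta.1 i ^+ 2 + \sum_(i < m) (tnth zeta.2 i)%:~R ^+ 2.

Definition phase (z : position) (zeta : frequency) : R :=
  \sum_(i < n) tnth z.1 i * tnth zeta.1 i +
  \sum_(i < m) tnth z.2 i * (tnth zeta.2 i)%:~R.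

Definition japanese (r : R) (zeta : frequency) : R :=
  (1 + frequency_sq zeta) `^ (r / 2).

Definition sobolev_weight (sigma : R) (zeta : frequency) : R :=
  japanese sigma zeta ^+ 2.

Lemma sobolev_weight_ge0 sigma zeta : 0 <= sobolev_weight sigma zeta.
Proof. exact: sqr_ge0. Qed.

Lemma measurable_frequency_sq : measurable_fun setT frequency_sq.
Proof.
apply: measurable_funD.
  apply: measurable_sum => i; apply: measurable_funX.
  exact: (measurableT_comp (measurable_tnth i) measurable_fst).
apply: measurable_sum => i; apply: measurable_funX.
have mint : measurable_fun setT (fun k : int => k%:~R : R) by [].
apply: (measurableT_comp mint).
exact: (measurableT_comp (measurable_tnth i) measurable_snd).
Qed.

Lemma measurable_sobolev_weight sigma :
  measurable_fun setT (sobolev_weight sigma).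
Proof.
apply: measurable_funX; apply: (measurableT_comp (measurable_powR _)).
by apply: measurable_funD => //; exact: measurable_frequency_sq.
Qed.

(* An element of H^sigma is given by its Fourier transform, a class of functions
   of finite norm in L^2 with weight (1 + |xi|^2 + |k|^2) ^ sigma. For
   sigma < 0 this includes distributions. *)
Definition sobolev (sigma : R) :=
  L2 (mweight frequency_measure (sobolev_weight_ge0 sigma)
    (measurable_sobolev_weight sigma)).

End Spaces.

Section Operations.
Context {R : realType} {n m : nat}.
Local Notation position := (position R n m).
Local Notation frequency := (frequency R n m).
Local Notation muM := (position_measure R n m).
Local Notation muF := (frequency_measure R n m).
Local Notation sobolev := (@sobolev R n m).

(* The Fourier multiplier of symbol [a], for a symbol that maps H^sigma into
   H^tau (its value is the junk 0 where [a * u] is not in H^tau). *)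
Definition multiplier (a : frequency -> R[i]) {sigma tau : R}
    (u : sobolev sigma) : sobolev tau :=
  L2of _ (fun zeta => a zeta * L2repr u zeta).

Definition bessel (r : R) {sigma tau : R} : sobolev sigma -> sobolev tau :=
  multiplier (fun zeta => (japanese r zeta)%:C).

Definition schrodinger (t : R) {sigma : R} : sobolev sigma -> sobolev sigma :=
  multiplier (fun zeta => cis (t * frequency_sq zeta)).

Definition truncated_fourier (f : L2 muM) (N : nat) (zeta : frequency) : R[i] :=
  cintegral muM (fun z =>
    (\1_[set z : position | \sum_(i < n) tnth z.1 i ^+ 2 <= N%:R ^+ 2] z)%:C *
    (L2repr f z * cis (- phase z zeta))).

(* Plancherel's extension of the Fourier transform to L^2: the L^2 limit of the
   Fourier transforms of the restrictions of [f] to |x| <= N. *)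
Definition is_fourier (f : L2 muM) (g : sobolev 0) : Prop :=
  (\int[muF]_zeta
    (sqmod (truncated_fourier f N zeta - L2repr g zeta))%:E)%E
  @[N --> \oo] --> 0%E.

Definition fourier (f : L2 muM) : sobolev 0 := xget 0 [set g | is_fourier f g].

Definition inverse_fourier (g : sobolev 0) : L2 muM :=
  xget 0 [set f | fourier f = g].

(* The inclusion of H^sigma in L^2, for 0 <= sigma. *)
Definition to_L2 {sigma : R} (u : sobolev sigma) : L2 muM :=
  inverse_fourier (multiplier (fun=> 1) u).

Definition sobolev_pairing {sigma tau : R}
    (u : sobolev sigma) (v : sobolev tau) : R[i] :=
  cintegral muF (fun zeta => (L2repr u zeta)^* * L2repr v zeta).

Definition ketbra {sigma tau : R} (g : sobolev sigma) (u : sobolev tau) :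
  sobolev sigma := sobolev_pairing g u *: g.

(* Self-adjointness for the L^2 duality pairing of H^(-s) with H^s. *)
Definition self_adjoint {s : R} (gamma : sobolev (- s) -> sobolev s) : Prop :=
  forall u v, sobolev_pairing u (gamma v) = (sobolev_pairing v (gamma u))^*.

Definition sobolev_schatten (alpha : R) {s : R}
    (gamma : sobolev (- s) -> sobolev s) : Prop :=
  compact_operator gamma /\
  schatten alpha (fun f : L2 muM => inverse_fourier
    (bessel s (gamma (bessel s (fourier f))))).

Definition evolution (t : R) {s : R} (gamma : sobolev (- s) -> sobolev s) :
    sobolev (- s) -> sobolev s :=
  fun u => schrodinger t (gamma (schrodinger (- t) u)).

(* [gamma] is [\sum_j lambda_j <nabla>^-s |f_j><f_j| <nabla>^-s], where the
   series converges strongly, from H^(-s) to H^s. *)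
Definition spectral_decomposition (alpha : R) {s : R}
    (gamma : sobolev (- s) -> sobolev s)
    (lambda : nat -> R) (f : nat -> L2 muM) : Prop :=
  [/\ (\sum_(j <oo) (`|lambda j| `^ alpha)%:E < +oo)%E,
      orthonormal_seq f &
      forall u, hcvg (fun J => \sum_(j < J) (lambda j)%:C *:
        (bessel (- s) (ketbra (fourier (f j)) (bessel (- s) u : sobolev 0))
          : sobolev s)) (gamma u)].

Definition partial_density {s : R} (lambda : nat -> R) (g : nat -> sobolev s)
    (J : nat) (z : position) : R :=
  \sum_(j < J) lambda j * sqmod (L2repr (to_L2 (g j)) z).

Definition unit_cylinder (x0 : n.-tuple R) : set position :=
  [set z | \sum_(i < n) (tnth z.1 i - tnth x0 i) ^+ 2 < 1].

Definition square_integrable_on (D : set position) (h : position -> R) : Prop :=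
  measurable_fun D h /\ (\int[muM]_(z in D) (h z ^+ 2)%:E < +oo)%E.

(* The density [\sum_j lambda_j |g_j|^2] of the operator
   [gamma = \sum_j lambda_j |g_j><g_j|] is well defined. *)
Definition density_well_defined {s : R} (gamma : sobolev (- s) -> sobolev s)
    (lambda : nat -> R) (g : nat -> sobolev s) : Prop :=
  (forall u, hcvg (fun J => \sum_(j < J) (lambda j)%:C *: ketbra (g j) u)
    (gamma u)) /\
  forall x0 : n.-tuple R,
    (forall J, square_integrable_on (unit_cylinder x0)
      (partial_density lambda g J)) /\
    exists2 rho, square_integrable_on (unit_cylinder x0) rho &
      (\int[muM]_(z in unit_cylinder x0)
        ((partial_density lambda g J z - rho z) ^+ 2)%:E)%E
      @[J --> \oo] --> 0%E.

Definition smooth_cutoff (eta1 : R -> R) : Prop :=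
  [/\ forall k x, derivable (derive1n k eta1) x 1,
      forall x, eta1 (- x) = eta1 x,
      forall x, 0 <= eta1 x <= 1,
      forall x, `|x| <= 1 -> eta1 x = 1 &
      forall x, 2 <= `|x| -> eta1 x = 0].

Definition product_cutoff (eta1 : R -> R) (N : R) (zeta : frequency) : R :=
  (\prod_(i < n) eta1 (tnth zeta.1 i / N)) *
  (\prod_(i < m) eta1 ((tnth zeta.2 i)%:~R / N)).

Section PointwiseValues.
Variable eta1 : R -> R.

(* The integral over R^n x Z^m is [\sum_k \int dxi]. *)
Definition regularized_schrodinger {s : R} (t : R) (g : sobolev s)
    (z : position) (l : nat) : R[i] :=
  cintegral muF (fun zeta => (product_cutoff eta1 (2 ^+ l) zeta)%:C *
    cis (phase z zeta + t * frequency_sq zeta) * L2repr g zeta).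

Definition schrodinger_at {s : R} (t : R) (g : sobolev s) (z : position) : R[i] :=
  limn (regularized_schrodinger t g z : nat -> R[i]^o).

Definition density_series {s : R} (lambda : nat -> R) (g : nat -> sobolev s)
    (t : R) (z : position) : nat -> R :=
  series (fun j => lambda j * sqmod (schrodinger_at t (g j) z)).

Definition density_at {s : R} (lambda : nat -> R) (g : nat -> sobolev s)
    (t : R) (z : position) : R :=
  limn (density_series lambda g t z).

Definition density_exists_at {s : R} (lambda : nat -> R) (g : nat -> sobolev s)
    (t : R) (z : position) : Prop :=
  (forall j, cvgn (regularized_schrodinger t (g j) z : nat -> R[i]^o)) /\
  cvgn (density_series lambda g t z).

End PointwiseValues.

End Operations.

(* Main.v *)
From HB Require Import structures.
Require Import Defs.
From mathcomp Require Import all_boot all_order all_algebra.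
From mathcomp Require Import all_classical all_reals all_analysis.
From mathcomp Require Import measurable_realfun complex ring lra zify.

Set Implicit Arguments.
Unset Strict Implicit.
Unset Printing Implicit Defensive.
Import Order.TTheory GRing.Theory Num.Theory.
Import numFieldNormedType.Exports.
Local Open Scope classical_set_scope.
Local Open Scope complex_scope.
Local Open Scope ring_scope.

Local Notation Re := complex.Re.
Local Notation Im := complex.Im.

(* The threshold for [s] exceeds [(d + 1) / 4], where [d = n + m >= 2]; this leaves enough room for an
   elementary argument. Cut the solutions in frequency into blocks at scale [N = 2 ^ l].
   For an orthonormal family [e_j] and a measurable choice of times [t z], duality turns the square norm of
   [\sum_j l_j |D_j (t z) z| ^ 2] into the pairing of [\sum_j l_j e_j (x) conj e_j] with a kernel [G] on pairs
   of frequencies, so that Bessel's inequality bounds it by the [l^2] norm of [l] and the norm of [G].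
   At [(zeta + a, zeta)] the kernel is a Fourier coefficient at [a] of a function modulated by
   [t z * (|a| ^ 2 + 2 a . zeta)]. As [t] is bounded, one may average over a unit interval of values of this
   last factor; those [zeta] in the box for which it lies in a given unit interval form a slab, whose volume
   gains one power of [N]. Plancherel's theorem in [a] then gives a maximal estimate with constant
   [N ^ (d + 1)], against which the weight [<nabla> ^ -s] contributes [N ^ (- 4 s)]. The estimates of the blocks
   can therefore be summed, uniformly in time at almost every point; continuity at [t = 0] holds block by
   block, again by Bessel's inequality. *)

(** * Hilbert spaces and the spectral decomposition *)

(** The obstacle is that the time [t z] varies with the point, so that a factor
    [cis (t z * |zeta| ^ 2)] ruins Plancherel's theorem in [z]. Once the resonance
    [|a| ^ 2 + 2 a . zeta] is frozen to a number [u], the factor depends on [z] alone and has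
    modulus 1; it is absorbed into the test function, whatever the regularity of [t]. The cost is
    the measure of the resonant [zeta], integrated over [u]: volume [N ^ (d - 1)] over a range of
    length [N ^ 2] in general, and volume [N ^ d] over a range of length [N] when [a] is bounded.
    Both give [N ^ (d + 1)]. Duality tests the density against itself, hence the [l^2] norm of the
    coefficients; [l^alpha] embeds in [l^2] for [alpha < 2]. The supremum over times is a maximum
    over finitely many rational times, for which a measurable choice is explicit. All other times
    are reached because a block of bounded frequency is continuous in time, uniformly over
    orthonormal families. *)

Section ComplexBasics.
Context {R : realType}.
Implicit Types z w : R[i].

Lemma cReD z w : Re (z + w) = Re z + Re w. Proof. by case: z w => ? ? []. Qed.
Lemma cImD z w : Im (z + w) = Im z + Im w. Proof. by case: z w => ? ? []. Qed.
Lemma cReN z : Re (- z) = - Re z. Proof. by case: z. Qed.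
Lemma cImN z : Im (- z) = - Im z. Proof. by case: z. Qed.
Lemma cReB z w : Re (z - w) = Re z - Re w. Proof. by rewrite cReD cReN. Qed.
Lemma cImB z w : Im (z - w) = Im z - Im w. Proof. by rewrite cImD cImN. Qed.
Lemma cReM z w : Re (z * w) = Re z * Re w - Im z * Im w.
Proof. by case: z w => ? ? []. Qed.
Lemma cImM z w : Im (z * w) = Re z * Im w + Im z * Re w.
Proof. by case: z w => ? ? []. Qed.
Lemma cRe_conj z : Re z^* = Re z. Proof. by case: z. Qed.
Lemma cIm_conj z : Im z^* = - Im z. Proof. by case: z. Qed.
Lemma cRe_real (x : R) : Re x%:C = x. Proof. by []. Qed.
Lemma cIm_real (x : R) : Im x%:C = 0. Proof. by []. Qed.
Lemma cRe_sum I r (P : pred I) (F : I -> R[i]) :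
  Re (\sum_(i <- r | P i) F i) = \sum_(i <- r | P i) Re (F i).
Proof. exact: raddf_sum. Qed.
Definition ReImE := (cReB, cImB, cReD, cImD, cReN, cImN, cReM, cImM, cRe_conj, cIm_conj, cRe_real, cIm_real).

Lemma complex_ext z w : Re z = Re w -> Im z = Im w -> z = w.
Proof. by case: z w => ? ? [? ?] /= -> ->. Qed.

Lemma sqmod0 : sqmod (0 : R[i]) = 0.
Proof. by rewrite /sqmod/= expr0n addr0. Qed.
Lemma sqmod1 : sqmod (1 : R[i]) = 1.
Proof. by rewrite /sqmod/= expr0n addr0 expr1n. Qed.
Lemma sqmodN z : sqmod (- z) = sqmod z.
Proof. by rewrite /sqmod !ReImE !sqrrN. Qed.
Lemma sqmodBC z w : sqmod (z - w) = sqmod (w - z).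
Proof. by rewrite -sqmodN opprB. Qed.
Lemma sqmod_conj z : sqmod z^* = sqmod z.
Proof. by rewrite /sqmod !ReImE sqrrN. Qed.
Lemma sqmod_real (x : R) : sqmod x%:C = x ^+ 2.
Proof. by rewrite /sqmod/= expr0n addr0. Qed.
Lemma conjM_sqmod z : z^* * z = (sqmod z)%:C.
Proof. by apply: complex_ext; rewrite !ReImE /sqmod; ring. Qed.
Lemma Re_le_sqmod z : Re z ^+ 2 <= sqmod z.
Proof. by rewrite /sqmod lerDl sqr_ge0. Qed.
Lemma Im_le_sqmod z : Im z ^+ 2 <= sqmod z.
Proof. by rewrite /sqmod lerDr sqr_ge0. Qed.

Lemma conj_real (x : R) : (x%:C)^* = x%:C.
Proof. by apply: complex_ext; rewrite !ReImE ?oppr0. Qed.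

Lemma ge0_complexE z : 0 <= z -> z = (Re z)%:C /\ 0 <= Re z.
Proof. by case: z => x y; rewrite lecE/= => /andP[/eqP -> ->]. Qed.

End ComplexBasics.

Section RealSequences.
Context {R : realType}.
Implicit Types u v : nat -> R.

Lemma cvgnP u (l : R) : u k @[k --> \oo] --> l <->
  forall e, 0 < e -> exists N, forall k, (N <= k)%N -> `|u k - l| < e.
Proof.
split=> [/cvgrPdist_lt ul e e0|ul].
  by have [N _ NP] := ul e e0; exists N => k Nk; rewrite distrC; apply: NP.
apply/cvgrPdist_lt => e e0; have [N NP] := ul e e0.
by exists N => // k /= Nk; rewrite distrC NP.
Qed.

Lemma cvg0_le u v : (forall k, `|u k| <= v k) ->
  v k @[k --> \oo] --> (0 : R) -> u k @[k --> \oo] --> (0 : R).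
Proof.
move=> uv /cvgnP v0; apply/cvgnP => e e0; have [N NP] := v0 e e0.
exists N => k Nk; rewrite subr0; apply: le_lt_trans (uv k) _.
by have := NP k Nk; rewrite subr0; apply: le_lt_trans; exact: ler_norm.
Qed.

Lemma cvgn_le u v (l m : R) : (forall k, u k <= v k) ->
  u k @[k --> \oo] --> l -> v k @[k --> \oo] --> m -> l <= m.
Proof.
move=> uv /cvgnP ul /cvgnP vm; rewrite leNgt; apply/negP => ml.
have e0 : 0 < (l - m) / 2 by lra.
have [N NP] := ul _ e0; have [M MP] := vm _ e0.
have := NP (maxn N M) (leq_maxl _ _); have := MP (maxn N M) (leq_maxr _ _).
have := uv (maxn N M); rewrite !ltr_norml => *; lra.
Qed.

Lemma cvgn_lec u (l c : R) : u k @[k --> \oo] --> l -> (forall k, u k <= c) -> l <= c.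
Proof. by move=> ul uc; apply: (@cvgn_le u (fun=> c)) => //; exact: cvg_cst. Qed.

Lemma cvgn_gec u (l c : R) : u k @[k --> \oo] --> l -> (forall k, c <= u k) -> c <= l.
Proof. by move=> ul uc; apply: (@cvgn_le (fun=> c) u) => //; exact: cvg_cst. Qed.

End RealSequences.

Section Hilbert.
Context {R : realType}.
Implicit Types H K : prehilbertType R.

(** Squared norms are polynomial in inner products, so most estimates avoid square roots; [hnorm] is
    kept for the triangle inequality and for normalization. *)
Definition nsq H (u : H) : R := Re (inner u u).

Section Basics.
Context {H : prehilbertType R}.
Implicit Types u v w : H.

Lemma innerDl u v w : inner (u + v) w = inner u w + inner v w :> R[i].
Proof. by rewrite inner_conj innerDr rmorphD/= -!inner_conj. Qed.
Lemma innerZl a u w : inner (a *: u) w = a^* * inner u w :> R[i].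
Proof. by rewrite inner_conj innerZr rmorphM/= -!inner_conj. Qed.
Lemma inner0r u : inner u 0 = 0 :> R[i].
Proof. by rewrite -(scale0r (0 : H)) innerZr mul0r. Qed.
Lemma inner0l u : inner 0 u = 0 :> R[i].
Proof. by rewrite inner_conj inner0r rmorph0. Qed.
Lemma innerNr u v : inner u (- v) = - inner u v :> R[i].
Proof. by rewrite -scaleN1r innerZr mulN1r. Qed.
Lemma innerNl u v : inner (- u) v = - inner u v :> R[i].
Proof. by rewrite -scaleN1r innerZl rmorphN1 mulN1r. Qed.
Lemma innerBr u v w : inner u (v - w) = inner u v - inner u w :> R[i].
Proof. by rewrite innerDr innerNr. Qed.
Lemma innerBl u v w : inner (u - v) w = inner u w - inner v w :> R[i].
Proof. by rewrite innerDl innerNl. Qed.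
Lemma inner_sumr u I r (P : pred I) (F : I -> H) :
  inner u (\sum_(i <- r | P i) F i) = \sum_(i <- r | P i) inner u (F i) :> R[i].
Proof. by elim/big_rec2: _ => [|i x y _ <-]; rewrite ?inner0r// innerDr. Qed.
Lemma inner_suml u I r (P : pred I) (F : I -> H) :
  inner (\sum_(i <- r | P i) F i) u = \sum_(i <- r | P i) inner (F i) u :> R[i].
Proof.
by elim/big_rec2: _ => [|i x y _ <-]; rewrite ?inner0l// innerDl.
Qed.

Lemma nsq_ge0 u : 0 <= nsq u.
Proof. by have [] := ge0_complexE (inner_ge0 u). Qed.
Lemma innerE u : inner u u = (nsq u)%:C :> R[i].
Proof. by have [] := ge0_complexE (inner_ge0 u). Qed.
Lemma nsq_eq0 u : nsq u = 0 -> u = 0.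
Proof. by move=> u0; apply: inner_eq0; rewrite innerE u0. Qed.
Lemma nsq0 : nsq (0 : H) = 0. Proof. by rewrite /nsq inner0r. Qed.
Lemma hnorm_ge0 u : 0 <= hnorm u. Proof. exact: sqrtr_ge0. Qed.
Lemma hnorm_sq u : hnorm u ^+ 2 = nsq u.
Proof. by rewrite sqr_sqrtr// nsq_ge0. Qed.
Lemma nsqZ a u : nsq (a *: u) = sqmod a * nsq u.
Proof. by rewrite /nsq innerZl innerZr mulrA conjM_sqmod innerE !ReImE; ring. Qed.
Lemma nsqN u : nsq (- u) = nsq u.
Proof. by rewrite /nsq innerNl innerNr opprK. Qed.
Lemma nsqD u v : nsq (u + v) = nsq u + nsq v + 2 * Re (inner u v).
Proof.
rewrite /nsq innerDl !innerDr [inner v u]inner_conj !ReImE; ring.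
Qed.
Lemma nsqB u v : nsq (u - v) = nsq u + nsq v - 2 * Re (inner u v).
Proof. by rewrite nsqD nsqN innerNr !ReImE mulrN. Qed.

(** The vector [nsq v * u - <v, u> * v] needs no division, and its squared norm is [nsq v] times the
    difference of the two sides. *)
Lemma hcauchy_schwarz u v : sqmod (inner u v) <= nsq u * nsq v.
Proof.
have [v0|vN0] := eqVneq (nsq v) 0.
  by rewrite (nsq_eq0 v0) inner0r sqmod0 nsq0 mulr0.
have vp : 0 < nsq v by rewrite lt0r vN0 nsq_ge0.
have := nsq_ge0 ((nsq v)%:C *: u - (inner v u) *: v).
rewrite nsqB !nsqZ innerZl innerZr sqmod_real !ReImE.
rewrite -cReM.
have -> : Re ((inner v u) * inner u v) = sqmod (inner u v).
  by rewrite [inner v u]inner_conj conjM_sqmod.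
have -> : sqmod (inner v u) = sqmod (inner u v).
  by rewrite inner_conj sqmod_conj.
move: (nsq u) (nsq v) (sqmod (inner u v)) vp => a b c bp.
have -> : forall d, b ^+ 2 * a + c * b - 2 * (b * c - - 0 * d) = b * (a * b - c).
  by move=> d; ring.
by rewrite pmulr_rge0// subr_ge0.
Qed.

Lemma hnormD u v : hnorm (u + v) <= hnorm u + hnorm v.
Proof.
rewrite -(@ler_pXn2r _ 2)// ?nnegrE ?addr_ge0 ?hnorm_ge0//.
suff : Re (inner u v) <= hnorm u * hnorm v.
  by rewrite sqrrD !hnorm_sq nsqD mulr2n; lra.
have := hcauchy_schwarz u v; rewrite -!hnorm_sq -exprMn => cs.
have : Re (inner u v) ^+ 2 <= (hnorm u * hnorm v) ^+ 2.
  by apply: le_trans cs; exact: Re_le_sqmod.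
have := mulr_ge0 (hnorm_ge0 u) (hnorm_ge0 v).
move: (hnorm u * hnorm v) (Re _) => a b a0 ab.
by rewrite leNgt; apply/negP => ba; nra.
Qed.
Lemma hnormN u : hnorm (- u) = hnorm u.
Proof. by rewrite /hnorm -/(nsq _) nsqN. Qed.
Lemma hnormB u v : hnorm (u - v) <= hnorm u + hnorm v.
Proof. by rewrite -[hnorm v]hnormN hnormD. Qed.
Lemma hnorm_eq0 u : hnorm u = 0 -> u = 0.
Proof. by move=> u0; apply: nsq_eq0; rewrite -hnorm_sq u0 expr0n. Qed.

Lemma hcvgP (u : nat -> H) l : hcvg u l <-> nsq (u k - l) @[k --> \oo] --> (0 : R).
Proof.
split=> [ul|ul].
  rewrite (_ : (fun k => _) = (fun k => hnorm (u k - l) * hnorm (u k - l))).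
    by rewrite -(mulr0 (0 : R)); exact: cvgM.
  by apply/funext => k; rewrite -expr2 hnorm_sq.
rewrite /hcvg -(sqrtr0 R); apply: (cvg_comp _ _ ul).
exact: sqrt_continuous.
Qed.

Lemma hcvg_squeeze (u : nat -> H) l (h : nat -> R) :
  (forall k, hnorm (u k - l) <= h k) -> h k @[k --> \oo] --> (0 : R) -> hcvg u l.
Proof. by move=> uh; apply: cvg0_le => k; rewrite ger0_norm ?hnorm_ge0. Qed.

Lemma hcvgD (u v : nat -> H) l m :
  hcvg u l -> hcvg v m -> hcvg (fun k => u k + v k) (l + m).
Proof.
move=> ul vm; apply: (hcvg_squeeze (h := fun k => hnorm (u k - l) + hnorm (v k - m))).
  by move=> k; rewrite opprD addrACA hnormD.
by rewrite -(addr0 (0 : R)); exact: cvgD.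
Qed.

Lemma hcvg_inner (u : nat -> H) l v :
  hcvg u l -> sqmod (inner v (u k) - inner v l) @[k --> \oo] --> (0 : R).
Proof.
move=> /hcvgP ul; apply: (cvg0_le (v := fun k => nsq v * nsq (u k - l))) => [k|].
  by rewrite ger0_norm ?sqmod_ge0// -innerBr hcauchy_schwarz.
by rewrite -(mulr0 (nsq v)); apply: cvgM => //; exact: cvg_cst.
Qed.

Lemma sqmod_cvg0 (c : nat -> R[i]) (l : R[i]) :
  sqmod (c k - l) @[k --> \oo] --> (0 : R) ->
  Re (c k) @[k --> \oo] --> Re l /\ Im (c k) @[k --> \oo] --> Im l.
Proof.
move=> cl; have sq0 (h : nat -> R) (m : R) : (forall k, (h k - m) ^+ 2 <= sqmod (c k - l)) ->
    h k @[k --> \oo] --> m.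
  move=> hc; apply/cvgnP => e e0; have e20 : 0 < e ^+ 2 by rewrite exprn_gt0.
  move/cvgnP : cl => /(_ _ e20)[N NP]; exists N => k /NP.
  rewrite subr0 ger0_norm ?sqmod_ge0// => /(le_lt_trans (hc k)).
  by rewrite -real_normK ?num_real// ltr_pXn2r// nnegrE ltW.
split; apply: sq0 => k; first by rewrite -cReB Re_le_sqmod.
by rewrite -cImB Im_le_sqmod.
Qed.

Lemma hcvg_unique (u : nat -> H) l m : hcvg u l -> hcvg u m -> l = m.
Proof.
move=> ul um; apply/eqP; rewrite -subr_eq0; apply/eqP/hnorm_eq0.
have lm : hnorm (u k - m) + hnorm (u k - l) @[k --> \oo] --> (0 : R).
  by rewrite -(addr0 (0 : R)); exact: cvgD.
apply/eqP; rewrite eq_le hnorm_ge0 andbT.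
apply: (cvgn_le _ (cvg_cst (hnorm (l - m))) lm) => k.
by rewrite (_ : l - m = (u k - m) - (u k - l)) ?hnormB// opprB [RHS]addrC addrA subrK.
Qed.

Lemma hcvg_nsq (u : nat -> H) l : hcvg u l -> nsq (u k) @[k --> \oo] --> nsq l.
Proof.
move=> ul; rewrite -hnorm_sq; under eq_fun do rewrite -hnorm_sq expr2.
rewrite expr2; suff nul : hnorm (u k) @[k --> \oo] --> hnorm l by exact: cvgM.
apply/cvgnP => e e0; have /cvgnP/(_ e e0)[N NP] := ul; exists N => k /NP.
rewrite subr0 [X in X < _]ger0_norm ?hnorm_ge0//; apply: le_lt_trans.
rewrite ler_norml; apply/andP; split.
  have := hnormB (u k) (u k - l); rewrite opprB addrCA subrr addr0; lra.
have := hnormD (u k - l) l; rewrite subrK; lra.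
Qed.

Definition oseries (e : nat -> H) u n : H := \sum_(j < n) inner (e j) u *: e j.

(** Orthonormality with zero vectors allowed, which is what Gram-Schmidt makes of a linearly
    dependent family. Bessel's inequality survives, as a zero vector contributes nothing to it. *)
Definition orthounit (e : nat -> H) : Prop :=
  (forall i j, i != j -> inner (e i) (e j) = 0 :> R[i]) /\
  forall i, e i = 0 \/ nsq (e i) = 1.

Lemma orthonormal_orthounit (e : nat -> H) : orthonormal_seq e -> orthounit e.
Proof.
move=> oe; split=> [i j ij|i]; first by rewrite oe (negbTE ij).
by right; rewrite /nsq oe eqxx.
Qed.

Section Orthounit.
Variables (e : nat -> H) (oe : orthounit e).

Lemma orthounit_self i u : inner (e i) u * inner (e i) (e i) = inner (e i) u :> R[i].
Proof.
have [->|e1] := oe.2 i; first by rewrite !inner0l mul0r.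
by rewrite (innerE (e i)) e1 mulr1.
Qed.

Lemma inner_orthosum (c : nat -> R[i]) i n :
  inner (e i) (\sum_(j < n) c j *: e j) =
    if (i < n)%N then c i * inner (e i) (e i) else 0 :> R[i].
Proof.
rewrite inner_sumr; case: ltnP => [ilt|nle].
  rewrite (bigD1 (Ordinal ilt))//= innerZr big1 ?addr0// => j ji.
  by rewrite innerZr oe.1 ?mulr0//; apply: contraNneq ji => ij; apply/eqP/val_inj.
rewrite big1// => j _; rewrite innerZr oe.1 ?mulr0//.
by rewrite neq_ltn (leq_trans (ltn_ord j) nle) orbT.
Qed.

Lemma inner_oseries i u n : inner (e i) (oseries e u n) =
  if (i < n)%N then inner (e i) u else 0 :> R[i].
Proof. by rewrite /oseries (inner_orthosum (fun j => inner (e j) u)) orthounit_self. Qed.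

Lemma nsq_orthosum (c : nat -> R[i]) m n :
  nsq (\sum_(m <= j < n) c j *: e j) = \sum_(m <= j < n) sqmod (c j) * nsq (e j).
Proof.
elim: n => [|n ih]; first by rewrite !big_geq// nsq0.
have [nm|mn] := ltnP n m; first by rewrite !big_geq ?nsq0.
rewrite !big_nat_recr//= nsqD ih nsqZ innerZr inner_suml [X in c n * X]big_nat [X in c n * X]big1 => [|j /andP[_ jn]].
  by rewrite !mulr0 addr0.
by rewrite innerZl oe.1 ?mulr0// neq_ltn jn.
Qed.

Lemma sqmod_orthounit i u : sqmod (inner (e i) u) * nsq (e i) = sqmod (inner (e i) u).
Proof.
by have [->|->] := oe.2 i; rewrite ?mulr1// inner0l sqmod0 mul0r.
Qed.

Lemma nsq_oseries u n : nsq (oseries e u n) = \sum_(j < n) sqmod (inner (e j) u).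
Proof.
rewrite /oseries -(big_mkord xpredT (fun j => inner (e j) u *: e j)) nsq_orthosum.
by rewrite big_mkord; apply: eq_bigr => j _; exact: sqmod_orthounit.
Qed.

Lemma nsq_residual u n :
  nsq (u - oseries e u n) = nsq u - \sum_(j < n) sqmod (inner (e j) u).
Proof.
rewrite nsqB nsq_oseries inner_sumr cRe_sum.
rewrite [X in _ - 2 * X](eq_bigr (fun j : 'I_n => sqmod (inner (e j) u))) => [|j _].
  by lra.
by rewrite innerZr [inner u _]inner_conj mulrC conjM_sqmod.
Qed.

Lemma bessel_ineq u n : \sum_(j < n) sqmod (inner (e j) u) <= nsq u.
Proof. by have := nsq_ge0 (u - oseries e u n); rewrite nsq_residual subr_ge0. Qed.

End Orthounit.
End Basics.

Definition hcomplete H : Prop := forall u : nat -> H,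
  (forall c : R, 0 < c -> exists N, forall i j, (N <= i <= j)%N -> nsq (u j - u i) < c) ->
  exists l, hcvg u l.

Lemma bounded_sum_cauchy (a : nat -> R) (M : R) : (forall j, 0 <= a j) ->
  (forall n, \sum_(j < n) a j <= M) ->
  forall c : R, 0 < c -> exists N, forall i j, (N <= i <= j)%N -> \sum_(i <= k < j) a k < c.
Proof.
move=> a0 aM c c0.
have nda : nondecreasing_seq (fun n => \sum_(j < n) a j).
  apply/nondecreasing_seqP => n; rewrite big_ord_recr/= lerDl//.
have /cvg_ex[l /cvgnP al] : cvgn (fun n => \sum_(j < n) a j).
  apply: nondecreasing_is_cvgn => //; exists M => _ [n _ <-]; exact: aM.
have c20 : 0 < c / 2 by lra.
have [N NP] := al _ c20; exists N => i j /andP[Ni ij].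
have := NP i Ni; have := NP j (leq_trans Ni ij).
rewrite -!(big_mkord xpredT a) (@big_cat_nat _ _ _ i 0 j)//= !ltr_norml.
move=> /andP[? ?] /andP[? ?]; lra.
Qed.

(** Bessel's inequality makes the expansion of [u] a Cauchy sequence; its limit [w] has the same
    coefficients as [u], and totality of the basis then forces [u = w]. *)
Lemma parseval H (b : nat -> H) : hcomplete H -> orthonormal_basis b ->
  forall u, \sum_(j < n) sqmod (inner (b j) u) @[n --> \oo] --> nsq u.
Proof.
move=> cH [/orthonormal_orthounit ob tb] u.
have [|w uw] := cH (oseries b u).
  move=> c /(bounded_sum_cauchy (fun j => sqmod_ge0 (inner (b j) u)) (bessel_ineq ob u)).
  move=> [N NP]; exists N => i j ij; have [_ ij'] := andP ij.
  apply: le_lt_trans (NP _ _ ij); rewrite /oseries.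
  rewrite -!(big_mkord xpredT (fun j => inner (b j) u *: b j)) (@big_cat_nat _ _ _ i 0 j)//=.
  rewrite [X in nsq X]addrC addKr nsq_orthosum//.
  by rewrite (eq_bigr _ (fun k _ => sqmod_orthounit ob k u)).
have -> : nsq u = nsq w.
  congr nsq; apply/eqP; rewrite -subr_eq0; apply/eqP/tb => j.
  rewrite innerBr; apply/eqP; rewrite subr_eq0; apply/eqP.
  have : forall c : R, 0 < c -> sqmod (inner (b j) u - inner (b j) w) < c.
    move=> c c0; have /cvgnP/(_ c c0)[N NP] := hcvg_inner (b j) uw.
    have := NP (maxn N j.+1) (leq_maxl _ _).
    rewrite inner_oseries// leq_maxr subr0 ger0_norm//; exact: sqmod_ge0.
  move=> h; apply/eqP; rewrite -subr_eq0; apply/eqP/sqmod_eq0/eqP.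
  rewrite eq_le sqmod_ge0 andbT leNgt; apply/negP => p.
  by have := h _ p; rewrite ltxx.
by under eq_fun do rewrite -nsq_oseries//; exact: hcvg_nsq.
Qed.

Section GramSchmidt.
Context {H : prehilbertType R}.
Variable v : nat -> H.

(** The inverse of 0 is 0, so the zero vector is normalized to itself: this is how dependent vectors
    become zeros in [gram_schmidt]. *)
Definition hnormalize (w : H) : H := (hnorm w)^-1%:C *: w.

Fixpoint gs_seq n : seq H := if n is n'.+1 then
  rcons (gs_seq n')
    (hnormalize (v n' - \sum_(q <- gs_seq n') inner q (v n') *: q)) else [::].

Definition gram_schmidt n : H := last 0 (gs_seq n.+1).
Local Notation q := gram_schmidt.

Lemma gs_seqE n : gs_seq n = [seq q i | i <- index_iota 0 n].
Proof.
rewrite /index_iota subn0; elim: n => // n ih.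
by rewrite -addn1 iotaD map_cat -ih add0n /= addn1/= /gram_schmidt/= last_rcons cats1.
Qed.

Lemma gram_schmidtE n : q n = hnormalize (v n - oseries q (v n) n).
Proof.
by rewrite {1}/gram_schmidt/= last_rcons gs_seqE big_map big_mkord.
Qed.

Lemma hnormalizeK w : w = (hnorm w)%:C *: hnormalize w.
Proof.
rewrite scalerA -rmorphM/=; have [w0|wN0] := eqVneq (hnorm w) 0.
  by rewrite w0 mul0r scale0r; exact: hnorm_eq0.
by rewrite divff// scale1r.
Qed.

Lemma gram_schmidt_orthounit : orthounit q.
Proof.
have q01 i : q i = 0 \/ nsq (q i) = 1.
  rewrite gram_schmidtE; set w := _ - _; have [w0|wN0] := eqVneq (hnorm w) 0.
    by left; rewrite (hnorm_eq0 w0) /hnormalize scaler0.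
  right; rewrite nsqZ sqmod_real -hnorm_sq exprVn mulVf// expf_neq0//.
have qq n : forall i j, (i < n)%N -> (j < i)%N -> inner (q j) (q i) = 0 :> R[i].
  elim: n => // n ih i j; rewrite ltnS leq_eqVlt => /orP[/eqP -> {i} jn|]; last exact: ih.
  rewrite (gram_schmidtE n) innerZr innerBr.
  rewrite inner_sumr (bigD1 (Ordinal jn))//= big1 => [|i ij].
    rewrite addr0 innerZr; have [->|qj] := q01 j; first by rewrite !inner0l mul0r subrr mulr0.
    by rewrite (innerE (q j)) qj mulr1 subrr mulr0.
  rewrite innerZr; suff -> : inner (q j) (q i) = 0 :> R[i] by rewrite mulr0.
  have [ij'|ji|ij'] := ltngtP i j.
  - by rewrite inner_conj ih ?rmorph0// (leq_trans jn).
  - exact: ih.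
  - by case/eqP: ij; apply/val_inj.
split=> // i j; rewrite neq_ltn => /orP[ij|ji]; first exact: qq (ltnSn _) ij.
by rewrite inner_conj (qq _ _ _ (ltnSn _) ji) rmorph0.
Qed.

Lemma gram_schmidt_span n u :
  (forall k, (k <= n)%N -> inner (q k) u = 0) -> inner (v n) u = 0.
Proof.
move=> qu; rewrite -[v n](subrK (oseries q (v n) n)) innerDl.
rewrite [X in inner X u]hnormalizeK -gram_schmidtE innerZl qu// mulr0 add0r.
rewrite inner_suml big1// => i _; rewrite innerZl qu ?mulr0//; exact: ltnW.
Qed.

(** Symmetry gives [c j * <q j, v n> = c n * <q j, v n>]: the projection subtracted from [v n] only
    involves vectors with the same eigenvalue, so that the remainder is still an eigenvector. *)
Lemma gram_schmidt_eigen (A : H -> H) (c : nat -> R) : linear A ->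
  (forall u w, inner (A u) w = inner u (A w) :> R[i]) ->
  (forall n, A (v n) = (c n)%:C *: v n) ->
  forall n, A (q n) = (c n)%:C *: q n.
Proof.
move=> lA sA Av; pose A' := HB.pack A (GRing.isLinear.Build _ _ _ _ A lA) : {linear H -> H}.
elim/ltn_ind => n ih; rewrite gram_schmidtE.
have -> : A (hnormalize (v n - oseries q (v n) n)) =
    (hnorm (v n - oseries q (v n) n))^-1%:C *: A (v n - oseries q (v n) n).
  exact: (linearZ_LR A').
rewrite /hnormalize [RHS]scalerA mulrC -scalerA; congr (_ *: _).
have -> : A (v n - oseries q (v n) n) =
    A (v n) - \sum_(j < n) inner (q j) (v n) *: A (q j).
  rewrite -[A]/(A' : _ -> _) linearB; congr (_ - _).
  by rewrite linear_sum; apply: eq_bigr => j _; rewrite linearZ.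
rewrite Av scalerBr; congr (_ - _); rewrite scaler_sumr; apply: eq_bigr => j _.
rewrite ih// !scalerA; congr (_ *: _).
have := sA (q j) (v n); rewrite ih// Av innerZl innerZr.
by rewrite conj_real => <-; rewrite mulrC.
Qed.

End GramSchmidt.

Lemma linear_op0 H K (A : H -> K) : linear A -> A 0 = 0.
Proof.
move=> lA; have := lA 1 0 0; rewrite !scale1r add0r => h.
by have := congr1 (fun x => x - A 0) h; rewrite subrr addrK.
Qed.

Lemma linear_opZ H K (A : H -> K) a u : linear A -> A (a *: u) = a *: A u.
Proof. by move=> lA; rewrite -[a *: u]addr0 lA linear_op0// addr0. Qed.

(** The last clause identifies partial sums over the selected indices with partial sums of the full
    series taken along [phi]. Convergence of the full series thus passes to the selection. *)
Lemma enumerate_pred (p : pred nat) : (forall N, exists2 k, (N <= k)%N & p k) ->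
  exists phi : nat -> nat, [/\ forall j, p (phi j), {homo phi : i j / (i < j)%N} &
    forall (V : zmodType) (F : nat -> V), (forall k, ~~ p k -> F k = 0) ->
      forall J, \sum_(j < J) F (phi j) = \sum_(k < phi J) F k].
Proof.
move=> pinf; have ex N : exists k, (N <= k)%N && p k.
  by have [k Nk pk] := pinf N; exists k; rewrite Nk.
pose next N := ex_minn (ex N).
have nextP N : [/\ (N <= next N)%N, p (next N) &
    forall k, (N <= k < next N)%N -> ~~ p k].
  rewrite /next; case: ex_minnP => k /andP[Nk pk] mk; split=> // i /andP[Ni ik].
  by apply/negP => pi; have := mk i; rewrite Ni pi leqNgt ik => /(_ isT).
pose phi := fix phi j := if j is j'.+1 then next (phi j').+1 else next 0%N.
have phiS j : (phi j < phi j.+1)%N by have [] := nextP (phi j).+1.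
have phim : {homo phi : i j / (i < j)%N} by apply: homo_ltn => //; exact: ltn_trans.
exists phi; split.
- by case=> [|j]; [have [] := nextP 0%N | have [] := nextP (phi j).+1].
- exact: phim.
- move=> V F F0; elim=> [|J ih].
    rewrite big_ord0 big1// => k _; apply: F0.
    by have [_ _ -> //] := nextP 0%N; rewrite ltn_ord.
  rewrite big_ord_recr/= ih -!(big_mkord xpredT F).
  rewrite (@big_cat_nat _ _ _ (phi J).+1 0 (phi J.+1))//=.
  rewrite [X in _ = _ + X]big_nat [X in _ = _ + X]big1 ?addr0 ?big_nat_recr// => k kJ.
  by apply: F0; have [_ _ ->] := nextP (phi J).+1.
Qed.

Lemma nneseries_lty (a : nat -> R) (M : R) : (forall j, 0 <= a j) ->
  (forall n, \sum_(j < n) a j <= M) -> (\sum_(j <oo) (a j)%:E < +oo)%E.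
Proof.
move=> a0 aM; apply: (@le_lt_trans _ _ M%:E); last exact: ltry.
apply: lime_le; first by apply: is_cvg_nneseries => n _ _; rewrite lee_fin.
by near=> n; rewrite sumEFin lee_fin big_mkord.
Unshelve. all: by end_near. Qed.

Lemma nneseries_le_fine (a : nat -> R) : (forall j, 0 <= a j) ->
  (\sum_(j <oo) (a j)%:E < +oo)%E ->
  forall n, \sum_(j < n) a j <= fine (\sum_(j <oo) (a j)%:E)%E.
Proof.
move=> a0 fa n; rewrite -lee_fin fineK; last first.
  by rewrite ge0_fin_numE//; apply: nneseries_ge0 => k _ _; rewrite lee_fin.
rewrite -sumEFin -(big_mkord xpredT (fun j => (a j)%:E)).
by apply: nneseries_lim_ge => k _; rewrite lee_fin.
Qed.

(** Used for the eigenvalues of a symmetric operator: the indices [2j] and [2j + 1] carry [mu j] and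
    [- mu j]. *)
Lemma sum_half (f : nat -> R) n : \sum_(k < n.*2) f k./2 = 2 * \sum_(j < n) f j.
Proof.
elim: n => [|n ih]; first by rewrite !big_ord0 mulr0.
rewrite doubleS !big_ord_recr/= ih uphalf_double doubleK; lra.
Qed.

(** * The spectral theorem for symmetric operators of Schatten class *)

Section SpectralTheorem.
Context {H : prehilbertType R}.
Hypothesis cH : hcomplete H.

Section Diagonal.
Variables (e : nat -> H) (mu : nat -> R) (B : H -> H).
Hypotheses (oe : orthonormal_seq e) (eB : diagonal_in e mu B).
Let oe' := orthonormal_orthounit oe.

Let partialE u J : \sum_(j < J) (mu j)%:C *: (inner (e j) u *: e j) =
  \sum_(j < J) ((mu j)%:C * inner (e j) u) *: e j.
Proof. by apply: eq_bigr => j _; rewrite scalerA. Qed.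

Lemma diagonal_basis i : B (e i) = (mu i)%:C *: e i.
Proof.
apply: hcvg_unique (eB (e i)) _; apply/hcvgP/cvgnP => c c0.
exists i.+1 => n ilt; rewrite (bigD1 (Ordinal ilt))//= oe eqxx scale1r.
rewrite big1 => [|j ji]; last first.
  by rewrite oe (_ : (j == i :> nat) = false) ?scale0r ?scaler0//; apply/negbTE.
by rewrite addr0 subrr nsq0 subrr normr0.
Qed.

Lemma nsq_diagonal u : \sum_(j < J) mu j ^+ 2 * sqmod (inner (e j) u) @[J --> \oo]
  --> nsq (B u).
Proof.
rewrite (_ : (fun J => _) = fun J => nsq (\sum_(j < J) (mu j)%:C *: (inner (e j) u *: e j))).
  exact: hcvg_nsq.
apply/funext => J; rewrite partialE.
rewrite -(big_mkord xpredT (fun j => ((mu j)%:C * inner (e j) u) *: e j)) nsq_orthosum//.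
rewrite big_mkord; apply: eq_bigr => j _.
by rewrite sqmodM sqmod_real -mulrA sqmod_orthounit.
Qed.

Lemma quadratic_diagonal u :
  \sum_(j < J) mu j * sqmod (inner (e j) u) @[J --> \oo] --> Re (inner u (B u)).
Proof.
have [+ _] := sqmod_cvg0 (hcvg_inner u (eB u)).
rewrite (_ : (fun J => Re _) = (fun J => \sum_(j < J) mu j * sqmod (inner (e j) u)))//.
apply/funext => J; rewrite inner_sumr cRe_sum; apply: eq_bigr => j _.
by rewrite !innerZr [inner u _]inner_conj [_ * _^*]mulrC conjM_sqmod !ReImE; ring.
Qed.

End Diagonal.

Arguments nsq_diagonal {e mu B} _ _ u : rename.
Arguments quadratic_diagonal {e mu B} _ u : rename.

Variables (A : H -> H) (alpha : R).
Hypotheses (alpha0 : 0 < alpha) (sA : schatten alpha A).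
Hypothesis symA : forall u w, inner (A u) w = inner u (A w) :> R[i].

(** The hypothesis diagonalizes only the absolute value [B] of [A]. By symmetry [A ^ 2 = B ^ 2], so
    that eigenvectors of [A] are found inside the eigenspaces of [B]. Each eigenvalue [mu j] is used
    at most twice, with either sign, which keeps the sum of powers finite. *)
Theorem schatten_spectral : exists (lambda : nat -> R) (f : nat -> H),
  [/\ (\sum_(j <oo) (`|lambda j| `^ alpha)%:E < +oo)%E, orthonormal_seq f &
    forall u, hcvg (fun J => \sum_(j < J) (lambda j)%:C *: (inner (f j) u *: f j)) (A u)].
Proof.
have [[lA _] [nu [B [P [b [[[[lB [cB bB]] posB] [A' [adjA BB]]] [e [mu [oe mu0 eB eP]]] ob nuE]]]] nufin]] := sA.
have oe' := orthonormal_orthounit oe.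
have AA u : A (A u) = B (B u).
  rewrite BB; apply/eqP; rewrite -subr_eq0; apply/eqP/inner_eq0.
  by rewrite innerBr -adjA symA subrr.
(* The trace is computed in a basis [b] unrelated to [e]. Parseval expands each [e j] in [b], and
   exchanging the finite sum over [j] with the sum over the basis leaves the diagonal coefficients
   [<b i, P (b i)>]. *)
have [M muM] : exists M, forall n, \sum_(j < n) mu j `^ alpha <= M.
  have tr0 i : 0 <= Re (inner (b i) (P (b i))).
    apply: (cvgn_gec (quadratic_diagonal eP (b i))) => J.
    by apply: sumr_ge0 => j _; rewrite mulr_ge0 ?powR_ge0 ?sqmod_ge0.
  have trlty : (trace_in b P < +oo)%E.
    rewrite ltey; apply/eqP => trE; move: nufin; rewrite nuE trE.
    by rewrite poweRyr ?ltxx// invr_neq0 ?lt0r_neq0.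
  exists (fine (trace_in b P)) => n.
  have cv : \sum_(j < n) mu j `^ alpha * (\sum_(i < I) sqmod (inner (b i) (e j)))
      @[I --> \oo] --> \sum_(j < n) mu j `^ alpha * nsq (e j).
    elim: n => [|n ih].
      by under eq_fun do rewrite big_ord0; rewrite big_ord0; exact: cvg_cst.
    under eq_fun do rewrite big_ord_recr/=; rewrite big_ord_recr/=.
    by apply: cvgD => //; apply: cvgM; [exact: cvg_cst | exact: parseval].
  have -> : \sum_(j < n) mu j `^ alpha = \sum_(j < n) mu j `^ alpha * nsq (e j).
    by apply: eq_bigr => j _; rewrite /nsq oe eqxx mulr1.
  apply: (cvgn_lec cv) => I.
  apply: le_trans (nneseries_le_fine tr0 trlty I).
  under eq_bigr do rewrite mulr_sumr; rewrite exchange_big/=; apply: ler_sum => i _.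
  have := quadratic_diagonal eP (b i) => cv'.
  have nd : nondecreasing_seq (fun J => \sum_(j < J) mu j `^ alpha * sqmod (inner (e j) (b i))).
    apply/nondecreasing_seqP => J; rewrite big_ord_recr/= lerDl.
    by rewrite mulr_ge0 ?powR_ge0 ?sqmod_ge0.
  have := nondecreasing_cvgn_le nd (cvgP _ cv') n; rewrite (cvg_lim _ cv')//.
  by apply: le_trans; apply: ler_sum => j _; rewrite inner_conj sqmod_conj.
have mu_small (d : R) : 0 < d -> exists N, forall j, (N <= j)%N -> mu j <= d.
  move=> d0; have [] := bounded_sum_cauchy (fun j => powR_ge0 (mu j) alpha) muM (powR_gt0 alpha d0).
  move=> N NP; exists N => j Nj; have := NP j j.+1; rewrite Nj leqnSn => /(_ isT).
  rewrite big_nat1 => lt; rewrite leNgt; apply/negP => dm; move: lt.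
  by rewrite ltNge ge0_ler_powR ?nnegrE//; exact: ltW.
(* [A ^ 2] is diagonal in [e], hence [A e_j + mu_j e_j] and [A e_j - mu_j e_j] are eigenvectors of [A] for
   [mu_j] and [- mu_j]. Gram-Schmidt makes them orthogonal, up to zero vectors, which [phi] skips. *)
pose c k := if odd k then - mu k./2 else mu k./2.
pose v k := if mu k./2 == 0 then e k./2 else A (e k./2) + (c k)%:C *: e k./2.
have Bsmall (d : R) N u : 0 <= d -> (forall j, (N <= j)%N -> mu j <= d) ->
    (forall j, (j < N)%N -> inner (e j) u = 0) -> nsq (B u) <= d ^+ 2 * nsq u.
  move=> d0 muN eu; apply: (cvgn_lec (nsq_diagonal oe eB u)) => J.
  apply: (@le_trans _ _ (\sum_(j < J) d ^+ 2 * sqmod (inner (e j) u))).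
    apply: ler_sum => j _; have [jN|Nj] := ltnP j N; first by rewrite eu// sqmod0 !mulr0.
    by rewrite ler_wpM2r ?sqmod_ge0// ler_pXn2r ?nnegrE ?muN.
  by rewrite -mulr_sumr ler_wpM2l ?sqr_ge0// bessel_ineq.
have Aeig i : A (A (e i)) = (mu i ^+ 2)%:C *: e i.
  by rewrite AA !(diagonal_basis oe eB) linear_opZ// (diagonal_basis oe eB) scalerA -rmorphM.
have A0 i : mu i = 0 -> A (e i) = 0.
  move=> mi; apply: inner_eq0; rewrite symA Aeig mi expr0n/= scale0r inner0r//.
have Av k : A (v k) = (c k)%:C *: v k.
  rewrite /v; case: eqP => [mk|/eqP mk].
    by rewrite /c mk oppr0 if_same scale0r A0.
  rewrite addrC lA Aeig scalerDr addrC; congr (_ + _).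
  by rewrite scalerA -rmorphM/= /c; case: ifP; rewrite ?mulrNN -expr2.
set q := gram_schmidt v.
have oq : orthounit q := gram_schmidt_orthounit v.
have Aq k : A (q k) = (c k)%:C *: q k by apply: gram_schmidt_eigen.
(* The difference of [v (2j)] and [v (2j + 1)] is [2 mu_j e_j]; when [mu j] vanishes, [v] is [e j]
   itself. So [e j] lies in the span of the first [2N] vectors [q] for [j < N]. *)
have eq0 N u : (forall k, (k < N.*2)%N -> inner (q k) u = 0) ->
    forall j, (j < N)%N -> inner (e j) u = 0 :> R[i].
  move=> qu j jN; have v0 k : (k < N.*2)%N -> inner (v k) u = 0 :> R[i].
    by move=> kN; apply: gram_schmidt_span => i ik; apply: qu; exact: leq_ltn_trans kN.
  have j2 : (j.*2.+1 < N.*2)%N by rewrite -doubleS leq_double.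
  have := v0 _ j2; have := v0 _ (ltnW j2).
  rewrite /v /c/= uphalf_double doubleK odd_double/=; case: eqP => // /eqP mj.
  rewrite !innerDl !innerZl !conj_real => h1 h2; apply/eqP.
  have : (mu j *+ 2)%:C * inner (e j) u = 0.
    rewrite -[RHS](subrr 0) -{1}h1 -h2 opprD addrACA subrr add0r rmorphMn/= rmorphN/=.
    by rewrite mulNr opprK -mulr2n mulrnAl.
  by move/eqP; rewrite mulf_eq0 (_ : (_ == 0) = false)//= eq_complex/= eqxx andbT mulrn_eq0/= (negbTE mj).
(* Otherwise all [e j] would lie in the span of [N] vectors. Summing the squares of the coefficients
   of [e 0], ..., [e N] in both orders would give [N + 1 <= N]. *)
have qinf N : exists2 k, (N <= k)%N & q k != 0.
  apply/not_exists2P => hq.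
  have qN k : (N <= k)%N -> q k = 0.
    by move=> Nk; have [//|] := hq k; case: eqP => // _ /(_ isT).
  have ne j : nsq (e j) = \sum_(k < N) sqmod (inner (q k) (e j)).
    have r0 k : inner (q k) (e j - oseries q (e j) N) = 0 :> R[i].
      rewrite innerBr inner_oseries//; case: ltnP => [_|/qN ->]; first by rewrite subrr.
      by rewrite inner0l subrr.
    have er0 : inner (e j) (e j - oseries q (e j) N) = 0 :> R[i].
      by apply: (eq0 j.+1) => // k _; exact: r0.
    have : nsq (e j - oseries q (e j) N) = 0.
      rewrite /nsq innerBl er0 sub0r inner_suml big1 ?oppr0// => k _.
      by rewrite innerZl r0 mulr0.
    by rewrite nsq_residual// => /eqP; rewrite subr_eq0 => /eqP.
  have : N.+1%:R <= (N%:R : R).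
    have -> : N.+1%:R = \sum_(j < N.+1) nsq (e j).
      under eq_bigr do rewrite /nsq oe eqxx.
      by rewrite sumr_const card_ord.
    under eq_bigr do rewrite ne; rewrite exchange_big/=.
    apply: (@le_trans _ _ (\sum_(k < N) 1)); last by rewrite sumr_const card_ord.
    apply: ler_sum => k _; apply: (@le_trans _ _ (nsq (q k))).
      by under eq_bigr do rewrite inner_conj sqmod_conj; exact: bessel_ineq.
    by have [->|->] := oq.2 k; rewrite ?nsq0.
  by rewrite ler_nat ltnn.
have [phi [phiq phi_homo phi_sum]] := enumerate_pred qinf.
have phi_inj : injective phi.
  by move=> i j ij; have [/phi_homo|/phi_homo|//] := ltngtP i j; rewrite ij ltnn.
exists (c \o phi), (q \o phi); split.
- apply: (@nneseries_lty _ (2 * M)) => [j|n]; first exact: powR_ge0.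
  pose F k := if q k != 0 then `|c k| `^ alpha else 0.
  rewrite (eq_bigr (fun j : 'I_n => F (phi j))) => [|j _]; last by rewrite /F phiq.
  rewrite phi_sum => [|k]; last by rewrite /F => /negbTE ->.
  (* Passing to an even number of indices completes the pairs that [sum_half] needs. *)
  apply: (@le_trans _ _ (\sum_(k < (phi n).*2) mu k./2 `^ alpha)).
    rewrite -(big_mkord xpredT F) -(big_mkord xpredT (fun k => mu k./2 `^ alpha)).
    rewrite [leRHS](@big_cat_nat _ _ _ (phi n))//=; last by rewrite -addnn leq_addr.
    rewrite -[leLHS]addr0 lerD//; last by apply: sumr_ge0 => *; exact: powR_ge0.
    apply: ler_sum => k _; rewrite /F; case: ifP => _; last exact: powR_ge0.
    by rewrite /c; case: ifP => _; rewrite ?normrN ger0_norm.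
  by rewrite (sum_half (fun j => mu j `^ alpha)) ler_pM2l.
- move=> i j; have [->|ij] := eqVneq i j.
    have [q0|q1] := oq.2 (phi j); first by have := phiq j; rewrite q0 eqxx.
    by rewrite /= innerE q1.
  by rewrite /= oq.1// (inj_eq phi_inj).
- move=> u; pose r (K : nat) := u - oseries q u K.
  have rE (K : nat) : A (r K) = A u - \sum_(k < K) (c k)%:C *: (inner (q k) u *: q k).
    rewrite /r addrC -scaleN1r lA scaleN1r addrC; congr (_ - _).
    elim: K => [|K ih].
      by rewrite /oseries !big_ord0 linear_op0.
    rewrite /oseries !big_ord_recr/= addrC lA -/(oseries _ _ _) ih addrC Aq; congr (_ + _).
    by rewrite !scalerA mulrC.
  (* The squared norm of [A r] is [<r, B (B r)>], at most [|r| |cB| |B r|]. The last factor is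
     small, since [r] is orthogonal to the first [N] vectors [e j] and the other eigenvalues of [B]
     are at most [d / m]. The number [m] is chosen so that the final product stays below [d]. *)
  have rcv : hcvg (fun K : nat => \sum_(k < K) (c k)%:C *: (inner (q k) u *: q k)) (A u).
    apply/hcvgP/cvgnP => d d0.
    pose m := `|cB| * nsq u + 1; have m0 : 0 < m by rewrite ltr_pwDr// mulr_ge0 ?nsq_ge0.
    have dm0 : 0 < d / m by rewrite divr_gt0.
    have [N NP] := mu_small _ dm0; exists N.*2 => K NK.
    rewrite subr0 ger0_norm ?nsq_ge0// -nsqN opprB -rE.
    have Brsmall : nsq (B (r K)) <= (d / m) ^+ 2 * nsq u.
      apply: le_trans (Bsmall _ N _ (ltW dm0) NP _) _ => [j jN|].
        apply: (eq0 N) => // k kN; rewrite innerBr inner_oseries// (leq_trans kN NK).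
        by rewrite subrr.
      rewrite ler_wpM2l ?sqr_ge0// nsq_residual// gerBl.
      by apply: sumr_ge0 => *; exact: sqmod_ge0.
    have ru : nsq (r K) <= nsq u.
      by rewrite nsq_residual// gerBl; apply: sumr_ge0 => *; exact: sqmod_ge0.
    have BBr : nsq (B (B (r K))) <= cB ^+ 2 * nsq (B (r K)).
      have := bB (B (r K)) => h; have := hnorm_ge0 (B (B (r K))) => h0.
      rewrite -!hnorm_sq -exprMn ler_pXn2r// nnegrE//; exact: le_trans h.
    have Ar : nsq (A (r K)) ^+ 2 <= (`|cB| * nsq u * (d / m)) ^+ 2.
      have -> : nsq (A (r K)) = Re (inner (r K) (B (B (r K)))) by rewrite /nsq symA AA.
      apply: le_trans (Re_le_sqmod _) _; apply: le_trans (hcauchy_schwarz _ _) _.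
      apply: (@le_trans _ _ (nsq u * (cB ^+ 2 * ((d / m) ^+ 2 * nsq u)))).
        apply: ler_pM; rewrite ?nsq_ge0//; apply: le_trans BBr _.
        by rewrite ler_wpM2l ?sqr_ge0.
      by rewrite !exprMn real_normK ?num_real// le_eqVlt; apply/orP; left; apply/eqP; ring.
    have b0 : 0 <= `|cB| * nsq u * (d / m).
      by rewrite mulr_ge0 ?(ltW dm0)// mulr_ge0 ?nsq_ge0.
    move: Ar; rewrite ler_pXn2r ?nnegrE ?nsq_ge0// => /le_lt_trans; apply.
    by rewrite mulrCA -ltr_pdivlMl// mulVf ?lt0r_neq0// ltr_pdivrMr// mul1r /m ltrDl.
  apply/hcvgP/cvgnP => d d0; have /hcvgP/cvgnP/(_ d d0)[N NP] := rcv.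
  have phi_ge J : (J <= phi J)%N.
    by elim: J => // J ih; exact: leq_ltn_trans ih (phi_homo _ _ (ltnSn _)).
  exists N => J NJ; have := NP (phi J) (leq_trans NJ (phi_ge J)).
  rewrite -(phi_sum _ (fun k => (c k)%:C *: (inner (q k) u *: q k)))// => k /negPn/eqP ->.
  by rewrite !scaler0.
Qed.

End SpectralTheorem.
End Hilbert.

(** * Complex-valued integrals and [L2] *)

Section Modulus.
Context {R : realType}.
Implicit Types z w : R[i].

(** The norm of [R[i]] has values in [R[i]]; this is the same number as a real, ready to be
    integrated. *)
Definition cmod z : R := Num.sqrt (sqmod z).

Lemma cmod_ge0 z : 0 <= cmod z. Proof. exact: sqrtr_ge0. Qed.
Lemma cmod_sq z : cmod z ^+ 2 = sqmod z.
Proof. by rewrite sqr_sqrtr// sqmod_ge0. Qed.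
Lemma cmodM z w : cmod (z * w) = cmod z * cmod w.
Proof. by rewrite /cmod sqmodM sqrtrM// sqmod_ge0. Qed.
Lemma cmod_conj z : cmod z^* = cmod z. Proof. by rewrite /cmod sqmod_conj. Qed.
Lemma cmod_real (x : R) : cmod x%:C = `|x|.
Proof. by rewrite /cmod sqmod_real sqrtr_sqr. Qed.
Lemma cmod0 : cmod (0 : R[i]) = 0. Proof. by rewrite /cmod sqmod0 sqrtr0. Qed.
Lemma cmodN z : cmod (- z) = cmod z. Proof. by rewrite /cmod sqmodN. Qed.
Lemma cmod_normE z : `|z| = (cmod z)%:C.
Proof. by rewrite normc_def. Qed.
Lemma cmodD z w : cmod (z + w) <= cmod z + cmod w.
Proof. by rewrite -lecR rmorphD/= -!cmod_normE ler_normD. Qed.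
Lemma normRe_le_cmod z : `|Re z| <= cmod z.
Proof. by rewrite -sqrtr_sqr ler_wsqrtr// Re_le_sqmod. Qed.
Lemma normIm_le_cmod z : `|Im z| <= cmod z.
Proof. by rewrite -sqrtr_sqr ler_wsqrtr// Im_le_sqmod. Qed.
Lemma cmod_le_ReIm z : cmod z <= `|Re z| + `|Im z|.
Proof.
rewrite -(@ler_pXn2r _ 2)// ?nnegrE ?cmod_ge0 ?addr_ge0// cmod_sq /sqmod.
rewrite -(real_normK (num_real (Re z))) -(real_normK (num_real (Im z))) sqrrD.
by rewrite lerD2r lerDl mulrn_wge0// mulr_ge0.
Qed.
Lemma cmodM_le z w : cmod z * cmod w <= sqmod z + sqmod w.
Proof.
rewrite -!cmod_sq; have := sqr_ge0 (cmod z - cmod w); have := cmod_ge0 z; have := cmod_ge0 w.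
nra.
Qed.
Lemma sqmod_le_sqr z (c : R) : 0 <= c -> (sqmod z <= c ^+ 2) = (cmod z <= c).
Proof. by move=> c0; rewrite -cmod_sq ler_pXn2r// nnegrE cmod_ge0. Qed.

(** Complex limits are mostly expressed as real sequences [sqmod (u k - l)] tending to 0, so that
    real convergence results apply directly. *)
Lemma ccvgP (u : nat -> R[i]) (l : R[i]) :
  Re (u k) @[k --> \oo] --> Re l -> Im (u k) @[k --> \oo] --> Im l ->
  sqmod (u k - l) @[k --> \oo] --> (0 : R).
Proof.
move=> ur ui; rewrite (_ : (fun k => _) = fun k =>
  (Re (u k) - Re l) * (Re (u k) - Re l) + (Im (u k) - Im l) * (Im (u k) - Im l)); last first.
  by apply/funext => k; rewrite /sqmod !ReImE !expr2.
have cz (h : nat -> R) m : h k @[k --> \oo] --> m -> (h k - m) * (h k - m) @[k --> \oo] --> (0 : R).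
  move=> hm; have : h k - m @[k --> \oo] --> (0 : R).
    by rewrite -(subrr m); apply: cvgB => //; exact: cvg_cst.
  by move=> h0; rewrite -(mulr0 (0 : R)); exact: cvgM.
by rewrite -(addr0 (0 : R)); apply: cvgD; exact: cz.
Qed.

End Modulus.

Section ComplexIntegral.
Context {d} {T : measurableType d} {R : realType}.
Variable mu : {measure set T -> \bar R}.
Implicit Types f g : T -> R[i].

Definition cintegrable f := mu.-integrable setT (fun x => (Re (f x))%:E) /\
  mu.-integrable setT (fun x => (Im (f x))%:E).

Lemma cmeasurableN f : cmeasurable f -> cmeasurable (fun x => - f x).
Proof.
move=> mf; rewrite (_ : (fun x => _) = fun x => cst (-1) x * f x).
  by apply: cmeasurableM => //; exact: cmeasurable_cst.
by apply/funext => x; rewrite mulN1r.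
Qed.

Lemma cmeasurableB f g : cmeasurable f -> cmeasurable g ->
  cmeasurable (fun x => f x - g x).
Proof. by move=> mf mg; apply: cmeasurableD => //; exact: cmeasurableN. Qed.

Lemma cmeasurable_sum I (r : seq I) (F : I -> T -> R[i]) :
  (forall i, cmeasurable (F i)) -> cmeasurable (fun x => \sum_(i <- r) F i x).
Proof.
move=> mF; elim: r => [|i r ih].
  rewrite (_ : (fun x => _) = cst 0); first exact: cmeasurable_cst.
  by apply/funext => x; rewrite big_nil.
rewrite (_ : (fun x => _) = fun x => F i x + \sum_(j <- r) F j x).
  exact: cmeasurableD.
by apply/funext => x; rewrite big_cons.
Qed.

Lemma cmeasurable_real (h : T -> R) : measurable_fun setT h ->
  cmeasurable (fun x => (h x)%:C).
Proof. by move=> mh; split => //=; exact: measurable_cst. Qed.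

Lemma measurable_cmod f : cmeasurable f -> measurable_fun setT (fun x => cmod (f x)).
Proof.
move=> mf; apply: (measurableT_comp _ (measurable_sqmod mf)).
exact: (continuous_measurable_fun (@sqrt_continuous R)).
Qed.

Lemma cintegrable_cmeasurable f : cintegrable f -> cmeasurable f.
Proof.
by move=> [/measurable_int/measurable_EFinP fr /measurable_int/measurable_EFinP fi].
Qed.

Lemma cintegrable_le f (g : T -> R) : cmeasurable f ->
  mu.-integrable setT (EFin \o g) -> (forall x, cmod (f x) <= g x) -> cintegrable f.
Proof.
move=> [mr mi] ig fg; split; (apply: (le_integrable measurableT _ _ ig);
  first exact/measurable_EFinP); move=> x _ /=; rewrite lee_fin (le_trans _ (ler_norm _))//;
  apply: le_trans (fg x); [exact: normRe_le_cmod | exact: normIm_le_cmod].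
Qed.

Lemma cintegrable_cmod f : cintegrable f -> mu.-integrable setT (fun x => (cmod (f x))%:E).
Proof.
move=> if_; have [fr fi] := if_; have mf := cintegrable_cmeasurable if_.
have := integrableD measurableT (integrable_abse fr) (integrable_abse fi).
apply: le_integrable => //; first exact/measurable_EFinP/measurable_cmod.
move=> x _; rewrite /= lee_fin ger0_norm ?cmod_ge0// ger0_norm ?addr_ge0//.
exact: cmod_le_ReIm.
Qed.

Lemma cintegrableD f g : cintegrable f -> cintegrable g -> cintegrable (fun x => f x + g x).
Proof.
move=> [fr fi] [gr gi]; split.
  by apply: eq_integrable (integrableD measurableT fr gr) => // x _; rewrite /= cReD EFinD.
by apply: eq_integrable (integrableD measurableT fi gi) => // x _; rewrite /= cImD EFinD.
Qed.

Lemma cintegrableZ (a : R[i]) f : cintegrable f -> cintegrable (fun x => a * f x).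
Proof.
move=> fi; apply: (cintegrable_le (g := fun x => cmod a * cmod (f x))).
- by apply: cmeasurableM; [exact: cmeasurable_cst | exact: cintegrable_cmeasurable].
- apply: eq_integrable (integrableZl measurableT (cmod a) (cintegrable_cmod fi)) => //.
- by move=> x; rewrite cmodM.
Qed.

Lemma cintegrableN f : cintegrable f -> cintegrable (fun x => - f x).
Proof.
move=> fi; rewrite (_ : (fun x => _) = fun x => -1 * f x); first exact: cintegrableZ.
by apply/funext => x; rewrite mulN1r.
Qed.

Lemma cintegrableB f g : cintegrable f -> cintegrable g -> cintegrable (fun x => f x - g x).
Proof. by move=> fi gi; apply: cintegrableD => //; exact: cintegrableN. Qed.

Lemma cintegrable_conj f : cintegrable f -> cintegrable (fun x => (f x)^*).
Proof.
move=> fi; apply: (cintegrable_le (g := fun x => cmod (f x))).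
- exact/cmeasurable_conj/cintegrable_cmeasurable.
- exact: cintegrable_cmod.
- by move=> x; rewrite cmod_conj.
Qed.

Lemma eq_cintegral f g : f =1 g -> cintegral mu f = cintegral mu g.
Proof. by move=> /funext ->. Qed.

Lemma cintegral0 : cintegral mu (fun=> 0) = 0.
Proof. by apply: complex_ext; rewrite /= Rintegral_cst//= mul0r. Qed.

Lemma cintegralD f g : cintegrable f -> cintegrable g ->
  cintegral mu (fun x => f x + g x) = cintegral mu f + cintegral mu g.
Proof.
move=> [fr fi] [gr gi]; apply: complex_ext; rewrite ?cReD ?cImD /cintegral/= -RintegralD//;
  by congr Rintegral; apply/funext => x; rewrite ?cReD ?cImD.
Qed.

Lemma cintegralZ (a : R[i]) f : cintegrable f ->
  cintegral mu (fun x => a * f x) = a * cintegral mu f.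
Proof.
move=> [fr fi].
have iZ k h : mu.-integrable setT (fun x => (h x)%:E) ->
    mu.-integrable setT (EFin \o (fun x => k * h x)).
  by move=> hi; apply: eq_integrable (integrableZl _ k hi).
apply: complex_ext; rewrite ?[RHS]cReM ?[RHS]cImM /cintegral/= -!RintegralZl//.
  rewrite -RintegralB//; try exact: iZ.
  by congr Rintegral; apply/funext => x; rewrite cReM.
rewrite -RintegralD//; try exact: iZ.
by congr Rintegral; apply/funext => x; rewrite cImM.
Qed.

Lemma cintegralN f : cintegrable f -> cintegral mu (fun x => - f x) = - cintegral mu f.
Proof.
move=> fi; rewrite -mulN1r -cintegralZ//; apply: eq_cintegral => x.
by rewrite mulN1r.
Qed.

Lemma cintegralB f g : cintegrable f -> cintegrable g ->
  cintegral mu (fun x => f x - g x) = cintegral mu f - cintegral mu g.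
Proof.
by move=> fi gi; rewrite cintegralD ?cintegralN//; exact: cintegrableN.
Qed.

Lemma cintegrable_sum I (r : seq I) (F : I -> T -> R[i]) :
  (forall i, cintegrable (F i)) -> cintegrable (fun x => \sum_(i <- r) F i x).
Proof.
move=> iF; elim: r => [|i r ih].
  rewrite (_ : (fun x => _) = fun=> 0); last by apply/funext => x; rewrite big_nil.
  by split; exact: integrable0.
rewrite (_ : (fun x => _) = fun x => F i x + \sum_(j <- r) F j x).
  exact: cintegrableD.
by apply/funext => x; rewrite big_cons.
Qed.

Lemma cintegral_sum I (r : seq I) (F : I -> T -> R[i]) :
  (forall i, cintegrable (F i)) ->
  cintegral mu (fun x => \sum_(i <- r) F i x) = \sum_(i <- r) cintegral mu (F i).
Proof.
move=> iF; elim: r => [|i r ih].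
  by rewrite big_nil -[RHS]cintegral0; apply: eq_cintegral => x; rewrite big_nil.
rewrite big_cons -ih -cintegralD//; last exact: cintegrable_sum.
by apply: eq_cintegral => x; rewrite big_cons.
Qed.

Lemma cintegral_conj f : cintegrable f ->
  cintegral mu (fun x => (f x)^*) = (cintegral mu f)^*.
Proof.
move=> [fr fi]; apply: complex_ext; rewrite !ReImE /cintegral/=.
  by congr Rintegral; apply/funext => x; rewrite cRe_conj.
rewrite -mulN1r -RintegralZl//; congr Rintegral.
by apply/funext => x; rewrite cIm_conj mulN1r.
Qed.

Lemma ae_eq_cintegral f g : cmeasurable f -> cmeasurable g ->
  {ae mu, forall x, f x = g x} -> cintegral mu f = cintegral mu g.
Proof.
move=> [fr fi] [gr gi] fg; rewrite /cintegral; congr Complex; congr fine;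
  (apply: ae_eq_integral => //; try exact/measurable_EFinP);
  by apply: filterS fg => x /= ->.
Qed.

(** Multiplying [f] by the conjugate of its integral [I] makes the integral the real number
    [|I| ^ 2], which is bounded through real parts; one factor [|I|] is then cancelled. *)
Lemma cmod_cintegral_le f : cintegrable f ->
  ((cmod (cintegral mu f))%:E <= \int[mu]_x (cmod (f x))%:E)%E.
Proof.
move=> fi; set I := cintegral mu f; have ic := cintegrable_cmod fi.
have [->|I0] := eqVneq (cmod I) 0.
  by apply: integral_ge0 => x _; rewrite lee_fin cmod_ge0.
have Ip : 0 < cmod I by rewrite lt0r I0 cmod_ge0.
have Z : Re (I^* * I) <= cmod I * (\int[mu]_x cmod (f x))%R.
  rewrite {2}/I -cintegralZ// /cintegral/= -RintegralZl//.
  apply: le_Rintegral => //.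
  - by have [] := cintegrableZ (I^*) fi.
  - by apply: eq_integrable (integrableZl measurableT (cmod I) ic).
  - move=> x _; rewrite -[X in _ <= X * _]cmod_conj -cmodM.
    exact: le_trans (ler_norm _) (normRe_le_cmod _).
move: Z; rewrite conjM_sqmod cRe_real -cmod_sq expr2 ler_pM2l// => Z.
by rewrite -[leRHS]fineK ?lee_fin//; exact: integrable_fin_num.
Qed.

Lemma cmod_cintegral_bound f (g : T -> R) : cmeasurable f ->
  mu.-integrable setT (EFin \o g) -> (forall x, cmod (f x) <= g x) ->
  cmod (cintegral mu f) <= \int[mu]_x g x.
Proof.
move=> mf ig fg; have fi := cintegrable_le mf ig fg.
rewrite -lee_fin; apply: le_trans (cmod_cintegral_le fi) _.
rewrite /Rintegral fineK; last exact: (integrable_fin_num measurableT ig).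
apply: le_integral => //; [exact: cintegrable_cmod|].
by move=> x _; rewrite lee_fin.
Qed.

End ComplexIntegral.

Section SquareNorm.
Context {d} {T : measurableType d} {R : realType}.
Variable mu : {measure set T -> \bar R}.
Implicit Types f g : T -> R[i].

(** Extended-real values allow square norms to be compared before they are known to be finite. *)
Definition N2 f : \bar R := (\int[mu]_x (sqmod (f x))%:E)%E.

Lemma N2_ge0 f : (0 <= N2 f)%E.
Proof. by apply: integral_ge0 => x _; rewrite lee_fin sqmod_ge0. Qed.

Lemma measurable_sqmodE f : cmeasurable f -> measurable_fun setT (fun x => (sqmod (f x))%:E).
Proof. by move=> mf; exact/measurable_EFinP/measurable_sqmod. Qed.

Lemma square_integrable_fin f : square_integrable mu f -> N2 f \is a fin_num.
Proof. by move=> [_ fi]; rewrite ge0_fin_numE// N2_ge0. Qed.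

Lemma square_integrable_int f : square_integrable mu f ->
  mu.-integrable setT (fun x => (sqmod (f x))%:E).
Proof.
move=> [mf fi]; apply/integrableP; split; first exact: measurable_sqmodE.
by under eq_integral do rewrite gee0_abs ?lee_fin ?sqmod_ge0//.
Qed.

Lemma N2_ae f g : cmeasurable f -> cmeasurable g ->
  {ae mu, forall x, f x = g x} -> N2 f = N2 g.
Proof.
move=> mf mg fg; apply: ge0_ae_eq_integral => //; try exact: measurable_sqmodE;
  try by move=> x _; rewrite lee_fin sqmod_ge0.
by apply: filterS fg => x /= ->.
Qed.

Lemma eq_N2 f g : (forall x, sqmod (f x) = sqmod (g x)) -> N2 f = N2 g.
Proof. by move=> fg; apply: eq_integral => x _; rewrite fg. Qed.

Lemma N2_le f g : cmeasurable f -> cmeasurable g ->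
  (forall x, sqmod (f x) <= sqmod (g x)) -> (N2 f <= N2 g)%E.
Proof.
move=> mf mg fg; apply: ge0_le_integral => //; try exact: measurable_sqmodE;
  by move=> x _; rewrite lee_fin ?sqmod_ge0.
Qed.

Lemma N2Z (a : R[i]) f : cmeasurable f -> N2 (fun x => a * f x) = ((sqmod a)%:E * N2 f)%E.
Proof.
move=> mf; rewrite /N2 -ge0_integralZl//=.
- by apply: eq_integral => x _; rewrite sqmodM EFinM.
- exact: measurable_sqmodE.
- by move=> x _; rewrite lee_fin sqmod_ge0.
- by rewrite lee_fin sqmod_ge0.
Qed.

Lemma N2D_le f g : cmeasurable f -> cmeasurable g ->
  (N2 (fun x => (f x + g x)%R) <= 2%:E * (N2 f + N2 g))%E.
Proof.
move=> mf mg; rewrite /N2 -ge0_integralD//; try exact: measurable_sqmodE;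
  try by move=> x _; rewrite lee_fin sqmod_ge0.
rewrite -ge0_integralZl//=.
- apply: ge0_le_integral => //.
  + by move=> x _; rewrite lee_fin sqmod_ge0.
  + exact/measurable_sqmodE/cmeasurableD.
  + by apply: measurable_funeM; apply: emeasurable_funD; exact: measurable_sqmodE.
  + by move=> x _; rewrite -EFinD -EFinM lee_fin sqmodD_le.
- by apply: emeasurable_funD; exact: measurable_sqmodE.
- by move=> x _; rewrite adde_ge0 ?lee_fin ?sqmod_ge0.
Qed.

Lemma N2B_le f g : cmeasurable f -> cmeasurable g ->
  (N2 (fun x => (f x - g x)%R) <= 2%:E * (N2 f + N2 g))%E.
Proof.
move=> mf mg; have := N2D_le mf (cmeasurableN mg).
by rewrite (eq_N2 (f := fun x => - g x) (g := g))// => x; rewrite sqmodN.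
Qed.

Lemma square_integrableZ a f : square_integrable mu f ->
  square_integrable mu (fun x => a * f x).
Proof.
move=> [mf fi]; split; first by apply: cmeasurableM => //; exact: cmeasurable_cst.
by rewrite -/(N2 _) N2Z// lte_mul_pinfty ?lee_fin ?sqmod_ge0.
Qed.

Lemma square_integrableD f g : square_integrable mu f -> square_integrable mu g ->
  square_integrable mu (fun x => f x + g x).
Proof.
move=> [mf fi] [mg gi]; split; first exact: cmeasurableD.
apply: le_lt_trans (N2D_le mf mg) _.
by apply: lte_mul_pinfty; rewrite ?lee_fin//; exact: lte_add_pinfty.
Qed.

Lemma square_integrableB f g : square_integrable mu f -> square_integrable mu g ->
  square_integrable mu (fun x => f x - g x).
Proof.
move=> fi gi; apply: (square_integrableD fi).
have := square_integrableZ (-1) gi; congr (square_integrable mu _).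
by apply/funext => x; rewrite mulN1r.
Qed.

Lemma square_integrable_le f g : cmeasurable f -> square_integrable mu g ->
  (forall x, sqmod (f x) <= sqmod (g x)) -> square_integrable mu f.
Proof.
by move=> mf [mg gi] fg; split=> //; apply: le_lt_trans gi; exact: N2_le.
Qed.

Lemma square_integrable_conj f : square_integrable mu f ->
  square_integrable mu (fun x => (f x)^*).
Proof.
move=> fi; apply: square_integrable_le (fi) _ => [|x].
  by apply: cmeasurable_conj; have [] := fi.
by rewrite sqmod_conj.
Qed.

Lemma cintegrableM f g : square_integrable mu f -> square_integrable mu g ->
  cintegrable mu (fun x => f x * g x).
Proof.
move=> fi gi; apply: (cintegrable_le (g := fun x => sqmod (f x) + sqmod (g x))).
- by apply: cmeasurableM; [have [] := fi | have [] := gi].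
- have := integrableD measurableT (square_integrable_int fi) (square_integrable_int gi).
  by apply: eq_integrable => // x _; rewrite /= EFinD.
- by move=> x; rewrite cmodM cmodM_le.
Qed.

Lemma cintegrableJM f g : square_integrable mu f -> square_integrable mu g ->
  cintegrable mu (fun x => (f x)^* * g x).
Proof. by move=> fi; apply: cintegrableM; exact: square_integrable_conj. Qed.

Lemma L2of_repr f : square_integrable mu f ->
  {ae mu, forall x, L2repr (L2of mu f) x = f x}.
Proof.
move=> fi; rewrite /L2of; case: insubP => [g _ gf|]; last by rewrite unfold_in => /asboolPn.
by have := L2repr_class g; apply: filterS => x ->; rewrite -[RHS](congr1 (fun h => h x) gf).
Qed.

Lemma sqfunP (u : sqfun mu) : square_integrable mu u.
Proof. by split; [exact: sqfun_cmeasurable | exact: sqfun_lty]. Qed.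

Lemma L2ext (u v : L2 mu) : {ae mu, forall x, L2repr u x = L2repr v x} -> u = v.
Proof. by move=> uv; rewrite -[u]L2reprK -[v]L2reprK; apply/L2classE. Qed.

Lemma L2reprD (u v : L2 mu) : {ae mu, forall x, L2repr (u + v) x = L2repr u x + L2repr v x}.
Proof. by have := L2repr_class (L2repr u + L2repr v); rewrite L2classD !L2reprK. Qed.

Lemma L2reprZ (a : R[i]) (u : L2 mu) : {ae mu, forall x, L2repr (a *: u) x = a * L2repr u x}.
Proof. exact: (L2repr_class (a *: L2repr u)). Qed.

Lemma L2reprB (u v : L2 mu) : {ae mu, forall x, L2repr (u - v) x = L2repr u x - L2repr v x}.
Proof.
rewrite -scaleN1r; have := L2reprD u (-1 *: v); have := L2reprZ (-1) v.
by apply: filterS2 => x -> ->; rewrite mulN1r.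
Qed.

Lemma L2repr0 : {ae mu, forall x, L2repr (0 : L2 mu) x = 0}.
Proof. by rewrite -L2class0; exact: L2repr_class. Qed.

Lemma L2_innerE (u v : L2 mu) f g : cmeasurable f -> cmeasurable g ->
  {ae mu, forall x, L2repr u x = f x} -> {ae mu, forall x, L2repr v x = g x} ->
  inner u v = cintegral mu (fun x => (f x)^* * g x) :> R[i].
Proof.
move=> mf mg uf vg; rewrite -[LHS]/(L2inner u v); apply: ae_eq_cintegral.
- by apply: cmeasurableM; [apply: cmeasurable_conj|]; exact: sqfun_cmeasurable.
- by apply: cmeasurableM => //; exact: cmeasurable_conj.
- by apply: filterS2 uf vg => x -> ->.
Qed.

Lemma L2_innerr (u v : L2 mu) :
  inner u v = cintegral mu (fun x => (L2repr u x)^* * L2repr v x) :> R[i].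
Proof. by []. Qed.

Lemma L2_innerof f g : square_integrable mu f -> square_integrable mu g ->
  inner (L2of mu f) (L2of mu g) = cintegral mu (fun x => (f x)^* * g x) :> R[i].
Proof.
by move=> fi gi; apply: L2_innerE; [by have [] := fi|by have [] := gi|exact: L2of_repr..].
Qed.

Lemma nsq_N2 (u : L2 mu) : (nsq u)%:E = N2 (L2repr u).
Proof.
rewrite /nsq L2_innerr /cintegral/= /Rintegral.
rewrite (_ : (fun x => _) = fun x => (sqmod (L2repr u x))%:E); last first.
  by apply/funext => x; rewrite conjM_sqmod.
by rewrite fineK//; apply: square_integrable_fin; exact: sqfunP.
Qed.

Lemma nsq_L2of f : square_integrable mu f -> (nsq (L2of mu f))%:E = N2 f.
Proof.
move=> fi; rewrite nsq_N2; apply: N2_ae; [exact: sqfun_cmeasurable|by have [] := fi|].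
exact: L2of_repr.
Qed.

Lemma nsqB_N2 (u v : L2 mu) : (nsq (u - v))%:E = N2 (fun x => L2repr u x - L2repr v x).
Proof.
rewrite nsq_N2; apply: N2_ae; [exact: sqfun_cmeasurable| |exact: L2reprB].
by apply: cmeasurableB; exact: sqfun_cmeasurable.
Qed.

Lemma L2of_reprK (u : L2 mu) : L2of mu (L2repr u) = u.
Proof. by apply: L2ext; apply: L2of_repr; exact: sqfunP. Qed.

Lemma L2of_ae f g : square_integrable mu f -> square_integrable mu g ->
  {ae mu, forall x, f x = g x} -> L2of mu f = L2of mu g.
Proof.
move=> fi gi fg; apply: L2ext; have := L2of_repr fi; have := L2of_repr gi.
by move=> hg; apply: filterS3 hg fg => x -> -> ->.
Qed.

Lemma cauchy_schwarz_cintegral f g : square_integrable mu f -> square_integrable mu g ->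
  ((sqmod (cintegral mu (fun x => f x * g x)))%:E <= N2 f * N2 g)%E.
Proof.
move=> fi gi; have fi' := square_integrable_conj fi.
have -> : cintegral mu (fun x => f x * g x) = inner (L2of mu (fun x => (f x)^*)) (L2of mu g).
  by rewrite L2_innerof//; apply: eq_cintegral => x; rewrite conjCK.
rewrite (eq_N2 (f := f) (g := fun x => (f x)^*)) => [|x]; last by rewrite sqmod_conj.
by rewrite -nsq_L2of// -(nsq_L2of gi) -EFinM lee_fin hcauchy_schwarz.
Qed.

End SquareNorm.

(** * Completeness of [L2], Fubini, dominated convergence *)

Section Cauchy.
Context {R : realType}.
Implicit Types (u a : nat -> R).

Lemma real_cauchy_cvg u :
  (forall e, 0 < e -> exists N, forall i j, (N <= i <= j)%N -> `|u j - u i| < e) -> cvgn u.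
Proof.
move=> uC; apply/cauchy_cvgP/cauchy_exP => e e0; have [N NP] := uC e e0.
exists (u N); exists N => // j /= Nj; rewrite /ball/= distrC.
by apply: NP; rewrite leqnn.
Qed.

Lemma increments_sum u a : (forall k, `|u k.+1 - u k| <= a k) ->
  forall i j, (i <= j)%N -> `|u j - u i| <= \sum_(i <= k < j) a k.
Proof.
move=> ua i j ij; rewrite -telescope_sumr//.
by apply: le_trans (ler_norm_sum _ _ _) _; apply: ler_sum => k _.
Qed.

Lemma increments_cvg u a M : (forall k, `|u k.+1 - u k| <= a k) ->
  (forall n, \sum_(k < n) a k <= M) -> cvgn u.
Proof.
move=> ua aM; have a0 k : 0 <= a k by apply: le_trans (ua k).
apply: real_cauchy_cvg => e e0; have [N NP] := bounded_sum_cauchy a0 aM e0.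
exists N => i j ij; apply: le_lt_trans (NP _ _ ij).
by apply: increments_sum => //; case/andP: ij.
Qed.

Lemma geometric_sum_le (q : R) n : 0 <= q -> q < 1 -> \sum_(k < n) q ^+ k <= (1 - q)^-1.
Proof.
move=> q0 q1; have q1' : 0 < 1 - q by rewrite subr_gt0.
rewrite -(ler_pM2l q1') divff ?gt_eqF// -[X in X * _]opprB mulNr -subrX1 opprB.
by rewrite gerBl exprn_ge0.
Qed.

Lemma sqmodB_cvg (u : nat -> R[i]) (l c : R[i]) :
  sqmod (u k - l) @[k --> \oo] --> (0 : R) ->
  sqmod (u k - c) @[k --> \oo] --> sqmod (l - c).
Proof.
move=> /sqmod_cvg0[ur ui]; rewrite /sqmod.
have sq (h : nat -> R) (m b : R) : h k @[k --> \oo] --> m ->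
    (h k - b) ^+ 2 @[k --> \oo] --> (m - b) ^+ 2.
  move=> hm; have hb : h k - b @[k --> \oo] --> m - b by apply: cvgB => //; exact: cvg_cst.
  by rewrite expr2; under eq_fun do rewrite expr2; exact: cvgM.
by apply: cvgD; rewrite ?cReB ?cImB; [under eq_fun do rewrite cReB | under eq_fun do rewrite cImB]; exact: sq.
Qed.

End Cauchy.

Section Measurability.
Context {d} {T : measurableType d} {R : realType}.

(** The upper limit is measurable everywhere, also where the sequence diverges; the limit function
    is defined from it, so that no exceptional set has to be removed. *)
Lemma measurable_limit (u : nat -> T -> R) : (forall k, measurable_fun setT (u k)) ->
  exists2 v : T -> R, measurable_fun setT v &
    forall x, cvgn (u^~ x) -> v x = limn (u^~ x).
Proof.
move=> mu_; exists (fun x => fine (limn_esup (fun k => (u k x)%:E))).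
  have mf : measurable_fun [set: \bar R] fine by exact: fine_measurable.
  apply: (measurableT_comp mf); apply: measurable_fun_limn_esup => k.
  exact/measurable_EFinP.
move=> x ux; have ux' : (u k x)%:E @[k --> \oo] --> (limn (u^~ x))%:E.
  by apply: cvg_EFin => //; near=> k.
by rewrite (cvg_limn_einf_sup ux').
Unshelve. all: by end_near. Qed.

Variable mu : {measure set T -> \bar R}.

(** Serves to remove truncations: a bound uniform in the truncation survives the almost everywhere
    limit, without any domination. *)
Lemma fatou_le (g : nat -> T -> R) (h : T -> R) (M : \bar R) :
  (forall k, measurable_fun setT (g k)) -> measurable_fun setT h ->
  (forall k x, 0 <= g k x) -> (forall x, 0 <= h x) ->
  {ae mu, forall x, g k x @[k --> \oo] --> h x} ->
  (forall k, \int[mu]_x (g k x)%:E <= M)%E -> (\int[mu]_x (h x)%:E <= M)%E.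
Proof.
move=> mg mh g0 h0 gh gM.
have mi : measurable_fun setT (fun x => limn_einf (fun k => (g k x)%:E)).
  rewrite (_ : (fun x => _) = fun x => - limn_esup (fun k => (- g k x)%:E))%E; last first.
    by apply/funext => x; rewrite -limn_einfN; congr limn_einf; apply/funext => k /=; rewrite opprK.
  apply: measurableT_comp => //; apply: measurable_fun_limn_esup => k.
  by apply/measurable_EFinP; exact: measurableT_comp.
have ge0 x : (0 <= limn_einf (fun k => (g k x)%:E))%E.
  rewrite limn_einf_lim; apply: lime_ge; first exact: is_cvg_einfs.
  by near=> n; apply: le_ereal_inf_tmp => _ [k /= _ <-]; rewrite lee_fin.
apply: (@le_trans _ _ (\int[mu]_x limn_einf (fun k => (g k x)%:E))%E).
  apply: ae_ge0_le_integral => //; [by move=> x _; rewrite lee_fin|exact/measurable_EFinP|].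
  apply: filterS gh => x gx _.
  have gx' : (g k x)%:E @[k --> \oo] --> (h x)%:E.
    by apply: cvg_EFin => //; near=> k.
  by rewrite (cvg_limn_einf_sup gx').
have mg' k : measurable_fun setT (fun x => (g k x)%:E) by exact/measurable_EFinP.
have g0' k x : setT x -> (0 <= (g k x)%:E)%E by rewrite lee_fin.
apply: le_trans (fatou mu measurableT mg' g0') _.
rewrite limn_einf_lim; apply: lime_le; first exact: is_cvg_einfs.
by near=> n; apply: le_trans (gM n); apply: ereal_inf_lbound; exists n => /=.
Unshelve. all: by end_near. Qed.

(** The sum of the whole series has integral at most [M] by monotone convergence, hence is finite
    almost everywhere. *)
Lemma ae_bounded (h : nat -> T -> R) (c : nat -> R) (M : R) :
  (forall k, measurable_fun setT (h k)) -> (forall k x, 0 <= h k x) ->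
  (forall k, \int[mu]_x (h k x)%:E <= (c k)%:E)%E ->
  (forall n, \sum_(k < n) c k <= M) ->
  {ae mu, forall x, exists C : R, forall n, \sum_(k < n) h k x <= C}.
Proof.
move=> mh h0 hc cM.
have mS : measurable_fun setT (fun x => (\sum_(k <oo) (h k x)%:E)%E).
  by apply: ge0_emeasurable_sum => [k x _ _|k _]; [rewrite lee_fin|exact/measurable_EFinP].
have S0 x : (0 <= \sum_(k <oo) (h k x)%:E)%E by apply: nneseries_ge0 => k _ _; rewrite lee_fin.
have iS : mu.-integrable setT (fun x => (\sum_(k <oo) (h k x)%:E)%E).
  apply/integrableP; split => //; under eq_integral do rewrite gee0_abs//.
  rewrite integral_nneseries//; [|by move=> k; exact/measurable_EFinP|by move=> k x _; rewrite lee_fin].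
  apply: (@le_lt_trans _ _ M%:E); last exact: ltry.
  apply: lime_le; first by apply: is_cvg_nneseries => n _ _; apply: integral_ge0 => x _; rewrite lee_fin.
  near=> n; apply: (@le_trans _ _ (\sum_(0 <= k < n) (c k)%:E)%E); first exact: lee_sum.
  by rewrite sumEFin lee_fin big_mkord.
have := integrable_ae measurableT iS; apply: filterS => x /(_ Logic.I) fx.
exists (fine (\sum_(k <oo) (h k x)%:E)%E); apply: nneseries_le_fine => //.
by rewrite -ge0_fin_numE.
Unshelve. all: by end_near. Qed.

End Measurability.

Section RealIntegrals.
Context {d} {T : measurableType d} {R : realType}.
Variable mu : {measure set T -> \bar R}.
Implicit Types h k : T -> R.

Lemma int_geZ (c : R) h : 0 <= c -> measurable_fun setT h -> (forall x, 0 <= h x) ->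
  (\int[mu]_x (c * h x)%:E = c%:E * \int[mu]_x (h x)%:E)%E.
Proof.
move=> c0 mh h0; under eq_integral do rewrite EFinM.
by rewrite ge0_integralZl//=; [exact/measurable_EFinP|move=> x _; rewrite lee_fin].
Qed.

Lemma int_geD h k : measurable_fun setT h -> (forall x, 0 <= h x) ->
  measurable_fun setT k -> (forall x, 0 <= k x) ->
  (\int[mu]_x (h x + k x)%:E = \int[mu]_x (h x)%:E + \int[mu]_x (k x)%:E)%E.
Proof.
move=> mh h0 mk k0; under eq_integral do rewrite EFinD.
by rewrite ge0_integralD//=; by [exact/measurable_EFinP|move=> x _; rewrite lee_fin].
Qed.

Lemma int_le h k : measurable_fun setT h -> (forall x, 0 <= h x) ->
  measurable_fun setT k -> (forall x, h x <= k x) ->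
  (\int[mu]_x (h x)%:E <= \int[mu]_x (k x)%:E)%E.
Proof.
by move=> mh h0 mk hk; apply: ge0_le_integral => //; by [exact/measurable_EFinP|move=> x _; rewrite lee_fin].
Qed.

Lemma int_ge0 h : (forall x, 0 <= h x) -> (0 <= \int[mu]_x (h x)%:E)%E.
Proof. by move=> h0; apply: integral_ge0 => x _; rewrite lee_fin. Qed.

Lemma integrable_ge0 h : measurable_fun setT h -> (forall x, 0 <= h x) ->
  (\int[mu]_x (h x)%:E < +oo)%E -> mu.-integrable setT (EFin \o h).
Proof.
move=> mh h0 hoo; apply/integrableP; split; first exact/measurable_EFinP.
by under eq_integral do rewrite /= ger0_norm//.
Qed.

Lemma int_ge0_lty h : (forall x, 0 <= h x) -> mu.-integrable setT (EFin \o h) ->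
  (\int[mu]_x (h x)%:E < +oo)%E.
Proof.
by move=> h0 /integrableP[_]; under eq_integral do rewrite /= ger0_norm//.
Qed.

Lemma Rintegral_EFin h : mu.-integrable setT (EFin \o h) ->
  ((\int[mu]_x h x)%R%:E = \int[mu]_x (h x)%:E)%E.
Proof. by move=> ih; rewrite /Rintegral fineK//; exact: integrable_fin_num. Qed.

Lemma integrable_dominated h k : measurable_fun setT h ->
  mu.-integrable setT (EFin \o k) -> (forall x, `|h x| <= k x) -> mu.-integrable setT (EFin \o h).
Proof.
move=> mh ik hk; apply: le_integrable ik => //; first exact/measurable_EFinP.
by move=> x _; rewrite /= lee_fin (le_trans (hk x))// ler_norm.
Qed.

End RealIntegrals.

(** * The Riesz-Fischer theorem *)

Section RieszFischer.
Context {d} {T : measurableType d} {R : realType}.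
Variable mu : {measure set T -> \bar R}.

(** Along [phi] the increments have square norm at most [8 ^ -k]. Multiplied by [4 ^ k] they are
    still summable, so that at almost every point the increments are at most a constant times
    [2 ^ -k]. The subsequence is part of the conclusion because it serves to identify pointwise
    limits later. *)
Lemma riesz_fischer (f : nat -> T -> R[i]) : (forall k, cmeasurable (f k)) ->
  (forall e : R, 0 < e -> exists N, forall i j, (N <= i <= j)%N ->
    (N2 mu (fun x => (f j x - f i x)%R) <= e%:E)%E) ->
  exists2 g : T -> R[i], cmeasurable g &
    (forall e : R, 0 < e -> exists N, forall i, (N <= i)%N ->
      (N2 mu (fun x => (f i x - g x)%R) <= e%:E)%E) /\
    exists2 phi : nat -> nat, {homo phi : i j / (i < j)%N} &
      {ae mu, forall x, sqmod (f (phi k) x - g x) @[k --> \oo] --> (0 : R)}.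
Proof.
move=> mf fC.
have p8 k : 0 < (8^-1 : R) ^+ k by rewrite exprn_gt0.
pose N k := sval (cid (fC _ (p8 k))).
have NP k : forall i j, (N k <= i <= j)%N -> (N2 mu (fun x => (f j x - f i x)%R) <= ((8^-1) ^+ k)%:E)%E.
  exact: svalP (cid (fC _ (p8 k))).
pose phi := fix phi k := if k is k'.+1 then maxn (phi k').+1 (N k) else N 0%N.
have phiS k : (phi k < phi k.+1)%N by rewrite /= leq_max ltnSn.
have Nphi k : (N k <= phi k)%N by case: k => //= k; rewrite leq_maxr.
have phi_homo : {homo phi : i j / (i < j)%N} by apply: homo_ltn => //; exact: ltn_trans.
pose D k x := f (phi k.+1) x - f (phi k) x.
have mD k : cmeasurable (D k) by apply: cmeasurableB.
have aeC : {ae mu, forall x, exists C : R, forall n, \sum_(k < n) 4 ^+ k * sqmod (D k x) <= C}.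
  apply: (ae_bounded (h := fun k x => 4 ^+ k * sqmod (D k x)) (c := fun k => (2^-1) ^+ k) (M := 2)).
  - by move=> k; apply: measurable_funM => //; exact: measurable_sqmod.
  - by move=> k x; rewrite mulr_ge0 ?exprn_ge0 ?sqmod_ge0.
  - move=> k; rewrite int_geZ ?exprn_ge0//; [|exact: measurable_sqmod|by move=> x; exact: sqmod_ge0].
    apply: (@le_trans _ _ ((4 ^+ k)%:E * ((8^-1) ^+ k)%:E)%E).
      rewrite lee_wpmul2l ?lee_fin ?exprn_ge0//.
      by apply: NP; rewrite Nphi ltnW.
    by rewrite -EFinM lee_fin -exprMn (_ : 4 * 8^-1 = 2^-1)//; field.
  - move=> n; have h : (2^-1 : R) < 1 by rewrite invf_lt1// ltr1n.
    by apply: le_trans (geometric_sum_le n _ h) _ => //; rewrite le_eqVlt; apply/orP; left; apply/eqP; field.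
have aecv : {ae mu, forall x, cvgn (fun k => Re (f (phi k) x)) /\ cvgn (fun k => Im (f (phi k) x))}.
  apply: filterS aeC => x [C hC].
  have C0 : 0 <= C by apply: le_trans (hC 0%N); rewrite big_ord0.
  have Dk k : cmod (D k x) <= Num.sqrt C * (2^-1) ^+ k.
    rewrite -sqmod_le_sqr ?mulr_ge0 ?exprn_ge0 ?sqrtr_ge0//.
    rewrite exprMn sqr_sqrtr// -exprM mulnC exprM.
    have := hC k.+1; rewrite big_ord_recr/= => h.
    have h' : 4 ^+ k * sqmod (D k x) <= C.
      apply: le_trans h; rewrite lerDr; apply: sumr_ge0 => i _.
      by rewrite mulr_ge0 ?exprn_ge0 ?sqmod_ge0.
    rewrite (_ : (2^-1 : R) ^+ 2 = 4^-1); last by field.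
    by rewrite exprVn ler_pdivlMr ?exprn_gt0// mulrC.
  have bd n : \sum_(k < n) Num.sqrt C * (2^-1) ^+ k <= Num.sqrt C * 2.
    rewrite -mulr_sumr ler_wpM2l ?sqrtr_ge0//.
    have h : (2^-1 : R) < 1 by rewrite invf_lt1// ltr1n.
    by apply: le_trans (geometric_sum_le n _ h) _ => //; rewrite le_eqVlt; apply/orP; left; apply/eqP; field.
  split; apply: (increments_cvg _ bd) => k; apply: le_trans (Dk k).
    by rewrite -cReB; exact: normRe_le_cmod.
  by rewrite -cImB; exact: normIm_le_cmod.
have [gr mgr grE] := measurable_limit (fun k => (mf (phi k)).1).
have [gi mgi giE] := measurable_limit (fun k => (mf (phi k)).2).
pose g x := gr x +i* gi x.
have mg : cmeasurable g by [].
have aeg : {ae mu, forall x, sqmod (f (phi k) x - g x) @[k --> \oo] --> (0 : R)}.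
  apply: filterS aecv => x [cr ci].
  by apply: ccvgP; rewrite /= ?grE ?giE.
exists g => //; split; last by exists phi.
move=> e e0; have [K KP] := fC e e0; exists K => i Ki.
have phiK k : (k <= phi k)%N by elim: k => // k ih; exact: leq_ltn_trans ih (phiS k).
(* Fatou's lemma in [k]: the pointwise limit compares [f i] with [g], and the shift by [i] keeps
   both indices in the range of the Cauchy condition. *)
apply: (@fatou_le _ _ _ mu (fun k x => sqmod (f (phi (i + k)%N) x - f i x))).
- by move=> k; exact/measurable_sqmod/cmeasurableB.
- exact/measurable_sqmod/cmeasurableB.
- by move=> k x; exact: sqmod_ge0.
- by move=> x; exact: sqmod_ge0.
- apply: filterS aeg => x gx.
  have gx' : sqmod (f (phi (i + k)%N) x - g x) @[k --> \oo] --> (0 : R).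
    apply/cvgnP => c c0; have /cvgnP/(_ c c0)[P PP] := gx.
    by exists P => k Pk; apply: PP; rewrite (leq_trans Pk)// leq_addl.
  by rewrite sqmodBC; exact: sqmodB_cvg.
- move=> k; apply: KP; rewrite Ki/=; apply: leq_trans (phiK _); exact: leq_addr.
Qed.

Lemma L2_complete : hcomplete (L2 mu : prehilbertType R).
Proof.
move=> u uC; have [|e e0|g mg [gC _]] := @riesz_fischer (fun k => L2repr (u k)).
- by move=> k; exact: sqfun_cmeasurable.
- have [N NP] := uC e e0; exists N => i j ij.
  by rewrite -nsqB_N2 lee_fin ltW// NP.
have [N NP] := gC 1 ltr01.
have gi : square_integrable mu g.
  split=> //; have mN := sqfun_cmeasurable (L2repr (u N)).
  have := N2B_le mu mN (cmeasurableB mN mg).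
  rewrite (@eq_N2 _ _ _ _ _ g) => [|x]; last by rewrite subKr.
  move=> /le_lt_trans; apply; rewrite lte_mul_pinfty ?lee_fin// lte_add_pinfty//.
    exact: sqfun_lty.
  by apply: le_lt_trans (NP _ (leqnn N)) _; exact: ltry.
exists (L2of mu g); apply/hcvgP/cvgnP => e e0.
have e20 : 0 < e / 2 by rewrite divr_gt0.
have [K KP] := gC _ e20; exists K => k Kk.
rewrite subr0 ger0_norm ?nsq_ge0//; apply: (@le_lt_trans _ _ (e / 2)); last lra.
rewrite -lee_fin nsqB_N2; apply: le_trans (KP k Kk); rewrite le_eqVlt; apply/orP; left; apply/eqP.
apply: N2_ae.
- by apply: cmeasurableB; exact: sqfun_cmeasurable.
- by apply: cmeasurableB => //; exact: sqfun_cmeasurable.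
- by apply: filterS (L2of_repr gi) => x ->.
Qed.

End RieszFischer.

Section Fubini.
Context {d1 d2} {T1 : measurableType d1} {T2 : measurableType d2} {R : realType}.
Variables (m1 : {sigma_finite_measure set T1 -> \bar R})
  (m2 : {sigma_finite_measure set T2 -> \bar R}).

Lemma measurable_Rintegral_section (h : T1 * T2 -> R) : measurable_fun setT h ->
  measurable_fun setT (fun x => \int[m2]_y h (x, y)).
Proof.
move=> mh; have mf : measurable_fun [set: \bar R] fine by exact: fine_measurable.
apply: (measurableT_comp mf).
have mh' : measurable_fun setT (EFin \o h) by exact/measurable_EFinP.
have h1 : measurable_fun setT (fubini_F m2 ((EFin \o h)^\+)%E).
  by apply: measurable_fun_fubini_tonelli_F => //; exact: measurable_funepos.
have h2 : measurable_fun setT (fubini_F m2 ((EFin \o h)^\-)%E).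
  by apply: measurable_fun_fubini_tonelli_F => //; exact: measurable_funeneg.
rewrite (_ : (fun x => _) = (fubini_F m2 ((EFin \o h)^\+)%E \- fubini_F m2 ((EFin \o h)^\-)%E)%E).
  exact: emeasurable_funB.
by apply/funext => x; rewrite integralE /=; congr (_ - _)%E; apply: eq_integral => y _; rewrite ?funeposE ?funenegE.
Qed.

Lemma cmeasurable_cintegral_section (f : T1 * T2 -> R[i]) : cmeasurable f ->
  cmeasurable (fun x => cintegral m2 (fun y => f (x, y))).
Proof.
move=> [fr fi]; split => /=.
  exact: (@measurable_Rintegral_section (fun z => Re (f z))).
exact: (@measurable_Rintegral_section (fun z => Im (f z))).
Qed.

Lemma cmeasurable_pair1 (f : T1 * T2 -> R[i]) x : cmeasurable f -> cmeasurable (fun y => f (x, y)).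
Proof.
move=> [fr fi]; split.
  exact: (measurableT_comp fr (measurable_pair1 x)).
exact: (measurableT_comp fi (measurable_pair1 x)).
Qed.

Lemma cmeasurable_pair2 (f : T1 * T2 -> R[i]) y : cmeasurable f -> cmeasurable (fun x => f (x, y)).
Proof.
move=> [fr fi]; split.
  exact: (measurableT_comp fr (measurable_pair2 y)).
exact: (measurableT_comp fi (measurable_pair2 y)).
Qed.

Lemma integrable_tensor (a : T1 -> R) (b : T2 -> R) :
  m1.-integrable setT (EFin \o a) -> m2.-integrable setT (EFin \o b) ->
  (m1 \x m2)%E.-integrable setT (EFin \o (fun z => a z.1 * b z.2)).
Proof.
move=> ia ib; have /measurable_int/measurable_EFinP ma' := ia.
have /measurable_int/measurable_EFinP mb' := ib.
have mab : measurable_fun setT (fun z : T1 * T2 => a z.1 * b z.2).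
  by apply: measurable_funM; apply: measurableT_comp => //; exact: measurable_fst || exact: measurable_snd.
apply/integrableP; split; first exact/measurable_EFinP.
rewrite fubini_tonelli1//=; last first.
  by apply/measurable_EFinP; exact: measurableT_comp.
have iaN := integrable_norm ia; have ibN := integrable_norm ib.
rewrite /fubini_F/=.
under eq_integral do (under eq_integral do rewrite normrM; rewrite int_geZ//; last exact: measurableT_comp).
rewrite /= -Rintegral_EFin//.
under eq_integral do rewrite muleC.
rewrite ge0_integralZl//=.
- rewrite lte_mul_pinfty ?lee_fin ?Rintegral_ge0//.
  exact: (int_ge0_lty (h := fun x => `|a x|)).
- by apply/measurable_EFinP; exact: measurableT_comp.
- by rewrite lee_fin Rintegral_ge0.
Qed.

(** A dominating product [a x * b y] makes every section integrable, not just almost every one, so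
    that the iterated real integrals need no exceptional null set. *)
Lemma Rintegral_fubini (h : T1 * T2 -> R) (a : T1 -> R) (b : T2 -> R) :
  measurable_fun setT h ->
  m1.-integrable setT (EFin \o a) -> m2.-integrable setT (EFin \o b) ->
  (forall x y, `|h (x, y)| <= a x * b y) ->
  (\int[m1]_x (\int[m2]_y h (x, y)) = \int[(m1 \x m2)%E]_z h z) /\
  (\int[m2]_y (\int[m1]_x h (x, y)) = \int[(m1 \x m2)%E]_z h z).
Proof.
move=> mh ia ib hab.
have ih : (m1 \x m2)%E.-integrable setT (EFin \o h).
  apply: (integrable_dominated mh (integrable_tensor ia ib)) => -[x y]; exact: hab.
have s1 x : m2.-integrable setT (EFin \o (fun y => h (x, y))).
  apply: (@integrable_dominated _ _ _ _ _ (fun y => a x * b y)) => //.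
    exact: (measurableT_comp mh (measurable_pair1 x)).
  by apply: eq_integrable (integrableZl measurableT (a x) ib).
have s2 y : m1.-integrable setT (EFin \o (fun x => h (x, y))).
  apply: (@integrable_dominated _ _ _ _ _ (fun x => a x * b y)) => //.
    exact: (measurableT_comp mh (measurable_pair2 y)).
  by apply: eq_integrable (integrableZr measurableT (b y) ia).
split; rewrite /Rintegral; congr fine.
  rewrite -(integral12_prod_meas1 ih); apply: eq_integral => x _.
  by rewrite fineK//; exact: (integrable_fin_num measurableT (s1 x)).
rewrite -(integral21_prod_meas1 ih); apply: eq_integral => x _.
by rewrite fineK//; exact: (integrable_fin_num measurableT (s2 x)).
Qed.

Lemma cintegral_fubini (f : T1 * T2 -> R[i]) (a : T1 -> R) (b : T2 -> R) :
  cmeasurable f ->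
  m1.-integrable setT (EFin \o a) -> m2.-integrable setT (EFin \o b) ->
  (forall x y, cmod (f (x, y)) <= a x * b y) ->
  cintegral m1 (fun x => cintegral m2 (fun y => f (x, y))) = cintegral (m1 \x m2)%E f /\
  cintegral m2 (fun y => cintegral m1 (fun x => f (x, y))) = cintegral (m1 \x m2)%E f.
Proof.
move=> [fr fi] ia ib fab.
have [r1 r2] := @Rintegral_fubini (fun z => Re (f z)) a b fr ia ib
  (fun x y => le_trans (normRe_le_cmod _) (fab x y)).
have [i1 i2] := @Rintegral_fubini (fun z => Im (f z)) a b fi ia ib
  (fun x y => le_trans (normIm_le_cmod _) (fab x y)).
by split; apply: complex_ext => /=.
Qed.

End Fubini.

Section DominatedConvergence.
Context {d} {T : measurableType d} {R : realType}.
Variable mu : {measure set T -> \bar R}.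

Lemma cintegral_dominated (f : nat -> T -> R[i]) (h : T -> R[i]) (g : T -> R) :
  (forall k, cmeasurable (f k)) -> cmeasurable h -> mu.-integrable setT (EFin \o g) ->
  (forall k x, cmod (f k x) <= g x) ->
  {ae mu, forall x, sqmod (f k x - h x) @[k --> \oo] --> (0 : R)} ->
  sqmod (cintegral mu (f k) - cintegral mu h) @[k --> \oo] --> (0 : R).
Proof.
move=> mf mh ig fg fh.
have dc (u : nat -> T -> R) (v : T -> R) : (forall k, measurable_fun setT (u k)) ->
    measurable_fun setT v -> (forall k x, `|u k x| <= g x) ->
    {ae mu, forall x, u k x @[k --> \oo] --> v x} ->
    (\int[mu]_x u k x)%R @[k --> \oo] --> (\int[mu]_x v x)%R.
  move=> mu_ mv ug uv.
  have muE k : measurable_fun setT (EFin \o u k) by exact/measurable_EFinP.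
  have mvE : measurable_fun setT (EFin \o v) by exact/measurable_EFinP.
  have uvE : {ae mu, forall x, setT x -> (EFin \o u k) x @[k --> \oo] --> (EFin \o v) x}.
    by apply: filterS uv => x ux _; apply: cvg_EFin => //; near=> k.
  have ugE : {ae mu, forall x n, setT x -> (`|(EFin \o u n) x| <= (EFin \o g) x)%E}.
    by apply: aeW => x n _; rewrite /= lee_fin.
  have [iv _ cv] := dominated_convergence measurableT muE mvE uvE ig ugE.
  by move: cv; rewrite -[X in _ --> X](Rintegral_EFin iv) => /fine_cvg.
apply: ccvgP; rewrite /cintegral/=; apply: dc.
- by move=> k; have [] := mf k.
- by have [] := mh.
- by move=> k x; exact: le_trans (normRe_le_cmod _) (fg k x).
- by apply: filterS fh => x /sqmod_cvg0[].
- by move=> k; have [] := mf k.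
- by have [] := mh.
- by move=> k x; exact: le_trans (normIm_le_cmod _) (fg k x).
- by apply: filterS fh => x /sqmod_cvg0[].
Unshelve. all: by end_near. Qed.

End DominatedConvergence.

Section Weight.
Context {d} {T : measurableType d} {R : realType}.
Variables (mu : {measure set T -> \bar R}) (w : T -> R).
Hypotheses (w0 : forall x, 0 <= w x) (mw : measurable_fun setT w).
Local Notation nu := (mweight mu w0 mw).

Import HBNNSimple.

Let weight_indic A : measurable A ->
  (\int[nu]_x (\1_A x)%:E = \int[mu]_x ((\1_A x) * w x)%:E)%E.
Proof.
move=> mA; rewrite integral_indic// setIT.
rewrite -[LHS]/(mweight mu w0 mw A) /mweight.
rewrite [LHS]integral_mkcond; apply: eq_integral => x _.
by rewrite patchE indicE; case: ifPn => xA; rewrite ?mul1r ?mul0r.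
Qed.

(** Both sides are monotone limits along the same simple functions, which reduces the identity to
    indicators, where it is the definition of the weighted measure. *)
Lemma integral_weight (h : T -> R) : measurable_fun setT h -> (forall x, 0 <= h x) ->
  (\int[nu]_x (h x)%:E = \int[mu]_x (h x * w x)%:E)%E.
Proof.
move=> mh h0; have mhE : measurable_fun setT (EFin \o h) by exact/measurable_EFinP.
pose f_ := nnsfun_approx measurableT mhE.
have fh x : (f_ n x)%:E @[n --> \oo] --> (h x)%:E.
  by apply: (@cvg_nnsfun_approx _ _ _ _ measurableT _ mhE) => //= y _; rewrite lee_fin.
have ndf n m x : (n <= m)%N -> (f_ n x <= f_ m x)%R.
  by move=> nm; have /lefP := nd_nnsfun_approx measurableT mhE nm.
transitivity (limn (fun n => \int[nu]_x (f_ n x)%:E)%E).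
  rewrite -monotone_convergence//.
  - by apply: eq_integral => x _; apply/esym/cvg_lim => //; exact: fh.
  - by move=> n; exact/measurable_EFinP.
  - by move=> n x _; rewrite lee_fin.
  - by move=> x _ n m nm; rewrite lee_fin ndf.
rewrite (_ : (\int[mu]_x _)%E = limn (fun n => \int[mu]_x (f_ n x * w x)%:E)%E); last first.
  rewrite -monotone_convergence//.
  - apply: eq_integral => x _; apply/esym/cvg_lim => //.
    by rewrite EFinM; under eq_fun do rewrite EFinM; apply: cvgeZr; [|exact: fh].
  - by move=> n; apply/measurable_EFinP; exact: measurable_funM.
  - by move=> n x _; rewrite lee_fin mulr_ge0.
  - by move=> x _ n m nm; rewrite lee_fin ler_wpM2r// ndf.
congr (limn _); apply/funext => n.
have fE x : (f_ n x)%:E = (\sum_(r \in range (f_ n)) (r * \1_(f_ n @^-1` [set r]) x)%:E)%E.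
  by rewrite fsumEFin// -fimfunE.
have fwE x : (f_ n x * w x)%:E =
    (\sum_(r \in range (f_ n)) (r * \1_(f_ n @^-1` [set r]) x * w x)%:E)%E.
  by rewrite fsumEFin// -mulr_fsuml -fimfunE.
rewrite (eq_integral _ _ (fun x _ => fE x)) (eq_integral _ _ (fun x _ => fwE x)).
have r0 (r : R) x : 0 <= r * \1_(f_ n @^-1` [set r]) x.
  rewrite indicE; have [xr|] := boolP (x \in _); last by rewrite mulr0.
  by rewrite mulr1; move: xr; rewrite inE/= => <-.
rewrite ge0_integral_fsum//; last 2 first.
  - by move=> r; apply/measurable_EFinP; exact: measurable_funM.
  - by move=> r x _; rewrite lee_fin.
rewrite ge0_integral_fsum//; last 2 first.
  - by move=> r; apply/measurable_EFinP; do 2 apply: measurable_funM => //.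
  - by move=> r x _; rewrite lee_fin mulr_ge0.
apply: eq_fsbigr => r; rewrite inE/= => -[x _ xr].
have rr : 0 <= r by rewrite -xr.
rewrite int_geZ//.
under [RHS]eq_integral do rewrite -mulrA.
rewrite int_geZ//; [|exact: measurable_funM|by move=> y; rewrite mulr_ge0].
by rewrite weight_indic.
Qed.

Hypothesis wp : forall x, 0 < w x.

(** A positive weight leaves the null sets unchanged; hence almost everywhere statements agree in
    all Sobolev spaces. *)
Lemma ae_weight (P : T -> Prop) : {ae nu, forall x, P x} <-> {ae mu, forall x, P x}.
Proof.
have mw' : measurable_fun setT (EFin \o w) by exact/measurable_EFinP.
have nuE A : measurable A -> nu A = 0%E <-> mu A = 0%E.
  move=> mA; split=> [|A0]; last first.
    rewrite -[LHS]/(mweight mu w0 mw A) /mweight null_set_integral//.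
    by apply: measurable_funS mw' => //.
  move=> nA; have : (\int[mu]_(x in A) `|(w x)%:E| = 0)%E.
    by under eq_integral do rewrite gee0_abs ?lee_fin//; exact: nA.
  have mwA : measurable_fun A (EFin \o w) by apply/measurable_EFinP; exact: measurable_funS mw.
  move/(ae_eq_integral_abs mu mA mwA).
  move=> [N [mN N0 sN]]; apply/eqP; rewrite eq_le measure_ge0 andbT -N0.
  apply: le_measure; rewrite ?inE// => x Ax; apply: sN => /= /(_ Ax)[].
  by apply/eqP; rewrite gt_eqF.
by split=> -[N [mN N0 sN]]; exists N; split=> //; apply/(nuE N mN).
Qed.

Lemma N2_weight (f : T -> R[i]) : cmeasurable f ->
  N2 nu f = N2 mu (fun x => (Num.sqrt (w x))%:C * f x).
Proof.
move=> mf; rewrite /N2 integral_weight; first last.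
- by move=> x; exact: sqmod_ge0.
- exact: measurable_sqmod.
by apply: eq_integral => x _; rewrite sqmodM sqmod_real sqr_sqrtr// mulrC.
Qed.

End Weight.

(** * Fourier series on an interval *)

Section Cis.
Context {R : realType}.
Implicit Types x y : R.

Lemma cisD x y : cis (x + y) = cis x * cis y.
Proof.
by apply: complex_ext; rewrite ?cReM ?cImM /= mulrDr ?cosD ?sinD//; ring.
Qed.
Lemma cis0 : cis (0 : R) = 1.
Proof. by apply: complex_ext; rewrite /= mulr0 ?cos0 ?sin0. Qed.
Lemma cis_conj x : (cis x)^* = cis (- x).
Proof. by apply: complex_ext; rewrite !ReImE/= mulrN ?cosN ?sinN. Qed.
Lemma sqmod_cis x : sqmod (cis x) = 1.
Proof. by rewrite /sqmod/= cos2Dsin2. Qed.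
Lemma cmod_cis x : cmod (cis x) = 1.
Proof. by rewrite /cmod sqmod_cis sqrtr1. Qed.
Lemma cis_nat (k : nat) : cis (k%:R : R) = 1.
Proof.
elim: k => [|k ih]; first exact: cis0.
rewrite -natr1 cisD ih mul1r; apply: complex_ext => /=; rewrite mulr1.
  by rewrite mulr_natl cos2pi.
by rewrite mulr_natl sin2pi.
Qed.
Lemma cis_int (k : int) : cis (k%:~R : R) = 1.
Proof.
case: k => k; first exact: cis_nat.
by rewrite NegzE mulrNz -cis_conj cis_nat rmorph1.
Qed.

Lemma cmeasurable_cis d (T : measurableType d) (h : T -> R) :
  measurable_fun setT h -> cmeasurable (fun z => cis (h z)).
Proof.
move=> mh; have m2 : measurable_fun setT (fun z => 2 * pi * h z) by exact: measurable_funM.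
split=> /=.
  by apply: (measurableT_comp _ m2); exact: (continuous_measurable_fun (@continuous_cos R)).
by apply: (measurableT_comp _ m2); exact: (continuous_measurable_fun (@continuous_sin R)).
Qed.

Lemma cosB_sin x y : cos x - cos y = 2 * sin ((x + y) / 2) * sin ((y - x) / 2) :> R.
Proof.
have -> : cos x = cos ((x + y) / 2 - (y - x) / 2) by congr cos; field.
have -> : cos y = cos ((x + y) / 2 + (y - x) / 2) by congr cos; field.
by rewrite cosB cosD; ring.
Qed.

(** The difference is twice a product of sines of [(x + y) / 2] and [(y - x) / 2], both in
    [[0, pi]]. The range goes past [pi], as needed for points almost a full period away from a
    peak. *)
Lemma cos_le_cos x y : 0 <= x -> x <= y -> y <= 2 * pi - x -> cos y <= cos x :> R.
Proof.
move=> x0 xy yx; rewrite -subr_ge0 cosB_sin !mulr_ge0//; apply: sin_ge0_pi; apply/andP; split; lra.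
Qed.

Lemma integral_cos (c phi a b : R) : c != 0 -> a < b ->
  \int[lebesgue_measure]_(x in `[a, b]) cos (c * x + phi) =
  (sin (c * b + phi) - sin (c * a + phi)) / c.
Proof.
move=> c0 ab; have cvl u : (fun x => c * x + phi) x @[x --> u] --> c * u + phi.
  by apply: cvgD; [apply: cvgM; [exact: cvg_cst|exact: cvg_id]|exact: cvg_cst].
have cc : continuous (fun x : R => cos (c * x + phi)).
  by move=> u; apply: (cvg_comp _ _ (cvl u)); exact: continuous_cos.
have dF (x : R) : is_derive x 1 (fun x : R => c^-1 * sin (c * x + phi)) (cos (c * x + phi)).
  have dl : is_derive x 1 (fun x : R => c * x + phi) c.
    have := is_deriveD (is_deriveZ c (is_derive_id x 1)) (is_derive_cst phi x 1).
    by rewrite addr0 /GRing.scale/= mulr1.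
  have ds := @is_derive1_comp _ sin (fun x : R => c * x + phi) x _ _ (is_derive_sin _) dl.
  have := is_deriveZ c^-1 ds.
  by congr is_derive; rewrite /GRing.scale/= mulrCA mulVf// mulr1.
rewrite /Rintegral (@continuous_FTC2 _ _ (fun x : R => c^-1 * sin (c * x + phi)) _ _ ab).
- by rewrite -EFinB/= -mulrBr mulrC.
- exact: continuous_subspaceT.
- have dd (x : R) : derivable (fun x : R => c^-1 * sin (c * x + phi)) x 1 by have [] := dF x.
  have Fc : continuous (fun x : R => c^-1 * sin (c * x + phi)).
    move=> u; apply: cvgM; first exact: cvg_cst.
    by apply: (cvg_comp _ _ (cvl u)); exact: continuous_sin.
  split => //; first by apply: cvg_at_right_filter; exact: Fc.
  by apply: cvg_at_left_filter; exact: Fc.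
- by move=> x _; rewrite derive1E; have [_] := dF x.
Qed.

End Cis.

Section IntervalMeasure.
Context {R : realType}.
Variables a b : R.
Local Notation lam := (@lebesgue_measure R).

(** For [a = 0] and [b = 1] this is [circle_measure]; long intervals serve Plancherel's theorem on
    the line. *)
Definition interval_measure : set (measurableTypeR R) -> \bar R :=
  mrestr lam (measurable_itv `[a, b[).

HB.instance Definition _ := Measure.on interval_measure.

Let interval_fin_num : fin_num_fun interval_measure.
Proof.
move=> A mA; rewrite ge0_fin_numE ?measure_ge0//.
apply: (@le_lt_trans _ _ (lam `[a, b[)); last first.
  by rewrite lebesgue_measure_itv/=; case: ifP => _; rewrite ?ltry// -EFinD ltry.
by apply: le_measure; rewrite ?inE//; exact: measurableI.
Qed.

HB.instance Definition _ := Measure_isFinite.Build _ _ _ interval_measure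
  interval_fin_num.

Lemma integral_intervalE (h : R -> R) : measurable_fun setT h -> (forall x, 0 <= h x) ->
  (\int[interval_measure]_x (h x)%:E = \int[lam]_(x in `[a, b[) (h x)%:E)%E.
Proof.
move=> mh h0; have mI : measurable_fun setT (\1_(`[a, b[%classic : set R) : R -> R).
  exact: measurable_indic.
have I0 (x : R) : 0 <= (\1_(`[a, b[%classic : set R) x : R) by rewrite indicE.
have := integral_weight lam I0 mI mh h0.
rewrite [X in _ = X -> _](_ : _ = \int[lam]_(x in `[a, b[) (h x)%:E)%E; last first.
  rewrite [RHS]integral_mkcond; apply: eq_integral => x _.
  by rewrite patchE indicE; case: ifPn; rewrite ?mulr1 ?mulr0.
move=> <-; apply: eq_measure_integral => A mA _.
rewrite /= /mweight integral_indic// setIC.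
by [].
Qed.

Lemma interval_integrable (h : R -> R) : measurable_fun setT h ->
  lam.-integrable `[a, b[ (EFin \o h) <-> interval_measure.-integrable setT (EFin \o h).
Proof.
move=> mh; have mN : measurable_fun setT (fun x => `|h x|) by exact: measurableT_comp.
have := integral_intervalE mN (fun x => normr_ge0 _) => E.
split=> /integrableP[_ hi]; apply/integrableP; split.
- exact/measurable_EFinP.
- by under eq_integral do rewrite /=; rewrite E; move: hi; under eq_integral do rewrite /=.
- by apply/measurable_EFinP; exact: measurable_funS mh.
- by apply: le_lt_trans hi; rewrite le_eqVlt; apply/orP; left; apply/eqP; exact: (esym E).
Qed.

Lemma Rintegral_intervalE (h : R -> R) : measurable_fun setT h ->
  \int[interval_measure]_x h x = \int[lam]_(x in `[a, b[) h x.
Proof.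
move=> mh; rewrite /Rintegral; congr fine; rewrite integralE [RHS]integralE.
have mp : measurable_fun setT (fun x => Num.max (h x) 0) by exact: measurable_maxr.
have mn : measurable_fun setT (fun x => Num.max (- h x) 0).
  by apply: measurable_maxr => //; exact: measurableT_comp.
have pE (x : R) : ((fun x => (h x)%:E)^\+ x = (Num.max (h x) 0)%:E)%E by rewrite funeposE EFin_max.
have nE (x : R) : ((fun x => (h x)%:E)^\- x = (Num.max (- h x) 0)%:E)%E.
  by rewrite funenegE -EFinN EFin_max.
have m0 (y : R) : 0 <= Num.max y 0 by rewrite le_max lexx orbT.
congr (_ - _)%E.
  by under eq_integral do rewrite pE; under [RHS]eq_integral do rewrite pE; exact: integral_intervalE.
by under eq_integral do rewrite nE; under [RHS]eq_integral do rewrite nE; exact: integral_intervalE.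
Qed.

Lemma interval_measure_lt : a < b -> interval_measure setT = (b - a)%:E.
Proof.
by move=> ab; rewrite /interval_measure /mrestr setTI lebesgue_measure_itv/= lte_fin ab.
Qed.

Lemma interval_bounded_integrable (h : R -> R) (M : R) : measurable_fun setT h ->
  (forall x, `|h x| <= M) -> interval_measure.-integrable setT (EFin \o h).
Proof.
move=> mh hM.
apply: (@integrable_dominated _ (measurableTypeR R) R interval_measure h (cst M)) => //.
apply: finite_measure_integrable_cst => //.
Qed.

End IntervalMeasure.

(** * Completeness of the trigonometric system *)

Section Primitive.
Context {R : realType}.
Variables a b : R.
Hypothesis ab : a < b.
Local Notation lam := (@lebesgue_measure R).
Local Notation nu := (interval_measure a b).
Let L := b - a.
Let w := 2 * pi / L.

Let L0 : 0 < L. Proof. by rewrite subr_gt0. Qed.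
Let w0 : 0 < w. Proof. by rewrite divr_gt0// mulr_gt0// pi_gt0. Qed.
Let wL : w * L = 2 * pi. Proof. by rewrite divfK// gt_eqF. Qed.

Section Peak.
Variables (G : R -> R) (M : R).
Hypotheses (mG : measurable_fun setT G) (GM : forall x, `|G x| <= M).
Hypothesis orthG : forall (k : int) phi, \int[nu]_x (G x * cos (w * k%:~R * x + phi)) = 0.
Variables (x0 d : R).
Let p (x : R) : R := 1 + cos (w * (x - x0)) - cos (w * d).

Let measurable_cos_affine (c phi : R) : measurable_fun setT (fun x : R => cos (c * x + phi)).
Proof.
apply: continuous_measurable_fun => u.
have cvl : (fun x => c * x + phi) x @[x --> u] --> c * u + phi.
  by apply: cvgD; [apply: cvgM; [exact: cvg_cst|exact: cvg_id]|exact: cvg_cst].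
by apply: (cvg_comp _ _ cvl); exact: continuous_cos.
Qed.

Let mp : measurable_fun setT p.
Proof.
rewrite (_ : p = fun x => (1 - cos (w * d)) + cos (w * x + - (w * x0))).
  by apply: measurable_funD => //; exact: measurable_cos_affine.
by apply/funext => x; rewrite /p -mulrBr; ring.
Qed.

Let p3 x : `|p x| <= 3.
Proof.
rewrite /p ler_norml; have := cos_le1 (w * (x - x0)); have := cos_geN1 (w * (x - x0)).
by have := cos_le1 (w * d); have := cos_geN1 (w * d); move=> *; apply/andP; split; lra.
Qed.

Let mterm N (c phi : R) : measurable_fun setT (fun x => G x * p x ^+ N * cos (c * x + phi)).
Proof. by do 2 (apply: measurable_funM => //); exact: measurable_funX. Qed.

Let iterm N (c phi : R) :
  nu.-integrable setT (EFin \o (fun x => G x * p x ^+ N * cos (c * x + phi))).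
Proof.
apply: (@interval_bounded_integrable _ _ _ _ (M * 3 ^+ N)) => [|x]; first exact: mterm.
rewrite !normrM normrX -[leRHS]mulr1 ler_pM// ?mulr_ge0 ?exprn_ge0//.
  by rewrite ler_pM// ?exprn_ge0// lerXn2r ?nnegrE.
by rewrite ler_norml cos_geN1 cos_le1.
Qed.

(* Rudin's completeness argument: [p] exceeds [1] near [x0] only, so that its powers concentrate there. *)
Lemma trig_orth_pow N (k : int) phi :
  \int[nu]_x (G x * p x ^+ N * cos (w * k%:~R * x + phi)) = 0.
Proof.
elim: N k phi => [|N ih] k phi.
  by rewrite -[RHS](orthG k phi); congr Rintegral; apply/funext => x; rewrite expr0 mulr1.
(* Multiplication by [cos (w * (x - x0))] moves the frequency [k] by one in either direction and the
   phase by [w * x0], which is why the induction runs over all [k] and [phi]. *)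
have E x : G x * p x ^+ N.+1 * cos (w * k%:~R * x + phi) =
    (1 - cos (w * d)) * (G x * p x ^+ N * cos (w * k%:~R * x + phi)) +
    (2^-1 * (G x * p x ^+ N * cos (w * (k + 1)%:~R * x + (phi - w * x0))) +
     2^-1 * (G x * p x ^+ N * cos (w * (k - 1)%:~R * x + (phi + w * x0)))).
  have -> : w * (k + 1)%:~R * x + (phi - w * x0) = (w * k%:~R * x + phi) + w * (x - x0).
    by rewrite intrD; ring.
  have -> : w * (k - 1)%:~R * x + (phi + w * x0) = (w * k%:~R * x + phi) - w * (x - x0).
    by rewrite intrD rmorphN1; ring.
  rewrite exprS; move: (p x ^+ N) => P; rewrite /p.
  set A := w * k%:~R * x + phi; set B := w * (x - x0); rewrite (cosD A B) (cosB A B).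
  by move: (cos A) (sin A) (cos B) (sin B) (cos (w * d)) => *; field.
rewrite (_ : (fun x => G x * _ * _) = (fun x =>
    (1 - cos (w * d)) * (G x * p x ^+ N * cos (w * k%:~R * x + phi)) +
    (2^-1 * (G x * p x ^+ N * cos (w * (k + 1)%:~R * x + (phi - w * x0))) +
     2^-1 * (G x * p x ^+ N * cos (w * (k - 1)%:~R * x + (phi + w * x0)))))); last exact/funext.
have iZ c N' c' phi' : nu.-integrable setT (EFin \o (fun x => c * (G x * p x ^+ N' * cos (c' * x + phi')))).
  by apply: eq_integrable (integrableZl measurableT c (iterm N' c' phi')).
rewrite RintegralD//; last first.
  by apply: eq_integrable (integrableD measurableT (iZ _ _ _ _) (iZ _ _ _ _)).
by rewrite RintegralD// !RintegralZl// !ih !mulr0 !addr0.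
Qed.

Hypotheses (d0 : 0 < d) (ad : a + d <= x0) (bd : x0 + d <= b).
Variable c : R.
Hypotheses (c0 : 0 < c) (Gc : forall x, `|x - x0| <= d -> c <= G x).

(** The integral of [G * p ^ N] vanishes for all [N]. Within [d / 2] of [x0] the integrand is at
    least [c * q ^ N] with [q > 1]; within [d] it is nonnegative; elsewhere [|p| <= 1] and it is at
    least [- M]. Hence [c * q ^ N * d <= M * L] for all [N], which is impossible. *)
Lemma trig_peak_absurd : False.
Proof.
have := ad; have := bd; have := d0; have := c0 => c0' d0' bd' ad'.
have := ab => ab'.
pose q := 1 + cos (w * d / 2) - cos (w * d).
have wd0 : 0 < w * d by rewrite mulr_gt0.
have wdpi : w * d <= pi.
  have : w * (2 * d) <= w * L by rewrite ler_pM2l//; rewrite /L; lra.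
  by rewrite wL; nra.
have pip := pi_gt0 R.
have q1 : 1 < q.
  have : 0 < cos (w * d / 2) - cos (w * d).
    by rewrite cosB_sin !mulr_gt0//; apply: sin_gt0_pi; apply/andP; split; lra.
  by rewrite /q; lra.
have cosabs x : cos (w * (x - x0)) = cos (w * `|x - x0|).
  case: (ger0P (x - x0)) => // _; by rewrite mulrN cosN.
have low N x : a <= x -> x < b ->
    c * q ^+ N * (\1_(`[x0 - d / 2, x0 + d / 2]%classic : set R) x) - M <= G x * p x ^+ N * cos (w * 0%:~R * x + 0).
  move=> ax xb; rewrite mulr0 mul0r addr0 cos0 mulr1 indicE.
  have M0 : 0 <= M by apply: le_trans (GM 0).
  have [xd|dx] := leP `|x - x0| d; last first.
    rewrite memNset/=; last first.
      rewrite in_itv/= => /andP[h1 h2]; move: dx; apply/negP; rewrite -leNgt ler_norml.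
      by apply/andP; split; lra.
    rewrite mulr0 sub0r; have p1 : `|p x| <= 1.
      have : cos (w * `|x - x0|) <= cos (w * d).
        apply: cos_le_cos; [exact: ltW|by rewrite ler_pM2l// ltW|].
        rewrite -wL -mulrBr ler_pM2l//; have : `|x - x0| <= L - d.
          by rewrite ler_norml /L; apply/andP; split; lra.
        by [].
      have := cos_geN1 (w * `|x - x0|); have := cos_le1 (w * d).
      by rewrite /p cosabs ler_norml => *; apply/andP; split; lra.
    have : `|G x * p x ^+ N| <= M.
      rewrite normrM normrX -[leRHS]mulr1 ler_pM// ?exprn_ge0//.
      by rewrite exprn_ile1.
    by rewrite ler_norml => /andP[].
  have Gx := Gc xd.
  have px : 1 <= p x.
    have : cos (w * d) <= cos (w * `|x - x0|).
      apply: cos_le_cos; [by rewrite mulr_ge0// ltW|by rewrite ler_pM2l|].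
      have : w * `|x - x0| <= w * d by rewrite ler_pM2l.
      lra.
    by rewrite /p cosabs; lra.
  have [xI|xNI] := boolP (x \in _); last first.
    rewrite mulr0 sub0r; apply: (@le_trans _ _ 0); first by rewrite oppr_le0.
    by rewrite mulr_ge0 ?exprn_ge0//; [apply: le_trans Gx; exact: ltW|lra].
  rewrite mulr1; apply: (@le_trans _ _ (c * q ^+ N)); first by rewrite gerBl.
  move: xI; rewrite inE/= in_itv/= => /andP[h1 h2].
  have xd2 : `|x - x0| <= d / 2 by rewrite ler_norml; apply/andP; split; lra.
  apply: ler_pM => //; [exact: ltW|by rewrite exprn_ge0// ltW// (lt_trans _ q1)|].
  apply: lerXn2r; rewrite ?nnegrE; [by rewrite ltW// (lt_trans _ q1)|exact: le_trans px|].
  rewrite /q /p cosabs lerD2r lerD2l; apply: cos_le_cos.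
  - by rewrite mulr_ge0// ltW.
  - by rewrite -mulrA ler_pM2l.
  - have : w * `|x - x0| <= w * (d / 2) by rewrite ler_pM2l.
    by rewrite mulrA; lra.
have bound N : c * q ^+ N * d <= M * L.
  pose I : R -> R := \1_(`[x0 - d / 2, x0 + d / 2]%classic : set R).
  have mI : measurable_fun setT I by exact: measurable_indic.
  have iI : nu.-integrable setT (EFin \o I).
    apply: (@interval_bounded_integrable _ _ _ _ 1) => // x.
    by rewrite /I indicE ger0_norm// lern1 leq_b1.
  have ilow : nu.-integrable setT (EFin \o (fun x => c * q ^+ N * I x - M)).
    apply: (@interval_bounded_integrable _ _ _ _ (`|c * q ^+ N| + `|M|)).
      by apply: measurable_funB => //; exact: measurable_funM.
    move=> x; apply: le_trans (ler_normB _ _) _; rewrite lerD2r normrM ler_piMr//.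
    by rewrite /I indicE ger0_norm// lern1 leq_b1.
  have mlow : measurable_fun setT (fun x => c * q ^+ N * I x - M).
    by apply: measurable_funB => //; exact: measurable_funM.
  have : \int[nu]_x (c * q ^+ N * I x - M) <= 0.
    rewrite -(trig_orth_pow N 0 0) !Rintegral_intervalE//; apply: le_Rintegral => //.
    - exact/interval_integrable.
    - by apply/interval_integrable; [exact: mterm|exact: iterm].
    - move=> x; rewrite /= in_itv/= => /andP[ax xb]; exact: low.
  have iM : nu.-integrable setT (EFin \o cst M).
    by apply: (@interval_bounded_integrable _ _ _ _ `|M|).
  have iZ : nu.-integrable setT (EFin \o (fun x => c * q ^+ N * I x)).
    by apply: eq_integrable (integrableZl measurableT (c * q ^+ N) iI).
  rewrite RintegralB// RintegralZl// Rintegral_cst//.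
  have -> : fine (nu setT) = L by rewrite interval_measure_lt.
  have -> : \int[nu]_x I x = d.
    rewrite /Rintegral /I integral_indic// setIT.
    rewrite [X in fine X](_ : _ = lam (`[x0 - d / 2, x0 + d / 2]%classic `&` `[a, b[%classic))// setIidl.
      by rewrite lebesgue_measure_itv/= lte_fin ifT; [rewrite -EFinB/=; field|lra].
    by move=> x; rewrite /= !in_itv/= => /andP[h1 h2]; apply/andP; split; lra.
  lra.
(* Bernoulli's inequality, enough to make [q ^ N] unbounded. *)
have qN N : 1 + N%:R * (q - 1) <= q ^+ N.
  elim: N => [|N ih]; first by rewrite mul0r addr0 expr0.
  rewrite exprS -natr1; have q0 : 0 <= q - 1 by lra.
  have := mulr_ge0 (ler0n R N) (sqr_ge0 (q - 1)).
  have := mulr_ge0 (le_trans q0 _ : 0 <= q) (_ : 0 <= q ^+ N - (1 + N%:R * (q - 1))).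
  rewrite subr_ge0 => /(_ _ ih); rewrite expr2 => h1 h2.
  have : 0 <= q * (q ^+ N - (1 + N%:R * (q - 1))) by apply: h1; lra.
  by move: h2; lra.
have [N] : exists N : nat, M * L < c * d * (N%:R * (q - 1)).
  pose y := M * L / (c * d * (q - 1)).
  exists (Num.bound `|y|); have : `|y| < (Num.bound `|y|)%:R by exact: archi_boundP.
  move=> /(le_lt_trans (ler_norm y)); rewrite /y ltr_pdivrMr ?mulr_gt0 ?subr_gt0//.
  by rewrite mulrCA.
apply/negP; rewrite -leNgt; apply: le_trans (bound N).
rewrite [leRHS]mulrAC ler_pM2l ?mulr_gt0//.
by apply: le_trans (qN N); rewrite lerDr.
Qed.

End Peak.

(** A positive value would persist on a small interval around [x0], against [trig_peak_absurd].
    Applied to a function and to its opposite, this yields vanishing at points of continuity. *)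
Lemma trig_orth_le0 (G : R -> R) (M : R) :
  measurable_fun setT G -> (forall x, `|G x| <= M) ->
  (forall (k : int) phi, \int[nu]_x (G x * cos (w * k%:~R * x + phi)) = 0) ->
  forall x0, x0 \in `]a, b[ -> {for x0, continuous G} -> G x0 <= 0.
Proof.
move=> mG GM oG x0; rewrite in_itv/= => /andP[ax xb] cG.
rewrite leNgt; apply/negP => G0.
have [e /= e0 eG] : \forall y \near x0, `|G x0 - G y| < G x0 / 2.
  by have /cvgrPdist_lt := cG; apply; rewrite divr_gt0.
pose d := Num.min (e / 2) (Num.min (x0 - a) (b - x0)).
have d0 : 0 < d by rewrite !lt_min divr_gt0// !subr_gt0 ax xb.
apply: (@trig_peak_absurd G M mG GM oG x0 d d0 _ _ (G x0 / 2)) => //.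
- have : d <= x0 - a by rewrite /d !ge_min lexx !orbT.
  lra.
- have : d <= b - x0 by rewrite /d !ge_min lexx !orbT.
  lra.
- by rewrite divr_gt0.
- move=> x xd; have : `|G x0 - G x| < G x0 / 2.
    apply: eG; rewrite /ball/= distrC; apply: le_lt_trans xd _.
    apply: (@le_lt_trans _ _ (e / 2)); last lra.
    by rewrite /d ge_min lexx.
  by rewrite ltr_norml => /andP[_ ?]; lra.
Qed.

End Primitive.

Section TrigComplete.
Context {R : realType}.
Variables a b : R.
Hypothesis ab : a < b.
Local Notation lam := (@lebesgue_measure R).
Local Notation nu := (interval_measure a b : {measure set (measurableTypeR R) -> \bar R}).
Let L := b - a.
Let w := 2 * pi / L.

Let L0 : 0 < L. Proof. by rewrite subr_gt0. Qed.
Let w0 : 0 < w. Proof. by rewrite divr_gt0// mulr_gt0// pi_gt0. Qed.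
Let wL : w * L = 2 * pi. Proof. by rewrite divfK// gt_eqF. Qed.

Let sin_cos (x : R) : sin x = cos (x - pi / 2). Proof. by rewrite cosBpihalf. Qed.

Lemma integral_cos_period (k : int) phi : k != 0 ->
  \int[nu]_x cos (w * k%:~R * x + phi) = 0.
Proof.
move=> k0; have ck : w * k%:~R != 0 by rewrite mulf_neq0 ?intr_eq0// gt_eqF.
have cc : continuous (fun x : R => cos (w * k%:~R * x + phi)).
  move=> u; have cvl : (fun x => w * k%:~R * x + phi) x @[x --> u] --> w * k%:~R * u + phi.
    by apply: cvgD; [apply: cvgM; [exact: cvg_cst|exact: cvg_id]|exact: cvg_cst].
  by apply: (cvg_comp _ _ cvl); exact: continuous_cos.
rewrite Rintegral_intervalE; last exact: continuous_measurable_fun.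
rewrite Rintegral_itv_bndo_bndc ?integral_cos//.
  have -> : w * k%:~R * b + phi = w * k%:~R * a + phi + (2 * pi) * k%:~R.
    by rewrite -wL /L; ring.
  have -> : forall u : R, sin (u + 2 * pi * k%:~R) = sin u.
    move=> u; rewrite sinD; have := cis_int (R := R) k; rewrite /cis.
    by move=> [-> ->]; rewrite mulr1 mulr0 addr0.
  by rewrite subrr mul0r.
apply: (@integrableS _ _ _ lam `[a, b]%classic) => //; first by apply: subset_itvl; rewrite bnd_simp.
apply: continuous_compact_integrable; first exact: segment_compact.
exact: continuous_subspaceT.
Qed.

(** As [f] is merely integrable, the peak argument is applied to its primitive [G], which is
    continuous. Integration by parts makes [G] minus its mean orthogonal to all frequencies, so that
    [G] is constant inside the interval, and Lebesgue's differentiation theorem gives [f = 0]. *)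
Lemma trig_complete_real (f : R -> R) : measurable_fun setT f ->
  nu.-integrable setT (EFin \o f) ->
  (forall (k : int) phi, \int[nu]_x (f x * cos (w * k%:~R * x + phi)) = 0) ->
  {ae nu, forall x, f x = 0}.
Proof.
move=> mf if_ of_.
pose G x := \int[nu]_y (f y * \1_(`]-oo, x]%classic : set R) y).
have mI x : measurable_fun setT (\1_(`]-oo, x]%classic : set R) : R -> R) by exact: measurable_indic.
pose h (z : R * R) := f z.2 * (z.2 <= z.1)%R%:R.
have mle : measurable_fun setT (fun z : R * R => ((z.2 <= z.1)%R%:R : R)).
  rewrite (_ : (fun z => _) = \1_[set z : R * R | 0 <= z.1 - z.2]).
    apply: measurable_indic; rewrite -[X in measurable X]setTI.
    rewrite (_ : [set z | _] = (fun z : R * R => z.1 - z.2) @^-1` `[0, +oo[).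
      have : measurable_fun setT (fun z : R * R => z.1 - z.2).
        by apply: measurable_funB; [exact: measurable_fst|exact: measurable_snd].
      exact.
    by apply/seteqP; split => z /=; rewrite in_itv/= andbT.
  apply/funext => z; rewrite indicE; congr (_%:R); congr nat_of_bool.
  by apply/idP/idP; rewrite inE/= subr_ge0.
have mh : measurable_fun setT h.
  by apply: measurable_funM => //; apply: measurableT_comp => //; exact: measurable_snd.
have GE x : G x = \int[nu]_y h (x, y).
  congr Rintegral; apply/funext => y; rewrite /h/= indicE; congr (_ * (nat_of_bool _)%:R).
  by apply/idP/idP; rewrite inE/= in_itv/=.
have mG : measurable_fun setT G.
  by rewrite (_ : G = fun x => \int[nu]_y h (x, y)); [exact: measurable_Rintegral_section|exact/funext].
pose M := \int[nu]_x `|f x|.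
have ifN : nu.-integrable setT (EFin \o (fun x => `|f x|)) by exact: integrable_norm.
have ifI x : nu.-integrable setT (EFin \o (fun y => f y * \1_(`]-oo, x]%classic : set R) y)).
  apply: (@integrable_dominated _ (measurableTypeR R) R nu _ (fun x => `|f x|)) => // [|y].
    exact: measurable_funM.
  by rewrite normrM ler_piMr// indicE ger0_norm// lern1 leq_b1.
have GM x : `|G x| <= M.
  apply: le_trans (le_normr_Rintegral _ (ifI x)) _ => //.
  apply: le_Rintegral => //; first exact: integrable_norm (ifI x).
  by move=> y _; rewrite normrM ler_piMr// indicE ger0_norm// lern1 leq_b1.
have mc (c phi : R) : measurable_fun setT (fun x : R => cos (c * x + phi)).
  apply: continuous_measurable_fun => u.
  have cvl : (fun x => c * x + phi) x @[x --> u] --> c * u + phi.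
    by apply: cvgD; [apply: cvgM; [exact: cvg_cst|exact: cvg_id]|exact: cvg_cst].
  by apply: (cvg_comp _ _ cvl); exact: continuous_cos.
have c1 (x : R) : `|cos x| <= 1 by rewrite ler_norml cos_geN1 cos_le1.
have i1 : nu.-integrable setT (EFin \o cst (1 : R)).
  by apply: (@interval_bounded_integrable _ _ _ _ 1) => // x; rewrite /= normr1.
have f0 : \int[nu]_x f x = 0.
  rewrite -[RHS](of_ 0 0); congr Rintegral; apply/funext => x.
  by rewrite mulr0 mul0r addr0 cos0 mulr1.
(* Integration by parts as Fubini on the triangle [y <= x]: the inner integral of the cosine over
   [[y, b[] leaves a boundary term, which vanishes with the integral of [f], and a cosine whose
   phase is shifted by a quarter turn. *)
have orthG (k : int) phi : k != 0 ->
    \int[nu]_x (G x * cos (w * k%:~R * x + phi)) = 0.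
  move=> k0; set c := w * k%:~R.
  have c0 : c != 0 by rewrite mulf_neq0 ?intr_eq0// gt_eqF.
  have -> : \int[nu]_x (G x * cos (c * x + phi)) =
      \int[nu]_x \int[nu]_y (h (x, y) * cos (c * x + phi)).
    congr Rintegral; apply/funext => x; rewrite GE RintegralZr//.
    by apply: eq_integrable (ifI x) => // y _; rewrite /= /h indicE/=; congr ((_ * (nat_of_bool _)%:R)%:E); apply/idP/idP; rewrite inE/= in_itv/=.
  pose H (z : R * R) := h z * cos (c * z.1 + phi).
  have mH : measurable_fun setT H.
    apply: measurable_funM => //.
    exact: (measurableT_comp (mc c phi) measurable_fst).
  have HM x y : `|H (x, y)| <= cst 1 x * `|f y|.
    rewrite /H /h/= !normrM mul1r -[leRHS]mulr1 ler_pM// ?mulr_ge0// ler_piMr//.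
    by rewrite ger0_norm// lern1 leq_b1.
  have [-> <-] := @Rintegral_fubini _ _ (measurableTypeR R) (measurableTypeR R) R
    (interval_measure a b) (interval_measure a b) H (cst 1) (fun y => `|f y|) mH i1 ifN HM.
  have inner y : y \in `[a, b[ -> \int[nu]_x H (x, y) =
      f y * ((sin (c * b + phi) - sin (c * y + phi)) / c).
    rewrite in_itv/= => /andP[ay yb].
    have mHy : measurable_fun setT (fun x => H (x, y)).
      exact: (measurableT_comp mH (measurable_pair2 y)).
    rewrite Rintegral_intervalE//.
    rewrite -integral_cos//.
    have -> : \int[lam]_(x in `[a, b[) H (x, y) = \int[lam]_(x in `[y, b[) (f y * cos (c * x + phi)).
      rewrite Rintegral_mkcond [RHS]Rintegral_mkcond; congr Rintegral; apply/funext => x.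
      rewrite !patchE !mem_setE !in_itv/= /H /h/=.
      case: (x < b); rewrite ?andbF// !andbT; case: (boolP (y <= x)) => yx.
        by rewrite (le_trans ay yx) mulr1.
      by rewrite mulr0 mul0r if_same.
    have icos : lam.-integrable `[y, b] (EFin \o (fun x => cos (c * x + phi))).
      apply: continuous_compact_integrable; first exact: segment_compact.
      apply: continuous_subspaceT => u.
      have cvl : (fun x => c * x + phi) x @[x --> u] --> c * u + phi.
        by apply: cvgD; [apply: cvgM; [exact: cvg_cst|exact: cvg_id]|exact: cvg_cst].
      by apply: (cvg_comp _ _ cvl); exact: continuous_cos.
    rewrite -RintegralZl//.
    by rewrite Rintegral_itv_bndo_bndc//; apply: integrableS (integrableZl _ (f y) icos) => //; apply: subset_itvl; rewrite bnd_simp.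
  have -> : \int[nu]_y \int[nu]_x H (x, y) =
      \int[nu]_y (f y * ((sin (c * b + phi) - sin (c * y + phi)) / c)).
    rewrite !Rintegral_intervalE.
    - by apply: eq_Rintegral => y; rewrite inE/= => yab; exact: inner.
    - apply: measurable_funM => //; apply: measurable_funM => //; apply: measurable_funB => //.
      by rewrite (_ : (fun y => _) = fun y => cos (c * y + (phi - pi / 2))) //; apply/funext => y; rewrite sin_cos addrA.
    - have mHs : measurable_fun setT (fun z : R * R => H (z.2, z.1)).
        apply: (measurableT_comp mH); apply: measurable_fun_pair.
          exact: measurable_snd.
        exact: measurable_fst.
      exact: (@measurable_Rintegral_section _ _ (measurableTypeR R) (measurableTypeR R) _ nu
        (fun z => H (z.2, z.1)) mHs).
  pose K := sin (c * b + phi) / c.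
  have -> : (fun y => f y * ((sin (c * b + phi) - sin (c * y + phi)) / c)) =
      (fun y => K * f y - c^-1 * (f y * cos (c * y + (phi - pi / 2)))).
    by apply/funext => y; rewrite sin_cos [sin (c * y + _)]sin_cos /K [in RHS]sin_cos -!addrA; field.
  have ifc : nu.-integrable setT (EFin \o (fun y => f y * cos (c * y + (phi - pi / 2)))).
    apply: (@integrable_dominated _ (measurableTypeR R) R nu _ (fun x => `|f x|)) => // [|y].
      exact: measurable_funM mf (mc _ _).
    by rewrite normrM ler_piMr.
  rewrite RintegralB//; last 2 first.
  - by apply: eq_integrable (integrableZl measurableT K if_).
  - by apply: eq_integrable (integrableZl measurableT c^-1 ifc).
  by rewrite !RintegralZl// f0 of_ !mulr0 subr0.
(* Subtracting the mean of [G] restores orthogonality at [k = 0], the only frequency that [orthG]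
   leaves out. *)
pose c0 := (\int[nu]_x G x) / L.
have iG : nu.-integrable setT (EFin \o G) by exact: (@interval_bounded_integrable _ _ _ G M).
have orthGc (k : int) phi : \int[nu]_x ((G x - c0) * cos (w * k%:~R * x + phi)) = 0.
  have iGc : nu.-integrable setT (EFin \o (fun x => G x * cos (w * k%:~R * x + phi))).
    apply: (@interval_bounded_integrable _ _ _ _ M) => [|x]; first exact: measurable_funM.
    by rewrite normrM -[leRHS]mulr1 ler_pM.
  have ic : nu.-integrable setT (EFin \o (fun x => cos (w * k%:~R * x + phi))).
    exact: (@interval_bounded_integrable _ _ _ _ 1).
  have -> : (fun x => (G x - c0) * cos (w * k%:~R * x + phi)) =
      (fun x => G x * cos (w * k%:~R * x + phi) - c0 * cos (w * k%:~R * x + phi)).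
    by apply/funext => x; rewrite mulrBl.
  rewrite RintegralB//; last by apply: eq_integrable (integrableZl measurableT c0 ic).
  rewrite RintegralZl//; have [->|k0] := eqVneq k 0.
    rewrite mulr0; under eq_Rintegral do rewrite mul0r add0r.
    under [X in _ - _ * X]eq_Rintegral do rewrite mul0r add0r.
    rewrite RintegralZr// Rintegral_cst//.
    have -> : fine (nu setT) = L by exact: (congr1 fine (interval_measure_lt ab)).
    by rewrite /c0 -/L mulrCA mulrAC -mulrA divff ?gt_eqF// mulr1 mulrC subrr.
  by rewrite orthG// integral_cos_period// mulr0 subr0.
pose fD := f \_ `[a, b[.
have ifD : lam.-integrable setT (EFin \o fD).
  have /(interval_integrable a b mf) := if_.
  rewrite integrable_mkcond//; apply: eq_integrable => // x _.
  by rewrite /fD /= !patchE; case: ifP.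
have GF x : G x = \int[lam]_(t in [set` Interval (BLeft a) (BRight x)]) fD t.
  rewrite /G Rintegral_intervalE; last exact: measurable_funM.
  rewrite Rintegral_mkcond [RHS]Rintegral_mkcond; congr Rintegral; apply/funext => y.
  rewrite /fD !patchE indicE !mem_setE !in_itv/=.
  by case: (a <= y); case: (y < b); case: (y <= x); rewrite ?mulr1 ?mulr0.
have cG x : x \in `]a, b[ -> {for x, continuous G}.
  move=> xab; have := @parameterized_integral_continuous R a b fD (ltW ab).
  have ifD' : lam.-integrable `[a, b] (EFin \o fD) by exact: integrableS ifD.
  move=> /(_ ifD')/(continuous_within_itvP _ ab)[+ _ _] => /(_ _ xab).
  by rewrite /parameterized_integral (_ : (fun x => _) = G)//; apply/funext => u; rewrite GF.
have Gc0 x : x \in `]a, b[ -> G x = c0.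
  move=> xab; have M0 : forall y, `|G y - c0| <= M + `|c0|.
    by move=> y; apply: le_trans (ler_normB _ _) _; rewrite lerD2r.
  have mGc : measurable_fun setT (fun y => G y - c0) by exact: measurable_funB.
  have h1 := @trig_orth_le0 _ _ _ ab (fun y => G y - c0) _ mGc M0 orthGc x xab.
  have mGc' : measurable_fun setT (fun y => c0 - G y) by exact: measurable_funB.
  have M0' : forall y, `|c0 - G y| <= M + `|c0| by move=> y; rewrite distrC.
  have h2 := @trig_orth_le0 _ _ _ ab (fun y => c0 - G y) _ mGc' M0'.
  apply/eqP; rewrite eq_le -subr_le0 -[X in _ && X]subr_le0; apply/andP; split.
    by apply: h1; apply: cvgB; [exact: cG|exact: cvg_cst].
  apply: h2 => // [k phi|]; last by apply: cvgB; [exact: cvg_cst|exact: cG].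
  transitivity (-1 * \int[nu]_x ((G x - c0) * cos (w * k%:~R * x + phi))).
    rewrite -RintegralZl//.
      by congr Rintegral; apply/funext => y; rewrite mulrA mulN1r opprB.
    apply: (@interval_bounded_integrable _ _ _ _ (M + `|c0|)).
      exact: measurable_funM.
    by move=> y; rewrite normrM -[leRHS]mulr1 ler_pM.
  by rewrite orthGc mulr0.
have ae_nu (P : R -> Prop) : {ae lam, forall x, P x} -> {ae nu, forall x, P x}.
  move=> [N [mN N0 sN]]; exists N; split => //; apply/eqP; rewrite eq_le measure_ge0 andbT.
  by rewrite -N0; apply: le_measure; rewrite ?inE//; exact: measurableI.
have aeD : {ae nu, forall x, x \in `]a, b[}.
  exists (~` `]a, b[%classic); split; first exact: measurableC.
    have sub : ~` `]a, b[%classic `&` `[a, b[%classic `<=` [set a].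
      move=> x [/= nx]; rewrite in_itv/= => /andP[ax xb]; apply/eqP; rewrite eq_le ax andbT leNgt.
      by apply/negP => xa; apply: nx; rewrite in_itv/= xa.
    apply/eqP; rewrite eq_le measure_ge0 andbT -(lebesgue_measure_set1 a).
    apply: le_measure => //; rewrite ?inE//; apply: measurableI => //; exact: measurableC.
  by move=> x /=.
have intF y : lam.-integrable [set` Interval (BLeft a) (BRight y)] (EFin \o fD).
  exact: integrableS ifD.
have locF : locally_integrable setT fD by apply: open_integrable_locally => //; exact: openT.
have ftc := ae_nu _ (FTC1 intF locF).
apply: (@filterS2 _ _ (ae_filter_ringOfSetsType nu) _ _ _ _ ftc aeD) => x {}ftc xab.
have xab' := xab; move: xab'; rewrite in_itv/= => /andP[ax xb].
have ax' : (a%:E < x%:E)%E by rewrite lte_fin.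
have [_] := ftc ax'.
have -> : (fun y : R => \int[lam]_(t in [set` Interval (BLeft a) (BRight y)]) fD t)^`()%classic x = 0.
  rewrite derive1E.
  have /(@near_eq_derive R R R _ _ x 1) -> : {near x, (fun y : R =>
      \int[lam]_(t in [set` Interval (BLeft a) (BRight y)]) fD t) =1 cst c0}.
    near=> y; rewrite -GF Gc0//; near: y; exact: near_in_itvoo.
  by rewrite derive_cst.
by rewrite /fD patchE mem_set// /= in_itv/= (ltW ax) xb.
Unshelve. all: by end_near. Qed.

End TrigComplete.

(** The order is 0, -1, 1, -2, 2, ...; it turns sums over the integers into series indexed by
    [nat]. *)
Definition int_enum (j : nat) : int := if odd j then Negz j./2 else Posz j./2.
Definition int_index (k : int) : nat :=
  match k with Posz m => m.*2 | Negz m => m.*2.+1 end.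

Lemma int_indexK : cancel int_index int_enum.
Proof.
by case=> m; rewrite /int_enum/= odd_double/= ?uphalf_double ?doubleK.
Qed.

Lemma int_enumK : cancel int_enum int_index.
Proof.
by move=> j; rewrite /int_enum -{4}(odd_double_half j); case: (odd j).
Qed.

Lemma integral_counting_int (R : realType) (h : int -> R) : (forall k, 0 <= h k) ->
  (\int[counting_int R]_k (h k)%:E = \sum_(j <oo) (h (int_enum j))%:E)%E.
Proof.
move=> h0; have cov : \bigcup_j [set int_enum j] = [set: int].
  by apply/seteqP; split => // k _; exists (int_index k) => //=; rewrite int_indexK.
have tr : trivIset setT (fun j => [set int_enum j]).
  apply/trivIsetP => i j _ _ ij; apply/seteqP; split => // k [/= -> /(can_inj int_enumK) ji].
  by rewrite ji eqxx in ij.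
rewrite -[X in integral _ X]cov ge0_integral_bigcup//.
- apply: eq_eseriesr => j _.
  rewrite (eq_integral (cst (h (int_enum j))%:E)); last by move=> k; rewrite inE/= => ->.
  have fin1 : finite_set [set int_enum j] by exact: finite_set1.
  rewrite integral_cst//=; set q := counting_int _ _.
  suff -> : q = 1%E by rewrite mule1.
  by rewrite /q /counting_int /counting asboolT// fset_set1 finmap.cardfs1.
- by move=> k _; rewrite lee_fin.
Qed.

(** * Parseval's identity on an interval *)

Section Parseval.
Context {R : realType}.
Variables a b : R.
Hypothesis ab : a < b.
Local Notation nu := (interval_measure a b : {measure set (measurableTypeR R) -> \bar R}).
Let L := b - a.
Let w := 2 * pi / L.

Let L0 : 0 < L. Proof. by rewrite subr_gt0. Qed.
Let w0 : 0 < w. Proof. by rewrite divr_gt0// mulr_gt0// pi_gt0. Qed.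

Lemma interval_cintegrable_bounded (f : measurableTypeR R -> R[i]) (M : R) :
  cmeasurable f -> (forall x, cmod (f x) <= M) -> cintegrable nu f.
Proof.
move=> mf fM; apply: (cintegrable_le (g := cst M)) => //.
apply: (@interval_bounded_integrable _ _ _ _ `|M|) => //.
Qed.

Lemma interval_bounded_sqint (f : measurableTypeR R -> R[i]) (M : R) :
  cmeasurable f -> (forall x, cmod (f x) <= M) -> square_integrable nu f.
Proof.
move=> mf fM; split => //; apply: int_ge0_lty => [x|]; first exact: sqmod_ge0.
apply: (@interval_bounded_integrable _ _ _ _ (M ^+ 2)); first exact: measurable_sqmod.
move=> x; rewrite ger0_norm ?sqmod_ge0// sqmod_le_sqr//.
exact: le_trans (cmod_ge0 _) (fM x).
Qed.

Lemma sqint_cintegrable (f : measurableTypeR R -> R[i]) :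
  square_integrable nu f -> cintegrable nu f.
Proof.
move=> fi; have one : square_integrable nu (fun=> 1 : R[i]).
  apply: (@interval_bounded_sqint _ 1); first exact: cmeasurable_cst.
  by move=> x; rewrite /cmod sqmod1 sqrtr1.
by have := cintegrableM one fi; congr cintegrable; apply/funext => x; rewrite mul1r.
Qed.

Let mlin (c : R) : measurable_fun setT (fun x : measurableTypeR R => c * x).
Proof. exact: measurable_funM. Qed.

Lemma trig_complete (f : measurableTypeR R -> R[i]) : square_integrable nu f ->
  (forall k : int, cintegral nu (fun x => cis (k%:~R / L * x) * f x) = 0) ->
  {ae nu, forall x, f x = 0}.
Proof.
move=> fi f0; have [mf _] := fi; have [f1i f2i] := sqint_cintegrable fi.
have mc (c : R) : measurable_fun setT (fun x : measurableTypeR R => cos (c * x)).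
  by apply: (measurableT_comp _ (mlin c)); exact: (continuous_measurable_fun (@continuous_cos R)).
have ms (c : R) : measurable_fun setT (fun x : measurableTypeR R => sin (c * x)).
  by apply: (measurableT_comp _ (mlin c)); exact: (continuous_measurable_fun (@continuous_sin R)).
have c1 (x : R) : `|cos x| <= 1 by rewrite ler_norml cos_geN1 cos_le1.
have s1 (x : R) : `|sin x| <= 1 by rewrite ler_norml sin_geN1 sin_le1.
have iM (g u : measurableTypeR R -> R) : measurable_fun setT u -> (forall x, `|u x| <= 1) ->
    nu.-integrable setT (EFin \o g) -> nu.-integrable setT (EFin \o (fun x => g x * u x)).
  move=> mu_ u1 gi; have /measurable_int/measurable_EFinP mg := gi.
  apply: (@integrable_dominated _ _ _ _ _ (fun x => `|g x|)).
  - exact: measurable_funM.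
  - exact: integrable_norm.
  - by move=> x; rewrite normrM ler_piMr.
pose C k g := \int[nu]_x (g x * cos (w * k%:~R * x)).
pose S k g := \int[nu]_x (g x * sin (w * k%:~R * x)).
have wE (k : int) x : 2 * pi * (k%:~R / L * x) = w * k%:~R * x by rewrite /w; ring.
have E k : C k (fun x => Re (f x)) - S k (fun x => Im (f x)) = 0 /\
    C k (fun x => Im (f x)) + S k (fun x => Re (f x)) = 0.
  have := f0 k; rewrite /cintegral => -[]; rewrite /C /S => e1 e2; split.
    rewrite -RintegralB//; [|exact: iM|exact: iM].
    by rewrite -[RHS]e1; congr Rintegral; apply/funext => x; rewrite cReM /= wE; ring.
  rewrite -RintegralD//; [|exact: iM|exact: iM].
  by rewrite -[RHS]e2; congr Rintegral; apply/funext => x; rewrite cImM /= wE; ring.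
have CN k g : C (- k) g = C k g.
  by congr Rintegral; apply/funext => x; rewrite mulrNz mulrN mulNr cosN.
have SN k g : nu.-integrable setT (EFin \o g) -> S (- k) g = - S k g.
  move=> gi; transitivity (-1 * S k g); last by rewrite mulN1r.
  rewrite /S -RintegralZl//; last exact: iM.
  by congr Rintegral; apply/funext => x; rewrite mulrNz mulrN mulNr sinN; ring.
(* [C] is even and [S] is odd in [k], so that the complex equations at [k] and [- k] are four real
   equations which separate the four coefficients. *)
have Z k : [/\ C k (fun x => Re (f x)) = 0, S k (fun x => Re (f x)) = 0,
    C k (fun x => Im (f x)) = 0 & S k (fun x => Im (f x)) = 0].
  have [e1 e2] := E k; have [] := E (- k); rewrite !CN !SN// => e3 e4.
  by split; lra.
have R0 (g : measurableTypeR R -> R) : measurable_fun setT g ->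
    nu.-integrable setT (EFin \o g) -> (forall k, C k g = 0) -> (forall k, S k g = 0) ->
    {ae nu, forall x, g x = 0}.
  move=> mg gi Cg Sg; apply: (trig_complete_real ab) => // k phi.
  have -> : (fun x => g x * cos (w * k%:~R * x + phi)) =
      (fun x => cos phi * (g x * cos (w * k%:~R * x)) - sin phi * (g x * sin (w * k%:~R * x))).
    by apply/funext => x; rewrite cosD; ring.
  have i1 := iM _ _ (mc (w * k%:~R)) (fun=> c1 _) gi.
  have i2 := iM _ _ (ms (w * k%:~R)) (fun=> s1 _) gi.
  rewrite RintegralB//; last 2 first.
  - by apply: eq_integrable (integrableZl measurableT (cos phi) i1).
  - by apply: eq_integrable (integrableZl measurableT (sin phi) i2).
  by rewrite !RintegralZl// -/(C _ _) -/(S _ _) Cg Sg !mulr0 subr0.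
have ReZ := R0 _ mf.1 f1i (fun k => let: And4 h _ _ _ := Z k in h) (fun k => let: And4 _ h _ _ := Z k in h).
have ImZ := R0 _ mf.2 f2i (fun k => let: And4 _ _ h _ := Z k in h) (fun k => let: And4 _ _ _ h := Z k in h).
apply: (@filterS2 _ _ (ae_filter_ringOfSetsType nu) _ _ _ _ ReZ ImZ) => x rx ix.
by apply: complex_ext; rewrite ?rx ?ix.
Qed.

Lemma cintegral_cis_period (k : int) :
  cintegral nu (fun x : measurableTypeR R => cis (k%:~R / L * x)) = (if k == 0 then L else 0)%:C.
Proof.
have wE x : 2 * pi * (k%:~R / L * x) = w * k%:~R * x by rewrite /w; ring.
have [->|k0] := eqVneq k 0.
  have -> : (fun x : measurableTypeR R => cis (0%:~R / L * x)) = cst (cis 0).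
    by apply/funext => x; rewrite !mul0r.
  rewrite cis0; apply: complex_ext; rewrite /cintegral/= Rintegral_cst//= ?mul0r// mul1r.
  exact: (congr1 fine (interval_measure_lt ab)).
apply: complex_ext; rewrite /cintegral/=.
  rewrite -[RHS](integral_cos_period ab 0 k0); congr Rintegral; apply/funext => x.
  by rewrite wE addr0.
rewrite -[RHS](integral_cos_period ab (- (pi / 2)) k0); congr Rintegral; apply/funext => x.
by rewrite wE -cosBpihalf.
Qed.

Definition trig_fun (j : nat) (x : measurableTypeR R) : R[i] :=
  ((Num.sqrt L)^-1)%:C * cis ((int_enum j)%:~R / L * x).

Let mtrig j : cmeasurable (trig_fun j).
Proof.
apply: cmeasurableM; first exact: cmeasurable_cst.
exact: cmeasurable_cis.
Qed.

Let trig_sqint j : square_integrable nu (trig_fun j).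
Proof.
apply: (@interval_bounded_sqint _ (Num.sqrt L)^-1) => // x.
by rewrite cmodM cmod_cis mulr1 cmod_real ger0_norm// invr_ge0 sqrtr_ge0.
Qed.

Lemma trig_basis : orthonormal_basis (fun j => L2of nu (trig_fun j)).
Proof.
have sq : (Num.sqrt L)^-1 * (Num.sqrt L)^-1 = L^-1.
  by rewrite -invfM -expr2 sqr_sqrtr// ltW.
split=> [i j|u u0].
  rewrite L2_innerof//.
  have -> : (fun x => (trig_fun i x)^* * trig_fun j x) =
      (fun x => (L^-1)%:C * cis ((int_enum j - int_enum i)%:~R / L * x)).
    apply/funext => x; rewrite /trig_fun rmorphM/= conj_real cis_conj mulrACA -rmorphM/= sq -cisD.
    by congr (_ * cis _); rewrite intrB; ring.
  rewrite cintegralZ; last first.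
    apply: (@interval_cintegrable_bounded _ 1); first exact: cmeasurable_cis.
    by move=> x; rewrite cmod_cis.
  rewrite cintegral_cis_period subr_eq0 eq_sym (can_eq int_enumK) -rmorphM/=.
  by case: eqP => _; rewrite ?mulr0// mulVf// gt_eqF.
apply: L2ext; have := L2repr0 nu; apply: (@filterS2 _ _ (ae_filter_ringOfSetsType nu) _ _ _ _
  (trig_complete (sqfunP (L2repr u)) _)) => [x -> -> //|k].
have := u0 (int_index (- k)); rewrite (L2_innerE (mtrig _) (sqfun_cmeasurable (L2repr u)) (L2of_repr (trig_sqint _))); last exact: aeW.
have -> : (fun x => (trig_fun (int_index (- k)) x)^* * L2repr u x) =
    (fun x => ((Num.sqrt L)^-1)%:C * (cis (k%:~R / L * x) * L2repr u x)).
  apply/funext => x; rewrite /trig_fun rmorphM/= conj_real cis_conj int_indexK -mulrA.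
  by congr (_ * (cis _ * _)); rewrite mulrNz; ring.
rewrite cintegralZ; last first.
  apply: cintegrableM; last exact: sqfunP.
  apply: (@interval_bounded_sqint _ 1); first exact: cmeasurable_cis.
  by move=> x; rewrite cmod_cis.
move/eqP; rewrite mulf_eq0 (_ : (_ == 0 :> R[i]) = false) => [/eqP//|].
by rewrite eq_complex/= eqxx andbT invr_eq0 gt_eqF// sqrtr_gt0.
Qed.

Lemma interval_parseval (f : measurableTypeR R -> R[i]) : square_integrable nu f ->
  (\sum_(j <oo) (L^-1 * sqmod (cintegral nu (fun x => f x * cis (- ((int_enum j)%:~R / L * x)))))%:E
    = N2 nu f)%E.
Proof.
move=> fi; rewrite -nsq_L2of//.
have cv := parseval (@L2_complete _ _ _ nu) trig_basis (u := L2of nu f).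
have E j : sqmod (inner (L2of nu (trig_fun j)) (L2of nu f)) =
    L^-1 * sqmod (cintegral nu (fun x => f x * cis (- ((int_enum j)%:~R / L * x)))).
  rewrite L2_innerof//.
  have -> : (fun x => (trig_fun j x)^* * f x) =
      (fun x => ((Num.sqrt L)^-1)%:C * (f x * cis (- ((int_enum j)%:~R / L * x)))).
    by apply/funext => x; rewrite /trig_fun rmorphM/= conj_real cis_conj -mulrA [f x * _]mulrC.
  rewrite cintegralZ; last first.
    apply: cintegrableM => //; apply: (@interval_bounded_sqint _ 1); last by move=> x; rewrite cmod_cis.
    by apply: cmeasurable_cis; apply: measurableT_comp => //.
  by rewrite sqmodM sqmod_real exprVn sqr_sqrtr// ltW.
apply: cvg_lim => //; apply: cvg_EFin; first by near=> n; rewrite sumEFin.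
move: cv; under eq_fun do (under eq_bigr do rewrite E).
rewrite (_ : (fine \o _) = (fun n => \sum_(j < n) L^-1 *
   sqmod (cintegral nu (fun x => f x * cis (- ((int_enum j)%:~R / L * x))))))//.
by apply/funext => n /=; rewrite sumEFin/= big_mkord.
Unshelve. all: by end_near. Qed.

End Parseval.

(** * Plancherel's theorem on the line *)

Lemma cmod_le0 (R : realType) (z : R[i]) : cmod z <= 0 -> z = 0.
Proof.
move=> z0; apply: sqmod_eq0; rewrite -cmod_sq.
suff -> : cmod z = 0 by rewrite expr0n.
by apply/eqP; rewrite eq_le z0 cmod_ge0.
Qed.

Section Line.
Context {R : realType}.
Local Notation lam := (@lebesgue_measure R).

Lemma lebesgue_measure_shift (c : R) (A : set (measurableTypeR R)) : measurable A ->
  pushforward lam (fun x : measurableTypeR R => (x + c : measurableTypeR R)) A = lam A.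
Proof.
have mc : measurable_fun setT (fun x : measurableTypeR R => (x + c : measurableTypeR R)).
  exact: measurable_funD.
move=> mA; apply/esym; apply: (@lebesgue_measure_unique _ (pushforward lam _)) => //= _ [[a b]] _ <-.
rewrite /pushforward (_ : _ @^-1` _ = `]a - c, b - c]%classic).
  by rewrite /= !lebesgue_measure_itv/= !lte_fin ltrD2r; case: ifP => // _; rewrite -EFinB; congr EFin; ring.
by apply/seteqP; split => x /=; rewrite !in_itv/= ltrBlDr lerBrDr.
Qed.

Lemma integral_shift (c : R) (D : set (measurableTypeR R)) (h : measurableTypeR R -> R) :
  measurable D -> measurable_fun setT h -> (forall x, 0 <= h x) ->
  (\int[lam]_(x in D) (h x)%:E = \int[lam]_(x in [set x | D (x + c)%R]) (h (x + c)%R)%:E)%E.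
Proof.
move=> mD mh h0.
have mc : measurable_fun setT (fun x : measurableTypeR R => (x + c : measurableTypeR R)).
  exact: measurable_funD.
rewrite -[RHS](@ge0_integral_pushforward _ _ _ _ R _ mc lam D (EFin \o h))//.
- by apply: eq_measure_integral => A mA _; exact/esym/(lebesgue_measure_shift c mA).
- by apply/measurable_EFinP; exact: measurable_funS mh.
- by move=> x _; rewrite lee_fin.
Qed.

(** Folds the line onto one period; in [plancherel_line] the period is the spacing of the dual
    lattice. *)
Lemma integral_tile (e : R) (h : measurableTypeR R -> R) : 0 < e ->
  measurable_fun setT h -> (forall x, 0 <= h x) ->
  (\int[lam]_x (h x)%:E = \int[lam]_(x in `[0%R, e[) (\sum_(j <oo) (h (x + (int_enum j)%:~R * e)%R)%:E))%E.
Proof.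
move=> e0 mh h0; pose A j := `[(int_enum j)%:~R * e, (int_enum j + 1)%:~R * e[%classic : set (measurableTypeR R).
have AE (j : nat) x : A j x <-> int_enum j = Num.floor (x / e).
  rewrite /A/= in_itv/= -ler_pdivlMr// -ltr_pdivrMr//; split=> [h1|->].
    exact/esym/floor_def.
  by rewrite ge_floor lt_succ_floor.
have mA j : measurable (A j) by exact: measurable_itv.
have cov : \bigcup_j A j = [set: R].
  apply/seteqP; split => // x _; exists (int_index (Num.floor (x / e))) => //.
  by apply/AE; rewrite int_indexK.
have tr : trivIset setT A.
  apply/trivIsetP => i j _ _ ij; apply/seteqP; split => // x [/AE ix /AE jx].
  by move: ij; rewrite -(inj_eq (can_inj int_enumK)) ix jx eqxx.
have mhA : measurable_fun (\bigcup_j A j) (EFin \o h) by rewrite cov; exact/measurable_EFinP.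
rewrite -[X in integral _ X]cov (ge0_integral_bigcup _ mA mhA _ tr); last first.
  by move=> x _; rewrite lee_fin.
rewrite integral_nneseries//; last 2 first.
- move=> j; apply/measurable_EFinP; apply: measurable_funTS.
  by apply: (measurableT_comp mh); exact: measurable_funD.
- by move=> j x _; rewrite lee_fin.
apply: eq_eseriesr => j _; rewrite (integral_shift ((int_enum j)%:~R * e))//.
suff -> : [set x : measurableTypeR R | A j (x + (int_enum j)%:~R * e)%R] = `[0%R, e[%classic by [].
by apply/seteqP; split => x; rewrite /A /mkset/= !in_itv/= intrD mulrDl mul1r lerDr addrC ltrD2l.
Qed.

Lemma Rintegral_interval (a b : R) (h : measurableTypeR R -> R) : measurable_fun setT h ->
  (forall x, ~~ (a <= x < b) -> h x = 0) ->
  \int[lam]_x h x = \int[interval_measure a b]_x h x.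
Proof.
move=> mh h0; rewrite Rintegral_intervalE// [RHS]Rintegral_mkcond.
congr Rintegral; apply/funext => x; rewrite patchE; case: ifPn => //.
by rewrite mem_setE in_itv/= => /h0.
Qed.

Lemma cintegral_interval (a b : R) (f : measurableTypeR R -> R[i]) : cmeasurable f ->
  (forall x, ~~ (a <= x < b) -> f x = 0) ->
  cintegral lam f = cintegral (interval_measure a b) f.
Proof.
by move=> [f1 f2] f0; congr Complex; apply: Rintegral_interval => // x /f0 ->.
Qed.

Lemma N2_interval (a b : R) (f : measurableTypeR R -> R[i]) : cmeasurable f ->
  (forall x, ~~ (a <= x < b) -> f x = 0) ->
  N2 lam f = N2 (interval_measure a b) f.
Proof.
move=> mf f0; rewrite /N2 integral_intervalE//; [|exact: measurable_sqmod|by move=> x; exact: sqmod_ge0].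
rewrite [RHS]integral_mkcond; apply: eq_integral => x _; rewrite patchE; case: ifPn => //.
by rewrite mem_setE in_itv/= => /f0 ->; rewrite sqmod0.
Qed.

(* For each shift of the dual lattice this is Parseval's identity on an interval that contains the support;
   the shifted lattices tile the dual line. *)
Lemma plancherel_line (f : measurableTypeR R -> R[i]) (M : R) (r : nat) : cmeasurable f ->
  (forall x, cmod (f x) <= M * \1_[set x : measurableTypeR R | `|x| <= r%:R] x) ->
  N2 lam (fun y : measurableTypeR R => cintegral lam (fun x => f x * cis (- (x * y)))) = N2 lam f.
Proof.
(* The interval of [interval_measure] is half-open; one more unit than [r] keeps the support, with
   both its end points, inside it. *)
move=> mf fM; pose a : R := - (r.+1)%:R; pose b : R := (r.+1)%:R.
have ab : a < b by rewrite /a /b; have : (0:R) < r.+1%:R by []; lra.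
have f0 (x : R) : ~~ (a <= x < b) -> f x = 0.
  move=> xab; have := fM x; rewrite indicE memNset/= ?mulr0 => [h|]; first exact: cmod_le0.
  rewrite ler_norml => /andP[h1 h2]; move: xab; rewrite /a /b -natr1.
  by rewrite (_ : _ <= _ < _)//; lra.
have mE : cmeasurable (fun p : measurableTypeR R * measurableTypeR R => f p.2 * cis (- (p.2 * p.1))).
  apply: cmeasurableM.
    by split; [exact: (measurableT_comp mf.1 measurable_snd)|exact: (measurableT_comp mf.2 measurable_snd)].
  by apply: cmeasurable_cis; apply: measurableT_comp => //; apply: measurable_funM.
have mEx y : cmeasurable (fun x : measurableTypeR R => f x * cis (- (x * y))) := cmeasurable_pair1 y mE.
pose h y := sqmod (cintegral lam (fun x : measurableTypeR R => f x * cis (- (x * y)))).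
have mh : measurable_fun setT h.
  exact: (measurable_sqmod (cmeasurable_cintegral_section _ mE)).
pose L := b - a; have L0 : 0 < L by rewrite subr_gt0.
rewrite [LHS](_ : _ = \int[lam]_x (h x)%:E)%E// (@integral_tile L^-1)//; last 2 first.
- by rewrite invr_gt0.
- by move=> x; exact: sqmod_ge0.
rewrite (eq_integral (cst (L%:E * N2 lam f)%E)).
  rewrite integral_cst//= lebesgue_measure_itv/= lte_fin invr_gt0 L0 sube0 muleAC -EFinM mulfV ?mul1e//.
  by rewrite gt_eqF.
move=> t _ /=.
have fit : square_integrable (interval_measure a b) (fun x : measurableTypeR R => f x * cis (- (x * t))).
  apply: (@interval_bounded_sqint _ _ _ _ `|M|) => // x.
  rewrite cmodM cmod_cis mulr1 (le_trans (fM x))// (le_trans (ler_norm _))// normrM.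
  by rewrite ler_piMr// indicE; case: (_ \in _); rewrite ?normr1 ?normr0.
have := interval_parseval ab fit.
rewrite -(N2_interval (mEx t)); last by move=> x /f0 ->; rewrite mul0r.
rewrite (@eq_N2 _ _ _ lam _ f); last by move=> x; rewrite sqmodM sqmod_cis mulr1.
move=> <-; rewrite -nneseriesZl//; last first.
  by move=> j _; rewrite lee_fin mulr_ge0 ?sqmod_ge0// invr_ge0 ltW.
apply: eq_eseriesr => j _; rewrite -EFinM mulrA mulfV ?gt_eqF// mul1r /h.
rewrite (@cintegral_interval a b)//; last by move=> x /f0 ->; rewrite mul0r.
congr ((sqmod _)%:E); apply: eq_cintegral => x; rewrite -mulrA -cisD; congr (_ * cis _).
by rewrite -/L; set u := L^-1; ring.
Qed.

End Line.

(** * Plancherel kernels on products *)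

Lemma cmeasurable_comp d1 d2 (T : measurableType d1) (S : measurableType d2) (R : realType)
    (f : S -> R[i]) (g : T -> S) : cmeasurable f -> measurable_fun setT g ->
  cmeasurable (fun x => f (g x)).
Proof. by move=> [f1 f2] mg; split; [exact: (measurableT_comp f1)|exact: (measurableT_comp f2)]. Qed.

Lemma cmeasurable_prod d (T : measurableType d) (R : realType) I (r : seq I) (F : I -> T -> R[i]) :
  (forall i, cmeasurable (F i)) -> cmeasurable (fun x => \prod_(i <- r) F i x).
Proof.
move=> mF; elim: r => [|i r IH].
  by under eq_fun do rewrite big_nil; exact: cmeasurable_cst.
by under eq_fun do rewrite big_cons; exact: cmeasurableM.
Qed.

Lemma integrable_indicZ d (T : measurableType d) (R : realType) (mu : {measure set T -> \bar R})
    (D : set T) (M : R) : measurable D -> (mu D < +oo)%E ->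
  mu.-integrable setT (EFin \o (fun x => M * \1_D x)).
Proof.
move=> mD Doo; have i1 : mu.-integrable setT (EFin \o \1_D).
  apply: integrable_ge0 => //; by rewrite integral_indic// setIT.
by apply: eq_integrable (integrableZl measurableT M i1).
Qed.

Lemma Rintegral_indic d (T : measurableType d) (R : realType) (mu : {measure set T -> \bar R})
    (D : set T) : measurable D -> \int[mu]_x \1_D x = fine (mu D).
Proof. by move=> mD; rewrite /Rintegral integral_indic// setIT. Qed.

Lemma indic_ge0 T (R : realType) (D : set T) (x : T) : 0 <= \1_D x :> R.
Proof. by rewrite indicE. Qed.

Section Kernel.
Context {d1 d2} {T : measurableType d1} {S : measurableType d2} {R : realType}.
Variables (mu : {measure set T -> \bar R}) (nu : {measure set S -> \bar R}).
Variables (E : T -> S -> R[i]) (D : nat -> set T).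

Definition transform (f : T -> R[i]) (y : S) : R[i] := cintegral mu (fun x => f x * E x y).

(** Abstracts the Fourier transforms of the line, the circle and the integers in a form stable under
    products. The isometry is only required for bounded functions supported in a box of finite
    measure, where all integrals converge absolutely and Fubini's theorem applies. *)
Definition plancherel_kernel : Prop :=
  [/\ forall r, measurable (D r) /\ (mu (D r) < +oo)%E,
      cmeasurable (fun p : T * S => E p.1 p.2),
      forall x y, cmod (E x y) <= 1 &
      forall f M r, cmeasurable f -> (forall x, cmod (f x) <= M * \1_(D r) x) ->
        N2 nu (transform f) = N2 mu f].

Hypothesis K : plancherel_kernel.

Lemma kernel_integrand f : cmeasurable f -> cmeasurable (fun p : T * S => f p.1 * E p.1 p.2).
Proof.
by case: K => _ mE _ _ mf; apply: cmeasurableM => //; exact: (cmeasurable_comp mf measurable_fst).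
Qed.

Lemma kernel_section f y : cmeasurable f -> cmeasurable (fun x : T => f x * E x y).
Proof. by move=> mf; exact: (cmeasurable_pair2 y (kernel_integrand mf)). Qed.

Lemma kernel_cmod f x y : cmod (f x * E x y) <= cmod (f x).
Proof. by case: K => _ _ E1 _; rewrite cmodM ler_piMr// cmod_ge0. Qed.

Lemma kernel_cintegrable f y : cintegrable mu f -> cintegrable mu (fun x => f x * E x y).
Proof.
move=> fi; apply: (cintegrable_le _ (cintegrable_cmod fi)).
  exact/kernel_section/cintegrable_cmeasurable/fi.
by move=> x; exact: kernel_cmod.
Qed.

Lemma box_cintegrable f M r : cmeasurable f -> (forall x, cmod (f x) <= M * \1_(D r) x) ->
  cintegrable mu f.
Proof.
move=> mf fM; have [/(_ r)[mD Doo] _ _ _] := K.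
exact: (cintegrable_le mf (integrable_indicZ M mD Doo)).
Qed.

End Kernel.

Lemma cmeasurable_transform d1 d2 (T : measurableType d1) (S : measurableType d2) (R : realType)
    (mu : {sigma_finite_measure set T -> \bar R}) (nu : {measure set S -> \bar R}) E (D : nat -> set T) f :
  plancherel_kernel mu nu E D -> cmeasurable f -> cmeasurable (transform mu E f).
Proof.
move=> K mf; pose g (p : S * T) := f p.2 * E p.2 p.1.
have mg : cmeasurable g by exact: (cmeasurable_comp (kernel_integrand K mf) (@measurable_swap _ _ _ _)).
exact: (cmeasurable_cintegral_section mu mg).
Qed.

Lemma tonelli d1 d2 (T1 : measurableType d1) (T2 : measurableType d2) (R : realType)
    (m1 : {sigma_finite_measure set T1 -> \bar R}) (m2 : {sigma_finite_measure set T2 -> \bar R})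
    (h : T1 * T2 -> R) : measurable_fun setT h -> (forall z, 0 <= h z) ->
  (\int[(m1 \x m2)%E]_z (h z)%:E = \int[m1]_x \int[m2]_y (h (x, y))%:E)%E /\
  (\int[(m1 \x m2)%E]_z (h z)%:E = \int[m2]_y \int[m1]_x (h (x, y))%:E)%E.
Proof.
move=> /measurable_EFinP mh h0.
have h0' z : (0 <= (EFin \o h) z)%E by rewrite lee_fin.
by split; [rewrite (@fubini_tonelli1 _ _ _ _ _ m1 m2 _ mh h0')|rewrite (@fubini_tonelli2 _ _ _ _ _ m1 m2 _ mh h0')].
Qed.

Section ProductMeasure.
Context {d1 d2} {T1 : measurableType d1} {T2 : measurableType d2} {R : realType}.
Variables (mu1 : {sigma_finite_measure set T1 -> \bar R}) (mu2 : {sigma_finite_measure set T2 -> \bar R}).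

Let product_sigma_finite_subproof : sigma_finite setT (mu1 \x mu2)%E.
Proof.
have /sigma_finiteP[F [TF ndF Foo]] := sigma_finiteT mu1.
have /sigma_finiteP[G [TG ndG Goo]] := sigma_finiteT mu2.
exists (fun i => F i `*` G i).
  apply/esym/seteqP; split => // -[x y] _.
  have [i _ Fi] : (\bigcup_i F i) x by rewrite -TF.
  have [k _ Gk] : (\bigcup_i G i) y by rewrite -TG.
  exists (maxn i k) => //; split => /=.
    by move: Fi; exact/subsetPset/ndF/leq_maxl.
  by move: Gk; exact/subsetPset/ndG/leq_maxr.
move=> i; have [mFi Fi] := Foo i; have [mGi Gi] := Goo i; split; first exact: measurableX.
by rewrite product_measure1E// lte_mul_pinfty// ge0_fin_numE.
Qed.

Let product_sigma_finite_mixin := Measure_isSigmaFinite.Build _ _ _ (mu1 \x mu2)%E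
  product_sigma_finite_subproof.

(** Makes a product measure available as a factor of a further product: pairs of frequencies are
    integrated by Tonelli's theorem, which asks for sigma-finite factors. *)
Definition product_sigma_finite : {sigma_finite_measure set (T1 * T2)%type -> \bar R} :=
  HB.pack (mu1 \x mu2)%E product_sigma_finite_mixin.

End ProductMeasure.

Section Product.
Context {d1 d2 e1 e2} {T1 : measurableType d1} {S1 : measurableType e1}
  {T2 : measurableType d2} {S2 : measurableType e2} {R : realType}.
Variables (mu1 : {sigma_finite_measure set T1 -> \bar R}) (nu1 : {sigma_finite_measure set S1 -> \bar R}).
Variables (mu2 : {sigma_finite_measure set T2 -> \bar R}) (nu2 : {sigma_finite_measure set S2 -> \bar R}).
Variables (E1 : T1 -> S1 -> R[i]) (D1 : nat -> set T1) (E2 : T2 -> S2 -> R[i]) (D2 : nat -> set T2).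

Local Notation mu12 := ((mu1 \x mu2)%E : {measure set (T1 * T2)%type -> \bar R}).
Local Notation nu12 := ((nu1 \x nu2)%E : {measure set (S1 * S2)%type -> \bar R}).

Definition tensor_kernel (x : T1 * T2) (y : S1 * S2) := E1 x.1 y.1 * E2 x.2 y.2.

(** The partial transform [F] in the first variable is bounded by [M'] and supported in the second
    box. The isometry is used first in the second variable, for each [y1], and then, after
    exchanging the integrals, in the first variable for each [x2]. *)
Lemma plancherel_kernel_prod : plancherel_kernel mu1 nu1 E1 D1 -> plancherel_kernel mu2 nu2 E2 D2 ->
  plancherel_kernel mu12 nu12 tensor_kernel (fun r => D1 r `*` D2 r).
Proof.
move=> K1 K2; have [D1m mE1 E11 P1] := K1; have [D2m mE2 E21 P2] := K2.
have mE : cmeasurable (fun p : (T1 * T2) * (S1 * S2) => tensor_kernel p.1 p.2).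
  apply: cmeasurableM.
    have m1 : measurable_fun setT (fun p : (T1 * T2) * (S1 * S2) => (p.1.1, p.2.1)).
      apply: measurable_fun_pair; apply: measurableT_comp => //.
    exact: (cmeasurable_comp mE1 m1).
  have m2 : measurable_fun setT (fun p : (T1 * T2) * (S1 * S2) => (p.1.2, p.2.2)).
    apply: measurable_fun_pair; apply: measurableT_comp => //.
  exact: (cmeasurable_comp mE2 m2).
have E1' x y : cmod (tensor_kernel x y) <= 1.
  by rewrite cmodM mulr_ile1 ?cmod_ge0.
split=> // [r|f M r mf fM].
  have [m1 o1] := D1m r; have [m2 o2] := D2m r.
  split; first exact: measurableX.
  by rewrite /= product_measure1E// lte_mul_pinfty// ge0_fin_numE.
have [mD1 D1oo] := D1m r; have [mD2 D2oo] := D2m r.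
have fM' x1 x2 : cmod (f (x1, x2)) <= (`|M| * \1_(D1 r) x1) * (1 * \1_(D2 r) x2).
  rewrite (le_trans (fM _))// mul1r -mulrA (_ : \1_(D1 r) x1 * _ = \1_(D1 r `*` D2 r) (x1, x2)).
    by rewrite ler_wpM2r ?indic_ge0// ler_norm.
  by rewrite !indicE -natrM mulnb in_setX.
pose F (p : S1 * T2) := cintegral mu1 (fun x1 => f (x1, p.2) * E1 x1 p.1).
pose M' := fine (mu1 (D1 r)) * `|M|.
have mF : cmeasurable F.
  have mg : cmeasurable (fun q : (S1 * T2) * T1 => f (q.2, q.1.2) * E1 q.2 q.1.1).
    apply: cmeasurableM.
      apply: (cmeasurable_comp mf); apply: measurable_fun_pair => //.
      exact: measurableT_comp.
    have m1 : measurable_fun setT (fun q : (S1 * T2) * T1 => (q.2, q.1.1)).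
      by apply: measurable_fun_pair => //; exact: measurableT_comp.
    exact: (cmeasurable_comp mE1 m1).
  exact: (cmeasurable_cintegral_section mu1 mg).
have mf2 x2 : cmeasurable (fun x1 => f (x1, x2)) := cmeasurable_pair2 x2 mf.
have fi x2 : cintegrable mu1 (fun x1 => f (x1, x2)).
  apply: (box_cintegrable K1 (M := `|M|) (r := r)) => // x1.
  rewrite (le_trans (fM' _ _))// mul1r ler_piMr ?mulr_ge0 ?indicE//.
  by case: (_ \in _).
have FM y1 x2 : cmod (F (y1, x2)) <= M' * \1_(D2 r) x2.
  have := @cmod_cintegral_bound _ _ _ mu1 (fun x1 => f (x1, x2) * E1 x1 y1)
    (fun x1 => (`|M| * \1_(D2 r) x2) * \1_(D1 r) x1).
  move=> /(_ (kernel_section K1 y1 (mf2 x2)) (integrable_indicZ _ mD1 D1oo)).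
  have -> : \int[mu1]_x1 (`|M| * \1_(D2 r) x2 * \1_(D1 r) x1) = M' * \1_(D2 r) x2.
    rewrite RintegralZl//; last first.
      by have := integrable_indicZ 1 mD1 D1oo; apply: eq_integrable => // x _ /=; rewrite mul1r.
    by rewrite Rintegral_indic// /M' mulrC mulrA.
  apply => x1; rewrite (le_trans (kernel_cmod K1 (fun x1 => f (x1, x2)) _ _))//.
  by rewrite (le_trans (fM' _ _))// mul1r mulrAC.
have tE y1 y2 : transform mu12 tensor_kernel f (y1, y2) =
    transform mu2 E2 (fun x2 => F (y1, x2)) y2.
  have [] := cintegral_fubini (m1 := mu1) (m2 := mu2) (a := fun x => `|M| * \1_(D1 r) x)
    (b := fun x => 1 * \1_(D2 r) x)
    (f := fun p => f p * tensor_kernel p (y1, y2)).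
  - by apply: cmeasurableM => //; exact: (cmeasurable_pair2 (y1, y2) mE).
  - exact: integrable_indicZ.
  - exact: integrable_indicZ.
  - by move=> x1 x2; rewrite (le_trans _ (fM' _ _))// cmodM ler_piMr ?cmod_ge0.
  move=> _ fub; rewrite /transform -fub; apply: eq_cintegral => x2.
  rewrite mulrC -cintegralZ; last exact: (kernel_cintegrable K1 _ (fi x2)).
  by apply: eq_cintegral => x1; rewrite /tensor_kernel/=; ring.
have mtr : cmeasurable (transform mu12 tensor_kernel f).
  pose g (p : (S1 * S2) * (T1 * T2)) := f p.2 * tensor_kernel p.2 p.1.
  have mg : cmeasurable g.
    apply: cmeasurableM; first exact: (cmeasurable_comp mf).
    exact: (cmeasurable_comp mE (@measurable_swap _ _ _ _)).
  exact: (cmeasurable_cintegral_section (product_sigma_finite mu1 mu2) mg).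
rewrite /N2 (tonelli nu1 nu2 (measurable_sqmod mtr) (fun=> sqmod_ge0 _)).1.
transitivity (\int[nu1]_y1 \int[mu2]_x2 (sqmod (F (y1, x2)))%:E)%E.
  apply: eq_integral => y1 _.
  under eq_integral do rewrite tE.
  by apply: (P2 _ M' r) => //; exact: (cmeasurable_pair1 y1 mF).
rewrite -(tonelli nu1 mu2 (measurable_sqmod mF) (fun=> sqmod_ge0 _)).1.
rewrite (tonelli nu1 mu2 (measurable_sqmod mF) (fun=> sqmod_ge0 _)).2.
rewrite (tonelli mu1 mu2 (measurable_sqmod mf) (fun=> sqmod_ge0 _)).2.
apply: eq_integral => x2 _.
have P1' := P1 (fun x1 => f (x1, x2)) `|M| r (mf2 x2).
apply: P1' => x1.
rewrite (le_trans (fM' _ _))// mul1r ler_piMr ?mulr_ge0 ?indicE//.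
by case: (_ \in _).
Qed.

End Product.

Definition tuple_set T n (D : set T) : set (n.-tuple T) := [set x | forall i, D (tnth x i)].
Arguments tuple_set {T} n D.

Section Power.
Context {d1 d2} {T : measurableType d1} {S : measurableType d2} {R : realType}.
Variables (mu : {sigma_finite_measure set T -> \bar R}).

Lemma integral_mpower n (h : n.+1.-tuple T -> R) : measurable_fun setT h -> (forall x, 0 <= h x) ->
  (\int[mpower mu n.+1]_x (h x)%:E = \int[(mu \x mpower mu n)%E]_p (h (tcons p))%:E)%E.
Proof.
move=> mh h0.
rewrite -[RHS](@ge0_integral_pushforward _ _ _ _ R _ (@measurable_tcons _ T n) (mu \x mpower mu n)%E setT (EFin \o h))//.
- exact/measurable_EFinP.
- by move=> x _; rewrite lee_fin.
Qed.

Lemma N2_mpower n (f : n.+1.-tuple T -> R[i]) : cmeasurable f ->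
  N2 (mpower mu n.+1) f = N2 (mu \x mpower mu n)%E (fun p => f (tcons p)).
Proof.
by move=> mf; apply: integral_mpower; [exact: measurable_sqmod|move=> x; exact: sqmod_ge0].
Qed.

Lemma Rintegral_mpower n (h : n.+1.-tuple T -> R) : measurable_fun setT h ->
  (mu \x mpower mu n)%E.-integrable setT (EFin \o (fun p => h (tcons p))) ->
  \int[mpower mu n.+1]_x h x = \int[(mu \x mpower mu n)%E]_p h (tcons p).
Proof.
move=> mh hi; rewrite /Rintegral; congr fine.
apply: (@integral_pushforward _ _ _ _ R _ (@measurable_tcons _ T n) (mu \x mpower mu n)%E setT (EFin \o h)) => //.
exact/measurable_EFinP.
Qed.

Lemma cintegral_mpower n (f : n.+1.-tuple T -> R[i]) : cmeasurable f ->
  cintegrable (mu \x mpower mu n)%E (fun p => f (tcons p)) ->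
  cintegral (mpower mu n.+1) f = cintegral (mu \x mpower mu n)%E (fun p => f (tcons p)).
Proof. by move=> [m1 m2] [i1 i2]; congr Complex; exact: Rintegral_mpower. Qed.

Lemma integral_mpower0 (h : 0.-tuple T -> \bar R) : measurable_fun setT h ->
  (\int[mpower mu 0]_x h x = h [tuple])%E.
Proof. by move=> mh; rewrite /= integral_dirac// diracE in_setT mul1e. Qed.

Lemma cintegral_mpower0 (f : 0.-tuple T -> R[i]) : cmeasurable f ->
  cintegral (mpower mu 0) f = f [tuple].
Proof.
move=> [m1 m2]; rewrite /cintegral/Rintegral !integral_mpower0; [|exact/measurable_EFinP..].
by rewrite /=; case: (f _).
Qed.

Lemma N2_mpower0 (f : 0.-tuple T -> R[i]) : cmeasurable f -> N2 (mpower mu 0) f = (sqmod (f [tuple]))%:E.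
Proof. by move=> mf; apply: integral_mpower0; exact: measurable_sqmodE. Qed.

Lemma measurable_tuple_set n (D : set T) : measurable D -> measurable (tuple_set n D).
Proof.
move=> mD; have -> : tuple_set n D = \bigcap_(i in [set: 'I_n]) ((fun x => tnth x i) @^-1` D).
  by apply/seteqP; split => x h; [move=> i _; exact: h|move=> i; exact: h].
apply: fin_bigcap_measurable => // i _.
by rewrite -[X in measurable X]setTI; exact: measurable_tnth.
Qed.

Lemma tuple_set_tcons (D : set T) n p : tuple_set n.+1 D (@tcons _ T n p) <-> D p.1 /\ tuple_set n D p.2.
Proof.
split=> [h|[h1 h2] i].
  split=> [|i]; first by have := h ord0; rewrite tnth0.
  by have := h (lift ord0 i); rewrite tnthS.
by case: (unliftP ord0 i) => [j ->|->]; rewrite ?tnth0 ?tnthS.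
Qed.

End Power.

Section PowerKernel.
Context {d1 d2} {T : measurableType d1} {S : measurableType d2} {R : realType}.
Variables (mu : {sigma_finite_measure set T -> \bar R}) (nu : {sigma_finite_measure set S -> \bar R}).
Variables (E : T -> S -> R[i]) (D : nat -> set T).

Definition power_kernel n (x : n.-tuple T) (y : n.-tuple S) := \prod_(i < n) E (tnth x i) (tnth y i).

Lemma power_kernel_tcons n p q : power_kernel (@tcons _ T n p) (@tcons _ S n q) =
  tensor_kernel E (@power_kernel n) p q.
Proof.
rewrite /power_kernel big_ord_recl !tnth0; congr (_ * _).
by apply: eq_bigr => i _; rewrite !tnthS.
Qed.

Lemma plancherel_kernel_power n : plancherel_kernel mu nu E D ->
  plancherel_kernel (mpower mu n) (mpower nu n) (@power_kernel n) (fun r => tuple_set n (D r)).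
Proof.
move=> K; have [mD mE E1 _] := K.
have mEn k : cmeasurable (fun p : k.-tuple T * k.-tuple S => power_kernel p.1 p.2).
  apply: cmeasurable_prod => i.
  have m1 : measurable_fun setT (fun p : k.-tuple T * k.-tuple S => (tnth p.1 i, tnth p.2 i)).
    by apply: measurable_fun_pair; [exact: (measurableT_comp (measurable_tnth i) measurable_fst)|exact: (measurableT_comp (measurable_tnth i) measurable_snd)].
  exact: (cmeasurable_comp mE m1).
have En1 k (x : k.-tuple T) (y : k.-tuple S) : cmod (power_kernel x y) <= 1.
  rewrite /power_kernel; elim/big_ind : _ => [|a b a1 b1|i _]; last exact: E1.
    by rewrite /cmod sqmod1 sqrtr1.
  by rewrite cmodM mulr_ile1 ?cmod_ge0.
elim: n => [|n IH].
  apply: And4 => [r|||f M r mf fM]; [|exact: mEn|exact: En1|].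
    split; first by have [mDr _] := mD r; exact: measurable_tuple_set.
    by rewrite /= diracE ltry.
  rewrite !N2_mpower0//; last first.
    apply: (cmeasurable_cintegral_section (mpower mu 0) (f := fun p => f p.2 * power_kernel p.2 p.1)).
    apply: cmeasurableM; first exact: (cmeasurable_comp mf).
    exact: (cmeasurable_comp (mEn 0) (@measurable_swap _ _ _ _)).
  rewrite /transform cintegral_mpower0; last first.
    by apply: cmeasurableM => //; exact: (cmeasurable_pair2 _ (mEn 0)).
  by rewrite /power_kernel big_ord0 mulr1.
have KP := plancherel_kernel_prod K IH; have [mDP _ _ PP] := KP.
apply: And4 => [r|||f M r mf fM]; [|exact: mEn|exact: En1|].
  split; first by have [mDr _] := mD r; exact: measurable_tuple_set.
  rewrite /= /mcons /pushforward (_ : _ @^-1` _ = D r `*` tuple_set n (D r)).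
    by have [] := mDP r.
  by apply/seteqP; split => p; [move/tuple_set_tcons|move=> h; exact/tuple_set_tcons].
have mg : cmeasurable (fun p : T * n.-tuple T => f (tcons p)).
  exact: (cmeasurable_comp mf (@measurable_tcons _ T n)).
have gM p : cmod (f (tcons p)) <= M * \1_(D r `*` tuple_set n (D r)) p.
  rewrite (le_trans (fM _))// (_ : \1_(tuple_set n.+1 (D r)) (tcons p) = \1_(D r `*` tuple_set n (D r)) p :> R)//.
  rewrite !indicE (_ : (tcons p \in tuple_set n.+1 (D r)) = (p \in D r `*` tuple_set n (D r)))//.
  by apply/idP/idP => /set_mem h; apply/mem_set; apply/tuple_set_tcons.
rewrite [RHS]N2_mpower// -(PP _ _ _ mg gM) N2_mpower; last first.
  apply: (cmeasurable_cintegral_section (mpower mu n.+1) (f := fun p => f p.2 * power_kernel p.2 p.1)).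
  apply: cmeasurableM; first exact: (cmeasurable_comp mf).
  exact: (cmeasurable_comp (mEn n.+1) (@measurable_swap _ _ _ _)).
congr N2; apply/funext => q; rewrite /transform.
have E' p : f (tcons p) * power_kernel (tcons p) (tcons q) = f (tcons p) * tensor_kernel E (@power_kernel n) p q.
  by rewrite power_kernel_tcons.
rewrite cintegral_mpower.
- by apply: eq_cintegral => p; rewrite E'.
- by apply: cmeasurableM => //; exact: (cmeasurable_pair2 _ (mEn n.+1)).
have := kernel_cintegrable KP q (box_cintegrable KP mg gM).
by congr cintegrable; apply/funext => p; rewrite E'.
Qed.

End PowerKernel.

(** * The kernels of the line, the circle and the integers *)

Section BaseKernels.
Context {R : realType}.
Local Notation lam := (@lebesgue_measure R).
Local Notation circ := (@circle_measure R).
Local Notation cnt := (@counting_int R).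

Definition line_box (r : nat) : set (measurableTypeR R) := [set x | `|x| <= r%:R].
Definition int_box (r : nat) : set int := [set k | (absz k <= r)%N].

Let mline r : measurable (line_box r).
Proof.
have -> : line_box r = `[- r%:R, r%:R]%classic.
  by apply/seteqP; split => x; rewrite /line_box /mkset/= in_itv/= ler_norml.
exact: measurable_itv.
Qed.

Let line_finite r : (lam (line_box r) < +oo)%E.
Proof.
have -> : line_box r = `[- r%:R, r%:R]%classic.
  by apply/seteqP; split => x; rewrite /line_box /mkset/= in_itv/= ler_norml.
by rewrite lebesgue_measure_itv/=; case: ifP; rewrite ?ltry.
Qed.

Let mphase_line : measurable_fun setT (fun p : measurableTypeR R * measurableTypeR R => p.1 * p.2).
Proof. exact: measurable_funM. Qed.

Lemma line_kernelN : plancherel_kernel lam lam (fun x y : measurableTypeR R => cis (- (x * y))) line_box.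
Proof.
apply: And4 => [r|||f M r mf fM].
- by split; [exact: mline|exact: line_finite].
- by apply: cmeasurable_cis; exact: measurableT_comp.
- by move=> x y; rewrite cmod_cis.
- exact: (plancherel_line mf fM).
Qed.

(** Conjugating [f] exchanges the two signs of the exponent, so this follows from [line_kernelN]. *)
Lemma line_kernel : plancherel_kernel lam lam (fun x y : measurableTypeR R => cis (x * y)) line_box.
Proof.
have [_ _ _ P] := line_kernelN.
apply: And4 => [r|||f M r mf fM].
- by split; [exact: mline|exact: line_finite].
- by apply: cmeasurable_cis; exact: mphase_line.
- by move=> x y; rewrite cmod_cis.
have mf' := cmeasurable_conj mf.
have fM' x : cmod (f x)^* <= M * \1_(line_box r) x by rewrite cmod_conj.
transitivity (N2 lam (fun x => (f x)^*)); last by apply: eq_N2 => x; rewrite sqmod_conj.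
rewrite -(P _ _ _ mf' fM'); apply: eq_N2 => y; rewrite -sqmod_conj; congr sqmod.
rewrite /transform -cintegral_conj.
  by apply: eq_cintegral => x; rewrite rmorphM/= cis_conj.
have := kernel_cintegrable line_kernelN y (box_cintegrable line_kernelN mf' fM').
move=> /cintegrable_conj; congr cintegrable; apply/funext => x.
by rewrite rmorphM/= conjCK cis_conj opprK.
Qed.

Let mint : measurable_fun setT (fun k : int => k%:~R : R). Proof. by []. Qed.

Lemma circle_kernel : plancherel_kernel circ cnt
  (fun (x : measurableTypeR R) (k : int) => cis (- (x * k%:~R))) (fun=> setT).
Proof.
have circT : circ setT = (1 - 0)%:E := @interval_measure_lt R 0 1 ltr01.
apply: And4 => [r|||f M r mf fM].
- by split=> //; rewrite [X in (X < _)%E]circT ltry.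
- apply: cmeasurable_cis; apply: measurableT_comp => //; apply: measurable_funM => //.
  exact: (measurableT_comp mint).
- by move=> x y; rewrite cmod_cis.
have fi : square_integrable (interval_measure 0 1) f.
  by apply: (@interval_bounded_sqint _ _ _ _ M) => // x; have := fM x; rewrite indicT mulr1.
have := interval_parseval (@ltr01 R) fi; rewrite subr0 invr1.
move=> <-; rewrite /N2 integral_counting_int; last by move=> k; exact: sqmod_ge0.
 apply: eq_eseriesr => j _; rewrite mul1r; congr ((sqmod _)%:E).
by apply: eq_cintegral => x; rewrite mulr1 [x * _]mulrC.
Qed.

Lemma cintegral_counting_delta (f : int -> R[i]) (k : int) :
  cintegral cnt (fun j => f j * (j == k)%:R) = f k.
Proof.
have fin1 : finite_set [set k] by exact: finite_set1.
have c1 : cnt [set k] = 1%E by rewrite /counting_int /counting asboolT// fset_set1 finmap.cardfs1.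
have E (h : int -> R) : \int[cnt]_j (h j * (j == k)%:R) = h k.
  transitivity (\int[cnt]_(j in [set k]) h j).
    rewrite [RHS]Rintegral_mkcond; congr Rintegral; apply/funext => j; rewrite patchE.
    case: ifPn => [/set_mem/= ->|]; first by rewrite eqxx mulr1.
    by move=> jk; case: eqP jk => [->|]; rewrite ?mulr0// mem_set.
  transitivity (\int[cnt]_(j in [set k]) cst (h k) j).
    by apply: eq_Rintegral => j /set_mem/= ->.
  by rewrite Rintegral_cst// /= c1 mulr1.
apply: complex_ext; [rewrite -(E (fun j => Re (f j)))|rewrite -(E (fun j => Im (f j)))];
  rewrite /cintegral/=; congr Rintegral; apply/funext => j;
  by case: eqP => _ /=; rewrite ?mulr1 ?mulr0.
Qed.

(** The transform of a function on a finite box is a bounded trigonometric polynomial [p]. By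
    orthogonality its Fourier coefficients are the values of [f], so the isometry of [circle_kernel]
    applied to [p] is the one wanted. *)
Lemma int_kernel : plancherel_kernel cnt circ
  (fun (k : int) (x : measurableTypeR R) => cis (k%:~R * x)) int_box.
Proof.
have mE : cmeasurable (fun p : int * measurableTypeR R => cis (p.1%:~R * p.2)).
  by apply: cmeasurable_cis; apply: measurable_funM => //; exact: (measurableT_comp mint).
have box r : measurable (int_box r) /\ (cnt (int_box r) < +oo)%E.
  split=> //; rewrite /counting_int /counting asboolT ?ltry//.
  apply: (@sub_finite_set _ _ (int_enum @` `I_(r.*2.+2))).
    move=> k kr; exists (int_index k); last exact: int_indexK.
    by move: kr; rewrite /int_box /mkset/=; case: k => k /=; lia.
  exact: finite_image.
have E1 x y : cmod (cis (x%:~R * y : R)) <= 1 by rewrite cmod_cis.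
apply: And4 => // f M r mf fM.
have [mb fb] := box r.
pose p := transform cnt (fun (k : int) (x : measurableTypeR R) => cis (k%:~R * x)) f.
pose M' := \int[cnt]_j (M * \1_(int_box r) j).
have iM := integrable_indicZ M mb fb.
have mp : cmeasurable p.
  have mg : cmeasurable (fun q : measurableTypeR R * int => f q.2 * cis (q.2%:~R * q.1)).
    apply: cmeasurableM; first exact: (cmeasurable_comp mf).
    exact: (cmeasurable_comp mE (@measurable_swap _ _ _ _)).
  exact: (cmeasurable_cintegral_section cnt mg).
have mfs x : cmeasurable (fun j => f j * cis (j%:~R * x : R)).
  by apply: cmeasurableM => //; exact: (cmeasurable_pair2 x mE).
have pM x : cmod (p x) <= M' * \1_(@setT (measurableTypeR R)) x.
  rewrite indicT mulr1; apply: (cmod_cintegral_bound (mfs x) iM) => j.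
  by rewrite cmodM cmod_cis mulr1.
have [_ _ _ P] := circle_kernel.
rewrite -[LHS](P _ _ 0%N mp pM); apply: eq_N2 => k; congr sqmod.
rewrite /transform -[RHS](cintegral_counting_delta f k).
have [] := cintegral_fubini (m1 := cnt) (m2 := circ) (a := fun j => M * \1_(int_box r) j)
  (b := fun x => 1 * \1_setT x) (f := fun q => f q.1 * cis (q.1%:~R * q.2) * cis (- (q.2 * k%:~R))).
- apply: cmeasurableM; first by apply: cmeasurableM => //; exact: (cmeasurable_comp mf).
  apply: cmeasurable_cis; apply: measurableT_comp => //; exact: measurable_funM.
- exact: iM.
- by apply: integrable_indicZ => //; have [/(_ 0%N)[]] := circle_kernel.
- by move=> j x; rewrite mul1r /= !cmodM !cmod_cis !mulr1 indicT mulr1.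
move=> e1 e2; rewrite -e1 in e2.
transitivity (cintegral circ (fun x : measurableTypeR R =>
    cintegral cnt (fun j => f j * cis (j%:~R * x) * cis (- (x * k%:~R))))).
  apply: eq_cintegral => x; rewrite mulrC -cintegralZ.
    by apply: eq_cintegral => j; rewrite mulrC.
  by apply: (cintegrable_le (mfs x) iM) => j; rewrite cmodM cmod_cis mulr1.
rewrite e2; apply: eq_cintegral => j /=.
have := @cintegral_cis_period R 0 1 ltr01 (j - k); rewrite subr0.
have -> : (fun x : measurableTypeR R => cis ((j - k)%:~R / 1 * x)) =
    (fun x => cis (j%:~R * x) * cis (- (x * k%:~R))).
  by apply/funext => x; rewrite -cisD; congr cis; rewrite divr1 intrB; ring.
rewrite subr_eq0 => e; under [LHS]eq_cintegral do rewrite -mulrA.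
rewrite cintegralZ; last first.
  apply: (@interval_cintegrable_bounded R 0 1 _ 1).
    apply: cmeasurableM; first exact: (cmeasurable_pair1 _ mE).
    by apply: cmeasurable_cis; apply: measurableT_comp => //; exact: measurable_funM.
  by move=> x; rewrite cmodM !cmod_cis mulr1.
by congr (_ * _); rewrite [LHS]e; case: eqP.
Qed.

End BaseKernels.

(** * Extension to square integrable functions *)

Section MeanConvergence.
Context {d} {T : measurableType d} {R : realType}.
Variable mu : {measure set T -> \bar R}.
Implicit Types (f g : T -> R[i]) (F : nat -> T -> R[i]).

(** Mean-square convergence to 0 stated for functions rather than for classes in [L2], because
    values at points matter later; [hcvg_mean] translates between the two. *)
Definition mean_null F : Prop :=
  forall e : R, 0 < e -> exists N, forall k, (N <= k)%N -> (N2 mu (F k) <= e%:E)%E.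

Lemma mean_nullP F : mean_null F <-> N2 mu (F k) @[k --> \oo] --> 0%E.
Proof.
split=> [h|/fine_cvgP[fin /cvgnP h] e e0]; last first.
  have [N1 hN1] := h e e0; have [N2' _ hN2] := fin.
  exists (maxn N1 N2') => k; rewrite geq_max => /andP[k1 k2].
  have := hN1 k k1; have := hN2 k k2 => /= fk.
  rewrite subr0 ger0_norm ?fine_ge0 ?N2_ge0// => /ltW.
  by rewrite -lee_fin fineK.
apply/fine_cvgP; split.
  have [N hN] := h 1 ltr01; exists N => // k /= Nk.
  by rewrite ge0_fin_numE ?N2_ge0// (le_lt_trans (hN k Nk))// ltry.
apply/cvgnP => e e0; have e20 : 0 < e / 2 by rewrite divr_gt0.
have [N hN] := h _ e20.
exists N => k Nk; rewrite /= subr0 ger0_norm ?fine_ge0 ?N2_ge0//.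
have := hN k Nk => h'; rewrite (@le_lt_trans _ _ (e / 2))//; last by rewrite ltr_pdivrMr// ltr_pMr// ltr1n.
by rewrite -lee_fin fineK// ge0_fin_numE ?N2_ge0// (le_lt_trans h')// ltry.
Qed.

Lemma hcvg_mean F f : (forall k, square_integrable mu (F k)) -> square_integrable mu f ->
  hcvg (fun k => L2of mu (F k)) (L2of mu f) <-> mean_null (fun k x => F k x - f x).
Proof.
move=> Fi fi; have E k : (nsq (L2of mu (F k) - L2of mu f))%:E = N2 mu (fun x => F k x - f x).
  rewrite nsqB_N2; apply: N2_ae.
  - by apply: cmeasurableB; exact: sqfun_cmeasurable.
  - by apply: cmeasurableB; [case: (Fi k)|case: fi].
  by apply: filterS2 (L2of_repr (Fi k)) (L2of_repr fi) => x -> ->.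
split=> [/hcvgP/cvgnP h e e0|h].
  have [N hN] := h e e0; exists N => k Nk; rewrite -E lee_fin.
  by have := hN k Nk; rewrite subr0 ger0_norm ?nsq_ge0// => /ltW.
apply/hcvgP/cvgnP => e e0; have e20 : 0 < e / 2 by rewrite divr_gt0.
have [N hN] := h _ e20; exists N => k Nk; rewrite subr0 ger0_norm ?nsq_ge0//.
have := hN k Nk; rewrite -E lee_fin => /le_lt_trans; apply.
by rewrite ltr_pdivrMr// ltr_pMr// ltr1n.
Qed.

Lemma mean_null_unique F f g : (forall k, cmeasurable (F k)) -> cmeasurable f -> cmeasurable g ->
  mean_null (fun k x => F k x - f x) -> mean_null (fun k x => F k x - g x) ->
  {ae mu, forall x, f x = g x}.
Proof.
move=> mF mf mg h1 h2.
have : N2 mu (fun x => f x - g x) = 0%E.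
  apply/eqP; rewrite eq_le N2_ge0 andbT; apply/lee_addgt0Pr => e e0; rewrite add0e.
  have e40 : 0 < e / 4 by rewrite divr_gt0.
  have [N1 hN1] := h1 _ e40; have [N3 hN3] := h2 _ e40; pose k := maxn N1 N3.
  have := @N2B_le _ _ _ mu _ _ (cmeasurableB (mF k) mg) (cmeasurableB (mF k) mf).
  rewrite (_ : (fun x => _) = (fun x => f x - g x)); last by apply/funext => x; ring.
  move=> /le_trans; apply; rewrite (_ : e = 2 * (e / 4 + e / 4)); last by field.
  rewrite [X in (_ <= X)%E]EFinM [X in (_ <= _ * X)%E]EFinD lee_pmul2l//.
  by apply: leeD; [apply: hN3; rewrite leq_maxr|apply: hN1; rewrite leq_maxl].
move=> n0; have mfg := cmeasurableB mf mg.
have /ae_eq_integral_abs : measurable_fun setT (fun x => (sqmod (f x - g x))%:E) by exact: measurable_sqmodE.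
move=> /(_ mu measurableT)[+ _].
under eq_integral do rewrite gee0_abs ?lee_fin ?sqmod_ge0//.
by move=> /(_ n0); apply: filterS => x /(_ Logic.I)/= [] /sqmod_eq0/subr0_eq.
Qed.

Lemma mean_dominated F (g : T -> R) : (forall k, cmeasurable (F k)) ->
  mu.-integrable setT (EFin \o g) -> (forall k x, sqmod (F k x) <= g x) ->
  {ae mu, forall x, sqmod (F k x) @[k --> \oo] --> (0 : R)} -> mean_null F.
Proof.
move=> mF gi Fg F0; apply/mean_nullP.
have Fi k : mu.-integrable setT (EFin \o (fun x => sqmod (F k x))).
  apply: (integrable_dominated _ gi); first exact: measurable_sqmod.
  by move=> x; rewrite ger0_norm ?sqmod_ge0.
have mF' k : cmeasurable (fun x => (sqmod (F k x))%:C) by exact/cmeasurable_real/measurable_sqmod.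
have FG k x : cmod (sqmod (F k x))%:C <= g x by rewrite cmod_real ger0_norm ?sqmod_ge0.
have ae0 : {ae mu, forall x, sqmod ((sqmod (F k x))%:C - 0) @[k --> \oo] --> (0 : R)}.
  apply: filterS F0 => x Fx; have := cvgM Fx Fx; rewrite mulr0 => h.
  by under eq_fun do rewrite subr0 sqmod_real expr2; exact: h.
have := cintegral_dominated mF' (cmeasurable_cst 0) gi FG ae0.
rewrite [cintegral mu (cst 0)](cintegral0 mu) => /sqmod_cvg0[+ _]; rewrite /cintegral/= => h.
have -> : (fun k => N2 mu (F k)) = EFin \o (fun k => \int[mu]_x sqmod (F k x)).
  by apply/funext => k; rewrite /= Rintegral_EFin.
by apply/fine_cvgP; split; [near=> k|exact: h].
Unshelve. all: by end_near. Qed.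

Definition ctrunc (A : set T) f x : R[i] := (\1_A x)%:C * f x.

Lemma cutE A f x : ctrunc A f x = if x \in A then f x else 0.
Proof. by rewrite /ctrunc indicE; case: ifP => _; rewrite ?mul1r ?mul0r. Qed.

Lemma cmeasurable_cut A f : measurable A -> cmeasurable f -> cmeasurable (ctrunc A f).
Proof.
by move=> mA mf; apply: cmeasurableM => //; apply: cmeasurable_real; exact: measurable_indic.
Qed.

Lemma sqmod_cut_le A f x : sqmod (ctrunc A f x) <= sqmod (f x).
Proof. by rewrite cutE; case: ifP => // _; rewrite sqmod0 sqmod_ge0. Qed.

Lemma cmod_cut_le A f x : cmod (ctrunc A f x) <= cmod (f x).
Proof. by rewrite cutE; case: ifP => // _; rewrite cmod0 cmod_ge0. Qed.

Lemma sqint_cut A f : measurable A -> square_integrable mu f -> square_integrable mu (ctrunc A f).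
Proof.
move=> mA fi; have [mf _] := fi.
exact: (square_integrable_le (cmeasurable_cut mA mf) fi (sqmod_cut_le A f)).
Qed.

Lemma cintegrable_cut A f : measurable A -> cintegrable mu f -> cintegrable mu (ctrunc A f).
Proof.
move=> mA fi; apply: (cintegrable_le _ (cintegrable_cmod fi)) => [|x]; last exact: cmod_cut_le.
exact/cmeasurable_cut/cintegrable_cmeasurable/fi.
Qed.

Lemma sqint_cut_cintegrable A f : measurable A -> (mu A < +oo)%E -> square_integrable mu f ->
  cintegrable mu (ctrunc A f).
Proof.
move=> mA Aoo fi; have [mf _] := fi.
apply: (cintegrable_le (g := fun x => 1 * \1_A x + sqmod (f x))); first exact: cmeasurable_cut.
  exact: (integrableD measurableT (integrable_indicZ 1 mA Aoo) (square_integrable_int fi)).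
move=> x; rewrite cutE mul1r indicE; case: ifP => _; last by rewrite cmod0 add0r sqmod_ge0.
by have := cmodM_le (f x) 1; rewrite sqmod1 /cmod sqmod1 sqrtr1 mulr1 addrC.
Qed.

Lemma cut_mean (A : nat -> set T) f : (forall k, measurable (A k)) -> square_integrable mu f ->
  (forall x, exists N, forall k, (N <= k)%N -> A k x) ->
  mean_null (fun k x => ctrunc (A k) f x - f x).
Proof.
move=> mA fi cov; have [mf _] := fi.
apply: (mean_dominated (g := fun x => sqmod (f x))).
- by move=> k; apply: cmeasurableB => //; exact: cmeasurable_cut.
- exact: square_integrable_int.
- by move=> k x; rewrite cutE; case: ifP => _; rewrite ?subrr ?sqmod0 ?sqmod_ge0// sub0r sqmodN.
apply: aeW => x; apply/cvgnP => e e0; have [N hN] := cov x.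
by exists N => k Nk; rewrite cutE mem_set ?subrr ?sqmod0 ?subrr ?normr0//; exact: hN.
Qed.

End MeanConvergence.

Section Extension.
Context {d1 d2} {T : measurableType d1} {S : measurableType d2} {R : realType}.
Variables (mu : {sigma_finite_measure set T -> \bar R}) (nu : {measure set S -> \bar R}).
Variables (E : T -> S -> R[i]) (D : nat -> set T).
Hypothesis K : plancherel_kernel mu nu E D.
Hypothesis Dmono : forall i j, (i <= j)%N -> D i `<=` D j.
Hypothesis Dcov : forall x, exists r, D r x.

Lemma transformB f g : cintegrable mu f -> cintegrable mu g ->
  forall y, transform mu E (fun x => f x - g x) y = transform mu E f y - transform mu E g y.
Proof.
move=> fi gi y; rewrite /transform -cintegralB; [|exact: (kernel_cintegrable K)..].
by apply: eq_cintegral => x; rewrite mulrBl.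
Qed.

(** The truncations and their differences are bounded and supported in boxes, so their transforms
    are isometric and form a Cauchy sequence. They converge pointwise to the transform of [f], since
    [f] is integrable, and Fatou's lemma makes this a convergence in mean. *)
Lemma plancherel_extension f : cintegrable mu f -> square_integrable mu f ->
  N2 nu (transform mu E f) = N2 mu f.
Proof.
move=> fi f2; have [mf _] := f2; have [Dm _ E1 P] := K.
(* The truncation limits both the domain and the size of [f], as the isometry of the kernel asks for
   bounded functions on boxes. *)
pose A r : set T := D r `&` [set x | cmod (f x) <= r%:R].
have mA r : measurable (A r).
  apply: measurableI; first by have [] := Dm r.
  have := measurable_cmod mf measurableT (measurable_itv `]-oo, r%:R]).
  by rewrite setTI; congr measurable; apply/seteqP; split => x; rewrite /preimage/= in_itv.
have Amono i j : (i <= j)%N -> A i `<=` A j.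
  move=> ij x [Dx fx]; split; first exact: (Dmono ij).
  by apply: (le_trans fx); rewrite ler_nat.
have cov x : exists N, forall k, (N <= k)%N -> A k x.
  have [r Dr] := Dcov x; exists (maxn r (Num.bound (cmod (f x)))) => k kN.
  apply: (Amono _ _ kN); split; first exact: (Dmono (leq_maxl _ _)).
  rewrite /= (le_trans (ltW (archi_boundP (cmod_ge0 _))))// ler_nat leq_maxr//.
have cl := cut_mean mA f2 cov.
pose F r := ctrunc (A r) f; pose G r := transform mu E (F r); pose g := transform mu E f.
have Fi r : cintegrable mu (F r) := cintegrable_cut (mA r) fi.
have F2 r : square_integrable mu (F r) := sqint_cut (mA r) f2.
have FD r x : cmod (F r x) <= r%:R * \1_(D r) x.
  rewrite /F cutE; case: ifPn => [/set_mem[Dx fx]|_].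
    by rewrite indicE mem_set// mulr1.
  by rewrite cmod0 mulr_ge0// indic_ge0.
have FB i j x : (i <= j)%N -> sqmod (F j x - F i x) <= sqmod (F i x - f x).
  move=> ij; rewrite /F !cutE; case: ifPn => [/set_mem Aj|]; case: ifPn => [/set_mem Ai|].
  - exact: lexx.
  - by rewrite subr0 sub0r sqmodN.
  - by move=> /negP[]; apply/mem_set/(Amono _ _ ij).
  - by rewrite subrr sqmod0 sqmod_ge0.
have FBD i j x : (i <= j)%N -> cmod (F j x - F i x) <= (j%:R + i%:R) * \1_(D j) x.
  move=> ij; apply: (le_trans (cmodD _ _)); rewrite cmodN mulrDl lerD//.
  apply: (le_trans (FD _ _)); rewrite ler_wpM2l// !indicE; case: (boolP (_ \in D i)) => [/set_mem Di|_//].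
  by rewrite mem_set//; exact: (Dmono ij).
have mG r : cmeasurable (G r) := cmeasurable_transform K (F2 r).1.
have mg : cmeasurable g := cmeasurable_transform K mf.
have GB i j : (i <= j)%N -> (N2 nu (fun y => G j y - G i y)%R <= N2 mu (fun x => F i x - f x)%R)%E.
  move=> ij; have mFB := cmeasurableB (F2 j).1 (F2 i).1.
  have -> : (fun y => G j y - G i y) = transform mu E (fun x => F j x - F i x).
    by apply/funext => y; rewrite transformB.
  rewrite (P _ _ _ mFB (fun x => FBD i j x ij)); apply: N2_le => //.
    exact: cmeasurableB (F2 i).1 mf.
  by move=> x; exact: FB.
have Gg y : sqmod (G k y - g y) @[k --> \oo] --> (0 : R).
  apply: (cintegral_dominated (g := fun x => cmod (f x))).
  - by move=> k; exact: (kernel_section K y (F2 k).1).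
  - exact: (kernel_section K y mf).
  - exact: cintegrable_cmod.
  - by move=> k x; apply: (le_trans (kernel_cmod K _ _ _)); exact: cmod_cut_le.
  apply: aeW => x; apply/cvgnP => e e0; have [N hN] := cov x; exists N => k Nk.
  by rewrite /F cutE mem_set ?subrr ?sqmod0 ?subrr ?normr0//; exact: hN.
have gG : mean_null nu (fun k y => G k y - g y).
  move=> e e0; have [N hN] := cl e e0; exists N => k Nk.
  apply: (@fatou_le _ _ _ nu (fun j y => sqmod (G (k + j)%N y - G k y))).
  - by move=> j; apply: measurable_sqmod; exact: cmeasurableB.
  - by apply: measurable_sqmod; exact: cmeasurableB.
  - by move=> j y; exact: sqmod_ge0.
  - by move=> y; exact: sqmod_ge0.
  - apply: aeW => y; rewrite sqmodBC; apply: sqmodB_cvg.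
    have := Gg y; rewrite -(cvg_shiftn k) => h; apply: cvg_trans h; apply: near_eq_cvg.
    by near=> j; rewrite addnC.
  - by move=> j; rewrite (le_trans (GB k (k + j)%N (leq_addr _ _)))// hN.
have G2 r : square_integrable nu (G r).
  by split => //; have := P _ _ _ (F2 r).1 (FD r); rewrite /N2 => ->; case: (F2 r).
have g2 : square_integrable nu g.
  split=> //; have [N hN] := gG 1 ltr01.
  have := @N2B_le _ _ _ nu _ _ (mG N) (cmeasurableB (mG N) mg).
  rewrite (_ : (fun x => _) = g); last by apply/funext => x; ring.
  move=> /le_lt_trans; apply; apply: lte_mul_pinfty => //.
  apply: lte_add_pinfty; first by case: (G2 N).
  by rewrite (le_lt_trans (hN N (leqnn _)))// ltry.
have c1 := hcvg_nsq ((hcvg_mean (fun k => F2 k) f2).2 cl).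
have c2 := hcvg_nsq ((hcvg_mean G2 g2).2 gG).
have E12 k : nsq (L2of nu (G k)) = nsq (L2of mu (F k)).
  apply: EFin_inj; rewrite (nsq_L2of (G2 k)) (nsq_L2of (F2 k)); exact: (P _ _ _ (F2 k).1 (FD k)).
rewrite -(nsq_L2of g2) -(nsq_L2of f2); congr EFin.
move: c2; under eq_fun do rewrite E12.
by move=> c2; apply: (cvg_unique _ c2 c1).
Unshelve. all: by end_near. Qed.

End Extension.

(** * The Fourier transform on the product of a Euclidean space and a torus *)

Section Isometry.
Context {R : realType} {H K : prehilbertType R}.
Variable U : H -> K.
Hypotheses (linU : linear U) (isoU : forall u, nsq (U u) = nsq u).

Lemma linear_opD u v : U (u + v) = U u + U v.
Proof. by have := linU 1 u v; rewrite !scale1r. Qed.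

Lemma linear_opB u v : U (u - v) = U u - U v.
Proof. by have := linU (-1) v u; rewrite !scaleN1r ![- _ + _]addrC. Qed.

Lemma linear_op_sum I (r : seq I) (F : I -> H) : U (\sum_(i <- r) F i) = \sum_(i <- r) U (F i).
Proof.
by elim: r => [|i r IH]; rewrite ?big_nil ?linear_op0// !big_cons linear_opD IH.
Qed.

(** Polarization: the squared norm of [u + v] yields the real part, and replacing [v] by [i v]
    yields the imaginary part. *)
Lemma isometry_inner u v : inner (U u) (U v) = inner u v :> R[i].
Proof.
have Re_eq x y : Re (inner (U x) (U y)) = Re (inner x y).
  have := isoU (x + y); rewrite linear_opD !nsqD !isoU => h.
  by have -> : Re (inner (U x) (U y)) = Re (inner x y) by lra.
apply: complex_ext; first exact: Re_eq.
have := Re_eq u ('i *: v); rewrite linear_opZ// !innerZr !ReImE /= !mul0r !mul1r !sub0r.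
by move/oppr_inj.
Qed.

Lemma isometry_hcvg (u : nat -> H) l : hcvg u l -> hcvg (fun k => U (u k)) (U l).
Proof.
move=> /hcvgP h; apply/hcvgP; apply: cvg_trans h; apply: near_eq_cvg; near=> k.
by rewrite -linear_opB isoU.
Unshelve. all: by end_near. Qed.

Lemma isometry_inj u v : U u = U v -> u = v.
Proof.
move=> uv; apply/eqP; rewrite -subr_eq0; apply/eqP/nsq_eq0.
by rewrite -isoU linear_opB uv subrr nsq0.
Qed.

End Isometry.

Lemma mean_limit_sqint d (T : measurableType d) (R : realType) (mu : {measure set T -> \bar R})
    (F : nat -> T -> R[i]) (f : T -> R[i]) : (forall k, square_integrable mu (F k)) -> cmeasurable f ->
  mean_null mu (fun k x => F k x - f x) -> square_integrable mu f.
Proof.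
move=> F2 mf h; split=> //; have [N hN] := h 1 ltr01; have [mF Fi] := F2 N.
have := @N2B_le _ _ _ mu _ _ mF (cmeasurableB mF mf).
rewrite (_ : (fun x => _) = f); last by apply/funext => x; ring.
move=> /le_lt_trans; apply; apply: lte_mul_pinfty => //; apply: lte_add_pinfty => //.
by rewrite (le_lt_trans (hN N (leqnn _)))// ltry.
Qed.

Lemma mean_null_cauchy d (T : measurableType d) (R : realType) (mu : {measure set T -> \bar R})
    (F : nat -> T -> R[i]) (f : T -> R[i]) : (forall k, cmeasurable (F k)) -> cmeasurable f ->
  mean_null mu (fun k x => F k x - f x) ->
  forall e : R, 0 < e -> exists N, forall i j, (N <= i <= j)%N ->
    (N2 mu (fun x => F j x - F i x)%R <= e%:E)%E.
Proof.
move=> mF mf h e e0; have e40 : 0 < e / 4 by rewrite divr_gt0.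
have [N hN] := h _ e40; exists N => i j /andP[Ni ij].
have := @N2B_le _ _ _ mu _ _ (cmeasurableB (mF j) mf) (cmeasurableB (mF i) mf).
rewrite (_ : (fun x => _) = (fun x => F j x - F i x)); last by apply/funext => x; ring.
move=> /le_trans; apply; rewrite (_ : e = 2 * (e / 4 + e / 4)); last by field.
rewrite [X in (_ <= X)%E]EFinM [X in (_ <= _ * X)%E]EFinD lee_pmul2l//.
by apply: leeD; apply: hN => //; exact: leq_trans Ni ij.
Qed.

Lemma cis_sum (R : realType) I (r : seq I) (h : I -> R) :
  cis (\sum_(i <- r) h i) = \prod_(i <- r) cis (h i).
Proof. by elim: r => [|i r IH]; rewrite ?big_nil ?cis0// !big_cons cisD IH. Qed.

Section Spaces.
Variables (R : realType) (n m : nat).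
Local Notation position := (position R n m).
Local Notation frequency := (frequency R n m).
Local Notation muM := (position_measure R n m).
Local Notation muF := (frequency_measure R n m).
Local Notation sobolev := (@sobolev R n m).
Local Notation lam := (@lebesgue_measure R).
Local Notation circ := (@circle_measure R).
Local Notation cnt := (@counting_int R).
Local Notation sM := (product_sigma_finite (mpower lam n) (mpower circ m)).
Local Notation sF := (product_sigma_finite (mpower lam n) (mpower cnt m)).

Definition position_box (r : nat) : set position :=
  tuple_set n (@line_box R r) `*` tuple_set m setT.
Definition frequency_box (r : nat) : set frequency :=
  tuple_set n (@line_box R r) `*` tuple_set m (int_box r).

Lemma position_kernel : plancherel_kernel sM sF (fun z zeta => cis (- phase z zeta)) position_box.
Proof.
have := plancherel_kernel_prod (plancherel_kernel_power n (@line_kernelN R))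
  (plancherel_kernel_power m (@circle_kernel R)).
congr plancherel_kernel; apply/funext => z; apply/funext => zeta.
by rewrite /tensor_kernel /power_kernel -!cis_sum -cisD /phase opprD !sumrN.
Qed.

Lemma frequency_kernel : plancherel_kernel sF sM (fun zeta z => cis (phase z zeta)) frequency_box.
Proof.
have := plancherel_kernel_prod (plancherel_kernel_power n (@line_kernel R))
  (plancherel_kernel_power m (@int_kernel R)).
congr plancherel_kernel; apply/funext => zeta; apply/funext => z.
rewrite /tensor_kernel /power_kernel -!cis_sum -cisD /phase.
by congr (cis (_ + _)); apply: eq_bigr => i _; rewrite mulrC.
Qed.

Lemma line_box_mono i j : (i <= j)%N -> @line_box R i `<=` line_box j.
Proof. by move=> ij x /= /le_trans; apply; rewrite ler_nat. Qed.

Lemma position_box_mono i j : (i <= j)%N -> position_box i `<=` position_box j.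
Proof. by move=> ij z [h _]; split => // k; exact: (line_box_mono ij (h k)). Qed.

Lemma frequency_box_mono i j : (i <= j)%N -> frequency_box i `<=` frequency_box j.
Proof.
move=> ij z [h1 h2]; split => k; first exact: (line_box_mono ij (h1 k)).
exact: leq_trans (h2 k) ij.
Qed.

Lemma tuple_bound N (h : 'I_N -> nat) : exists r, forall i, (h i <= r)%N.
Proof. by exists (\max_i h i)%N => i; exact: leq_bigmax. Qed.

Lemma line_tuple_cover (x : n.-tuple R) : exists r, tuple_set n (@line_box R r) x.
Proof.
have [r hr] := tuple_bound (fun i => Num.bound `|tnth x i|); exists r => i.
by rewrite /line_box /mkset/= (le_trans (ltW (archi_boundP (normr_ge0 _))))// ler_nat.
Qed.

Lemma position_box_cover z : exists r, position_box r z.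
Proof. by have [r hr] := line_tuple_cover z.1; exists r. Qed.

Lemma frequency_box_cover zeta : exists r, frequency_box r zeta.
Proof.
have [r hr] := line_tuple_cover zeta.1; have [q hq] := tuple_bound (fun i => absz (tnth zeta.2 i)).
exists (maxn r q); split => i; first exact: (line_box_mono (leq_maxl r q) (hr i)).
by apply: (leq_trans (hq i)); rewrite leq_maxr.
Qed.

Definition ft : (position -> R[i]) -> frequency -> R[i] :=
  transform sM (fun z zeta => cis (- phase z zeta)).
Definition ift : (frequency -> R[i]) -> position -> R[i] :=
  transform sF (fun zeta z => cis (phase z zeta)).

Lemma plancherel_ft f : cintegrable muM f -> square_integrable muM f -> N2 muF (ft f) = N2 muM f.
Proof. exact: (plancherel_extension position_kernel position_box_mono position_box_cover). Qed.

Lemma plancherel_ift f : cintegrable muF f -> square_integrable muF f -> N2 muM (ift f) = N2 muF f.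
Proof. exact: (plancherel_extension frequency_kernel frequency_box_mono frequency_box_cover). Qed.

Lemma cmeasurable_ft f : cmeasurable f -> cmeasurable (ft f).
Proof. exact: (cmeasurable_transform position_kernel). Qed.

Lemma cmeasurable_ift f : cmeasurable f -> cmeasurable (ift f).
Proof. exact: (cmeasurable_transform frequency_kernel). Qed.

Lemma ftB f g : cintegrable muM f -> cintegrable muM g ->
  ft (fun x => f x - g x) = (fun y => ft f y - ft g y).
Proof. by move=> fi gi; apply/funext => y; exact: (transformB position_kernel fi gi). Qed.

Lemma ft_sqint f : cintegrable muM f -> square_integrable muM f -> square_integrable muF (ft f).
Proof.
move=> fi f2; split; first exact: (cmeasurable_ft f2.1).
by have := plancherel_ft fi f2; rewrite /N2 => ->; case: f2.
Qed.

Lemma ift_sqint f : cintegrable muF f -> square_integrable muF f -> square_integrable muM (ift f).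
Proof.
move=> fi f2; split; first exact: (cmeasurable_ift f2.1).
by have := plancherel_ift fi f2; rewrite /N2 => ->; case: f2.
Qed.

Lemma ft_adjoint f h : cintegrable muM f -> cintegrable muF h ->
  cintegral muF (fun zeta => (ft f zeta)^* * h zeta) = cintegral muM (fun z => (f z)^* * ift h z).
Proof.
move=> fi hi; have mf := cintegrable_cmeasurable fi; have mh := cintegrable_cmeasurable hi.
have [_ mE _ _] := frequency_kernel.
have mE' : cmeasurable (fun q : position * frequency => cis (phase q.1 q.2)).
  exact: (cmeasurable_comp mE (@measurable_swap _ _ _ _)).
have [] := cintegral_fubini (m1 := sM) (m2 := sF) (a := fun z => cmod (f z)) (b := fun zeta => cmod (h zeta))
  (f := fun q => (f q.1)^* * (cis (phase q.1 q.2) * h q.2)).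
- apply: cmeasurableM.
    exact: (cmeasurable_comp (cmeasurable_conj mf) measurable_fst).
  apply: cmeasurableM; first exact: mE'.
  exact: (cmeasurable_comp mh measurable_snd).
- exact: cintegrable_cmod.
- exact: cintegrable_cmod.
- by move=> x y /=; rewrite !cmodM cmod_conj cmod_cis mul1r.
move=> e1 e2; rewrite -e1 in e2.
transitivity (cintegral sF (fun zeta => cintegral sM (fun z => (f z)^* * (cis (phase z zeta) * h zeta)))).
  apply: eq_cintegral => zeta; rewrite /ft /transform -cintegral_conj; last exact: (kernel_cintegrable position_kernel).
  rewrite mulrC -cintegralZ; last exact/cintegrable_conj/(kernel_cintegrable position_kernel).
  by apply: eq_cintegral => z; rewrite rmorphM/= cis_conj opprK; ring.
rewrite [LHS]e2; apply: eq_cintegral => z; rewrite /ift /transform -cintegralZ; last exact: (kernel_cintegrable frequency_kernel).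
by apply: eq_cintegral => zeta /=; ring.
Qed.

End Spaces.

Lemma L2of_linear d (T : measurableType d) (R : realType) (mu : {measure set T -> \bar R}) (a : R[i])
    (f g : T -> R[i]) : square_integrable mu f -> square_integrable mu g ->
  L2of mu (fun x => a * f x + g x) = a *: L2of mu f + L2of mu g.
Proof.
move=> fi gi; have i2 := square_integrableD (square_integrableZ a fi) gi.
apply: L2ext.
have h : {ae mu, forall x, L2repr (a *: L2of mu f) x = a * f x}.
  by apply: filterS2 (L2reprZ a (L2of mu f)) (L2of_repr fi) => x -> ->.
have h' : {ae mu, forall x, L2repr (a *: L2of mu f + L2of mu g) x = a * f x + g x}.
  apply: filterS3 (L2reprD (a *: L2of mu f) (L2of mu g)) h (L2of_repr gi).
  by move=> x -> -> ->.
by apply: filterS2 (L2of_repr i2) h' => x -> ->.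
Qed.

Lemma isometry_nsqB (R : realType) (H K : prehilbertType R) (U : H -> K) u v u' v' : linear U ->
  (forall u, nsq (U u) = nsq u) -> U u = u' -> U v = v' -> nsq (u - v) = nsq (u' - v').
Proof. by move=> lU iU <- <-; rewrite -(linear_opB lU) iU. Qed.

Lemma hcvgZ (R : realType) (H : prehilbertType R) a (u : nat -> H) l :
  hcvg u l -> hcvg (fun k => a *: u k) (a *: l).
Proof.
move=> /hcvgP h; apply/hcvgP.
have -> : (fun k => nsq (a *: u k - a *: l)) = (fun k => sqmod a * nsq (u k - l)).
  by apply/funext => k; rewrite -scalerBr nsqZ.
by rewrite -(mulr0 (sqmod a)); apply: cvgM => //; exact: cvg_cst.
Qed.

(** * Unitarity of the Fourier transform on square integrable functions *)

Section FourierL2.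
Context {R : realType} {n m : nat}.
Local Notation position := (position R n m).
Local Notation frequency := (frequency R n m).
Local Notation muM := (position_measure R n m).
Local Notation muF := (frequency_measure R n m).
Local Notation sobolev := (@sobolev R n m).
Local Notation nu sigma := (mweight muF (sobolev_weight_ge0 sigma) (measurable_sobolev_weight sigma)).
Implicit Types (f : L2 muM) (g : sobolev 0).

Lemma frequency_sq_ge0 (zeta : frequency) : 0 <= frequency_sq zeta.
Proof. by rewrite addr_ge0// sumr_ge0// => i _; exact: sqr_ge0. Qed.

Lemma japanese_gt0 (r : R) (zeta : frequency) : 0 < japanese r zeta.
Proof. by rewrite powR_gt0// ltr_pwDl// frequency_sq_ge0. Qed.

Lemma japanese0 (zeta : frequency) : japanese (0 : R) zeta = 1.
Proof. by rewrite /japanese mul0r powRr0. Qed.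

Lemma japaneseD (r q : R) (zeta : frequency) : japanese (r + q) zeta = japanese r zeta * japanese q zeta.
Proof.
rewrite /japanese mulrDl powRD//; apply/implyP => _.
by rewrite gt_eqF// ltr_pwDl// frequency_sq_ge0.
Qed.

Lemma measurable_japanese (r : R) : measurable_fun setT (@japanese R n m r).
Proof.
apply: (measurableT_comp (measurable_powR _)).
by apply: measurable_funD => //; exact: measurable_frequency_sq.
Qed.

Lemma sobolev_ae sigma (P : frequency -> Prop) : {ae nu sigma, forall z, P z} <-> {ae muF, forall z, P z}.
Proof. by apply: ae_weight => z; rewrite exprn_gt0// japanese_gt0. Qed.

Lemma sobolev_N2 sigma (h : frequency -> R[i]) : cmeasurable h ->
  N2 (nu sigma) h = N2 muF (fun z => (japanese sigma z)%:C * h z).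
Proof.
move=> mh; have wp z : 0 < @sobolev_weight R n m sigma z by rewrite exprn_gt0// japanese_gt0.
rewrite N2_weight//.
by apply: eq_N2 => z; rewrite /sobolev_weight sqrtr_sqr ger0_norm// ltW// japanese_gt0.
Qed.

Lemma sobolev0_N2 (h : frequency -> R[i]) : cmeasurable h -> N2 (nu 0) h = N2 muF h.
Proof. by move=> mh; rewrite sobolev_N2//; apply: eq_N2 => z; rewrite japanese0 mul1r. Qed.

Lemma sobolev0_sqint (h : frequency -> R[i]) : square_integrable (nu 0) h <-> square_integrable muF h.
Proof.
by split=> -[mh hi]; split => //; move: hi; have := sobolev0_N2 mh; rewrite /N2 => ->.
Qed.

Lemma sobolev0_mean (F : nat -> frequency -> R[i]) : (forall k, cmeasurable (F k)) ->
  mean_null (nu 0) F <-> mean_null muF F.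
Proof.
by move=> mF; split=> h e e0; have [N hN] := h e e0; exists N => k Nk; have := hN k Nk; rewrite sobolev0_N2.
Qed.

Lemma sobolev0_cintegral (h : frequency -> R[i]) : cintegral (nu 0) h = cintegral muF h.
Proof.
have E A : measurable A -> nu 0 A = muF A.
  move=> mA; rewrite /= /mweight (eq_integral (cst 1%E)); last first.
    by move=> z _; rewrite /sobolev_weight japanese0 expr1n.
  by rewrite integral_cst// mul1e.
by congr Complex; congr fine; apply: eq_measure_integral => A mA _; exact: E.
Qed.

Definition ball_set (N : nat) : set position := [set z | \sum_(i < n) tnth z.1 i ^+ 2 <= N%:R ^+ 2].

Lemma measurable_ball_set N : measurable (ball_set N).
Proof.
have mh : measurable_fun setT (fun z : position => \sum_(i < n) tnth z.1 i ^+ 2).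
  apply: measurable_sum => i; apply: measurable_funX.
  exact: (measurableT_comp (measurable_tnth i) measurable_fst).
have := mh measurableT _ (measurable_itv `]-oo, N%:R ^+ 2]); rewrite setTI.
by congr measurable; apply/seteqP; split => z; rewrite /preimage/= in_itv.
Qed.

Lemma ball_set_box N : ball_set N `<=` position_box N.
Proof.
move=> z zN; split => // i; rewrite /line_box /mkset/= -(@ler_pXn2r _ 2)// ?nnegrE// real_normK ?num_real//.
apply: le_trans zN; rewrite (bigD1 i)//= lerDl sumr_ge0// => j _; exact: sqr_ge0.
Qed.

Lemma ball_set_finite N : (muM (ball_set N) < +oo)%E.
Proof.
have [/(_ N)[mb fb] _ _ _] := position_kernel R n m.
by apply: le_lt_trans fb; apply: le_measure; rewrite ?inE//; [exact: measurable_ball_set|exact: ball_set_box].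
Qed.

Lemma ball_set_cover z : exists N, forall k, (N <= k)%N -> ball_set k z.
Proof.
exists (Num.bound (\sum_(i < n) tnth z.1 i ^+ 2)) => k Nk; rewrite /ball_set/=.
set S := \sum_(_ < n) _; have S0 : 0 <= S by rewrite sumr_ge0// => i _; exact: sqr_ge0.
have Sk : S <= k%:R by rewrite (le_trans (ltW (archi_boundP S0)))// ler_nat.
rewrite (le_trans Sk)// expr2; case: k Nk Sk => [|k] _ _; first by rewrite mulr0.
by rewrite ler_peMl// ler1n.
Qed.

Section Truncation.
Variable f : L2 muM.
Let fN N := ctrunc (ball_set N) (L2repr f).

Lemma truncated_fourierE N : truncated_fourier f N = ft (fN N).
Proof. by apply/funext => zeta; apply: eq_cintegral => z; rewrite mulrA. Qed.

Lemma truncation_sqint N : square_integrable muM (fN N).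
Proof. exact: sqint_cut (measurable_ball_set N) (sqfunP _). Qed.

Lemma truncation_cintegrable N : cintegrable muM (fN N).
Proof. exact: sqint_cut_cintegrable (measurable_ball_set N) (ball_set_finite N) (sqfunP _). Qed.

Lemma truncation_mean : mean_null muM (fun N z => fN N z - L2repr f z).
Proof. exact: cut_mean measurable_ball_set (sqfunP _) ball_set_cover. Qed.

Lemma truncated_fourier_sqint N : square_integrable muF (truncated_fourier f N).
Proof. by rewrite truncated_fourierE; exact: ft_sqint (truncation_cintegrable N) (truncation_sqint N). Qed.

Definition truncated_class N : sobolev 0 := L2of (nu 0) (truncated_fourier f N).

Lemma is_fourierP g : is_fourier f g <-> hcvg truncated_class g.
Proof.
have s0 N : square_integrable (nu 0) (truncated_fourier f N) by apply/sobolev0_sqint/truncated_fourier_sqint.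
rewrite -{2}(L2of_reprK g) hcvg_mean//; last exact: sqfunP.
rewrite sobolev0_mean; last by move=> k; apply: cmeasurableB; [case: (s0 k)|exact: sqfun_cmeasurable].
by rewrite mean_nullP.
Qed.

Lemma truncated_class_nsq N : nsq (truncated_class N) = nsq (L2of muM (fN N)).
Proof.
have s0 : square_integrable (nu 0) (truncated_fourier f N) by apply/sobolev0_sqint/truncated_fourier_sqint.
apply: EFin_inj; rewrite (nsq_L2of s0) (nsq_L2of (truncation_sqint N)) sobolev0_N2; last by case: s0.
by rewrite truncated_fourierE; exact: plancherel_ft (truncation_cintegrable N) (truncation_sqint N).
Qed.

Lemma truncation_hcvg : hcvg (fun N => L2of muM (fN N)) f.
Proof.
rewrite -[X in hcvg _ X](L2of_reprK f).
exact: ((hcvg_mean truncation_sqint (sqfunP _)).2 truncation_mean).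
Qed.

(** Truncations to balls are integrable, so [plancherel_ft] applies to their differences and
    transfers the Cauchy property to their transforms. This justifies the choice operator in the
    definition of [fourier]. *)
Lemma is_fourier_exists : exists g, is_fourier f g.
Proof.
have mT N : cmeasurable (truncated_fourier f N) by case: (truncated_fourier_sqint N).
have mF N : cmeasurable (fN N) by case: (truncation_sqint N).
have [|g mg [hg _]] := @riesz_fischer _ _ _ muF (truncated_fourier f) mT.
  have mf : cmeasurable (L2repr f) by exact: sqfun_cmeasurable.
  move=> e e0; have [N hN] := mean_null_cauchy mF mf truncation_mean e0.
  exists N => i j ij; rewrite (le_trans _ (hN i j ij))//.
  rewrite (_ : (fun x => _) = ft (fun z => fN j z - fN i z)).
    rewrite plancherel_ft//.
      exact: cintegrableB (truncation_cintegrable j) (truncation_cintegrable i).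
    exact: square_integrableB (truncation_sqint j) (truncation_sqint i).
  by rewrite (ftB (truncation_cintegrable j) (truncation_cintegrable i)) !truncated_fourierE.
have g2 : square_integrable (nu 0) g.
  exact/sobolev0_sqint/(mean_limit_sqint truncated_fourier_sqint mg hg).
have sN N : square_integrable (nu 0) (truncated_fourier f N) by apply/sobolev0_sqint/truncated_fourier_sqint.
exists (L2of _ g); apply/is_fourierP; apply: (hcvg_mean sN g2).2.
by apply/sobolev0_mean => // k; exact: cmeasurableB.
Qed.

Lemma fourierP : hcvg truncated_class (fourier f).
Proof. apply/is_fourierP; exact: (xgetPex 0 is_fourier_exists). Qed.

Lemma fourier_nsq : nsq (fourier f) = nsq f.
Proof.
have c1 := hcvg_nsq fourierP; have c2 := hcvg_nsq truncation_hcvg.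
have E : (fun k => nsq (truncated_class k)) = (fun k => nsq (L2of muM (fN k))).
  by apply/funext => k; exact: truncated_class_nsq.
by rewrite E in c1; exact: (cvg_unique _ c1 c2).
Qed.

End Truncation.

Lemma truncated_class_linear a (f g : L2 muM) N :
  truncated_class (a *: f + g) N = a *: truncated_class f N + truncated_class g N.
Proof.
have E : truncated_fourier (a *: f + g) N = (fun zeta => a * truncated_fourier f N zeta + truncated_fourier g N zeta).
  apply/funext => zeta; rewrite !truncated_fourierE /ft /transform.
  have i1 := kernel_cintegrable (position_kernel R n m) zeta (truncation_cintegrable f N).
  have i2 := kernel_cintegrable (position_kernel R n m) zeta (truncation_cintegrable g N).
  rewrite -cintegralZ// -cintegralD//; last exact: cintegrableZ.
  have m1 := cintegrable_cmeasurable i1; have m2 := cintegrable_cmeasurable i2.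
  apply: ae_eq_cintegral.
  - exact/cintegrable_cmeasurable/(kernel_cintegrable (position_kernel R n m))/truncation_cintegrable.
  - by apply: cmeasurableD => //; apply: cmeasurableM => //; exact: cmeasurable_cst.
  apply: filterS2 (L2reprD (a *: f) g) (L2reprZ a f) => z h1 h2.
  by rewrite /ctrunc h1 h2; ring.
have sf := proj2 (sobolev0_sqint _) (truncated_fourier_sqint f N).
have sg := proj2 (sobolev0_sqint _) (truncated_fourier_sqint g N).
rewrite /truncated_class E; exact: L2of_linear sf sg.
Qed.

Lemma fourier_linear : linear (@fourier R n m).
Proof.
move=> a f g; apply: (hcvg_unique (fourierP _)).
have h1 := fourierP f; have h2 := fourierP g.
have -> : truncated_class (a *: f + g) = (fun N => a *: truncated_class f N + truncated_class g N).
  by apply/funext => N; exact: truncated_class_linear.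
by apply: hcvgD => //; exact: hcvgZ.
Qed.

Lemma fourier_inner f f' : inner (fourier f) (fourier f') = inner f f' :> R[i].
Proof. exact: (isometry_inner fourier_linear fourier_nsq). Qed.

Lemma fourier_adjoint f (h : frequency -> R[i]) : cintegrable muF h -> square_integrable muF h ->
  inner (fourier f) (L2of (nu 0) h) = inner f (L2of muM (ift h)) :> R[i].
Proof.
move=> hi h2; have i2 := ift_sqint hi h2; have s0 := proj2 (sobolev0_sqint _) h2.
have c1 := @hcvg_inner _ _ _ _ (L2of (nu 0) h) (fourierP f).
have c2 := @hcvg_inner _ _ _ _ (L2of muM (ift h)) (truncation_hcvg f).
have E N : inner (L2of (nu 0) h) (truncated_class f N) =
    inner (L2of muM (ift h)) (L2of muM (ctrunc (ball_set N) (L2repr f))) :> R[i].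
  rewrite inner_conj [RHS]inner_conj; congr (_^*).
  have sN := proj2 (sobolev0_sqint _) (truncated_fourier_sqint f N).
  rewrite /truncated_class (L2_innerof sN s0) (L2_innerof (truncation_sqint f N) i2).
  rewrite -(ft_adjoint (truncation_cintegrable f N) hi) -truncated_fourierE.
  exact: sobolev0_cintegral.
have [d1 d2] := sqmod_cvg0 c1; have [d3 d4] := sqmod_cvg0 c2.
rewrite inner_conj [RHS]inner_conj; congr (_^*).
apply: complex_ext.
  by move: d1; under eq_fun do rewrite E; move=> d1; exact: (cvg_unique _ d1 d3).
by move: d2; under eq_fun do rewrite E; move=> d2; exact: (cvg_unique _ d2 d4).
Qed.

(** In the squared distance of the two sides both squared norms equal that of [h], as both
    transforms are isometric, and adjointness turns the cross term into the squared norm of [ift h];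
    so the distance vanishes. Fourier inversion thus follows from two isometries. *)
Lemma fourier_ift (h : frequency -> R[i]) : cintegrable muF h -> square_integrable muF h ->
  fourier (L2of muM (ift h)) = L2of (nu 0) h.
Proof.
move=> hi h2; have i2 := ift_sqint hi h2; have s0 := proj2 (sobolev0_sqint _) h2.
have E : nsq (L2of muM (ift h)) = nsq (L2of (nu 0) h).
  by apply: EFin_inj; rewrite (nsq_L2of i2) (nsq_L2of s0) (plancherel_ift hi h2) (sobolev0_N2 h2.1).
apply/eqP; rewrite -subr_eq0; apply/eqP/nsq_eq0.
rewrite nsqB fourier_nsq (fourier_adjoint _ hi h2) innerE cRe_real E; ring.
Qed.

(** Restrictions of [g] to boxes are in the image by [fourier_ift]; they converge to [g], their
    preimages are Cauchy by isometry, and [L2] is complete. *)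
Lemma fourier_surjective g : exists f, fourier f = g.
Proof.
pose gN N := ctrunc (frequency_box N) (L2repr g).
have g2 : square_integrable muF (L2repr g) by apply/sobolev0_sqint/sqfunP.
have box N : measurable (@frequency_box R n m N) /\ (muF (frequency_box N) < +oo)%E.
  by have [/(_ N)] := frequency_kernel R n m.
have gi N : cintegrable muF (gN N) := sqint_cut_cintegrable (box N).1 (box N).2 g2.
have gN2 N : square_integrable muF (gN N) := sqint_cut (box N).1 g2.
have cov (zeta : frequency) : exists N, forall k, (N <= k)%N -> frequency_box k zeta.
  have [N hN] := frequency_box_cover zeta; exists N => k Nk.
  exact: (frequency_box_mono Nk hN).
have gm := cut_mean (fun k => (box k).1) g2 cov.
have s0 N := proj2 (sobolev0_sqint _) (gN2 N).
have hg : hcvg (fun N => L2of (nu 0) (gN N)) g.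
  rewrite -[X in hcvg _ X](L2of_reprK g); apply: (hcvg_mean s0 (sqfunP _)).2.
  by apply/sobolev0_mean => // k; apply: cmeasurableB; [case: (gN2 k)|case: g2].
have [f hf] : exists f, hcvg (fun N => L2of muM (ift (gN N))) f.
  apply: L2_complete => c c0.
  have mg k : cmeasurable (gN k) by case: (gN2 k).
  have c20 : 0 < c / 2 by rewrite divr_gt0.
  have [N hN] := mean_null_cauchy mg g2.1 gm c20; exists N => i j ij.
  have F k : fourier (L2of muM (ift (gN k))) = L2of (nu 0) (gN k) := fourier_ift (gi k) (gN2 k).
  have E := isometry_nsqB fourier_linear fourier_nsq (F j) (F i).
  apply: (@le_lt_trans _ _ (nsq (L2of (nu 0) (gN j) - L2of (nu 0) (gN i)))); first by rewrite -E lexx.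
  have : ((nsq (L2of (nu 0) (gN j) - L2of (nu 0) (gN i)))%:E <= (c / 2)%:E)%E.
    rewrite nsqB_N2; apply: le_trans (hN i j ij).
    rewrite -sobolev0_N2; last exact: cmeasurableB.
    rewrite le_eqVlt; apply/orP; left; apply/eqP; apply: N2_ae.
    - by apply: cmeasurableB; exact: sqfun_cmeasurable.
    - exact: cmeasurableB.
    by apply: filterS2 (L2of_repr (s0 j)) (L2of_repr (s0 i)) => x -> ->.
  by rewrite lee_fin => /le_lt_trans; apply; rewrite ltr_pdivrMr// ltr_pMr// ltr1n.
exists f; have := isometry_hcvg fourier_linear fourier_nsq hf.
have -> : (fun k => fourier (L2of muM (ift (gN k)))) = (fun N => L2of (nu 0) (gN N)).
  by apply/funext => k; rewrite fourier_ift.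
by move=> /hcvg_unique; apply.
Qed.

Lemma inverse_fourierK g : fourier (inverse_fourier g) = g.
Proof. exact: (xgetPex 0 (fourier_surjective g)). Qed.

Lemma fourierK f : inverse_fourier (fourier f) = f.
Proof. by apply: (isometry_inj fourier_linear fourier_nsq); rewrite inverse_fourierK. Qed.

Lemma inverse_fourier_linear : linear (@inverse_fourier R n m).
Proof.
move=> a u v; apply: (isometry_inj fourier_linear fourier_nsq).
by rewrite fourier_linear !inverse_fourierK.
Qed.

Lemma inverse_fourier_nsq g : nsq (inverse_fourier g) = nsq g.
Proof. by rewrite -fourier_nsq inverse_fourierK. Qed.

Lemma inverse_fourier_ift (h : frequency -> R[i]) : cintegrable muF h -> square_integrable muF h ->
  inverse_fourier (L2of (nu 0) h) = L2of muM (ift h).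
Proof. by move=> hi h2; rewrite -(fourier_ift hi h2) fourierK. Qed.

End FourierL2.

(** * Fourier multipliers and the spectral decomposition of the operator *)

Lemma isometry_series (R : realType) (H K : prehilbertType R) (U : H -> K) (c : nat -> R[i])
    (v : nat -> H) (w : nat -> K) l l' : linear U -> (forall u, nsq (U u) = nsq u) ->
  hcvg (fun J => \sum_(j < J) c j *: v j) l -> (forall j, U (v j) = w j) -> U l = l' ->
  hcvg (fun J => \sum_(j < J) c j *: w j) l'.
Proof.
move=> linU isoU h vw <-; have := isometry_hcvg linU isoU h.
congr hcvg; apply/funext => J; rewrite (linear_op_sum linU); apply: eq_bigr => j _.
by rewrite (linear_opZ _ _ linU) vw.
Qed.

Section Multipliers.
Context {R : realType} {n m : nat}.
Local Notation position := (position R n m).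
Local Notation frequency := (frequency R n m).
Local Notation muF := (frequency_measure R n m).
Local Notation sobolev := (@sobolev R n m).
Local Notation nu sigma := (mweight muF (sobolev_weight_ge0 sigma) (measurable_sobolev_weight sigma)).

Lemma sobolev_ext sigma (u v : sobolev sigma) : {ae muF, forall z, L2repr u z = L2repr v z} -> u = v.
Proof. by move=> /(sobolev_ae sigma) h; apply: L2ext. Qed.

Lemma sobolev_reprD sigma (u v : sobolev sigma) : {ae muF, forall z, L2repr (u + v) z = L2repr u z + L2repr v z}.
Proof. by apply/(sobolev_ae sigma); exact: L2reprD. Qed.

Lemma sobolev_reprZ sigma a (u : sobolev sigma) : {ae muF, forall z, L2repr (a *: u) z = a * L2repr u z}.
Proof. by apply/(sobolev_ae sigma); exact: L2reprZ. Qed.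

Lemma sobolev_pairingE sigma tau (u : sobolev sigma) (v : sobolev tau) (f g : frequency -> R[i]) :
  cmeasurable f -> cmeasurable g ->
  {ae muF, forall z, L2repr u z = f z} -> {ae muF, forall z, L2repr v z = g z} ->
  sobolev_pairing u v = cintegral muF (fun z => (f z)^* * g z).
Proof.
move=> mf mg uf vg; apply: ae_eq_cintegral.
- by apply: cmeasurableM; [apply: cmeasurable_conj|]; exact: sqfun_cmeasurable.
- by apply: cmeasurableM => //; exact: cmeasurable_conj.
by apply: filterS2 uf vg => z e1 e2; exact: (f_equal2 (fun x y => x^* * y) e1 e2).
Qed.

Lemma pairing_inner (u v : sobolev 0) : sobolev_pairing u v = inner u v.
Proof. by rewrite L2_innerr sobolev0_cintegral. Qed.

Section Isometric.
Variables (a : frequency -> R[i]) (sigma tau : R).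
Hypotheses (ma : cmeasurable a)
  (ha : forall z, cmod (a z) * japanese tau z = japanese sigma z).

Let mau (u : sobolev sigma) : cmeasurable (fun z => a z * L2repr u z).
Proof. by apply: cmeasurableM => //; exact: sqfun_cmeasurable. Qed.

Let N2au (u : sobolev sigma) : N2 (nu tau) (fun z => a z * L2repr u z) = N2 (nu sigma) (L2repr u).
Proof.
rewrite sobolev_N2// sobolev_N2; last exact: sqfun_cmeasurable.
apply: eq_N2 => z; rewrite mulrA !sqmodM !sqmod_real -(ha z) exprMn cmod_sq; ring.
Qed.

Let au_sqint (u : sobolev sigma) : square_integrable (nu tau) (fun z => a z * L2repr u z).
Proof. by split=> //; have := N2au u; rewrite /N2 => ->; case: (sqfunP (L2repr u)). Qed.

Lemma multiplier_ae (u : sobolev sigma) :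
  {ae muF, forall z, L2repr (multiplier a u : sobolev tau) z = a z * L2repr u z}.
Proof. by apply/(sobolev_ae tau); exact: (L2of_repr (au_sqint u)). Qed.

Lemma multiplier_linear : linear (multiplier a : sobolev sigma -> sobolev tau).
Proof.
move=> c u v; apply: sobolev_ext.
have h1 : {ae muF, forall z, L2repr (c *: u + v) z = c * L2repr u z + L2repr v z}.
  apply: filterS2 (sobolev_reprD (c *: u) v) (sobolev_reprZ c u) => z e1 e2.
  exact: (etrans e1 (f_equal (fun x => x + L2repr v z) e2)).
set w := (multiplier a u : sobolev tau); set w' := (multiplier a v : sobolev tau).
have h2 : {ae muF, forall z, L2repr (c *: w + w') z = c * (a z * L2repr u z) + a z * L2repr v z}.
  have h3 : {ae muF, forall z, L2repr (c *: w) z = c * (a z * L2repr u z)}.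
    apply: filterS2 (sobolev_reprZ c w) (multiplier_ae u) => z e1 e2.
    exact: (etrans e1 (f_equal (fun x => c * x) e2)).
  apply: filterS3 (sobolev_reprD (c *: w) w') h3 (multiplier_ae v) => z e1 e2 e3.
  exact: (etrans e1 (f_equal2 +%R e2 e3)).
have E x y z : a z * (c * x + y) = c * (a z * x) + a z * y by ring.
apply: filterS3 (multiplier_ae (c *: u + v)) h1 h2 => z e1 e2 e3.
exact: (etrans e1 (etrans (f_equal (fun x => a z * x) e2) (etrans (E _ _ z) (esym e3)))).
Qed.

Lemma multiplier_nsq (u : sobolev sigma) : nsq (multiplier a u : sobolev tau) = nsq u.
Proof.
have := nsq_L2of (au_sqint u); have := nsq_N2 u; rewrite -N2au => <- h.
exact: (EFin_inj h).
Qed.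

End Isometric.

Section Bessel.
Variables (r sigma tau : R).
Hypothesis st : r + tau = sigma.

Let mJ : cmeasurable (fun z : frequency => (japanese r z)%:C).
Proof. by apply: cmeasurable_real; exact: measurable_japanese. Qed.

Let hJ (z : frequency) : cmod (japanese r z)%:C * japanese tau z = japanese sigma z.
Proof. by rewrite cmod_real ger0_norm ?ltW ?japanese_gt0// -japaneseD st. Qed.

Lemma bessel_ae (u : sobolev sigma) :
  {ae muF, forall z, L2repr (bessel r u : sobolev tau) z = (japanese r z)%:C * L2repr u z}.
Proof. exact: multiplier_ae mJ hJ u. Qed.

Lemma bessel_linear : linear (bessel r : sobolev sigma -> sobolev tau).
Proof. exact: multiplier_linear mJ hJ. Qed.

Lemma bessel_nsq (u : sobolev sigma) : nsq (bessel r u : sobolev tau) = nsq u.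
Proof. exact: multiplier_nsq mJ hJ u. Qed.

End Bessel.

Lemma besselK (r r' sigma tau : R) (u : sobolev sigma) : r + tau = sigma -> r' + sigma = tau ->
  bessel r' (bessel r u : sobolev tau) = u.
Proof.
move=> st st'; apply: sobolev_ext.
have rr : r' + r = 0 by lra.
apply: filterS2 (bessel_ae st' (bessel r u)) (bessel_ae st u) => z e1 e2.
apply: (etrans e1 (etrans (f_equal (fun x => (japanese r' z)%:C * x) e2) _)).
by rewrite mulrA -rmorphM/= -japaneseD rr japanese0 mul1r.
Qed.

Section Schrodinger.
Variables (t sigma : R).

Let mS : cmeasurable (fun z : frequency => cis (t * frequency_sq z)).
Proof. by apply: cmeasurable_cis; apply: measurable_funM => //; exact: measurable_frequency_sq. Qed.

Let hS (z : frequency) : cmod (cis (t * frequency_sq z)) * japanese sigma z = japanese sigma z.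
Proof. by rewrite cmod_cis mul1r. Qed.

Lemma schrodinger_ae (u : sobolev sigma) :
  {ae muF, forall z, L2repr (schrodinger t u) z = cis (t * frequency_sq z) * L2repr u z}.
Proof. exact: multiplier_ae mS hS u. Qed.

Lemma schrodinger_linear : linear (schrodinger t : sobolev sigma -> sobolev sigma).
Proof. exact: multiplier_linear mS hS. Qed.

Lemma schrodinger_nsq (u : sobolev sigma) : nsq (schrodinger t u) = nsq u.
Proof. exact: multiplier_nsq mS hS u. Qed.

End Schrodinger.

(** For opposite orders the Sobolev weights cancel, so that the pairing is one of square integrable
    functions; its absolute convergence is what allows the conjugation to enter the integral. *)
Lemma pairing_sym (sigma tau : R) (u : sobolev sigma) (v : sobolev tau) : sigma + tau = 0 ->
  sobolev_pairing v u = (sobolev_pairing u v)^*.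
Proof.
move=> st.
have ju : square_integrable muF (fun z => (japanese sigma z)%:C * L2repr u z).
  split; first by apply: cmeasurableM; [apply: cmeasurable_real; exact: measurable_japanese|exact: sqfun_cmeasurable].
  by have := sobolev_N2 sigma (sqfun_cmeasurable (L2repr u)); rewrite /N2 => <-; case: (sqfunP (L2repr u)).
have jv : square_integrable muF (fun z => (japanese tau z)%:C * L2repr v z).
  split; first by apply: cmeasurableM; [apply: cmeasurable_real; exact: measurable_japanese|exact: sqfun_cmeasurable].
  by have := sobolev_N2 tau (sqfun_cmeasurable (L2repr v)); rewrite /N2 => <-; case: (sqfunP (L2repr v)).
have E (z : frequency) (x y : R[i]) : ((japanese sigma z)%:C * x)^* * ((japanese tau z)%:C * y) = x^* * y.
  by rewrite rmorphM/= conj_real mulrACA -rmorphM/= -japaneseD st japanese0 mul1r.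
have := cintegrableJM ju jv; under eq_fun do rewrite E; move=> i1.
rewrite /sobolev_pairing -(cintegral_conj i1).
by apply: eq_cintegral => z; rewrite rmorphM/= conjCK mulrC.
Qed.

(** The symbol is real and can be moved from one factor to the other inside the integral. The
    integrands agree almost everywhere, hence no convergence is involved. *)
Lemma pairing_besselr (r sigma tau rho sigma' : R) (u : sobolev sigma) (v : sobolev tau) :
  r + sigma' = sigma -> r + rho = tau ->
  sobolev_pairing u (bessel r v : sobolev rho) = sobolev_pairing (bessel r u : sobolev sigma') v.
Proof.
move=> s1 s2.
have mJ : cmeasurable (fun z : frequency => (japanese r z)%:C).
  by apply: cmeasurable_real; exact: measurable_japanese.
have mu' := sqfun_cmeasurable (L2repr u); have mv := sqfun_cmeasurable (L2repr v).
have aeT (f : frequency -> R[i]) : {ae muF, forall z, f z = f z} by apply: aeW.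
rewrite (sobolev_pairingE mu' (cmeasurableM mJ mv) (aeT _) (bessel_ae s2 v)).
rewrite (sobolev_pairingE (cmeasurableM mJ mu') mv (bessel_ae s1 u) (aeT _)).
apply: eq_cintegral => z; rewrite rmorphM/= conj_real; ring.
Qed.

Lemma pairing_schrodinger (t sigma tau : R) (u : sobolev sigma) (v : sobolev tau) :
  sobolev_pairing (schrodinger t u) v = sobolev_pairing u (schrodinger (- t) v).
Proof.
have mS t' : cmeasurable (fun z : frequency => cis (t' * frequency_sq z)).
  by apply: cmeasurable_cis; apply: measurable_funM => //; exact: measurable_frequency_sq.
have mu' := sqfun_cmeasurable (L2repr u); have mv := sqfun_cmeasurable (L2repr v).
have aeT (f : frequency -> R[i]) : {ae muF, forall z, f z = f z} by apply: aeW.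
rewrite (sobolev_pairingE mu' (cmeasurableM (mS _) mv) (aeT _) (schrodinger_ae (- t) v)).
rewrite (sobolev_pairingE (cmeasurableM (mS _) mu') mv (schrodinger_ae t u) (aeT _)).
apply: eq_cintegral => z; rewrite rmorphM/= cis_conj mulNr; ring.
Qed.

End Multipliers.

Lemma ketbra_schrodinger (R : realType) (n m : nat) (s t : R) (g : @sobolev R n m s) (u : @sobolev R n m (- s)) :
  ketbra (schrodinger t g) u = schrodinger t (ketbra g (schrodinger (- t) u)).
Proof.
rewrite /ketbra pairing_schrodinger.
exact: (esym (linear_opZ _ _ (schrodinger_linear t (sigma := s)))).
Qed.

(** * Transport of the spectral decomposition to Sobolev spaces *)

Section Spectral.
Context {R : realType} {n m : nat}.
Local Notation muM := (position_measure R n m).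
Local Notation sobolev := (@sobolev R n m).
Variables (s : R) (gamma : sobolev (- s) -> sobolev s).

Let e1 : s + - s = 0 :> R. Proof. by rewrite subrr. Qed.
Let e2 : s + 0 = s :> R. Proof. by rewrite addr0. Qed.
Let e3 : - s + 0 = - s :> R. Proof. by rewrite addr0. Qed.
Let e4 : - s + s = 0 :> R. Proof. by rewrite addNr. Qed.

(** This is the operator on which [sobolev_schatten] imposes its Schatten condition, hence the one
    to which the spectral theorem applies. *)
Definition transported (f : L2 muM) : L2 muM :=
  inverse_fourier (bessel s (gamma (bessel s (fourier f)))).

Let B (f : L2 muM) : sobolev (- s) := bessel s (fourier f).

Let inner_transported (f h : L2 muM) : inner (transported f) h = sobolev_pairing (gamma (B f)) (B h).
Proof.
apply: (etrans (esym (fourier_inner (transported f) h))).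
apply: (etrans (f_equal (fun x => inner x (fourier h)) (inverse_fourierK _))).
apply: (etrans (esym (pairing_inner _ _))).
exact: (esym (pairing_besselr (gamma (B f)) (fourier h) e2 e1)).
Qed.

Lemma transported_symmetric : self_adjoint gamma ->
  forall f h, inner (transported f) h = inner f (transported h) :> R[i].
Proof.
move=> sa f h; apply: (etrans (inner_transported f h)); apply: esym.
apply: (etrans (inner_conj (transported h) f)).
apply: (etrans (f_equal Num.conj (inner_transported h f))).
apply: (etrans (esym (pairing_sym (gamma (B h)) (B f) e1))).
apply: (etrans (sa (B f) (B h))).
exact: (esym (pairing_sym (B h) (gamma (B f)) e4)).
Qed.

Lemma ketbra_bessel (g : sobolev 0) (u : sobolev (- s)) :
  ketbra (bessel (- s) g : sobolev s) u = bessel (- s) (ketbra g (bessel (- s) u : sobolev 0)).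
Proof.
rewrite /ketbra -(pairing_besselr _ _ e4 e3).
exact: (esym (linear_opZ _ _ (bessel_linear e4))).
Qed.

(** The expansion of [transported] at the function [w] representing [u] is carried to [H^s] by the
    isometry [T], the Fourier transform followed by [bessel (- s)]. Linear isometries preserve
    convergent series, and the two Bessel potentials cancel. *)
Lemma spectral_exists (alpha : R) : 0 < alpha -> sobolev_schatten alpha gamma -> self_adjoint gamma ->
  exists lambda f, spectral_decomposition alpha gamma lambda f.
Proof.
move=> alpha0 [_ sA] sa.
have [lambda [f [h1 h2 h3]]] := schatten_spectral (@L2_complete _ _ _ muM) alpha0 sA (transported_symmetric sa).
exists lambda, f; split => // u.
pose w : L2 muM := inverse_fourier (bessel (- s) u : sobolev 0).
pose T (v : L2 muM) : sobolev s := bessel (- s) (fourier v).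
have linT : linear T by move=> a v v'; rewrite /T fourier_linear; exact: bessel_linear.
have isoT v : nsq (T v) = nsq v by rewrite /T bessel_nsq// fourier_nsq.
pose w' j : sobolev s := bessel (- s) (ketbra (fourier (f j)) (bessel (- s) u : sobolev 0)).
apply: (@isometry_series _ _ _ T (fun j => (lambda j)%:C) (fun j => inner (f j) w *: f j) w' _ _ linT isoT (h3 w)) => [j|].
  apply: (etrans (linear_opZ _ _ linT)); apply: esym.
  apply: (etrans (linear_opZ _ _ (bessel_linear e4))).
  apply: (f_equal (fun x => x *: T (f j))).
  apply: (etrans (pairing_inner _ _)); apply: esym.
  apply: (etrans (esym (fourier_inner (f j) w))).
  exact: (f_equal (inner (fourier (f j))) (inverse_fourierK _)).
apply: (etrans (f_equal (bessel (- s)) (inverse_fourierK _))).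
apply: (etrans (besselK _ e2 e4)); apply: (f_equal gamma).
apply: (etrans (f_equal (bessel s) (inverse_fourierK _))).
exact: (besselK _ e3 e1).
Qed.

Lemma spectral_strong (alpha : R) (lambda : nat -> R) (f : nat -> L2 muM) : spectral_decomposition alpha gamma lambda f ->
  forall u, hcvg (fun J => \sum_(j < J) (lambda j)%:C *: ketbra (bessel (- s) (fourier (f j)) : sobolev s) u) (gamma u).
Proof.
move=> [_ _ h] u; refine (eq_ind_r (fun F => hcvg F (gamma u)) (h u) _).
apply/funext => J; apply: eq_bigr => j _.
exact: (f_equal (fun x => (lambda j)%:C *: x) (ketbra_bessel (fourier (f j)) u)).
Qed.

Lemma evolution_strong (t : R) (lambda : nat -> R) (g : nat -> sobolev s) :
  (forall u, hcvg (fun J => \sum_(j < J) (lambda j)%:C *: ketbra (g j) u) (gamma u)) ->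
  forall u, hcvg (fun J => \sum_(j < J) (lambda j)%:C *: ketbra (schrodinger t (g j)) u) (evolution t gamma u).
Proof.
move=> h u.
exact: (@isometry_series _ _ _ (schrodinger t) (fun j => (lambda j)%:C)
  (fun j => ketbra (g j) (schrodinger (- t) u)) (fun j => ketbra (schrodinger t (g j)) u) _ _
  (schrodinger_linear t (sigma := s)) (schrodinger_nsq t (sigma := s)) (h (schrodinger (- t) u))
  (fun j => esym (ketbra_schrodinger t (g j) u)) erefl).
Qed.

End Spectral.

(** * Slabs in frequency space *)

Section Shift.
Context {R : realType}.

(** An integral form of Haar invariance that passes to products and powers by Tonelli's theorem. It
    justifies the substitution of [zeta + a] for a frequency on the product of a Euclidean space and
    a lattice. *)
Definition shift_invariant d (T : measurableType d) (mu : {measure set T -> \bar R}) (add : T -> T -> T) : Prop :=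
  measurable_fun setT (fun p : T * T => add p.1 p.2) /\
  forall b (h : T -> R), measurable_fun setT h -> (forall x, 0 <= h x) ->
    (\int[mu]_x (h x)%:E = \int[mu]_x (h (add x b))%:E)%E.

Lemma measurable_shift d (T : measurableType d) (mu : {measure set T -> \bar R}) add (b : T) :
  shift_invariant mu add -> measurable_fun setT (fun x => add x b).
Proof.
move=> [ma _]; apply: (measurableT_comp (f := fun p : T * T => add p.1 p.2) (g := fun x => (x, b))) => //.
Qed.

Lemma line_shift_invariant : shift_invariant (@lebesgue_measure R) (fun x y : measurableTypeR R => x + y).
Proof.
split; first exact: measurable_funD.
by move=> b h mh h0; rewrite (@integral_shift _ b).
Qed.

Lemma int_shift_invariant : shift_invariant (@counting_int R) (fun x y : int => x + y).
Proof.
split=> [_ A _|b h _ h0].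
  rewrite (_ : _ `&` _ = \bigcup_j ([set int_enum j] `*` [set y | A (int_enum j + y)])).
    by apply: bigcup_measurable => j _; exact: measurableX.
  apply/seteqP; split=> [[x y] [_ /= Axy]|[x y] [j _ [/= -> ?]]]; last by split.
  by exists (int_index x) => //; rewrite int_indexK.
rewrite !integral_counting_int//.
pose e j := int_index (int_enum j + b).
have h0' k : (0 <= (h k)%:E)%E by rewrite lee_fin.
rewrite !nneseries_esumT//.
rewrite (@reindex_esum _ _ _ setT setT e (fun j => (h (int_enum j))%:E)); last first.
  split=> //.
    by move=> i j _ _ /(can_inj int_indexK)/addIr/(can_inj int_enumK).
  by move=> j _; exists (int_index (int_enum j - b)) => //; rewrite /e int_indexK subrK int_enumK.
by apply: eq_esum => j _; rewrite /e int_indexK.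
Qed.

Section ShiftProduct.
Context {d1 d2} {T1 : measurableType d1} {T2 : measurableType d2}.
Variables (mu1 : {sigma_finite_measure set T1 -> \bar R}) (mu2 : {sigma_finite_measure set T2 -> \bar R}).
Variables (add1 : T1 -> T1 -> T1) (add2 : T2 -> T2 -> T2).

Lemma shift_invariant_prod : shift_invariant mu1 add1 -> shift_invariant mu2 add2 ->
  shift_invariant (mu1 \x mu2)%E (fun x y : T1 * T2 => (add1 x.1 y.1, add2 x.2 y.2)).
Proof.
move=> s1 s2; have [m1 i1] := s1; have [m2 i2] := s2; split.
  apply: measurable_fun_pair.
    apply: (measurableT_comp (f := fun p : T1 * T1 => add1 p.1 p.2)
      (g := fun p : (T1 * T2) * (T1 * T2) => (p.1.1, p.2.1))) => //.
    by apply: measurable_fun_pair; apply: measurableT_comp.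
  apply: (measurableT_comp (f := fun p : T2 * T2 => add2 p.1 p.2)
    (g := fun p : (T1 * T2) * (T1 * T2) => (p.1.2, p.2.2))) => //.
  by apply: measurable_fun_pair; apply: measurableT_comp.
move=> [b1 b2] h mh h0.
have mh2 x : measurable_fun setT (fun y => h (x, y)).
  by apply: (measurableT_comp mh); exact: measurable_fun_pair.
have mh' : measurable_fun setT (fun p : T1 * T2 => h (p.1, add2 p.2 b2)).
  apply: (measurableT_comp mh); apply: measurable_fun_pair => //.
  exact: (measurableT_comp (measurable_shift b2 s2) measurable_snd).
have mh1 y : measurable_fun setT (fun x => h (x, y)).
  by apply: (measurableT_comp mh); exact: measurable_fun_pair.
have mh'' : measurable_fun setT (fun p : T1 * T2 => h (add1 p.1 b1, add2 p.2 b2)).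
  apply: (measurableT_comp mh); apply: measurable_fun_pair.
    exact: (measurableT_comp (measurable_shift b1 s1) measurable_fst).
  exact: (measurableT_comp (measurable_shift b2 s2) measurable_snd).
rewrite (tonelli mu1 mu2 mh h0).1.
transitivity (\int[mu1]_x \int[mu2]_y (h (x, add2 y b2))%:E)%E.
  by apply: eq_integral => x _; exact: (i2 b2 (fun y => h (x, y)) (mh2 x)).
have h0' p : 0 <= h (p.1, add2 p.2 b2) by exact: h0.
rewrite -(tonelli mu1 mu2 mh' h0').1 (tonelli mu1 mu2 mh' h0').2.
have h0'' p : 0 <= h (add1 p.1 b1, add2 p.2 b2) by exact: h0.
rewrite (tonelli mu1 mu2 mh'' h0'').2.
by apply: eq_integral => y _; exact: (i1 b1 (fun x => h (x, add2 y b2)) (mh1 _)).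
Qed.

End ShiftProduct.

Section ShiftPower.
Context {d} {T : measurableType d}.
Variables (mu : {sigma_finite_measure set T -> \bar R}) (add : T -> T -> T).

Definition tuple_add n (x y : n.-tuple T) : n.-tuple T := [tuple add (tnth x i) (tnth y i) | i < n].

Lemma tuple_add_tcons n p q : tuple_add (@tcons _ T n p) (@tcons _ T n q) =
  tcons (add p.1 q.1, tuple_add p.2 q.2).
Proof.
apply: eq_from_tnth => i; rewrite tnth_mktuple.
by case: (unliftP ord0 i) => [j ->|->]; rewrite ?tnth0 ?tnthS ?tnth_mktuple.
Qed.

Lemma measurable_tuple_fun d' (S : measurableType d') n (f : S -> n.-tuple T) :
  (forall i, measurable_fun setT (fun x => tnth (f x) i)) -> measurable_fun setT f.
Proof. by move=> mf; apply/measurable_fun_tnthP. Qed.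

Lemma shift_invariant_power n : shift_invariant mu add -> shift_invariant (mpower mu n) (@tuple_add n).
Proof.
move=> s; have [ma i1] := s; have mt k : measurable_fun setT (fun p : k.-tuple T * k.-tuple T => tuple_add p.1 p.2).
  apply: measurable_tuple_fun => i; under eq_fun do rewrite tnth_mktuple.
  apply: (measurableT_comp (f := fun p : T * T => add p.1 p.2)
    (g := fun p : k.-tuple T * k.-tuple T => (tnth p.1 i, tnth p.2 i))) => //.
  apply: measurable_fun_pair; first exact: (measurableT_comp (measurable_tnth i) measurable_fst).
  exact: (measurableT_comp (measurable_tnth i) measurable_snd).
elim: n => [|n IH]; (split; first exact: mt) => b h mh h0.
  by congr integral; apply/funext => x; congr ((h _)%:E); apply: eq_from_tnth => -[].
have [_ iP] := shift_invariant_prod s IH.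
have mtb : measurable_fun setT (fun x : n.+1.-tuple T => tuple_add x b).
  apply: (measurableT_comp (mt n.+1) (g := fun x => (x, b))).
  exact: measurable_fun_pair.
rewrite integral_mpower// integral_mpower//; last exact: measurableT_comp.
case: b / (tupleP b) mtb => b0 b mtb.
rewrite (iP (b0, b) (fun p => h (tcons p)))//.
  by apply: eq_integral => p _; rewrite -(tuple_add_tcons p (b0, b)).
by apply: (measurableT_comp mh); exact: measurable_tcons.
Qed.

End ShiftPower.

End Shift.

Section Slab.
Context {R : realType}.

Definition slab_fun T (B : set T) (L : T -> R) (c : R) (x : T) : R :=
  \1_(B `&` [set x | c <= L x <= c + 1]) x.

(** The bound is uniform in the offset [c]: slicing a slab of a product along one factor gives slabs
    of the other factor with varying offsets. *)
Definition slab_le d (T : measurableType d) (mu : {measure set T -> \bar R}) (B : set T) (L : T -> R) (W : R) : Prop :=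
  forall c, (\int[mu]_x (slab_fun B L c x)%:E <= W%:E)%E.

Definition volume_le d (T : measurableType d) (mu : {measure set T -> \bar R}) (B : set T) (V : R) : Prop :=
  (\int[mu]_x (\1_B x)%:E <= V%:E)%E.

Lemma slab_fun_ge0 T (B : set T) L c x : 0 <= slab_fun B L c x.
Proof. exact: indic_ge0. Qed.

Lemma measurable_slab_set d (T : measurableType d) (B : set T) (L : T -> R) c : measurable B ->
  measurable_fun setT L -> measurable (B `&` [set x | c <= L x <= c + 1]).
Proof.
move=> mB mL; apply: measurableI => //.
have := mL measurableT _ (measurable_itv `[c, c + 1]); rewrite setTI.
by congr measurable; apply/seteqP; split => x; rewrite /preimage/= in_itv.
Qed.

Lemma measurable_slab_fun d (T : measurableType d) (B : set T) (L : T -> R) c : measurable B ->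
  measurable_fun setT L -> measurable_fun setT (slab_fun B L c).
Proof. by move=> mB mL; apply: measurable_indic; exact: measurable_slab_set. Qed.

Section SlabProduct.
Context {d1 d2} {T1 : measurableType d1} {T2 : measurableType d2}.
Variables (mu1 : {sigma_finite_measure set T1 -> \bar R}) (mu2 : {sigma_finite_measure set T2 -> \bar R}).
Variables (B1 : set T1) (B2 : set T2) (L1 : T1 -> R) (L2 : T2 -> R).
Hypotheses (mB1 : measurable B1) (mB2 : measurable B2) (mL1 : measurable_fun setT L1) (mL2 : measurable_fun setT L2).
Let L (p : T1 * T2) := L1 p.1 + L2 p.2.

Let mL : measurable_fun setT L.
Proof. by apply: measurable_funD; apply: measurableT_comp. Qed.

Let mB : measurable (B1 `*` B2). Proof. exact: measurableX. Qed.

Lemma volume_prod V1 V2 : 0 <= V1 -> volume_le mu1 B1 V1 -> volume_le mu2 B2 V2 ->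
  volume_le (mu1 \x mu2)%E (B1 `*` B2) (V1 * V2).
Proof.
rewrite /volume_le => V10 h1 h2; rewrite !integral_indic// !setIT in h1 h2 *.
by rewrite /= product_measure1E// EFinM lee_pmul.
Qed.

(** For fixed [y] the condition is a slab condition in [x] with offset [c - L2 y]. One thin factor
    therefore makes the product thin, the other contributing its volume. *)
Lemma slab_prodl W V : 0 <= W -> slab_le mu1 B1 L1 W -> volume_le mu2 B2 V ->
  slab_le (mu1 \x mu2)%E (B1 `*` B2) L (W * V).
Proof.
move=> W0 s1 v2 c; rewrite (tonelli mu1 mu2 (measurable_slab_fun c mB mL) (slab_fun_ge0 _ _ _)).2.
apply: (@le_trans _ _ (\int[mu2]_y (W * \1_B2 y)%:E)%E); last first.
  rewrite int_geZ//.
  by rewrite EFinM lee_wpmul2l// lee_fin.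
apply: ge0_le_integral => //.
- by move=> y _; apply: integral_ge0 => x _; rewrite lee_fin slab_fun_ge0.
- apply: (@measurable_fun_fubini_tonelli_G _ _ _ _ _ mu1 (fun p => (slab_fun (B1 `*` B2) L c p)%:E)).
    by apply/measurable_EFinP; exact: measurable_slab_fun.
  by move=> p; rewrite lee_fin slab_fun_ge0.
- by apply/measurable_EFinP; apply: measurable_funM => //; exact: measurable_indic.
move=> y _; have E x : slab_fun (B1 `*` B2) L c (x, y) = \1_B2 y * slab_fun B1 L1 (c - L2 y) x.
  rewrite /slab_fun !indicE -natrM mulnb; congr (_%:R); congr nat_of_bool; apply/idP/andP.
    by move=> /set_mem[[Bx By] /= h]; split; apply/mem_set => //; split => //=; move: h; rewrite /L/=; lra.
  move=> [/set_mem By /set_mem[Bx /= h]]; apply/mem_set; split => //=.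
  by move: h; rewrite /L/=; lra.
under eq_integral do rewrite E.
rewrite int_geZ//; last exact: measurable_slab_fun.
by rewrite mulrC EFinM lee_wpmul2l// lee_fin indic_ge0.
Qed.

Lemma slab_prodr W V : 0 <= W -> slab_le mu2 B2 L2 W -> volume_le mu1 B1 V ->
  slab_le (mu1 \x mu2)%E (B1 `*` B2) L (W * V).
Proof.
move=> W0 s1 v2 c; rewrite (tonelli mu1 mu2 (measurable_slab_fun c mB mL) (slab_fun_ge0 _ _ _)).1.
apply: (@le_trans _ _ (\int[mu1]_y (W * \1_B1 y)%:E)%E); last first.
  rewrite int_geZ//.
  by rewrite EFinM lee_wpmul2l// lee_fin.
apply: ge0_le_integral => //.
- by move=> y _; apply: integral_ge0 => x _; rewrite lee_fin slab_fun_ge0.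
- apply: (@measurable_fun_fubini_tonelli_F _ _ _ _ _ mu2 (fun p => (slab_fun (B1 `*` B2) L c p)%:E)).
    by apply/measurable_EFinP; exact: measurable_slab_fun.
  by move=> p; rewrite lee_fin slab_fun_ge0.
- by apply/measurable_EFinP; apply: measurable_funM => //; exact: measurable_indic.
move=> x _; have E y : slab_fun (B1 `*` B2) L c (x, y) = \1_B1 x * slab_fun B2 L2 (c - L1 x) y.
  rewrite /slab_fun !indicE -natrM mulnb; congr (_%:R); congr nat_of_bool; apply/idP/andP.
    by move=> /set_mem[[Bx By] /= h]; split; apply/mem_set => //; split => //=; move: h; rewrite /L/=; lra.
  move=> [/set_mem Bx /set_mem[By /= h]]; apply/mem_set; split => //=.
  by move: h; rewrite /L/=; lra.
under eq_integral do rewrite E.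
rewrite int_geZ//; last exact: measurable_slab_fun.
by rewrite mulrC EFinM lee_wpmul2l// lee_fin indic_ge0.
Qed.

End SlabProduct.

Section SlabPower.
Context {d} {T : measurableType d}.
Variables (mu : {sigma_finite_measure set T -> \bar R}) (B : set T) (iota : T -> R) (V : R).
Hypotheses (mB : measurable B) (mi : measurable_fun setT iota) (V0 : 0 <= V) (vB : volume_le mu B V).
Hypothesis slabB : forall a, 2 <= `|a| -> slab_le mu B (fun x => a * iota x) 1.

Definition tuple_form n (a : n.-tuple R) (x : n.-tuple T) : R := \sum_(i < n) tnth a i * iota (tnth x i).

Lemma measurable_tuple_form n (a : n.-tuple R) : measurable_fun setT (tuple_form a).
Proof.
apply: measurable_sum => i; apply: measurable_funM => //.
exact: (measurableT_comp mi (measurable_tnth i)).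
Qed.

Lemma tuple_form_tcons n a0 (a : n.-tuple R) p :
  tuple_form [tuple of a0 :: a] (tcons p) = a0 * iota p.1 + tuple_form a p.2.
Proof.
rewrite /tuple_form big_ord_recl !tnth0; congr (_ + _).
by apply: eq_bigr => i _; rewrite !tnthS.
Qed.

Lemma indic_tuple_set n (p : T * n.-tuple T) (A : set (n.+1.-tuple T)) (A' : set (T * n.-tuple T)) :
  (A (tcons p) <-> A' p) -> \1_A (tcons p) = \1_A' p :> R.
Proof.
move=> h; rewrite !indicE; congr (_%:R); congr nat_of_bool.
by apply/idP/idP => /set_mem k; apply/mem_set/h.
Qed.

Lemma volume_power n : volume_le (mpower mu n) (tuple_set n B) (V ^+ n).
Proof.
elim: n => [|n IH]; rewrite /volume_le.
  rewrite expr0 integral_mpower0; last by apply/measurable_EFinP; apply: measurable_indic; exact: measurable_tuple_set.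
  by rewrite lee_fin indicE; case: (_ \in _).
have mI : measurable_fun setT (\1_(tuple_set n.+1 B) : n.+1.-tuple T -> R).
  by apply: measurable_indic; exact: measurable_tuple_set.
rewrite integral_mpower//.
have := volume_prod mB (measurable_tuple_set mB) V0 vB IH; rewrite -exprS /volume_le.
congr (_ <= _)%E; apply: eq_integral => p _; congr EFin.
by apply/esym/indic_tuple_set; exact: tuple_set_tcons.
Qed.

(** The coordinate with the large coefficient contributes 1 in place of [V], which is the gain of
    one power; every other coordinate contributes its full volume. *)
Lemma slab_power n (a : n.-tuple R) : (exists i, 2 <= `|tnth a i|) ->
  slab_le (mpower mu n) (tuple_set n B) (tuple_form a) (V ^+ n.-1).
Proof.
elim: n a => [a [[]]//|n IH a]; case: a / (tupleP a) => a0 a [i ai] c.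
rewrite integral_mpower; last first.
- by move=> x; exact: slab_fun_ge0.
- by apply: measurable_slab_fun; [exact: measurable_tuple_set|exact: measurable_tuple_form].
have mai : measurable_fun setT (fun x : T => a0 * iota x) by exact: measurable_funM.
have E p : slab_fun (tuple_set n.+1 B) (tuple_form [tuple of a0 :: a]) c (tcons p) =
    slab_fun (B `*` tuple_set n B) (fun p => a0 * iota p.1 + tuple_form a p.2) c p.
  apply: indic_tuple_set; rewrite /setI/= tuple_form_tcons.
  by split=> -[h1 h2]; split => //; apply/tuple_set_tcons.
under eq_integral do rewrite E.
have mtB : measurable (tuple_set n B) by exact: measurable_tuple_set.
case: (unliftP ord0 i) ai => [j ->|->]; rewrite ?tnthS ?tnth0 => ai.
  have := slab_prodr mB mtB mai (measurable_tuple_form a) (exprn_ge0 _ V0) (IH a (ex_intro _ j ai)) vB c.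
  have n0 : (0 < n)%N := leq_ltn_trans (leq0n j) (ltn_ord j).
  by rewrite /= -exprSr prednK.
have := slab_prodl mB mtB mai (measurable_tuple_form a) ler01 (slabB ai) (volume_power n) c.
by rewrite mul1r.
Qed.

End SlabPower.

(** The factor 3 is shared with the integers, where a box has [2 N + 1 <= 3 N] points, so that both
    kinds of coordinates have the same volume bound. *)
Lemma line_volume (N : nat) : (0 < N)%N -> volume_le (@lebesgue_measure R) (@line_box R N) (3 * N%:R).
Proof.
move=> N0; rewrite /volume_le (_ : line_box N = `[- N%:R, N%:R]%classic); last first.
  by apply/seteqP; split => x; rewrite /line_box /mkset/= in_itv/= ler_norml.
have N1 : (0 : R) < N%:R by rewrite ltr0n.
rewrite integral_indic// setIT /= lebesgue_measure_itv/= lte_fin ifT; last lra.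
by rewrite -EFinB lee_fin; lra.
Qed.

Lemma line_slab (N : nat) (a : R) : 2 <= `|a| ->
  slab_le (@lebesgue_measure R) (@line_box R N) (fun x : measurableTypeR R => a * x) 1.
Proof.
move=> a2 c.
have [u [v [uv h]]] : exists u v, v = u + `|a|^-1 /\ forall x, c <= a * x <= c + 1 -> u <= x <= v.
  have [a0|a0] := ltrP 0 a.
    rewrite (gtr0_norm a0) in a2 *; exists (c / a), ((c + 1) / a); split; first by field; rewrite gt_eqF.
    by move=> x /andP[h1 h2]; rewrite ler_pdivrMr// ler_pdivlMr// [x * a]mulrC h1.
  have a1 : a < 0 by move: a2; rewrite ler0_norm//; lra.
  rewrite (ltr0_norm a1) in a2 *; exists ((c + 1) / a), (c / a); split; first by field; rewrite lt_eqF.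
  by move=> x /andP[h1 h2]; rewrite ler_ndivrMr// ler_ndivlMr// [x * a]mulrC h1 h2.
apply: (@le_trans _ _ (\int[lebesgue_measure]_x (\1_(`[u, v]%classic : set (measurableTypeR R)) x)%:E)%E).
  apply: int_le.
  - apply: measurable_slab_fun; last exact: measurable_funM.
    by have [/(_ N)[]] := @line_kernel R.
  - by move=> x; exact: slab_fun_ge0.
  - by apply: measurable_indic; exact: measurable_itv.
  move=> x; rewrite /slab_fun !indicE ler_nat; case: (boolP (_ \in _)) => // /set_mem[_ /= /h uxv].
  by rewrite mem_set//= in_itv.
rewrite integral_indic// setIT /= lebesgue_measure_itv/=; case: ifP => _; last by rewrite lee_fin.
have := normr_ge0 a => a0; rewrite -EFinB lee_fin uv addrAC subrr add0r invf_le1; lra.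
Qed.

Lemma int_volume (N : nat) : (0 < N)%N -> volume_le (@counting_int R) (int_box N) (3 * N%:R).
Proof.
move=> N0; rewrite /volume_le integral_counting_int; last by move=> k; exact: indic_ge0.
apply: lime_le; first by apply: is_cvg_nneseries => j _ _; rewrite lee_fin indic_ge0.
apply: nearW => K; rewrite sumEFin lee_fin big_mkord.
have E j : \1_(int_box N) (int_enum j) = (j < N.*2.+1)%:R :> R.
  rewrite indicE; congr (_%:R); congr nat_of_bool; apply/idP/idP => [/set_mem|jN].
    by rewrite /int_box/= /int_enum; case: ifP => /=; lia.
  by apply/mem_set; rewrite /int_box/= /int_enum; case: ifP => /=; lia.
under eq_bigr do rewrite E.
have -> : \sum_(j < K) (j < N.*2.+1)%:R = (minn K N.*2.+1)%:R :> R.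
  elim: K => [|K IH]; first by rewrite big_ord0 min0n.
  by rewrite big_ord_recr/= IH -natrD; congr (_%:R); lia.
by rewrite -natrM ler_nat; lia.
Qed.

(** The values of the form at distinct integers differ by at least 2, so that an interval of length
    1 contains at most one of them. *)
Lemma int_slab (N : nat) (a : R) : 2 <= `|a| ->
  slab_le (@counting_int R) (int_box N) (fun k : int => a * k%:~R) 1.
Proof.
move=> a2 c; rewrite /slab_fun; set A := _ `&` _.
have mA : measurable A by [].
rewrite /slab_fun integral_indic// setIT.
have [[k0 Ak0]|nA] := pselect (exists k, A k); last first.
  rewrite (_ : A = set0) ?measure0 ?lee_fin//.
  by apply/seteqP; split => // k Ak; apply: nA; exists k.
have c1 : @counting_int R [set k0] = 1%E.
  by rewrite /counting_int /counting asboolT// ?fset_set1 ?finmap.cardfs1//; exact: finite_set1.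
rewrite -c1; apply: le_measure; rewrite ?inE// => k Ak /=; apply/eqP; apply: contraT => kk0.
have : 1 <= `|k%:~R - k0%:~R| :> R by rewrite -intrB -intr_norm ler1z -gtz0_ge1 normr_gt0 subr_eq0.
have : `|a * (k%:~R - k0%:~R)| <= 1 by rewrite ler_norml; case: Ak Ak0 => _ /= h1 [_ /= h2]; lra.
rewrite normrM => h1 h2; have : 2 * 1 <= `|a| * `|k%:~R - k0%:~R| by apply: ler_pM.
lra.
Qed.

End Slab.

Section FrequencySlab.
Context {R : realType} {n m : nat}.
Local Notation position := (position R n m).
Local Notation frequency := (frequency R n m).
Local Notation muF := (frequency_measure R n m).
Local Notation lam := (@lebesgue_measure R).
Implicit Types (z : position) (a b : frequency).

Definition frequency_add a b : frequency :=
  (tuple_add (fun x y : measurableTypeR R => x + y) a.1 b.1, tuple_add (fun x y : int => x + y) a.2 b.2).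

Definition frequency_dot a b : R :=
  \sum_(i < n) tnth a.1 i * tnth b.1 i + \sum_(i < m) (tnth a.2 i)%:~R * (tnth b.2 i)%:~R.

Lemma frequency_shift : shift_invariant muF frequency_add.
Proof.
exact: (shift_invariant_prod (shift_invariant_power n (@line_shift_invariant R))
  (shift_invariant_power m (@int_shift_invariant R))).
Qed.

Lemma phaseD z a b : phase z (frequency_add a b) = phase z a + phase z b.
Proof.
rewrite /phase addrACA -!big_split /=; congr (_ + _); apply: eq_bigr => i _; rewrite tnth_mktuple ?intrD; ring.
Qed.

Lemma frequency_sqD a b :
  frequency_sq (frequency_add a b) = frequency_sq a + 2 * frequency_dot a b + frequency_sq b.
Proof.
have h1 : \sum_(i < n) tnth (frequency_add a b).1 i ^+ 2 =
    \sum_(i < n) tnth a.1 i ^+ 2 + 2 * \sum_(i < n) tnth a.1 i * tnth b.1 i + \sum_(i < n) tnth b.1 i ^+ 2.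
  rewrite mulr_sumr -!big_split /=; apply: eq_bigr => i _; rewrite tnth_mktuple; ring.
have h2 : \sum_(i < m) (tnth (frequency_add a b).2 i)%:~R ^+ 2 = \sum_(i < m) (tnth a.2 i)%:~R ^+ 2 +
    2 * \sum_(i < m) (tnth a.2 i)%:~R * (tnth b.2 i)%:~R + \sum_(i < m) (tnth b.2 i)%:~R ^+ 2 :> R.
  rewrite mulr_sumr -!big_split /=; apply: eq_bigr => i _; rewrite tnth_mktuple intrD; ring.
by rewrite /frequency_sq h1 h2 /frequency_dot; ring.
Qed.

Let form1 a := tuple_form (T := measurableTypeR R) id [tuple 2 * tnth a.1 i | i < n].
Let form2 a := tuple_form (T := int) (fun k => k%:~R : R) [tuple 2 * (tnth a.2 i)%:~R | i < m].

Let dotE a b : 2 * frequency_dot a b = form1 a b.1 + form2 a b.2.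
Proof.
rewrite /frequency_dot mulrDr !mulr_sumr; congr (_ + _); apply: eq_bigr => i _;
  by rewrite tnth_mktuple mulrA.
Qed.

Lemma measurable_frequency_dot a : measurable_fun setT (fun b => 2 * frequency_dot a b).
Proof.
under eq_fun do rewrite dotE; apply: measurable_funD.
  by apply: (measurableT_comp _ measurable_fst); apply: measurable_tuple_form.
by apply: (measurableT_comp _ measurable_snd); apply: measurable_tuple_form.
Qed.

Section Box.
Variable N : nat.
Hypothesis N0 : (0 < N)%N.
Local Notation V := (3 * N%:R : R).

Let V0 : 0 <= V. Proof. by rewrite mulr_ge0. Qed.
Let N1 : 1 <= N%:R :> R. Proof. by rewrite ler1n. Qed.
Let V1 : 1 <= V. Proof. by have := N1; lra. Qed.
Let mline : measurable (@line_box R N). Proof. by have [/(_ N)[]] := @line_kernel R. Qed.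
Let mint : measurable (int_box N). Proof. by []. Qed.
Let miota : measurable_fun setT (fun k : int => k%:~R : R). Proof. by []. Qed.

Lemma measurable_frequency_box : measurable (@frequency_box R n m N).
Proof. by have [/(_ N)[]] := frequency_kernel R n m. Qed.

Lemma frequency_box_volume : volume_le muF (frequency_box N) (V ^+ (n + m)).
Proof.
rewrite exprD; apply: volume_prod; rewrite ?exprn_ge0//; try exact: measurable_tuple_set.
  exact: (volume_power mline V0 (line_volume N0)).
exact: (volume_power mint V0 (@int_volume R N N0)).
Qed.

(* Slabs are thin only when [2 * a] has a coefficient of modulus at least [2]; the other [a] lie in a bounded
   box, where [2 a . b] takes few values. *)
Definition large_frequency a : Prop := (exists i, 1 <= `|tnth a.1 i|) \/ exists i, tnth a.2 i != 0.

Lemma frequency_slab a : large_frequency a ->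
  slab_le muF (frequency_box N) (fun b => 2 * frequency_dot a b) (V ^+ (n + m).-1).
Proof.
have -> : (fun b => 2 * frequency_dot a b) = (fun b => form1 a b.1 + form2 a b.2).
  by apply/funext => b; exact: dotE.
have mt1 := measurable_tuple_set (n := n) mline; have mt2 := measurable_tuple_set (n := m) mint.
have mf1 : measurable_fun setT (form1 a) by apply: measurable_tuple_form.
have mf2 : measurable_fun setT (form2 a) by apply: measurable_tuple_form.
have v1 := volume_power mline V0 (line_volume N0) n.
have v2 := volume_power mint V0 (@int_volume R N N0) m.
move=> [[i ai]|[i ai]].
  have ai2 : exists i, 2 <= `|tnth [tuple 2 * tnth a.1 i | i < n] i|.
    by exists i; rewrite tnth_mktuple normrM ger0_norm//; lra.
  have := slab_power mline (@measurable_id _ _ _) V0 (line_volume N0) (fun c : R => @line_slab R N c) ai2.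
  move=> s1; have := slab_prodl mt1 mt2 mf1 mf2 (exprn_ge0 _ V0) s1 v2; rewrite -exprD.
  have n0 : (0 < n)%N := leq_ltn_trans (leq0n i) (ltn_ord i).
  by rewrite (_ : (n.-1 + m)%N = (n + m).-1)//; lia.
have ai2 : exists i, 2 <= `|tnth [tuple 2 * (tnth a.2 i)%:~R | i < m] i : R|.
  exists i; rewrite tnth_mktuple normrM ger0_norm// ler_pMr// -intr_norm ler1z.
  by rewrite -gtz0_ge1 normr_gt0.
have := slab_power mint miota V0 (@int_volume R N N0) (fun c : R => @int_slab R N c) ai2.
move=> s2; have := slab_prodr mt1 mt2 mf1 mf2 (exprn_ge0 _ V0) s2 v1; rewrite -exprD.
have m0 : (0 < m)%N := leq_ltn_trans (leq0n i) (ltn_ord i).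
by rewrite (_ : (m.-1 + n)%N = (n + m).-1)//; lia.
Qed.

Let sum_bound k (h : 'I_k -> R) (c : R) : (forall i, `|h i| <= c) -> `|\sum_(i < k) h i| <= k%:R * c.
Proof.
move=> hc; apply: (le_trans (ler_norm_sum _ _ _)); apply: (le_trans (ler_sum _ (fun i _ => hc i))).
by rewrite sumr_const card_ord mulr_natl.
Qed.

Let box1 k a i : frequency_box k a -> `|tnth a.1 i| <= k%:R.
Proof. by move=> [h _]; exact: h. Qed.
Let box2 k a i : frequency_box k a -> `|(tnth a.2 i)%:~R| <= k%:R :> R.
Proof. by move=> [_ h]; rewrite -intr_norm -abszE -pmulrn ler_nat; exact: h. Qed.

Lemma frequency_dot_bound a b j k : frequency_box j a -> frequency_box k b ->
  `|frequency_dot a b| <= (n + m)%:R * (j%:R * k%:R).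
Proof.
move=> ja kb; rewrite natrD mulrDl (le_trans (ler_normD _ _))// lerD// sum_bound// => i;
  rewrite normrM ler_pM//; by [exact: box1|exact: box2].
Qed.

Lemma frequency_dotss a : frequency_dot a a = frequency_sq a.
Proof. by congr (_ + _); apply: eq_bigr => i _; rewrite expr2. Qed.

Lemma small_frequency_box a : ~ large_frequency a -> frequency_box 1 a.
Proof.
move=> na; split=> i.
  by rewrite /line_box /mkset/= leNgt; apply/negP => /ltW h; apply: na; left; exists i.
by rewrite /int_box /mkset/=; case: (eqVneq (tnth a.2 i) 0) => [->//|h]; case: na; right; exists i.
Qed.

(** With [d = n + m], the first term is for large [a] in the box of size [2 N], where [|u| <= |a| ^
    2 + 2 |a . b| + 1 <= 4 d N ^ 2 + 4 d N ^ 2 + 1]. The second is for [a] in the unit box, where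
    slabs may be thick but [|u| <= d + 2 d N + 1]. *)
Definition slab_weight (u : R) : R :=
  V ^+ (n + m).-1 * \1_[set u : measurableTypeR R | `|u| <= 9 * (n + m)%:R * N%:R ^+ 2] u +
  V ^+ (n + m) * \1_[set u : measurableTypeR R | `|u| <= 4 * (n + m)%:R * N%:R] u.

Lemma slab_weight_ge0 u : 0 <= slab_weight u.
Proof. by rewrite addr_ge0// mulr_ge0// ?exprn_ge0// indic_ge0. Qed.

(** The offset [u - 1 - |a| ^ 2] is chosen so that, for fixed [b], the condition on [u] is to lie in
    the unit interval that starts at [|a| ^ 2 + 2 a . b], the one that appears in
    [slice_sqmod_le]. *)
Definition resonance a (u : R) b : R :=
  slab_fun (frequency_box N) (fun b => 2 * frequency_dot a b) (u - 1 - frequency_sq a) b.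

Lemma resonanceE a u b : resonance a u b =
  \1_(frequency_box N `&` [set b | frequency_sq a + 2 * frequency_dot a b <= u <= frequency_sq a + 2 * frequency_dot a b + 1]) b.
Proof.
rewrite /resonance /slab_fun !indicE; congr (_%:R); congr nat_of_bool; apply/idP/idP => /set_mem[h1 /= h2];
  apply/mem_set; split => //=; move: h2; lra.
Qed.

(** For [u] outside the range that the size of [a] permits, no [b] of the box is resonant. Inside
    it, either the slab is thin or [a] is small and the whole box is counted. *)
Lemma resonance_weight a u : (0 < n + m)%N -> frequency_box N.*2 a ->
  (\int[muF]_b (resonance a u b)%:E <= (slab_weight u)%:E)%E.
Proof.
move=> d0 aN; have d1 : 1 <= (n + m)%:R :> R by rewrite ler1n.
set dd := (n + m)%:R in d1 *.
have zero K : (forall b, frequency_box N b -> frequency_sq a + 2 * frequency_dot a b <= u <= frequency_sq a + 2 * frequency_dot a b + 1 -> `|u| <= K) ->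
    ~ `|u| <= K -> (\int[muF]_b (resonance a u b)%:E = 0)%E.
  move=> h nu; rewrite (eq_integral (cst 0%E)) ?integral0// => b _.
  by rewrite resonanceE indicE memNset// => -[/= h1 h2]; apply: nu; exact: h h1 h2.
have [la|sa] := pselect (large_frequency a).
  have [uK|nuK] := pselect (`|u| <= 9 * dd * N%:R ^+ 2).
    apply: (le_trans (frequency_slab la _)); rewrite lee_fin /slab_weight indicE mem_set// mulr1.
    by rewrite lerDl mulr_ge0// ?exprn_ge0// indic_ge0.
  rewrite (zero _ _ nuK) ?lee_fin ?slab_weight_ge0// => b bN ub.
  have h1 := frequency_dot_bound aN bN; have h2 := frequency_dot_bound aN aN.
  rewrite frequency_dotss -/dd in h2; rewrite -/dd in h1.
  rewrite -mul2n natrM in h1 h2; move: h1 h2 ub; rewrite !ler_norml.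
  have NN : 1 <= N%:R * N%:R :> R by rewrite -[leLHS]mulr1 ler_pM.
  have dN : 1 <= dd * (N%:R * N%:R) by rewrite -[leLHS]mulr1 ler_pM.
  have -> : dd * (2 * N%:R * N%:R) = 2 * (dd * (N%:R * N%:R)) by ring.
  have -> : dd * (2 * N%:R * (2 * N%:R)) = 4 * (dd * (N%:R * N%:R)) by ring.
  have -> : 9 * dd * N%:R ^+ 2 = 9 * (dd * (N%:R * N%:R)) by rewrite expr2; ring.
  set X := dd * _ in dN *; have := frequency_sq_ge0 a; lra.
have [uK|nuK] := pselect (`|u| <= 4 * dd * N%:R).
  apply: (@le_trans _ _ (V ^+ (n + m))%:E); last first.
    rewrite lee_fin /slab_weight [X in _ + _ * X]indicE mem_set// mulr1.
    by rewrite lerDr mulr_ge0// ?exprn_ge0// indic_ge0.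
  apply: le_trans frequency_box_volume; apply: int_le.
  - by apply: measurable_slab_fun; [exact: measurable_frequency_box|exact: measurable_frequency_dot].
  - by move=> b; exact: slab_fun_ge0.
  - by apply: measurable_indic; exact: measurable_frequency_box.
  move=> b; rewrite /resonance /slab_fun !indicE ler_nat; case: (boolP (_ \in _)) => // /set_mem[bN _].
  by rewrite mem_set.
rewrite (zero _ _ nuK) ?lee_fin ?slab_weight_ge0// => b bN ub.
have a1 := small_frequency_box sa.
have h1 := frequency_dot_bound a1 bN; have h2 := frequency_dot_bound a1 a1.
rewrite frequency_dotss -/dd in h2; rewrite -/dd in h1.
move: h1 h2 ub; rewrite !ler_norml !mulr1 mul1r.
have dN : dd <= dd * N%:R by rewrite ler_peMr//; lra.
have -> : 4 * dd * N%:R = 4 * (dd * N%:R) by ring.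
set X := dd * _ in dN *; have := frequency_sq_ge0 a; lra.
Qed.

Lemma measurable_slab_weight : measurable_fun setT (slab_weight : measurableTypeR R -> R).
Proof.
have mI K : measurable [set u : measurableTypeR R | `|u| <= K].
  rewrite (_ : [set _ | _] = `[- K, K]%classic); first exact: measurable_itv.
  by apply/seteqP; split => x; rewrite /mkset/= in_itv/= ler_norml.
by apply: measurable_funD; apply: measurable_funM => //; exact: measurable_indic.
Qed.

(** Thin slabs over a long range and thick ones over a short range cost the same power of [N]. With
    [d = n + m], the constant is [18 * 3 ^ (d - 1) + 8 * 3 ^ d = 14 * 3 ^ d], times [d]. *)
Lemma integral_slab_weight : (0 < n + m)%N ->
  (\int[lam]_u (slab_weight u)%:E <= (3 ^+ (n + m) * 14 * (n + m)%:R * N%:R ^+ (n + m).+1)%:E)%E.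
Proof.
move=> d0; have mI K : measurable [set u : measurableTypeR R | `|u| <= K].
  rewrite (_ : [set _ | _] = `[- K, K]%classic); first exact: measurable_itv.
  by apply/seteqP; split => x; rewrite /mkset/= in_itv/= ler_norml.
have vol K : 0 <= K -> (\int[lam]_u (\1_[set u : measurableTypeR R | `|u| <= K] u)%:E = (2 * K)%:E)%E.
  move=> K0; rewrite integral_indic// setIT (_ : [set _ | _] = `[- K, K]%classic); last first.
    by apply/seteqP; split => x; rewrite /mkset/= in_itv/= ler_norml.
  rewrite /= lebesgue_measure_itv/= lte_fin; case: ifPn => [_|]; first by rewrite -EFinB; congr EFin; ring.
  by rewrite -leNgt => h; congr EFin; lra.
have dd0 : 0 <= (n + m)%:R :> R by [].
rewrite /slab_weight int_geD//; last 2 first.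
- by apply: measurable_funM => //; exact: measurable_indic.
- by apply: measurable_funM => //; exact: measurable_indic.
rewrite !int_geZ ?exprn_ge0//; [|exact: measurable_indic..].
rewrite !vol; [|by rewrite !mulr_ge0// ?exprn_ge0..].
rewrite -!EFinM -EFinD lee_fin.
have [d de] : exists d, (n + m)%N = d.+1 by exists (n + m).-1; lia.
rewrite de /= !exprMn !exprS; set A := 3 ^+ d; set B := N%:R ^+ d; set D := d.+1%:R.
by rewrite le_eqVlt; apply/orP; left; apply/eqP; rewrite ?expr0; ring.
Qed.

End Box.

End FrequencySlab.

(** * Averages in time *)

Section TimeAverage.
Context {R : realType}.
Local Notation I := (interval_measure 0 1 : {measure set (measurableTypeR R) -> \bar R}).

(** Fixes the range of times once and for all: for [|t| <= T0] the phases [t * x] with [x] in a unit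
    interval are too small to cancel in an average. *)
Lemma cos_half : exists2 T0 : R, 0 < T0 & forall t, `|t| <= T0 -> forall x, 0 <= x < 1 -> 1 / 2 <= cos (2 * pi * (- (t * x))).
Proof.
have /cvgrPdist_lt/(_ (1 / 2) _)[|d /= d0 hd] := @continuous_cos R 0; first by rewrite divr_gt0.
have p0 : 0 < 4 * pi :> R by rewrite mulr_gt0// pi_gt0.
exists (d / (4 * pi)); first exact: divr_gt0.
move=> t td x /andP[x0 x1].
have : `|2 * pi * (- (t * x))| < d.
  rewrite normrM normrN [`|t * x|]normrM (ger0_norm x0) ger0_norm ?mulr_ge0 ?pi_ge0//.
  apply: (@le_lt_trans _ _ (2 * pi * (d / (4 * pi)))).
    rewrite ler_wpM2l ?mulr_ge0 ?pi_ge0//; apply: le_trans td.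
    by rewrite ler_piMr// ltW.
  rewrite (_ : 2 * pi * (d / (4 * pi)) = d / 2); first by rewrite ltr_pdivrMr// ltr_pMr// ltr1n.
  have E p : p != 0 -> 2 * p * (d / (4 * p)) = d / 2 by move=> p1; field.
  by apply: E; rewrite gt_eqF// pi_gt0.
move=> h; have /hd : ball 0 d (2 * pi * - (t * x)) by rewrite /ball/= sub0r normrN.
rewrite cos0 ltr_norml => /andP[]; lra.
Qed.

(** Averaging [cis (- (t * v))] over [v] in [[u, u + 1]] multiplies its value at [u] by this number,
    which does not depend on [u] and stays away from 0 for small [t]. *)
Definition time_average (t : R) : R[i] := cintegral I (fun x => cis (- (t * x))).

Lemma cmeasurable_time_average : cmeasurable (time_average : measurableTypeR R -> R[i]).
Proof.
apply: (@cmeasurable_cintegral_section _ _ _ _ _ (interval_measure 0 1)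
  (fun p : measurableTypeR R * measurableTypeR R => cis (- (p.1 * p.2)))).
by apply: cmeasurable_cis; apply: measurableT_comp => //; exact: measurable_funM.
Qed.

Lemma time_average_ge (T0 t : R) : (forall x, 0 <= x < 1 -> 1 / 2 <= cos (2 * pi * (- (t * x)))) ->
  1 / 4 <= sqmod (time_average t).
Proof.
move=> h; have mc : measurable_fun setT (fun x : measurableTypeR R => cos (2 * pi * (- (t * x)))).
  have [] := @cmeasurable_cis R _ (measurableTypeR R) (fun x => - (t * x)) _ => //.
  by apply: measurableT_comp => //; exact: measurable_funM.
have : 1 / 2 <= Re (time_average t).
  rewrite /time_average /cintegral/= Rintegral_intervalE//.
  have c1 x : `|cos (2 * pi * (- (t * x)))| <= 1 by rewrite ler_norml cos_geN1 cos_le1.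
  have ic := @interval_bounded_integrable R 0 1 _ _ mc c1.
  have mk : measurable_fun setT (cst (1 / 2) : measurableTypeR R -> R) by exact: measurable_cst.
  have ik := @interval_bounded_integrable R 0 1 _ _ mk (fun=> lexx `|1 / 2|).
  apply: (@le_trans _ _ (\int[lebesgue_measure]_(x in `[0, 1[) (1 / 2 : R))).
    by rewrite Rintegral_cst//= lebesgue_measure_itv/= lte_fin ltr01 /= oppr0 addr0 mulr1.
  have ik' := (interval_integrable 0 1 mk).2 ik; have ic' := (interval_integrable 0 1 mc).2 ic.
  have h' x : (`[0, 1[%classic : set (measurableTypeR R)) x -> cst (1 / 2) x <= cos (2 * pi * (- (t * x))).
    by rewrite /= in_itv/=; exact: h.
  exact: (@le_Rintegral _ (measurableTypeR R) R lebesgue_measure _ (cst (1 / 2)) _ (measurable_itv _) ik' ic' h').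
move=> h1; apply: le_trans (Re_le_sqmod _); rewrite expr2.
have -> : 1 / 4 = (1 / 2) * (1 / 2) :> R by field.
by apply: ler_pM => //; lra.
Qed.

End TimeAverage.

(** * The kernel with frozen resonance *)

Section KernelBound.
Context {R : realType} {n m : nat}.
Local Notation position := (position R n m).
Local Notation frequency := (frequency R n m).
Local Notation muM := (position_measure R n m).
Local Notation muF := (frequency_measure R n m).
Local Notation lam := (@lebesgue_measure R).
Local Notation sM := (product_sigma_finite (mpower (@lebesgue_measure R) n) (mpower (@circle_measure R) m)).
Local Notation I := (interval_measure 0 1 : {measure set (measurableTypeR R) -> \bar R}).

Lemma cmeasurable_phaseN : cmeasurable (fun p : position * frequency => cis (- phase p.1 p.2)).
Proof. by have [] := position_kernel R n m. Qed.

Lemma cmeasurable_phase : cmeasurable (fun p : position * frequency => cis (phase p.1 p.2)).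
Proof.
have [_ mE _ _] := frequency_kernel R n m.
exact: (cmeasurable_comp mE (@measurable_swap _ _ _ _)).
Qed.

Section Phi.
Variables (g : position -> R[i]) (t : position -> R) (M : R) (r : nat).
Hypotheses (mg : cmeasurable g) (mt : measurable_fun setT (t : position -> measurableTypeR R)).
Hypothesis gM : forall z, cmod (g z) <= M * \1_(position_box r) z.

Definition modulated (u : R) (z : position) : R[i] := g z * cis (- (t z * u)).
(** The kernel with the resonance replaced by a free variable [u]. For fixed [u] it is the Fourier
    transform in [a] of a function of the same modulus as [g]. *)
Definition slice (a : frequency) (u : R) : R[i] := ft (modulated u) a.

Lemma cmeasurable_modulated u : cmeasurable (modulated u).
Proof.
apply: cmeasurableM => //; apply: cmeasurable_cis.
by apply: measurableT_comp => //; exact: measurable_funM.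
Qed.

Lemma modulated_bound u z : cmod (modulated u z) <= M * \1_(position_box r) z.
Proof. by rewrite cmodM cmod_cis mulr1. Qed.

Lemma g_cintegrable : cintegrable muM g.
Proof. exact: (box_cintegrable (position_kernel R n m) mg gM). Qed.

Lemma slice_N2 u : N2 muF (slice^~ u) = N2 muM g.
Proof.
have [_ _ _ P] := position_kernel R n m.
transitivity (N2 muM (modulated u)).
  exact: (P _ _ _ (cmeasurable_modulated u) (modulated_bound u)).
by apply: eq_N2 => z; rewrite sqmodM sqmod_cis mulr1.
Qed.

Lemma cmeasurable_slice : cmeasurable (fun p : frequency * measurableTypeR R => slice p.1 p.2).
Proof.
apply: (@cmeasurable_cintegral_section _ _ _ _ _ sM
  (fun q : (frequency * measurableTypeR R) * position => modulated q.1.2 q.2 * cis (- phase q.2 q.1.1))).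
apply: cmeasurableM.
  apply: cmeasurableM; first exact: (cmeasurable_comp mg measurable_snd).
  apply: cmeasurable_cis; apply: measurableT_comp => //; apply: measurable_funM.
    exact: (measurableT_comp mt measurable_snd).
  exact: (measurableT_comp measurable_snd measurable_fst).
apply: (cmeasurable_comp cmeasurable_phaseN (g := fun q : (frequency * measurableTypeR R) * position => (q.2, q.1.1))).
apply: measurable_fun_pair => //.
exact: (measurableT_comp measurable_fst measurable_fst).
Qed.

End Phi.

Section Average.
Variables (g : position -> R[i]) (t : position -> R) (M : R) (r : nat) (T0 : R).
Hypotheses (mg : cmeasurable g) (mt : measurable_fun setT (t : position -> measurableTypeR R)).
Hypothesis gM : forall z, cmod (g z) <= M * \1_(position_box r) z.
Hypothesis T0h : forall t', `|t'| <= T0 -> forall x, 0 <= x < 1 -> 1 / 2 <= cos (2 * pi * (- (t' * x))).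
Hypothesis tT : forall z, `|t z| <= T0.

(* Dividing by [time_average] compensates the average over [[u, u + 1]] in [slice_average]. *)
Definition averaged (z : position) : R[i] :=
  g z * ((sqmod (time_average (t z)) `^ (-1))%:C * (time_average (t z))^*).

Let ge4 z : 1 / 4 <= sqmod (time_average (t z)).
Proof. by apply: (time_average_ge 0); exact: T0h. Qed.

Let inv_average z : (sqmod (time_average (t z)) `^ (-1))%:C * (time_average (t z))^* * time_average (t z) = 1.
Proof.
rewrite -mulrA conjM_sqmod -rmorphM/= powR_inv1 ?sqmod_ge0// mulVf//.
by rewrite gt_eqF//; have := ge4 z; lra.
Qed.

Lemma cmeasurable_averaged : cmeasurable averaged.
Proof.
have mA : cmeasurable (fun z => time_average (t z)) by exact: (cmeasurable_comp cmeasurable_time_average mt).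
apply: cmeasurableM => //; apply: cmeasurableM; last exact: cmeasurable_conj.
apply: cmeasurable_real; apply: (measurableT_comp (measurable_powR _)).
exact: measurable_sqmod.
Qed.

Lemma sqmod_averaged z : sqmod (averaged z) <= 4 * sqmod (g z).
Proof.
rewrite /averaged sqmodM mulrC ler_wpM2r ?sqmod_ge0//.
have := congr1 sqmod (inv_average z); rewrite sqmodM sqmod1 => h.
have := ge4 z => h4; have := sqmod_ge0 ((sqmod (time_average (t z)) `^ (-1))%:C * (time_average (t z))^*) => h0.
nra.
Qed.

Lemma averaged_bound z : cmod (averaged z) <= (2 * M) * \1_(position_box r) z.
Proof.
rewrite -mulrA; apply: (@le_trans _ _ (2 * cmod (g z))); last by rewrite ler_wpM2l.
rewrite -sqmod_le_sqr ?mulr_ge0 ?cmod_ge0// exprMn cmod_sq.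
by apply: (le_trans (sqmod_averaged z)); rewrite ler_wpM2r ?sqmod_ge0//; lra.
Qed.

(** Exchanging the two integrals produces the factor [time_average (t z)] at each point, which the
    definition of [averaged] cancels. *)
Lemma slice_average a u : slice g t a u = cintegral I (fun x => slice averaged t a (u + x)).
Proof.
have mA := cmeasurable_averaged.
have [] := cintegral_fubini (m1 := sM) (m2 := interval_measure 0 1)
  (a := fun z => 2 * M * \1_(position_box r) z) (b := fun x => 1 * \1_setT x)
  (f := fun q => modulated averaged t (u + q.2) q.1 * cis (- phase q.1 a)).
- apply: cmeasurableM; last first.
    exact: (cmeasurable_comp (cmeasurable_pair2 a cmeasurable_phaseN) measurable_fst).
  apply: cmeasurableM; first exact: (cmeasurable_comp mA measurable_fst).
  apply: cmeasurable_cis; apply: measurableT_comp => //; apply: measurable_funM.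
    exact: (measurableT_comp mt measurable_fst).
  exact: measurable_funD.
- have [/(_ r)[mB fB] _ _ _] := position_kernel R n m.
  exact: integrable_indicZ.
- apply: integrable_indicZ => //.
  by rewrite [X in (X < _)%E](interval_measure_lt (@ltr01 R)) ltry.
- move=> z x; rewrite mul1r indicT mulr1 /= cmodM cmod_cis mulr1.
  by rewrite cmodM cmod_cis mulr1 averaged_bound.
move=> e1 e2; rewrite -e1 in e2; rewrite [RHS]e2; apply: eq_cintegral => z /=.
have E x : modulated averaged t (u + x) z * cis (- phase z a) =
    (averaged z * cis (- (t z * u)) * cis (- phase z a)) * cis (- (t z * x)).
  by rewrite /modulated mulrDr opprD cisD; ring.
under eq_cintegral do rewrite E.
rewrite cintegralZ; last first.
  apply: (@interval_cintegrable_bounded R 0 1 _ 1); last by move=> x; rewrite cmod_cis.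
  by apply: cmeasurable_cis; apply: measurableT_comp => //; exact: measurable_funM.
rewrite -[cintegral _ _]/(time_average (t z)) /averaged /modulated.
have := inv_average z; set w := (_ `^ _)%:C * _; set v := time_average _ => wv.
have -> : g z * w * cis (- (t z * u)) * cis (- phase z a) * v =
  g z * cis (- (t z * u)) * cis (- phase z a) * (w * v) by ring.
by rewrite wv mulr1.
Qed.

(** Cauchy-Schwarz against the constant 1 on a unit interval. A value at a single [u], which in the
    application depends on [b], becomes an integral over [u], where Plancherel's theorem can be used
    for each [u]. *)
Lemma slice_sqmod_le a u :
  ((sqmod (slice g t a u))%:E <= \int[lam]_(x in `[u, (u + 1)%R]) (sqmod (slice averaged t a x))%:E)%E.
Proof.
have mS := cmeasurable_slice cmeasurable_averaged mt.
have mSa := cmeasurable_pair1 a mS.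
have mh : measurable_fun setT (fun x : measurableTypeR R => sqmod (slice averaged t a x)).
  exact: measurable_sqmod mSa.
have mu : measurable_fun setT (fun x : measurableTypeR R => u + x : measurableTypeR R) by exact: measurable_funD.
have mSu : cmeasurable (fun x : measurableTypeR R => slice averaged t a (u + x)).
  exact: (cmeasurable_comp mSa mu).
have S2 : square_integrable I (fun x : measurableTypeR R => slice averaged t a (u + x)).
  have [mB fB] : measurable (@position_box R n m r) /\ (muM (position_box r) < +oo)%E.
    by have [/(_ r)] := position_kernel R n m.
  apply: (@interval_bounded_sqint _ _ _ _ (\int[muM]_z (2 * M * \1_(position_box r) z))) => // x.
  apply: cmod_cintegral_bound.
  - apply: cmeasurableM; first exact: cmeasurable_modulated cmeasurable_averaged mt _.
    exact: (cmeasurable_pair2 a cmeasurable_phaseN).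
  - exact: integrable_indicZ.
  - by move=> z; rewrite cmodM cmod_cis mulr1; exact: modulated_bound averaged_bound _ _.
have one : square_integrable I (fun=> 1 : R[i]).
  apply: (@interval_bounded_sqint _ _ _ _ 1); first exact: cmeasurable_cst.
  by move=> x; rewrite /cmod sqmod1 sqrtr1.
have := cauchy_schwarz_cintegral one S2; rewrite slice_average.
under eq_cintegral do rewrite mul1r.
move=> /le_trans; apply.
have -> : N2 I (fun=> 1) = 1%E.
  rewrite /N2; under eq_integral do rewrite sqmod1.
  by rewrite integral_cst// mul1e; have := interval_measure_lt (@ltr01 R); rewrite subr0.
rewrite mul1e /N2 integral_intervalE; [|exact: measurable_sqmod|by move=> x; exact: sqmod_ge0].
have E := @integral_shift R u `[u, u + 1]%classic _ (measurable_itv _) mh (fun=> sqmod_ge0 _).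
rewrite E (_ : [set x | `[u, (u + 1)%R]%classic (x + u)%R] = `[0, 1]%classic :> set (measurableTypeR R)); last first.
  by apply/seteqP; split => x; rewrite /mkset /= !in_itv/= -lerBlDr subrr addrC lerD2l.
under [leRHS]eq_integral do rewrite addrC.
apply: (@ge0_subset_integral _ _ _ lam `[0%R, 1%R[%classic `[0%R, 1%R]%classic (measurable_itv _) (measurable_itv _)).
- by apply/measurable_EFinP; apply: measurable_funTS; exact: measurable_sqmod.
- by move=> x _; rewrite lee_fin sqmod_ge0.
by move=> x /=; rewrite !in_itv/= => /andP[-> /ltW].
Qed.

End Average.

End KernelBound.

(** * The maximal estimate on a frequency box *)

Lemma box_sqint d1 d2 (T : measurableType d1) (S : measurableType d2) (R : realType)
    (mu : {measure set T -> \bar R}) (nu : {measure set S -> \bar R}) E D f (M : R) r :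
  plancherel_kernel mu nu E D -> cmeasurable f -> (forall x, cmod (f x) <= M * \1_(D r) x) ->
  square_integrable mu f.
Proof.
move=> [/(_ r)[mD Doo] _ _ _] mf fM; split => //; apply: int_ge0_lty => [x|]; first exact: sqmod_ge0.
apply: (integrable_dominated _ (integrable_indicZ (M ^+ 2) mD Doo)); first exact: measurable_sqmod.
move=> x; rewrite ger0_norm ?sqmod_ge0//; have := fM x.
rewrite indicE; case: (_ \in _); rewrite ?mulr1 ?mulr0 => fx.
  by rewrite sqmod_le_sqr//; exact: le_trans (cmod_ge0 _) fx.
by rewrite (cmod_le0 fx) sqmod0.
Qed.

(** * The kernel on pairs of frequencies *)

Section Gram.
Context {R : realType} {n m : nat}.
Local Notation position := (position R n m).
Local Notation frequency := (frequency R n m).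
Local Notation muM := (position_measure R n m).
Local Notation muF := (frequency_measure R n m).
Local Notation lam := (@lebesgue_measure R).
Local Notation sM := (product_sigma_finite (mpower (@lebesgue_measure R) n) (mpower (@circle_measure R) m)).
Local Notation sF := (product_sigma_finite (mpower (@lebesgue_measure R) n) (mpower (@counting_int R) m)).

Variables (g : position -> R[i]) (t : position -> R) (M : R) (r : nat) (T0 : R).
Hypotheses (mg : cmeasurable g) (mt : measurable_fun setT (t : position -> measurableTypeR R)).
Hypothesis gM : forall z, cmod (g z) <= M * \1_(position_box r) z.
Hypothesis T0h : forall t', `|t'| <= T0 -> forall x, 0 <= x < 1 -> 1 / 2 <= cos (2 * pi * (- (t' * x))).
Hypothesis tT : forall z, `|t z| <= T0.

Definition wave (z : position) (zeta : frequency) : R[i] := cis (phase z zeta + t z * frequency_sq zeta).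

(** The matrix, in the continuous family of waves at the times [t z], of multiplication by the test
    function [g]. *)
Definition gram (zeta zeta' : frequency) : R[i] :=
  cintegral muM (fun z => g z * ((wave z zeta)^* * wave z zeta')).

Lemma cmeasurable_wave : cmeasurable (fun p : position * frequency => wave p.1 p.2).
Proof.
have -> : (fun p : position * frequency => wave p.1 p.2) =
    (fun p => cis (phase p.1 p.2) * cis (t p.1 * frequency_sq p.2)).
  by apply/funext => p; rewrite -cisD.
apply: cmeasurableM; first exact: cmeasurable_phase.
apply: cmeasurable_cis; apply: measurable_funM; first exact: (measurableT_comp mt measurable_fst).
exact: (measurableT_comp (@measurable_frequency_sq R n m) measurable_snd).
Qed.

Lemma cmeasurable_gram : cmeasurable (fun p : frequency * frequency => gram p.1 p.2).
Proof.
apply: (@cmeasurable_cintegral_section _ _ _ _ _ sM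
  (fun q : (frequency * frequency) * position => g q.2 * ((wave q.2 q.1.1)^* * wave q.2 q.1.2))).
apply: cmeasurableM; first exact: (cmeasurable_comp mg measurable_snd).
apply: cmeasurableM.
  apply: cmeasurable_conj.
  apply: (cmeasurable_comp cmeasurable_wave (g := fun q : (frequency * frequency) * position => (q.2, q.1.1))).
  by apply: measurable_fun_pair => //; exact: (measurableT_comp measurable_fst measurable_fst).
apply: (cmeasurable_comp cmeasurable_wave (g := fun q : (frequency * frequency) * position => (q.2, q.1.2))).
by apply: measurable_fun_pair => //; exact: (measurableT_comp measurable_snd measurable_fst).
Qed.

(** The spatial phases at [b] and the terms [|b| ^ 2] cancel, so that [b] survives only through the
    resonance [|a| ^ 2 + 2 a . b]. *)
Lemma gram_shift a b : gram (frequency_add a b) b =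
  slice g t a (frequency_sq a + 2 * frequency_dot a b).
Proof.
apply: eq_cintegral => z; rewrite /modulated /wave phaseD frequency_sqD cis_conj -cisD -mulrA -cisD.
by congr (_ * cis _); ring.
Qed.

Variable N : nat.
Hypotheses (N0 : (0 < N)%N) (d0 : (0 < n + m)%N).
Local Notation B := (@frequency_box R n m N).
Local Notation S a u := (sqmod (slice (averaged g t) t a u)).
Local Notation W := (slab_weight N (n := n) (m := m)).

Let mB : measurable B := measurable_frequency_box N.

Let mS : cmeasurable (fun p : frequency * measurableTypeR R => slice (averaged g t) t p.1 p.2).
Proof. exact: cmeasurable_slice (cmeasurable_averaged mg mt) mt. Qed.

Lemma measurable_resonance a :
  measurable_fun setT (fun p : frequency * measurableTypeR R => resonance N a p.2 p.1).
Proof.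
pose A := (B `*` [set: measurableTypeR R]) `&`
  [set p : frequency * measurableTypeR R | 0 <= p.2 - (frequency_sq a + 2 * frequency_dot a p.1) <= 1].
have mA : measurable A.
  apply: measurableI; first exact: measurableX.
  have mh : measurable_fun setT (fun p : frequency * measurableTypeR R =>
      p.2 - (frequency_sq a + 2 * frequency_dot a p.1)).
    apply: measurable_funB => //; apply: measurable_funD => //.
    exact: (measurableT_comp (measurable_frequency_dot a) measurable_fst).
  have := mh measurableT _ (measurable_itv `[0, 1]); rewrite setTI.
  by congr measurable; apply/seteqP; split => p; rewrite /preimage/= in_itv.
rewrite (_ : (fun p => _) = \1_A); first exact: measurable_indic.
apply/funext => -[b u]; rewrite resonanceE !indicE; congr (_%:R); congr nat_of_bool.
apply/idP/idP => /set_mem; rewrite /A/setI/= => -[h1 h2]; apply/mem_set.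
  by split=> //=; move: h2; lra.
by case: h1 => h1 _; split => //=; move: h2; lra.
Qed.

(** Each value is bounded by an integral over the unit interval of [u] that starts at its resonance.
    After exchanging the integrals, what multiplies a given [u] is the measure of the [b] resonant
    with it. *)
Lemma gram_slice_le a : frequency_box N.*2 a ->
  (\int[muF]_b (\1_B b * sqmod (slice g t a (frequency_sq a + 2 * frequency_dot a b)))%:E <=
   \int[lam]_u (W u * S a u)%:E)%E.
Proof.
move=> aN; have mSa : measurable_fun setT (fun u : measurableTypeR R => S a u).
  exact: measurable_sqmod (cmeasurable_pair1 a mS).
pose h (p : frequency * measurableTypeR R) := resonance N a p.2 p.1 * S a p.2.
have mh : measurable_fun setT h.
  apply: measurable_funM; first exact: measurable_resonance.
  exact: (measurableT_comp mSa measurable_snd).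
have h0 p : 0 <= h p by rewrite mulr_ge0 ?sqmod_ge0// slab_fun_ge0.
apply: (@le_trans _ _ (\int[sF]_b \int[lam]_u (h (b, u))%:E)%E).
  apply: ge0_le_integral => //.
  - by move=> b _; rewrite lee_fin mulr_ge0 ?sqmod_ge0// indic_ge0.
  - apply/measurable_EFinP; apply: measurable_funM; first exact: measurable_indic.
    apply: measurable_sqmod; apply: (cmeasurable_comp (cmeasurable_pair1 a (cmeasurable_slice mg mt))).
    by apply: measurable_funD => //; exact: measurable_frequency_dot.
  - apply: (@measurable_fun_fubini_tonelli_F _ _ _ _ _ lam (fun p => (h p)%:E)).
      exact/measurable_EFinP.
    by move=> p; rewrite lee_fin.
  move=> b _; set tau := frequency_sq a + 2 * frequency_dot a b.
  rewrite indicE; case: (boolP (b \in B)) => bB; last first.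
    by rewrite mul0r integral_ge0// => u _; rewrite lee_fin.
  rewrite mul1r; apply: (le_trans (slice_sqmod_le mg mt gM T0h tT a tau)).
  rewrite integral_mkcond; apply: le_trans (lexx _); rewrite le_eqVlt; apply/orP; left; apply/eqP.
  apply: eq_integral => u _; rewrite patchE /h resonanceE mem_setE in_itv/= -/tau.
  rewrite indicE; case: ifPn => uu.
    by rewrite mem_set ?mul1r//; split => //; exact: set_mem bB.
  by rewrite memNset ?mul0r// => -[_ /= /idP]; rewrite (negbTE uu).
rewrite -(tonelli sF lam mh h0).1 (tonelli sF lam mh h0).2.
apply: ge0_le_integral => //.
- by move=> u _; apply: integral_ge0 => b _; rewrite lee_fin.
- apply: (@measurable_fun_fubini_tonelli_G _ _ _ _ _ sF (fun p => (h p)%:E)).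
    exact/measurable_EFinP.
  by move=> p; rewrite lee_fin.
- by apply/measurable_EFinP; apply: measurable_funM => //; exact: measurable_slab_weight.
move=> u _; rewrite /h/=; under eq_integral do rewrite mulrC.
rewrite int_geZ ?sqmod_ge0//; last first.
  by apply: measurable_slab_fun; [exact: mB|exact: measurable_frequency_dot].
rewrite [X in (_ <= X)%E]EFinM muleC lee_wpmul2r ?lee_fin ?sqmod_ge0//.
exact: resonance_weight.
Qed.

(** The outer 4 is the loss of [sqmod_averaged]; the rest is the bound of [integral_slab_weight]. *)
Definition gram_constant : R := 4 * (3 ^+ (n + m) * 14 * (n + m)%:R * N%:R ^+ (n + m).+1).

(** For each [u], Plancherel's theorem in [a] gives the square norm of [averaged], independent of
    [u]; only the weight remains to be integrated. *)
Lemma integral_weight_slice :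
  (\int[sF]_a \int[lam]_u (W u * S a u)%:E <= gram_constant%:E * N2 muM g)%E.
Proof.
pose h (p : frequency * measurableTypeR R) := W p.2 * S p.1 p.2.
have mh : measurable_fun setT h.
  apply: measurable_funM; last exact: measurable_sqmod mS.
  exact: (measurableT_comp (@measurable_slab_weight R n m N) measurable_snd).
have h0 p : 0 <= h p by rewrite mulr_ge0 ?sqmod_ge0// slab_weight_ge0.
rewrite -(tonelli sF lam mh h0).1 (tonelli sF lam mh h0).2 /h/=.
have mA := cmeasurable_averaged mg mt.
have g2 : square_integrable muM g := box_sqint (position_kernel R n m) mg gM.
have NA : (N2 muM (averaged g t) <= (4 * fine (N2 muM g))%:E)%E.
  rewrite EFinM fineK ?square_integrable_fin// /N2 -int_geZ//; last 2 first.
  - exact: measurable_sqmod.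
  - by move=> z; exact: sqmod_ge0.
  apply: int_le.
  - exact: measurable_sqmod.
  - by move=> z; exact: sqmod_ge0.
  - by apply: measurable_funM => //; exact: measurable_sqmod.
  by move=> z; exact: sqmod_averaged T0h tT z.
apply: (@le_trans _ _ (\int[lam]_u ((4 * fine (N2 muM g)) * W u)%:E)%E); last first.
  rewrite int_geZ//; last 3 first.
  - by rewrite mulr_ge0// fine_ge0// N2_ge0.
  - exact: measurable_slab_weight.
  - by move=> u; exact: slab_weight_ge0.
  rewrite /gram_constant -[X in (_ <= _ * X)%E](fineK (square_integrable_fin g2)) -EFinM.
  apply: (@le_trans _ _ ((4 * fine (N2 muM g))%:E * (3 ^+ (n + m) * 14 * (n + m)%:R * N%:R ^+ (n + m).+1)%:E)%E).
    by apply: lee_wpmul2l; [rewrite lee_fin mulr_ge0// fine_ge0// N2_ge0|exact: integral_slab_weight].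
  by rewrite -EFinM lee_fin; set x := fine _; rewrite le_eqVlt; apply/orP; left; apply/eqP; ring.
apply: ge0_le_integral => //.
- by move=> u _; apply: integral_ge0 => b _; rewrite lee_fin; exact: (h0 (b, u)).
- apply: (@measurable_fun_fubini_tonelli_G _ _ _ _ _ sF (fun p => (h p)%:E)).
    exact/measurable_EFinP.
  by move=> p; rewrite lee_fin.
- by apply/measurable_EFinP; apply: measurable_funM => //; exact: measurable_slab_weight.
move=> u _; have mSu : measurable_fun setT (fun a => S a u).
  exact: measurable_sqmod (cmeasurable_pair2 u mS).
rewrite int_geZ//; last 2 first.
- exact: slab_weight_ge0.
- by move=> a; exact: sqmod_ge0.
rewrite [_ * W u]mulrC EFinM; apply: lee_wpmul2l; first by rewrite lee_fin slab_weight_ge0.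
apply: le_trans NA; rewrite le_eqVlt; apply/orP; left; apply/eqP.
exact: (slice_N2 mA mt (averaged_bound gM T0h tT) u).
Qed.

Definition gram_window (p : frequency * frequency) : R := \1_B p.1 * \1_B p.2 * sqmod (gram p.1 p.2).

Lemma measurable_gram_window : measurable_fun setT gram_window.
Proof.
apply: measurable_funM; last exact: measurable_sqmod cmeasurable_gram.
by apply: measurable_funM; apply: measurableT_comp => //; exact: measurable_indic.
Qed.

Lemma gram_window_ge0 p : 0 <= gram_window p.
Proof. by rewrite !mulr_ge0 ?sqmod_ge0// indic_ge0. Qed.

(** Translation of the first frequency by the second turns a pair into its difference [a] and a base
    point [b], the coordinates in which the kernel is a slice. *)
Theorem gram_bound :
  (\int[(sF \x sF)%E]_p (gram_window p)%:E <= gram_constant%:E * N2 muM g)%E.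
Proof.
have mG := measurable_gram_window; have G0 := gram_window_ge0.
rewrite (tonelli sF sF mG G0).2; have [madd shift] := @frequency_shift R n m.
pose h (p : frequency * frequency) := gram_window (frequency_add p.1 p.2, p.2).
have mh : measurable_fun setT h.
  exact: (measurableT_comp mG (measurable_fun_pair madd measurable_snd)).
have h0 p : 0 <= h p by exact: G0.
have -> : (\int[sF]_b \int[sF]_a (gram_window (a, b))%:E = \int[sF]_b \int[sF]_a (h (a, b))%:E)%E.
  apply: eq_integral => b _; apply: (shift b (fun a => gram_window (a, b))) => [|a]; last exact: G0.
  by apply: (measurableT_comp mG); exact: measurable_fun_pair.
rewrite -(tonelli sF sF mh h0).2 (tonelli sF sF mh h0).1.
apply: le_trans integral_weight_slice; apply: ge0_le_integral => //.
- by move=> a _; apply: integral_ge0 => b _; rewrite lee_fin.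
- apply: (@measurable_fun_fubini_tonelli_F _ _ _ _ _ sF (fun p => (h p)%:E)).
    exact/measurable_EFinP.
  by move=> p; rewrite lee_fin.
- apply: (@measurable_fun_fubini_tonelli_F _ _ _ _ _ lam (fun p => (W p.2 * S p.1 p.2)%:E)).
    apply/measurable_EFinP; apply: measurable_funM; last exact: measurable_sqmod mS.
    exact: (measurableT_comp (@measurable_slab_weight R n m N) measurable_snd).
  by move=> p; rewrite lee_fin mulr_ge0 ?sqmod_ge0// slab_weight_ge0.
(* A difference of two points of the box of size [N] lies in the box of size [2 N]; for any other
   [a] the integrand vanishes. *)
move=> a _; have [aN|aN] := pselect (frequency_box N.*2 a); last first.
  rewrite (eq_integral (cst 0%E)); last first.
    move=> b _; rewrite /h /gram_window/= !indicE.
    case: (boolP (_ \in B)) => [/set_mem h1|]; last by rewrite !mul0r.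
    case: (boolP (_ \in B)) => [/set_mem h2|]; last by rewrite mulr0 mul0r.
    case: aN; split => i.
      have := h1.1 i; have := h2.1 i; rewrite /line_box /mkset/= tnth_mktuple -mul2n natrM => k2 k1.
      rewrite (_ : tnth a.1 i = (tnth a.1 i + tnth b.1 i) - tnth b.1 i); last by rewrite addrK.
      by rewrite (le_trans (ler_normB _ _))//; lra.
    have k1 : (absz (tnth a.2 i + tnth b.2 i)%R <= N)%N by have := h1.2 i; rewrite /int_box /mkset/= tnth_mktuple.
    have k2 : (absz (tnth b.2 i) <= N)%N := h2.2 i.
    change ((absz (tnth a.2 i) <= N.*2)%N); lia.
  rewrite integral0 integral_ge0// => u _; rewrite lee_fin mulr_ge0 ?sqmod_ge0// slab_weight_ge0.
  by [].
apply: le_trans (gram_slice_le aN); apply: int_le.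
- by apply: (measurableT_comp mh); exact: measurable_fun_pair.
- by move=> b; exact: h0.
- apply: measurable_funM; first exact: measurable_indic.
  apply: measurable_sqmod; apply: (cmeasurable_comp (cmeasurable_pair1 a (cmeasurable_slice mg mt))).
  by apply: measurable_funD => //; exact: measurable_frequency_dot.
move=> b; rewrite /h /gram_window/= gram_shift ler_wpM2r ?sqmod_ge0//.
by rewrite ler_piMl ?indic_ge0// indicE; case: (_ \in _).
Qed.

End Gram.

Section Tensor.
Context {d1 d2} {T1 : measurableType d1} {T2 : measurableType d2} {R : realType}.
Variables (m1 : {sigma_finite_measure set T1 -> \bar R}) (m2 : {sigma_finite_measure set T2 -> \bar R}).

Lemma cmeasurable_tensor (f1 : T1 -> R[i]) (f2 : T2 -> R[i]) : cmeasurable f1 -> cmeasurable f2 ->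
  cmeasurable (fun p : T1 * T2 => f1 p.1 * f2 p.2).
Proof.
by move=> h1 h2; apply: cmeasurableM; [exact: (cmeasurable_comp h1 measurable_fst)|exact: (cmeasurable_comp h2 measurable_snd)].
Qed.

Lemma cintegral_tensor (f1 : T1 -> R[i]) (f2 : T2 -> R[i]) : cintegrable m1 f1 -> cintegrable m2 f2 ->
  cintegral (m1 \x m2)%E (fun p => f1 p.1 * f2 p.2) = cintegral m1 f1 * cintegral m2 f2.
Proof.
move=> i1 i2.
have [|e1 _] := cintegral_fubini (cmeasurable_tensor (cintegrable_cmeasurable i1) (cintegrable_cmeasurable i2))
  (cintegrable_cmod i1) (cintegrable_cmod i2); first by move=> x y; rewrite cmodM.
rewrite -e1 mulrC -cintegralZ//; apply: eq_cintegral => x.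
by rewrite /= cintegralZ// mulrC.
Qed.

Lemma N2_tensor (f1 : T1 -> R[i]) (f2 : T2 -> R[i]) : square_integrable m1 f1 -> square_integrable m2 f2 ->
  square_integrable (m1 \x m2)%E (fun p => f1 p.1 * f2 p.2).
Proof.
move=> i1 i2; have mt := cmeasurable_tensor i1.1 i2.1; split=> //.
apply: int_ge0_lty => [p|]; first exact: sqmod_ge0.
have := integrable_tensor (square_integrable_int i1) (square_integrable_int i2).
by congr (_.-integrable _ _); apply/funext => p; rewrite /= sqmodM.
Qed.

End Tensor.

(** * Duality and the maximal function over finitely many times *)

Section Maximal.
Context {R : realType} {n m : nat}.
Local Notation position := (position R n m).
Local Notation frequency := (frequency R n m).
Local Notation muM := (position_measure R n m).
Local Notation muF := (frequency_measure R n m).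
Local Notation sM := (product_sigma_finite (mpower (@lebesgue_measure R) n) (mpower (@circle_measure R) m)).
Local Notation sF := (product_sigma_finite (mpower (@lebesgue_measure R) n) (mpower (@counting_int R) m)).
Local Notation sFF := (product_sigma_finite sF sF).

Variables (T0 : R) (e : nat -> frequency -> R[i]) (phi : frequency -> R[i]) (beta : R) (N : nat).
Hypothesis T0h : forall t', `|t'| <= T0 -> forall x, 0 <= x < 1 -> 1 / 2 <= cos (2 * pi * (- (t' * x))).
Hypothesis e2 : forall j, square_integrable muF (e j).
Hypothesis eo : forall i j, cintegral muF (fun x => (e i x)^* * e j x) = (i == j)%:R.
Hypotheses (mphi : cmeasurable phi) (beta0 : 0 < beta) (N0 : (0 < N)%N) (d0 : (0 < n + m)%N).
Hypothesis phib : forall x, cmod (phi x) <= beta * \1_(@frequency_box R n m N) x.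

Definition piece j (x : frequency) : R[i] := phi x * e j x.

Lemma piece_cintegrable j : cintegrable muF (piece j).
Proof.
have [mB fB] : measurable (@frequency_box R n m N) /\ (muF (frequency_box N) < +oo)%E.
  by have [/(_ N)] := frequency_kernel R n m.
have ci := sqint_cut_cintegrable mB fB (e2 j).
apply: (cintegrable_le (g := fun x => beta * cmod (ctrunc (frequency_box N) (e j) x))).
- by apply: cmeasurableM => //; case: (e2 j).
- by apply: eq_integrable (integrableZl measurableT beta (cintegrable_cmod ci)).
move=> x; rewrite /piece cmodM cutE; have := phib x; rewrite indicE.
case: (_ \in _); rewrite ?mulr1 ?mulr0 => h; first by rewrite ler_wpM2r ?cmod_ge0.
by rewrite (cmod_le0 h) cmod0 mul0r mulr0.
Qed.

(** The localization in frequency makes the integral converge absolutely, so that the solution has a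
    value at every point and every time, not just as a class. *)
Definition evolved (tau : R) j (z : position) : R[i] :=
  cintegral muF (fun x => cis (phase z x + tau * frequency_sq x) * piece j x).

Lemma evolved_bound tau j z : cmod (evolved tau j z) <= \int[muF]_x cmod (piece j x).
Proof.
apply: cmod_cintegral_bound; [|exact: cintegrable_cmod (piece_cintegrable j)|]; last first.
  by move=> x; rewrite cmodM cmod_cis mul1r.
apply: cmeasurableM; last exact: cintegrable_cmeasurable (piece_cintegrable j).
exact: (cmeasurable_pair1 z (cmeasurable_wave (t := fun=> tau) (measurable_cst tau))).
Qed.

Section Linearized.
Variable (t : position -> R).
Hypotheses (mt : measurable_fun setT (t : position -> measurableTypeR R)) (tT : forall z, `|t z| <= T0).

Let D j z := evolved (t z) j z.

Lemma cmeasurable_linearized j : cmeasurable (D j).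
Proof.
apply: (@cmeasurable_cintegral_section _ _ _ _ _ sF (fun p : position * frequency => wave t p.1 p.2 * piece j p.2)).
apply: cmeasurableM; first exact: cmeasurable_wave.
exact: (cmeasurable_comp (cintegrable_cmeasurable (piece_cintegrable j)) measurable_snd).
Qed.

Variables (g : position -> R) (M : R) (r : nat).
Hypotheses (mg : measurable_fun setT g) (gM : forall z, cmod (g z)%:C <= M * \1_(position_box r) z).
Local Notation gc := (fun z => (g z)%:C).
Local Notation G := (fun p : frequency * frequency => (phi p.1)^* * phi p.2 * gram gc t p.1 p.2).

Let mgc : cmeasurable gc. Proof. exact: cmeasurable_real. Qed.

Let mwave z : cmeasurable (fun x => wave t z x).
Proof. exact: (cmeasurable_pair1 z (cmeasurable_wave mt)). Qed.

(** Writing the square modulus as a double integral over frequencies and integrating over positions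
    first leaves [gram], paired with the tensor product of [e j] and its conjugate. *)
Lemma gram_identity j : cintegral muM (fun z => (g z)%:C * ((D j z)^* * D j z)) =
  cintegral (sF \x sF)%E (fun p => (e j p.1 * (e j p.2)^*)^* * G p).
Proof.
have pi_ := piece_cintegrable j; have mp := cintegrable_cmeasurable pi_.
have wi z : cintegrable muF (fun x => wave t z x * piece j x).
  apply: (cintegrable_le _ (cintegrable_cmod pi_)) => [|x]; last by rewrite cmodM cmod_cis mul1r.
  exact: cmeasurableM.
have [||||e1 e2'] := cintegral_fubini (m1 := sM) (m2 := sFF) (a := fun z => cmod (g z)%:C)
  (b := fun p => cmod (piece j p.1) * cmod (piece j p.2))
  (f := fun q => (g q.1)%:C * ((wave t q.1 q.2.1 * piece j q.2.1)^* * (wave t q.1 q.2.2 * piece j q.2.2))).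
- apply: cmeasurableM; first exact: (cmeasurable_comp mgc measurable_fst).
  have m1 : measurable_fun setT (fun q : position * (frequency * frequency) => (q.1, q.2.1)).
    by apply: measurable_fun_pair => //; exact: (measurableT_comp measurable_fst measurable_snd).
  have m2 : measurable_fun setT (fun q : position * (frequency * frequency) => (q.1, q.2.2)).
    by apply: measurable_fun_pair => //; exact: (measurableT_comp measurable_snd measurable_snd).
  have mw : cmeasurable (fun q : position * frequency => wave t q.1 q.2 * piece j q.2).
    apply: cmeasurableM; first exact: cmeasurable_wave.
    exact: (cmeasurable_comp mp measurable_snd).
  apply: cmeasurableM; last exact: (cmeasurable_comp mw m2).
  by apply: cmeasurable_conj; exact: (cmeasurable_comp mw m1).
- exact: (cintegrable_cmod (g_cintegrable mgc gM)).
- exact: (@integrable_tensor _ _ _ _ _ sF sF _ _ (cintegrable_cmod pi_) (cintegrable_cmod pi_)).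
- by move=> z p /=; rewrite !cmodM cmod_conj !cmodM !cmod_cis !mul1r.
transitivity (cintegral sM (fun z => cintegral sFF (fun p =>
    (g z)%:C * ((wave t z p.1 * piece j p.1)^* * (wave t z p.2 * piece j p.2))))).
  apply: eq_cintegral => z; rewrite cintegralZ; last first.
    have := @integrable_tensor _ _ _ _ _ sF sF _ _ (cintegrable_cmod pi_) (cintegrable_cmod pi_).
    move=> /(cintegrable_le _); apply; last by move=> p; rewrite !cmodM cmod_conj !cmodM !cmod_cis !mul1r.
    exact: (cmeasurable_tensor (cmeasurable_conj (cintegrable_cmeasurable (wi z))) (cintegrable_cmeasurable (wi z))).
  congr (_ * _); rewrite [RHS](@cintegral_tensor _ _ _ _ _ sF sF _ _ (cintegrable_conj (wi z)) (wi z)).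
  by rewrite (cintegral_conj (wi z)).
rewrite [LHS]e1 -e2'; apply: eq_cintegral => p /=.
rewrite /gram -cintegralZ; last first.
  apply: (cintegrable_le (g := fun z => cmod (g z)%:C)).
  - apply: cmeasurableM => //; apply: cmeasurableM; first apply: cmeasurable_conj;
      exact: (cmeasurable_pair2 _ (cmeasurable_wave mt)).
  - exact: (cintegrable_cmod (g_cintegrable mgc gM)).
  - by move=> z; rewrite !cmodM cmod_conj !cmod_cis !mulr1.
rewrite -cintegralZ; last first.
  apply: cintegrableZ; apply: (cintegrable_le (g := fun z => cmod (g z)%:C)).
  - apply: cmeasurableM => //; apply: cmeasurableM; first apply: cmeasurable_conj;
      exact: (cmeasurable_pair2 _ (cmeasurable_wave mt)).
  - exact: (cintegrable_cmod (g_cintegrable mgc gM)).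
  - by move=> z; rewrite !cmodM cmod_conj !cmod_cis !mulr1.
apply: eq_cintegral => z; rewrite /piece !rmorphM/= conjCK; ring.
Qed.

(** The symbol enters once for each of the two frequencies and is squared by the norm, hence
    [beta ^ 4]. *)
Lemma gram_weighted_N2 : (N2 (sF \x sF)%E G <= (beta ^+ 4 * gram_constant N (R := R) (n := n) (m := m))%:E * N2 muM gc)%E.
Proof.
have mG : cmeasurable G.
  apply: cmeasurableM; last exact: (cmeasurable_gram mgc mt).
  exact: (cmeasurable_tensor (cmeasurable_conj mphi) mphi).
have b4 : 0 <= beta ^+ 4 by rewrite exprn_ge0// ltW.
rewrite EFinM -muleA; apply: (@le_trans _ _ (beta%:E ^+ 4 * \int[(sF \x sF)%E]_p (gram_window gc t N p)%:E)%E); last first.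
  by rewrite -EFin_expe; apply: lee_wpmul2l => //; exact: (gram_bound mgc mt gM T0h tT N0 d0).
rewrite -EFin_expe -int_geZ//; last 2 first.
- exact: (measurable_gram_window mgc mt).
- by move=> p; exact: gram_window_ge0.
apply: int_le.
- exact: measurable_sqmod.
- by move=> p; exact: sqmod_ge0.
- by apply: measurable_funM => //; exact: (measurable_gram_window mgc mt).
move=> [x y] /=; rewrite !sqmodM sqmod_conj /gram_window/= mulrA ler_wpM2r ?sqmod_ge0//.
have sq w : sqmod (phi w) <= beta ^+ 2 * \1_(@frequency_box R n m N) w.
  have := phib w; rewrite indicE; case: (_ \in _); rewrite ?mulr1 ?mulr0 => h.
    by rewrite sqmod_le_sqr// ltW.
  by rewrite (cmod_le0 h) sqmod0.
rewrite (_ : beta ^+ 4 * _ = (beta ^+ 2 * \1_(@frequency_box R n m N) x) * (beta ^+ 2 * \1_(@frequency_box R n m N) y)).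
  by apply: ler_pM; rewrite ?sqmod_ge0.
ring.
Qed.

Let E j (p : frequency * frequency) := e j p.1 * (e j p.2)^*.

Let E2 j : square_integrable (sF \x sF)%E (E j).
Proof. exact: (@N2_tensor _ _ _ _ _ sF sF _ _ (e2 j) (square_integrable_conj (e2 j))). Qed.

(** The inner product of two such tensors is the product of [<e i, e j>] and [<e j, e i>].
    Orthonormality of the tensors is what permits Bessel's inequality in the space of pairs. *)
Let Eo : orthonormal_seq (fun j => L2of (sF \x sF)%E (E j)).
Proof.
move=> i j; rewrite (L2_innerof (E2 i) (E2 j)).
have -> : (fun p => (E i p)^* * E j p) =
    (fun p => ((e i p.1)^* * e j p.1) * ((e j p.2)^* * e i p.2)).
  by apply/funext => p; rewrite /E rmorphM/= conjCK; ring.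
rewrite (@cintegral_tensor _ _ _ _ _ sF sF _ _ (cintegrableJM (e2 i) (e2 j)) (cintegrableJM (e2 j) (e2 i))).
by rewrite [cintegral _ _]eo [X in _ * X]eo [j == i]eq_sym -natrM mulnb andbb.
Qed.

Lemma gram_bessel J : ((\sum_(j < J) sqmod (cintegral muM (fun z => (g z)%:C * ((D j z)^* * D j z))))%:E <=
  (beta ^+ 4 * gram_constant N (R := R) (n := n) (m := m))%:E * N2 muM gc)%E.
Proof.
have mG : cmeasurable G.
  apply: cmeasurableM; last exact: (cmeasurable_gram mgc mt).
  exact: (cmeasurable_tensor (cmeasurable_conj mphi) mphi).
have g2 : square_integrable muM gc := box_sqint (position_kernel R n m) mgc gM.
have G2 : square_integrable (sF \x sF)%E G.
  split=> //; apply: (le_lt_trans gram_weighted_N2).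
  by rewrite -(fineK (square_integrable_fin g2)) -EFinM ltry.
apply: le_trans gram_weighted_N2; rewrite -(nsq_L2of G2) lee_fin.
apply: le_trans (bessel_ineq (orthonormal_orthounit Eo) (L2of (sF \x sF)%E G) J).
by apply: ler_sum => j _; rewrite (L2_innerof (E2 j) G2) gram_identity.
Qed.

End Linearized.

Local Notation K := (beta ^+ 4 * gram_constant N (R := R) (n := n) (m := m)).

Lemma gram_constant_gt0 : 0 < gram_constant N (R := R) (n := n) (m := m).
Proof. by rewrite /gram_constant !mulr_gt0 ?exprn_gt0 ?ltr0n. Qed.

Variables (l : nat -> R) (ts : nat -> R).
Hypotheses (l0 : forall j, 0 <= l j) (tsT : forall k, `|ts k| <= T0).

Definition energy J (tau : R) (z : position) : R := \sum_(j < J) l j * sqmod (evolved tau j z).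

Lemma energy_ge0 J tau z : 0 <= energy J tau z.
Proof. by apply: sumr_ge0 => j _; rewrite mulr_ge0// sqmod_ge0. Qed.

Lemma energy_mono J tau z : energy J tau z <= energy J.+1 tau z.
Proof. by rewrite /energy big_ord_recr/= lerDl mulr_ge0// sqmod_ge0. Qed.

Section LinearizedBound.
Variables (t : position -> R) (J : nat).
Hypotheses (mt : measurable_fun setT (t : position -> measurableTypeR R)) (tT : forall z, `|t z| <= T0).
Local Notation S := (fun z => energy J (t z) z).
Local Notation D := (fun j z => evolved (t z) j z).

Let mD j : cmeasurable (D j). Proof. exact: cmeasurable_linearized. Qed.

Lemma measurable_linearized : measurable_fun setT S.
Proof.
by apply: measurable_sum => j; apply: measurable_funM => //; exact: measurable_sqmod.
Qed.

(** The density is tested against its own restriction [g] to a box, so that [I], the square norm of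
    [g], equals the sum of [l j * Re (c j)]. The restriction makes [g] bounded and [I] finite, and
    [I] can then be absorbed in the left-hand side. *)
Let local_bound r : (\int[muM]_z ((S z * \1_(position_box r) z) ^+ 2)%:E <= (K * \sum_(j < J) l j ^+ 2)%:E)%E.
Proof.
pose g z := S z * \1_(position_box r) z.
pose C j := (\int[muF]_x cmod (piece j x)).
have DC j z : cmod (D j z) <= C j by exact: evolved_bound.
pose M := \sum_(j < J) l j * C j ^+ 2.
have SM z : S z <= M.
  apply: ler_sum => j _; rewrite ler_wpM2l// sqmod_le_sqr//.
  exact: le_trans (cmod_ge0 _) (DC j z).
have mbox : measurable (@position_box R n m r) by have [/(_ r)[]] := position_kernel R n m.
have mg : measurable_fun setT g.
  by apply: measurable_funM; [exact: measurable_linearized|exact: measurable_indic].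
have gM z : cmod (g z)%:C <= M * \1_(position_box r) z.
  rewrite cmod_real ger0_norm; last by rewrite mulr_ge0 ?energy_ge0// indic_ge0.
  by rewrite ler_wpM2r// indic_ge0.
have g2 : square_integrable muM (fun z => (g z)%:C) := box_sqint (position_kernel R n m) (cmeasurable_real mg) gM.
pose c j := cintegral muM (fun z => (g z)%:C * ((D j z)^* * D j z)).
have K0 : 0 < K by rewrite mulr_gt0 ?exprn_gt0// gram_constant_gt0.
have -> : (\int[muM]_z ((S z * \1_(position_box r) z) ^+ 2)%:E = N2 muM (fun z => (g z)%:C))%E.
  by apply: eq_integral => z _; rewrite sqmod_real.
rewrite -(fineK (square_integrable_fin g2)) lee_fin; set I := fine _.
have bes : \sum_(j < J) sqmod (c j) <= K * I.
  have := gram_bessel mt tT mg gM J.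
  by rewrite -(fineK (square_integrable_fin g2)) -EFinM lee_fin.
have ci j : cintegrable muM (fun z => (g z)%:C * ((D j z)^* * D j z)).
  apply: (cintegrable_le (g := fun z => (C j ^+ 2) * cmod (g z)%:C)).
  - apply: cmeasurableM; first exact: cmeasurable_real.
    by apply: cmeasurableM => //; exact: cmeasurable_conj.
  - have gi := cintegrable_cmod (g_cintegrable (cmeasurable_real mg) gM).
    by apply: eq_integrable (integrableZl measurableT (C j ^+ 2) gi).
  move=> z; rewrite !cmodM cmod_conj mulrC ler_wpM2r ?cmod_ge0// expr2.
  by apply: ler_pM; rewrite ?cmod_ge0.
have IE : I = \sum_(j < J) l j * Re (c j).
  have -> : I = Re (cintegral muM (fun z => \sum_(j < J) (l j)%:C * ((g z)%:C * ((D j z)^* * D j z)))).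
    rewrite /I /N2 /cintegral/= /Rintegral; congr fine; apply: eq_integral => z _; congr EFin.
    rewrite sqmod_real cRe_sum expr2 {1}/g mulrAC -mulrA -/(g z).
    have -> : g z * \1_(position_box r) z = g z.
      by rewrite /g -mulrA; congr (_ * _); rewrite indicE -natrM mulnb andbb.
    rewrite mulr_suml; apply: eq_bigr => j _.
    by rewrite conjM_sqmod -!rmorphM/=; ring.
  rewrite cintegral_sum => [|j]; last exact/cintegrableZ/ci.
  rewrite cRe_sum; apply: eq_bigr => j _; rewrite cintegralZ//.
  by rewrite -/(c j) !ReImE mul0r subr0.
(* The inequality of means with weight [K]: the sum of the [sqmod (c j)], which is at most [K * I],
   then costs exactly one of the two copies of [I]. *)
have le2 : 2 * I <= K * (\sum_(j < J) l j ^+ 2) + K^-1 * \sum_(j < J) sqmod (c j).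
  rewrite IE !mulr_sumr -big_split/=; apply: ler_sum => j _.
  have h := Re_le_sqmod (c j); set x := Re (c j) in h *; set y := l j.
  apply: (@le_trans _ _ (K * y ^+ 2 + K^-1 * x ^+ 2)); last by rewrite lerD2l ler_wpM2l// invr_ge0 ltW.
  rewrite -subr_ge0; have -> : K * y ^+ 2 + K^-1 * x ^+ 2 - 2 * (y * x) = K^-1 * (K * y - x) ^+ 2.
    have E k : k != 0 -> k * y ^+ 2 + k^-1 * x ^+ 2 - 2 * (y * x) = k^-1 * (k * y - x) ^+ 2.
      by move=> k0; field.
    by apply: E; rewrite gt_eqF.
  by rewrite mulr_ge0 ?sqr_ge0// invr_ge0 ltW.
have : K^-1 * \sum_(j < J) sqmod (c j) <= I.
  by rewrite ler_pdivrMl.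
by move: le2; set a := K * _; lra.
Qed.

Lemma linearized_bound : (\int[muM]_z ((S z) ^+ 2)%:E <= (K * \sum_(j < J) l j ^+ 2)%:E)%E.
Proof.
have mS := measurable_linearized.
apply: (@fatou_le _ _ _ muM (fun r z => (S z * \1_(position_box r) z) ^+ 2)).
- move=> r; apply: measurable_funX; apply: measurable_funM => //; apply: measurable_indic.
  by have [/(_ r)[]] := position_kernel R n m.
- exact: measurable_funX.
- by move=> r z; exact: sqr_ge0.
- by move=> z; exact: sqr_ge0.
- apply: aeW => z; apply/cvgnP => eps eps0; have [N' hN] := position_box_cover z; exists N' => k Nk.
  rewrite indicE mem_set ?mulr1 ?subrr ?normr0//.
  exact: (position_box_mono Nk hN).
exact: local_bound.
Qed.

End LinearizedBound.

(** An explicit maximizer among the first [k + 1] times, built by successive comparisons of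
    measurable functions; its measurability needs no selection theorem. *)
Fixpoint best_time J k : position -> R :=
  if k is k'.+1 then
    fun z => if energy J (best_time J k' z) z < energy J (ts k) z then ts k else best_time J k' z
  else fun=> ts 0.

Lemma best_time_bound J k z : `|best_time J k z| <= T0.
Proof. by elim: k => [|k IH] /=; [exact: tsT|case: ifP]. Qed.

Lemma measurable_best_time J k : measurable_fun setT (best_time J k : position -> measurableTypeR R).
Proof.
elim: k => [|k IH]; first exact: measurable_cst.
apply: measurable_fun_ifT => //.
by apply: measurable_fun_ltr; apply: measurable_linearized.
Qed.

Lemma best_time_ge J k i z : (i <= k)%N -> energy J (ts i) z <= energy J (best_time J k z) z.
Proof.
elim: k => [|k IH]; first by rewrite leqn0 => /eqP ->.
rewrite leq_eqVlt => /predU1P[->|]; rewrite /=; first by case: ltrP.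
by rewrite ltnS => /IH h; case: ltrP => // /ltW; exact: le_trans.
Qed.

Lemma best_time_attained J k z : exists2 i, (i <= k)%N & best_time J k z = ts i.
Proof.
elim: k => [|k [i ik h]]; first by exists 0%N.
rewrite /=; case: ifP => _; first by exists k.+1.
by exists i => //; exact: leqW.
Qed.

(** One index counts both the functions and the times, so that a single monotone limit reaches all
    of them. *)
Definition maximal_energy J z : R := energy J (best_time J J z) z.

Lemma maximal_energy_ge J i z : (i <= J)%N -> energy J (ts i) z <= maximal_energy J z.
Proof. exact: best_time_ge. Qed.

Lemma maximal_energy_ge0 J z : 0 <= maximal_energy J z.
Proof. exact: energy_ge0. Qed.

(** An additional function increases the energy, and the time chosen at stage [J] is still a
    candidate at stage [J + 1]. *)
Lemma maximal_energy_mono J z : maximal_energy J z <= maximal_energy J.+1 z.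
Proof.
rewrite /maximal_energy; have [i iJ ->] := best_time_attained J J z.
by apply: (le_trans (energy_mono _ _ _)); apply: best_time_ge; exact: leqW.
Qed.

Lemma measurable_maximal_energy J : measurable_fun setT (maximal_energy J).
Proof. by apply: measurable_linearized; exact: measurable_best_time. Qed.

Theorem maximal_bound J :
  (\int[muM]_z ((maximal_energy J z) ^+ 2)%:E <= (K * \sum_(j < J) l j ^+ 2)%:E)%E.
Proof. by apply: linearized_bound; [exact: measurable_best_time|move=> z; exact: best_time_bound]. Qed.

End Maximal.

(** * Littlewood-Paley decomposition *)

Section WeightedSum.
Context {R : realType}.

(** After clearing denominators, the difference of the two sides is the square modulus of
    [q x - p y]. *)
Lemma sqmodD_weighted (x y : R[i]) (p q : R) : 0 < p -> 0 < q ->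
  sqmod (x + y) <= (p + q) * (sqmod x / p + sqmod y / q).
Proof.
move=> p0 q0; rewrite -(ler_pM2l (mulr_gt0 p0 q0)).
have -> : p * q * ((p + q) * (sqmod x / p + sqmod y / q)) = (p + q) * (q * sqmod x + p * sqmod y).
  by field; rewrite !gt_eqF.
rewrite -subr_ge0; case: x y => [a b] [c d]; rewrite /sqmod/=.
have -> : (p + q) * (q * (a ^+ 2 + b ^+ 2) + p * (c ^+ 2 + d ^+ 2)) - p * q * ((a + c) ^+ 2 + (b + d) ^+ 2) =
  (q * a - p * c) ^+ 2 + (q * b - p * d) ^+ 2 by ring.
by rewrite addr_ge0 ?sqr_ge0.
Qed.

(* Replaces Minkowski's inequality in the sums over frequency blocks. *)
Lemma sqmod_sum_weighted (a : nat -> R[i]) (p : nat -> R) m n : (forall l, 0 < p l) -> (m <= n)%N ->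
  sqmod (\sum_(m <= l < n) a l) <= (\sum_(m <= l < n) p l) * \sum_(m <= l < n) sqmod (a l) / p l.
Proof.
move=> p0; elim: n => [|n IH]; first by rewrite leqn0 => /eqP ->; rewrite !big_geq// sqmod0 mul0r.
rewrite leq_eqVlt => /predU1P[->|]; first by rewrite !big_geq// sqmod0 mul0r.
rewrite ltnS => mn; rewrite !big_nat_recr//=; have := IH mn.
have Q0 : 0 <= \sum_(m <= l < n) sqmod (a l) / p l.
  by apply: sumr_ge0 => l _; rewrite divr_ge0 ?sqmod_ge0// ltW.
move: Q0; set A := \sum_(_ <= _ < _) a _; set P := \sum_(_ <= _ < _) p _; set Q := \sum_(_ <= _ < _) _ => Q0 h.
have P0 : 0 <= P by apply: sumr_ge0 => l _; exact: ltW.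
have [P1|P1] := eqVneq P 0.
  have -> : A = 0.
    by apply: sqmod_eq0; apply/eqP; rewrite eq_le sqmod_ge0 andbT; move: h; rewrite P1 mul0r.
  rewrite add0r P1 add0r mulrDr mulrCA mulfV; last by rewrite gt_eqF.
  by rewrite mulr1 lerDr; apply: mulr_ge0 => //; exact: ltW.
have Pp : 0 < P by rewrite lt_neqAle eq_sym P1 P0.
apply: (le_trans (sqmodD_weighted A (a n) Pp (p0 n))).
apply: ler_wpM2l; first by apply: addr_ge0 => //; exact: ltW.
by rewrite lerD2r ler_pdivrMr// mulrC.
Qed.

Lemma sqr_sum_weighted (a p : nat -> R) n : (forall l, 0 < p l) ->
  (\sum_(l < n) a l) ^+ 2 <= (\sum_(l < n) p l) * \sum_(l < n) a l ^+ 2 / p l.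
Proof.
move=> p0; have := sqmod_sum_weighted (fun l => (a l)%:C) p0 (leq0n n).
rewrite !big_mkord -rmorph_sum/= sqmod_real => /le_trans; apply.
by rewrite le_eqVlt; apply/orP; left; apply/eqP; congr (_ * _); apply: eq_bigr => l _; rewrite sqmod_real.
Qed.

(** The free parameter separates a small multiple of the total energy from a large multiple of the
    difference. Continuity of a density then follows from bounded energies and continuity in the
    energy norm. *)
Lemma sqmodB_sqmod (x y : R[i]) (eta : R) : 0 < eta ->
  `|sqmod x - sqmod y| <= eta * (sqmod x + sqmod y) + (1 + eta^-1) * sqmod (x - y).
Proof.
have H (u v : R[i]) : 0 < eta -> sqmod u <= (1 + eta) * sqmod v + (1 + eta^-1) * sqmod (u - v).
  move=> e0; have := sqmodD_weighted v (u - v) ltr01 e0; rewrite addrC subrK divr1 => /le_trans; apply.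
  rewrite mulrDr lerD2l mulrCA; have -> : (1 + eta) / eta = 1 + eta^-1 by field; rewrite gt_eqF.
  by rewrite mulrC.
move=> e0; have h1 := H x y e0; have h2 := H y x e0; rewrite sqmodBC in h2.
rewrite ler_norml; have := mulr_ge0 (ltW e0) (sqmod_ge0 x); have := mulr_ge0 (ltW e0) (sqmod_ge0 y).
move: h1 h2; rewrite ![(1 + eta) * _]mulrDl !mul1r.
move: (sqmod x) (sqmod y) ((1 + _) * _) => a b c h1 h2 b0 a0.
by apply/andP; split; lra.
Qed.

End WeightedSum.

Section LittlewoodPaley.
Context {R : realType} {n m : nat}.
Local Notation position := (position R n m).
Local Notation frequency := (frequency R n m).
Variables (eta1 : R -> R) (s : R).
Hypotheses (smooth : smooth_cutoff eta1) (s0 : 0 < s).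

Let eta01 x : 0 <= eta1 x <= 1. Proof. by case: smooth. Qed.

Lemma measurable_eta1 : measurable_fun setT (eta1 : measurableTypeR R -> R).
Proof.
apply: continuous_measurable_fun => x; case: smooth => /(_ 0%N x)/= dx _ _ _ _.
exact/differentiable_continuous/derivable1_diffP.
Qed.

Definition cutoff (l : nat) (x : frequency) : R := product_cutoff eta1 (2 ^+ l) x.

Lemma measurable_cutoff l : measurable_fun setT (cutoff l).
Proof.
have mint : measurable_fun setT (fun k : int => k%:~R : measurableTypeR R) by [].
have md : measurable_fun setT (fun x : measurableTypeR R => eta1 (x / 2 ^+ l)).
  by apply: (measurableT_comp measurable_eta1); exact: measurable_funM.
apply: measurable_funM; apply: measurable_prod => i _.
  apply: (measurableT_comp md); exact: (measurableT_comp (measurable_tnth i) measurable_fst).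
apply: (measurableT_comp md); apply: (measurableT_comp mint).
exact: (measurableT_comp (measurable_tnth i) measurable_snd).
Qed.

Let prod01 k (h : 'I_k -> R) : (forall i, 0 <= h i <= 1) -> 0 <= \prod_(i < k) h i <= 1.
Proof.
move=> h01; elim/big_ind : _ => [|x y /andP[x0 x1] /andP[y0 y1]|i _]; rewrite ?ler01 ?lexx//.
by rewrite mulr_ge0//= mulr_ile1.
Qed.

Lemma cutoff01 l x : 0 <= cutoff l x <= 1.
Proof.
have /andP[a0 a1] := prod01 (fun i : 'I_n => eta01 (tnth x.1 i / 2 ^+ l)).
have /andP[b0 b1] := prod01 (fun i : 'I_m => eta01 ((tnth x.2 i)%:~R / 2 ^+ l)).
by rewrite mulr_ge0//= mulr_ile1.
Qed.

Lemma cutoff_out k l x : (l <= k)%N -> ~ frequency_box (2 ^ k.+1) x -> cutoff l x = 0.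
Proof.
move=> lk xb; have p2 : 0 < 2 ^+ l :> R by rewrite exprn_gt0.
have e0 y : (2 ^ k.+1)%:R < `|y| -> eta1 (y / 2 ^+ l) = 0.
  move=> ky; case: smooth => _ _ _ _; apply; rewrite normrM normfV (gtr0_norm p2) ler_pdivlMr//.
  apply: ltW; apply: le_lt_trans ky; rewrite -exprS natrX.
  by rewrite ler_eXn2l// ?ltr1n.
have [[i xi]|h1] := pselect (exists i, (2 ^ k.+1)%:R < `|tnth x.1 i|).
  by rewrite /cutoff /product_cutoff (bigD1 i)//= e0// !mul0r.
have [[i xi]|h2] := pselect (exists i, (2 ^ k.+1)%:R < `|(tnth x.2 i)%:~R : R|).
  by rewrite /cutoff /product_cutoff [X in _ * X](bigD1 i)//= e0// mul0r mulr0.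
case: xb; split=> i.
  by rewrite /line_box /mkset/= leNgt; apply/negP => xi; apply: h1; exists i.
rewrite /int_box /mkset/= leqNgt; apply/negP => xi; apply: h2; exists i.
by rewrite -intr_norm -abszE -pmulrn ltr_nat.
Qed.

Lemma cutoff_in l k x : (k <= l)%N -> frequency_box (2 ^ k) x -> cutoff l x = 1.
Proof.
move=> kl [h1 h2]; have p2 : 0 < 2 ^+ l :> R by rewrite exprn_gt0.
have e1 y : `|y| <= (2 ^ k)%:R -> eta1 (y / 2 ^+ l) = 1.
  move=> ky; case: smooth => _ _ _ h _; apply: h.
  rewrite normrM normfV (gtr0_norm p2) ler_pdivrMr// mul1r (le_trans ky)// natrX.
  by rewrite ler_eXn2l// ?ltr1n.
rewrite /cutoff /product_cutoff !big1 ?mulr1// => i _; apply: e1; last exact: h1.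
by have := h2 i; rewrite /int_box /mkset/= -intr_norm -abszE -pmulrn ler_nat.
Qed.

(** The pieces are differences of the very cutoffs of [regularized_schrodinger], so that its values
    are partial sums of blocks, and pointwise values are sums of the series of blocks. *)
Definition littlewood_paley (l : nat) (x : frequency) : R :=
  if l is l'.+1 then cutoff l x - cutoff l' x else cutoff 0 x.

Lemma littlewood_paley_sum l x : \sum_(i < l.+1) littlewood_paley i x = cutoff l x.
Proof.
elim: l => [|l IH]; first by rewrite big_ord1.
by rewrite big_ord_recr/= IH addrC subrK.
Qed.

Definition lp_symbol l (x : frequency) : R[i] := (littlewood_paley l x * japanese (- s) x)%:C.
(** This is [2 ^ (- s (l - 1))]: the piece of index [l >= 1] lives where some coordinate exceeds
    [2 ^ (l - 1)]. *)
Definition lp_size (l : nat) : R := 2 `^ s * (2 `^ (- s)) ^+ l.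
Definition lp_box (l : nat) : nat := (2 ^ l.+1)%N.

Lemma lp_size_gt0 l : 0 < lp_size l.
Proof. by rewrite mulr_gt0 ?exprn_gt0// powR_gt0. Qed.

Lemma cmeasurable_lp_symbol l : cmeasurable (lp_symbol l).
Proof.
apply: cmeasurable_real; apply: measurable_funM; last exact: measurable_japanese.
by case: l => [|l]; [|apply: measurable_funB]; exact: measurable_cutoff.
Qed.

Lemma japanese_small (c : R) (x : frequency) : 0 < c -> c ^+ 2 <= 1 + frequency_sq x -> japanese (- s) x <= c `^ (- s).
Proof.
move=> c0 cx; have x0 : 0 < 1 + frequency_sq x by rewrite (lt_le_trans _ cx)// exprn_gt0.
rewrite /japanese mulNr !powRN lef_pV2 ?posrE ?powR_gt0//.
have -> : c `^ s = (c ^+ 2) `^ (s / 2).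
  by rewrite -powR_mulrn ?ltW// -powRrM mulrC divfK.
by apply: ge0_ler_powR => //; rewrite ?nnegrE ?sqr_ge0//; rewrite ltW// divr_gt0.
Qed.

(** Successive cutoffs are both 0 outside the box [2 ^ (l + 1)] and, for positive index, both 1 on
    an inner box; in between a large coordinate makes the weight small. The initial piece only uses
    that the weight is at most 1. *)
Lemma lp_symbol_bound l x : cmod (lp_symbol l x) <= lp_size l * \1_(@frequency_box R n m (lp_box l)) x.
Proof.
rewrite /lp_symbol cmod_real normrM [X in _ * X]gtr0_norm ?japanese_gt0//.
have [xb|xb] := pselect (frequency_box (lp_box l) x); last first.
  have -> : littlewood_paley l x = 0.
    by case: l xb => [|l] xb /=; rewrite !(cutoff_out (k := _) _ xb)// ?subrr.
  by rewrite normr0 mul0r mulr_ge0 ?indic_ge0// ltW// lp_size_gt0.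
rewrite indicE mem_set// mulr1; case: l xb => [|l] xb.
  have /andP[c0 c1] := cutoff01 0 x.
  rewrite /lp_size expr0 mulr1 /= ger0_norm// -[leRHS]mul1r; apply: ler_pM => //; first exact/ltW/japanese_gt0.
  apply: (@le_trans _ _ (1 `^ (- s))); last first.
    by rewrite powR1 -[X in X <= _](@powRr0 _ 2); apply: ler_powR; rewrite ?ler1n// ltW.
  by apply: japanese_small => //; rewrite expr1n lerDl frequency_sq_ge0.
have [xs|xs] := pselect (frequency_box (2 ^ l) x).
  by rewrite /= !(cutoff_in (k := l) _ xs)// subrr normr0 mul0r ltW// lp_size_gt0.
have lp1 : `|littlewood_paley l.+1 x| <= 1.
  have /andP[c0 c1] := cutoff01 l.+1 x; have /andP[c2 c3] := cutoff01 l x.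
  by rewrite /= ler_norml; lra.
have -> : lp_size l.+1 = 1 * (2 ^+ l) `^ (- s).
  rewrite mul1r /lp_size exprS mulrA powRN mulfV ?gt_eqF ?powR_gt0// mul1r -powRN.
  rewrite -[in LHS](@powR_mulrn _ _ l (powR_ge0 2 (- s))) -powRrM mulrC powRrM.
  by rewrite (@powR_mulrn _ 2 l).
apply: ler_pM => //; first exact/ltW/japanese_gt0.
apply: japanese_small; first by rewrite exprn_gt0.
have term1 (i : 'I_n) : tnth x.1 i ^+ 2 <= frequency_sq x.
  rewrite /frequency_sq (bigD1 i)//= -addrA lerDl addr_ge0// sumr_ge0// => j _; exact: sqr_ge0.
have term2 (i : 'I_m) : (tnth x.2 i)%:~R ^+ 2 <= frequency_sq x.
  rewrite /frequency_sq [X in _ + X](bigD1 i)//= addrCA lerDl addr_ge0// sumr_ge0// => j _; exact: sqr_ge0.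
have big y : y ^+ 2 <= frequency_sq x -> (2 ^ l)%:R < `|y| -> (2 ^+ l) ^+ 2 <= 1 + frequency_sq x.
  move=> h1 h2; apply: (@le_trans _ _ (y ^+ 2)); last by lra.
  by rewrite -(real_normK (num_real y)) ler_pXn2r ?nnegrE// ?exprn_ge0// -natrX ltW.
have [[i xi]|h1] := pselect (exists i, (2 ^ l)%:R < `|tnth x.1 i|); first exact: big (term1 i) xi.
have [[i xi]|h2] := pselect (exists i, (2 ^ l)%:R < `|(tnth x.2 i)%:~R : R|); first exact: big (term2 i) xi.
case: xs; split=> i.
  by rewrite /line_box /mkset/= leNgt; apply/negP => xi; apply: h1; exists i.
rewrite /int_box /mkset/= leqNgt; apply/negP => xi; apply: h2; exists i.
by rewrite -intr_norm -abszE -pmulrn ltr_nat.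
Qed.

(** An eighth root of the decay [2 ^ (d + 1 - 4 s)] per block, where [d = n + m]. Squares of
    energies have integrals of size [q ^ (8 i)]; pointwise they are kept at [q ^ (4 i)], hence
    energies at [q ^ (2 i)], and one more factor [q ^ i] is spent on the weights that sum the
    blocks. *)
Definition lp_ratio : R := 2 `^ (((n + m).+1%:R - 4 * s) / 8).
(** The factor [2 ^ (n + m + 1)] arises because the box of block [l] has size [2 * 2 ^ l]; the
    remaining factors are those of [lp_size] and [gram_constant]. *)
Definition lp_constant : R := (2 `^ s) ^+ 4 * (4 * (3 ^+ (n + m) * 14 * (n + m)%:R * 2 ^+ (n + m).+1)).

Lemma lp_ratio_gt0 : 0 < lp_ratio. Proof. by rewrite powR_gt0. Qed.

Lemma lp_ratio_lt1 : (n + m).+1%:R < 4 * s -> lp_ratio < 1.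
Proof.
move=> h; rewrite /lp_ratio /powR pnatr_eq0/= -[X in _ < X]expR0 ltr_expR pmulr_llt0 ?ln_gt0 ?ltr1n//.
by rewrite ltr_pdivrMr// mul0r subr_lt0.
Qed.

Lemma lp_constantE l : lp_size l ^+ 4 * gram_constant (lp_box l) (R := R) (n := n) (m := m) =
  lp_constant * (lp_ratio ^+ 8) ^+ l.
Proof.
have E : lp_ratio ^+ 8 = 2 ^+ (n + m).+1 * (2 `^ (- s)) ^+ 4.
  rewrite /lp_ratio -!powR_mulrn ?powR_ge0// -!powRrM divfK// -powRD; last by apply/implyP => _; rewrite pnatr_eq0.
  by congr (_ `^ _); ring.
rewrite E /lp_size /gram_constant /lp_box /lp_constant natrX exprMn.
rewrite [2 ^+ l.+1]exprS exprMn exprMn -!exprM [(4 * l)%N]mulnC [((n + m).+1 * l)%N]mulnC.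
set A := (2 `^ s) ^+ 4; set B := (2 `^ (- s)) ^+ _; set C := 2 ^+ (l * _); set D := 2 ^+ _.
by ring.
Qed.

End LittlewoodPaley.

(** * Densities as square integrable functions *)

Section Geometric.
Context {R : realType}.
Variables (q : R) (q0 : 0 < q) (q1 : q < 1).

Lemma geometric_tail m n : \sum_(m <= l < n) q ^+ l <= q ^+ m / (1 - q).
Proof.
rewrite -{1}[m]add0n big_addn; have := geometric_sum_le (n - m)%N (ltW q0) q1; rewrite big_mkord => h.
rewrite (eq_bigr (fun l : 'I_(n - m) => q ^+ m * q ^+ l)) => [|l _]; last by rewrite exprD mulrC.
by rewrite -mulr_sumr ler_wpM2l// exprn_ge0// ltW.
Qed.

(** The weights [q ^ l] of the inequality for sums turn the decay [q ^ (2 l)] of the energies into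
    [q ^ l]. Both resulting sums are geometric, and each contributes a factor [q ^ m / (1 - q)]. *)
Lemma energy_tail (w : nat -> R) (a : nat -> nat -> R[i]) (C : R) J : (forall j, 0 <= w j) ->
  (forall l, \sum_(j < J) w j * sqmod (a l j) <= C * (q ^+ 2) ^+ l) ->
  forall m n, (m <= n)%N -> \sum_(j < J) w j * sqmod (\sum_(m <= l < n) a l j) <= C * (q ^+ m / (1 - q)) ^+ 2.
Proof.
move=> w0 aC m n mn; have p0 l : 0 < q ^+ l by rewrite exprn_gt0.
have C0 : 0 <= C.
  by have := aC 0%N; rewrite expr0 mulr1; apply: le_trans; apply: sumr_ge0 => j _; rewrite mulr_ge0// sqmod_ge0.
have G0 : 0 <= \sum_(m <= l < n) q ^+ l by apply: sumr_ge0 => l _; exact: ltW.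
apply: (@le_trans _ _ (\sum_(j < J) w j * ((\sum_(m <= l < n) q ^+ l) * \sum_(m <= l < n) sqmod (a l j) / q ^+ l))).
  by apply: ler_sum => j _; rewrite ler_wpM2l// sqmod_sum_weighted.
have -> : \sum_(j < J) w j * ((\sum_(m <= l < n) q ^+ l) * \sum_(m <= l < n) sqmod (a l j) / q ^+ l) =
    (\sum_(m <= l < n) q ^+ l) * \sum_(m <= l < n) (\sum_(j < J) w j * sqmod (a l j)) / q ^+ l.
  rewrite (eq_bigr (fun j : 'I_J => (\sum_(m <= l < n) q ^+ l) * \sum_(m <= l < n) w j * sqmod (a l j) / q ^+ l)); last first.
    move=> j _; rewrite mulrCA [in LHS]mulr_sumr; apply: f_equal.
    by apply: eq_bigr => l _; rewrite mulrA.
  by rewrite -mulr_sumr exchange_big/=; congr (_ * _); apply: eq_bigr => l _; rewrite mulr_suml.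
have h := geometric_tail m n.
have T0 : 0 <= q ^+ m / (1 - q) by rewrite divr_ge0 ?subr_ge0// ltW.
apply: (@le_trans _ _ ((q ^+ m / (1 - q)) * (C * \sum_(m <= l < n) q ^+ l))); last first.
  by rewrite mulrCA expr2 ler_wpM2l// ler_wpM2l.
apply: ler_pM => //.
  by apply: sumr_ge0 => l _; rewrite divr_ge0 ?(ltW (p0 l))//; apply: sumr_ge0 => j _; rewrite mulr_ge0// sqmod_ge0.
rewrite mulr_sumr; apply: ler_sum => l _; rewrite ler_pdivrMr// -mulrA -expr2 -exprM mulnC exprM; exact: aC.
Qed.

Lemma geometric_cvg0 (C : R) : C * (q ^+ m / (1 - q)) ^+ 2 @[m --> \oo] --> (0 : R).
Proof.
rewrite (_ : (fun m => _) = (fun m => C / (1 - q) ^+ 2 * (q ^+ 2) ^+ m)); last first.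
  apply/funext => m; rewrite expr_div_n -!exprM mulnC; ring.
rewrite -(mulr0 (C / (1 - q) ^+ 2)); apply: cvgM; first exact: cvg_cst.
apply: cvg_expr; rewrite ger0_norm ?sqr_ge0// expr_lt1// ltW//.
Qed.

(** A limit known only along a subsequence is the limit of the whole sequence, with the Cauchy rate
    as error bound. *)
Lemma cauchy_subsequence (u : nat -> R[i]) (v : R[i]) (phi : nat -> nat) (eps : nat -> R) :
  {homo phi : i j / (i < j)%N} -> (forall i j, (i <= j)%N -> sqmod (u j - u i) <= eps i) ->
  sqmod (u (phi k) - v) @[k --> \oo] --> (0 : R) ->
  forall k, sqmod (u k - v) <= eps k.
Proof.
move=> mphi ue uv k.
have phik i : (i <= phi i)%N by elim: i => // i IH; exact: leq_ltn_trans IH (mphi _ _ _).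
have h : sqmod (u (phi (i + k)%N) - u k) @[i --> \oo] --> sqmod (v - u k).
  by apply: (sqmodB_cvg (u := fun i => u (phi (i + k)%N))); rewrite (cvg_shiftn k (fun i => sqmod (u (phi i) - v))).
rewrite sqmodBC; apply: (cvgn_lec h) => i; apply: ue.
exact: leq_trans (leq_addl _ _) (phik _).
Qed.

End Geometric.

(** * Square integrability of densities at a fixed time *)

Section Blocks.
Context {R : realType} {n m : nat}.
Local Notation position := (position R n m).
Local Notation frequency := (frequency R n m).
Local Notation muM := (position_measure R n m).
Local Notation muF := (frequency_measure R n m).
Local Notation sobolev := (@sobolev R n m).
Local Notation nu sigma := (mweight muF (sobolev_weight_ge0 sigma) (measurable_sobolev_weight sigma)).
Variables (eta1 : R -> R) (s T0 : R).
Hypotheses (smooth : smooth_cutoff eta1) (s0 : 0 < s) (d0 : (0 < n + m)%N).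
Hypothesis sd : (n + m).+1%:R < 4 * s.
Hypothesis T00 : 0 < T0.
Hypothesis T0h : forall t', `|t'| <= T0 -> forall x, 0 <= x < 1 -> 1 / 2 <= cos (2 * pi * (- (t' * x))).
Variables (e : nat -> frequency -> R[i]).
Hypothesis e2 : forall j, square_integrable muF (e j).
Hypothesis eo : forall i j, cintegral muF (fun x => (e i x)^* * e j x) = (i == j)%:R.

Definition block tau i j (z : position) : R[i] := evolved e (lp_symbol eta1 s i) tau j z.

Local Notation q := (lp_ratio (n := n) (m := m) s).
Local Notation C1 := (lp_constant (n := n) (m := m) s).

Let q0 : 0 < q. Proof. exact: lp_ratio_gt0. Qed.
Let q1 : q < 1. Proof. exact: lp_ratio_lt1. Qed.

Let phib i (x : frequency) := lp_symbol_bound smooth s0 i x.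
Let mphi i := @cmeasurable_lp_symbol R n m eta1 s smooth i.
Let box_gt0 i : (0 < lp_box i)%N. Proof. by rewrite expn_gt0. Qed.

Lemma lp_constant_ge0 : 0 <= C1.
Proof. by rewrite !mulr_ge0 ?exprn_ge0// powR_ge0. Qed.

Lemma block_piece i j : cintegrable muF (piece e (lp_symbol eta1 s i) j).
Proof. exact: piece_cintegrable e2 (mphi i) (phib i) j. Qed.

Lemma cmeasurable_block tau i j : cmeasurable (block tau i j).
Proof. exact: (cmeasurable_linearized e2 (mphi i) (phib i) (measurable_cst tau)). Qed.

Lemma block_energy_bound tau i (w : nat -> R) J : `|tau| <= T0 -> (forall j, 0 <= w j) ->
  (\int[muM]_z ((\sum_(j < J) w j * sqmod (block tau i j z)) ^+ 2)%:E <=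
    (C1 * (q ^+ 8) ^+ i * \sum_(j < J) w j ^+ 2)%:E)%E.
Proof.
move=> tauT w0.
rewrite -(lp_constantE s i).
exact: (linearized_bound T0h e2 eo (mphi i) (lp_size_gt0 s i) (box_gt0 i) d0 (phib i) w0
  J (measurable_cst tau) (fun=> tauT)).
Qed.

(** The Littlewood-Paley pieces telescope; the sum is finite and each block converges absolutely, so
    that no limit is exchanged. *)
Lemma phase_cutoff tau j z l : cintegral muF (fun x =>
    (cutoff eta1 l x)%:C * cis (phase z x + tau * frequency_sq x) * ((japanese (- s) x)%:C * e j x)) =
  \sum_(i < l.+1) block tau i j z.
Proof.
transitivity (cintegral muF (fun x => \sum_(i < l.+1)
    cis (phase z x + tau * frequency_sq x) * piece e (lp_symbol eta1 s i) j x)); last first.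
  apply: (cintegral_sum _ (F := fun (i : 'I_l.+1) x => cis (phase z x + tau * frequency_sq x) *
    piece e (lp_symbol eta1 s i) j x)) => i.
  apply: (cintegrable_le _ (cintegrable_cmod (block_piece i j))) => [|x].
    apply: cmeasurableM; last exact: cintegrable_cmeasurable (block_piece i j).
    exact: (cmeasurable_pair1 z (cmeasurable_wave (t := fun=> tau) (measurable_cst tau))).
  by rewrite cmodM cmod_cis mul1r.
apply: eq_cintegral => x; rewrite -(littlewood_paley_sum eta1 l x) rmorph_sum/= -mulrA big_distrl/=.
by apply: eq_bigr => i _; rewrite /piece /lp_symbol !rmorphM/=; ring.
Qed.

Variable G : nat -> sobolev s.
Hypothesis Ge : forall j, {ae muF, forall x, L2repr (G j) x = (japanese (- s) x)%:C * e j x}.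

Local Notation h j := (fun x => (japanese (- s) x)%:C * e j x).
Local Notation hk l j := (fun x => (cutoff eta1 l x)%:C * ((japanese (- s) x)%:C * e j x)).

Let japanese_le1 (x : frequency) : japanese (- s) x <= 1.
Proof.
have := japanese_small s0 (c := 1) (x := x) ltr01; rewrite powR1; apply.
by rewrite expr1n lerDl frequency_sq_ge0.
Qed.

Let h2 j : square_integrable muF (h j).
Proof.
apply: (square_integrable_le _ (e2 j)) => [|x].
  exact: (cmeasurableM (cmeasurable_real (measurable_japanese _)) (e2 j).1).
rewrite sqmodM sqmod_real ler_piMl ?sqmod_ge0//.
by rewrite expr_le1 ?japanese_le1// ltW// japanese_gt0.
Qed.

Let mhk l j : cmeasurable (hk l j).
Proof. exact: (cmeasurableM (cmeasurable_real (measurable_cutoff smooth l)) (h2 j).1). Qed.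

Let hk2 l j : square_integrable muF (hk l j).
Proof.
apply: (square_integrable_le (mhk l j) (h2 j)) => x.
rewrite sqmodM sqmod_real ler_piMl ?sqmod_ge0//.
by have /andP[c0 c1] := cutoff01 smooth l x; rewrite expr_le1.
Qed.

Let hk1 l j : cintegrable muF (hk l j).
Proof.
have : cintegrable muF (fun x => \sum_(i < l.+1) piece e (lp_symbol eta1 s i) j x).
  by apply: cintegrable_sum => i; exact: block_piece.
congr cintegrable; apply/funext => x.
rewrite -(littlewood_paley_sum eta1 l x) rmorph_sum/= big_distrl/=.
by apply: eq_bigr => i _; rewrite /piece /lp_symbol !rmorphM/=; ring.
Qed.

Let ift_block l j z : ift (hk l j) z = \sum_(i < l.+1) block 0 i j z.
Proof.
rewrite -phase_cutoff; apply: eq_cintegral => x.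
by rewrite mul0r addr0; ring.
Qed.

Let hk_mean j : mean_null muF (fun l x => hk l j x - h j x).
Proof.
apply: (mean_dominated (g := fun x => sqmod (h j x))).
- by move=> l; exact: cmeasurableB (mhk l j) (h2 j).1.
- exact: (square_integrable_int (h2 j)).
- move=> l x; set y := (japanese _ _)%:C * _.
  have -> : (cutoff eta1 l x)%:C * y - y = (cutoff eta1 l x - 1)%:C * y by rewrite rmorphB/= mulrBl mul1r.
  rewrite sqmodM ler_piMl ?sqmod_ge0// sqmod_real; have /andP[c0 c1] := cutoff01 smooth l x.
  by nra.
apply: aeW => x; apply/cvgnP => eps eps0.
have [N xN] := frequency_box_cover x; exists N => k Nk.
rewrite (cutoff_in smooth Nk) ?mul1r ?subrr ?sqmod0 ?subrr ?normr0//.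
by apply: (frequency_box_mono _ xN); exact: ltnW (ltn_expl _ _).
Qed.

(** The truncated symbols converge in mean on the frequency side by domination. The inverse Fourier
    transform carries this over isometrically, and on the truncations it is the absolutely
    convergent integral [ift]. *)
Lemma to_L2_mean j : mean_null muM (fun l z => \sum_(i < l.+1) block 0 i j z - L2repr (to_L2 (G j)) z).
Proof.
have mE : multiplier (fun=> 1) (G j) = L2of (nu 0) (h j) :> sobolev 0.
  have E2 : {ae muF, forall x, 1 * L2repr (G j) x = h j x}.
    by apply: filterS (Ge j) => x ex; exact: (etrans (mul1r _) ex).
  apply: L2of_ae.
  - apply/sobolev0_sqint; split.
      by apply: cmeasurableM; [exact: cmeasurable_cst|exact: sqfun_cmeasurable].
    rewrite -[X in (X < _)%E]/(N2 muF _) (N2_ae _ _ E2); first exact: (h2 j).2.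
      by apply: cmeasurableM; [exact: cmeasurable_cst|exact: sqfun_cmeasurable].
    by case: (h2 j).
  - exact/sobolev0_sqint/h2.
  - exact/sobolev_ae.
have H1 : hcvg (fun l => L2of (nu 0) (hk l j)) (L2of (nu 0) (h j)).
  apply/hcvg_mean => [l||]; [exact/sobolev0_sqint/hk2|exact/sobolev0_sqint/h2|].
  apply/sobolev0_mean => [l|]; last exact: hk_mean.
  exact: cmeasurableB (mhk l j) (h2 j).1.
have H2 := isometry_hcvg (@inverse_fourier_linear R n m) (@inverse_fourier_nsq R n m) H1.
have E l : inverse_fourier (L2of (nu 0) (hk l j)) = L2of muM (ift (hk l j)).
  exact: inverse_fourier_ift (hk1 l j) (hk2 l j).
have H3 : hcvg (fun l => L2of muM (ift (hk l j))) (L2of muM (L2repr (to_L2 (G j)))).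
  rewrite L2of_reprK /to_L2 mE.
  exact: (eq_ind _ (fun u : nat -> L2 muM => hcvg u (inverse_fourier (L2of (nu 0) (h j)))) H2 _ (funext E)).
have : mean_null muM (fun l z => ift (hk l j) z - L2repr (to_L2 (G j)) z).
  exact: ((hcvg_mean (fun l => ift_sqint (hk1 l j) (hk2 l j)) (sqfunP (L2repr (to_L2 (G j))))).1 H3).
by congr mean_null; apply/funext => l; apply/funext => z; rewrite ift_block.
Qed.

Let C0 := (1 - q)^-1 ^+ 4 * C1.

(* A single function is controlled by the energy with weights concentrated at [j]. *)
Lemma block_ae_bound j : {ae muM, forall z, exists C, forall i, sqmod (block 0 i j z) <= C * (q ^+ 2) ^+ i}.
Proof.
pose w k : R := (k == j)%:R.
have wE (F : nat -> R) : \sum_(k < j.+1) w k * F k = F j.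
  rewrite big_ord_recr/= big1 => [|k _]; last by rewrite /w ltn_eqF ?mul0r.
  by rewrite /w eqxx mul1r add0r.
have w0 k : 0 <= w k by rewrite /w ler0n.
have q40 i : 0 < q ^+ (4 * i) by rewrite exprn_gt0.
have mb i : measurable_fun setT (fun z => sqmod (block 0 i j z) ^+ 2).
  by apply: measurable_funX; exact: measurable_sqmod (cmeasurable_block 0 i j).
have H := @ae_bounded _ _ _ muM (fun i z => (q ^+ (4 * i))^-1 * sqmod (block 0 i j z) ^+ 2)
  (fun i => C1 * q ^+ i) (C1 / (1 - q)).
apply: filterS (H _ _ _ _) => {H} [z [C hC]||||].
- have tC i : (q ^+ (4 * i))^-1 * sqmod (block 0 i j z) ^+ 2 <= C.
    apply: le_trans (hC i.+1); rewrite big_ord_recr/= lerDr; apply: sumr_ge0 => k _.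
    by rewrite mulr_ge0 ?sqr_ge0// invr_ge0 ltW.
  have C_ge0 : 0 <= C by apply: le_trans (tC 0%N); rewrite mulr_ge0 ?sqr_ge0// invr_ge0 ltW.
  exists (C + 1) => i; have := tC i; rewrite mulrC ler_pdivrMr// => h.
  rewrite -(ler_pXn2r (n := 2))// ?nnegrE ?sqmod_ge0//; last by rewrite mulr_ge0 ?exprn_ge0 ?addr_ge0// ltW.
  apply: (le_trans h); have -> : ((C + 1) * (q ^+ 2) ^+ i) ^+ 2 = (C + 1) ^+ 2 * q ^+ (4 * i).
    by rewrite exprMn -!exprM; congr (_ * q ^+ _); lia.
  rewrite ler_wpM2r ?(ltW (q40 _))//.
  by rewrite sqrrD expr1n mulr1; have := sqr_ge0 C; lra.
- by move=> i; apply: measurable_funM.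
- by move=> i z; rewrite mulr_ge0 ?sqr_ge0// invr_ge0 ltW.
- move=> i; rewrite int_geZ//; last 2 first.
  + by rewrite invr_ge0 ltW.
  + by move=> z; exact: sqr_ge0.
  have := @block_energy_bound 0 i w j.+1; rewrite normr0 => /(_ (ltW T00) w0).
  have -> : \sum_(k < j.+1) w k ^+ 2 = 1.
    by rewrite -[RHS](wE (fun=> 1)); apply: eq_bigr => k _; rewrite mulr1 /w; case: eqP; rewrite ?expr1n ?expr0n.
  have -> : (\int[muM]_z ((\sum_(k < j.+1) w k * sqmod (block 0 i k z)) ^+ 2)%:E =
      \int[muM]_z (sqmod (block 0 i j z) ^+ 2)%:E)%E.
    by apply: eq_integral => z _; rewrite (wE (fun k => sqmod (block 0 i k z))).
  rewrite mulr1 => hb; apply: (le_trans (lee_wpmul2l _ hb)); first by rewrite lee_fin invr_ge0 ltW.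
  rewrite -EFinM lee_fin mulrCA ler_wpM2l ?lp_constant_ge0// -exprM.
  rewrite mulrC ler_pdivrMr// -exprD; apply: ler_wiXn2l; [exact: ltW|exact: ltW|lia].
- move=> k; rewrite -mulr_sumr ler_wpM2l ?lp_constant_ge0//.
  exact: geometric_sum_le (ltW q0) q1.
Qed.

(** Convergence in mean identifies the limit only along a subsequence; the geometric decay of
    [block_ae_bound] makes the full sequence Cauchy at almost every point. *)
Lemma to_L2_ae j : {ae muM, forall z, sqmod (\sum_(i < l.+1) block 0 i j z - L2repr (to_L2 (G j)) z) @[l --> \oo] --> (0 : R)}.
Proof.
pose F l z := \sum_(i < l.+1) block 0 i j z.
have mF l : cmeasurable (F l) by apply: cmeasurable_sum => i; exact: cmeasurable_block.
have mL := sqfun_cmeasurable (L2repr (to_L2 (G j))).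
have [v mv [vm [phi phim phic]]] := riesz_fischer mF (mean_null_cauchy mF mL (to_L2_mean j)).
have vE := mean_null_unique mF mv mL vm (to_L2_mean j).
apply: filterS3 phic vE (block_ae_bound j) => z c1 e1 [C hC].
have h k : sqmod (F k z - v z) <= C * (q ^+ k.+1 / (1 - q)) ^+ 2.
  apply: (cauchy_subsequence (u := fun k => F k z) (eps := fun k => C * (q ^+ k.+1 / (1 - q)) ^+ 2) phim _ c1) => a b ab.
  have H := @energy_tail _ _ q0 q1 (fun=> 1) (fun i _ => block 0 i j z) C 1 (fun=> ler01).
  have {}H : forall m' n', (m' <= n')%N -> \sum_(j0 < 1) 1 * sqmod (\sum_(m' <= l < n') block 0 l j z) <= C * (q ^+ m' / (1 - q)) ^+ 2.
    by apply: H => i; rewrite big_ord1 mul1r; exact: hC.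
  have := H a.+1 b.+1 ab; rewrite big_ord1 mul1r; apply: le_trans.
  by rewrite /F -!(big_mkord xpredT (fun i => block 0 i j z)) (@big_cat_nat _ _ _ a.+1 0 b.+1)//= addrAC subrr add0r.
rewrite -e1; apply: (cvg0_le (v := fun k => C * (q ^+ k.+1 / (1 - q)) ^+ 2)) => [k|].
  by rewrite ger0_norm ?sqmod_ge0//; exact: h.
have := geometric_cvg0 q0 q1 C; rewrite -(cvg_shiftS (fun k => C * (q ^+ k / (1 - q)) ^+ 2)); exact.
Qed.

(** The bound for a single block at time 0 is summed over blocks with geometric weights, uniformly
    in the number of blocks, and Fatou's lemma passes to the full functions. *)
Lemma density_bound (w : nat -> R) J : (forall j, 0 <= w j) ->
  (\int[muM]_z ((\sum_(j < J) w j * sqmod (L2repr (to_L2 (G j)) z)) ^+ 2)%:E <= (C0 * \sum_(j < J) w j ^+ 2)%:E)%E.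
Proof.
move=> w0; pose E i z := \sum_(j < J) w j * sqmod (block 0 i j z).
pose S l z := \sum_(j < J) w j * sqmod (\sum_(i < l.+1) block 0 i j z).
have p0 i : 0 < q ^+ i by rewrite exprn_gt0.
have r0 : 0 <= (1 - q)^-1 by rewrite invr_ge0 subr_ge0 ltW.
have E0 i z : 0 <= E i z by apply: sumr_ge0 => j _; rewrite mulr_ge0// sqmod_ge0.
have S0 l z : 0 <= S l z by apply: sumr_ge0 => j _; rewrite mulr_ge0// sqmod_ge0.
have mE i : measurable_fun setT (E i).
  by apply: measurable_sum => j; apply: measurable_funM => //; exact: measurable_sqmod (cmeasurable_block 0 i j).
have mS l : measurable_fun setT (S l).
  apply: measurable_sum => j; apply: measurable_funM => //; apply: measurable_sqmod.
  by apply: cmeasurable_sum => i; exact: cmeasurable_block.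
have wsum_ge0 : 0 <= \sum_(j < J) w j ^+ 2 by apply: sumr_ge0 => j _; exact: sqr_ge0.
(* The weighted inequality is used twice: within each function, whose loss is squared, and then for
   the square of a sum of energies. The total loss is [(1 - q) ^ -3] and [q ^ (- 3 i)], well within
   the decay [q ^ (8 i)] of the block bound. *)
have SE l z : S l z ^+ 2 <= (1 - q)^-1 ^+ 3 * \sum_(i < l.+1) (q ^+ i)^-1 ^+ 3 * E i z ^+ 2.
  have g1 : \sum_(i < l.+1) q ^+ i <= (1 - q)^-1 := geometric_sum_le _ (ltW q0) q1.
  have g0 : 0 <= \sum_(i < l.+1) q ^+ i by apply: sumr_ge0 => i _; exact: ltW.
  have h1 : S l z <= (1 - q)^-1 * \sum_(i < l.+1) E i z / q ^+ i.
    apply: (@le_trans _ _ (\sum_(j < J) w j * ((\sum_(i < l.+1) q ^+ i) * \sum_(i < l.+1) sqmod (block 0 i j z) / q ^+ i))).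
      apply: ler_sum => j _; rewrite ler_wpM2l//.
      have := sqmod_sum_weighted (fun i => block 0 i j z) p0 (leq0n l.+1).
      by rewrite !big_mkord.
    have -> : \sum_(j < J) w j * ((\sum_(i < l.+1) q ^+ i) * \sum_(i < l.+1) sqmod (block 0 i j z) / q ^+ i) =
        (\sum_(i < l.+1) q ^+ i) * \sum_(i < l.+1) E i z / q ^+ i.
      rewrite (eq_bigr (fun j : 'I_J => (\sum_(i < l.+1) q ^+ i) * \sum_(i < l.+1) w j * sqmod (block 0 i j z) / q ^+ i)); last first.
        by move=> j _; rewrite mulrCA [in LHS]mulr_sumr; apply: f_equal; apply: eq_bigr => i _; rewrite mulrA.
      by rewrite -mulr_sumr exchange_big/=; apply: f_equal; apply: eq_bigr => i _; rewrite mulr_suml.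
    by apply: ler_wpM2r => //; apply: sumr_ge0 => i _; rewrite divr_ge0// ltW.
  apply: (@le_trans _ _ (((1 - q)^-1 * \sum_(i < l.+1) E i z / q ^+ i) ^+ 2)).
    by rewrite ler_pXn2r ?nnegrE ?mulr_ge0//; apply: sumr_ge0 => i _; rewrite divr_ge0// ltW.
  rewrite exprMn [_ ^+ 3]exprSr -mulrA ler_wpM2l ?sqr_ge0//.
  apply: (le_trans (sqr_sum_weighted (fun i => E i z / q ^+ i) l.+1 p0)).
  have -> : \sum_(i < l.+1) (E i z / q ^+ i) ^+ 2 / q ^+ i = \sum_(i < l.+1) (q ^+ i)^-1 ^+ 3 * E i z ^+ 2.
    by apply: eq_bigr => i _; rewrite exprMn; ring.
  apply: ler_wpM2r => //.
  by apply: sumr_ge0 => i _; rewrite mulr_ge0 ?sqr_ge0// exprn_ge0// invr_ge0 ltW.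
apply: (@fatou_le _ _ _ muM (fun l z => S l z ^+ 2)).
- by move=> l; apply: measurable_funX.
- apply: measurable_funX; apply: measurable_sum => j; apply: measurable_funM => //.
  exact: measurable_sqmod (sqfun_cmeasurable _).
- by move=> l z; exact: sqr_ge0.
- by move=> z; exact: sqr_ge0.
- have : {ae muM, forall z, forall j, sqmod (\sum_(i < l.+1) block 0 i j z - L2repr (to_L2 (G j)) z) @[l --> \oo] --> (0 : R)}.
    by apply/ae_foralln => j; exact: to_L2_ae.
  apply: filterS => z hz.
  apply: (@cvg_comp _ _ _ (fun l => S l z) (fun x => x ^+ 2)); last exact: exprn_continuous.
  apply: cvg_big => [|j _]; first exact: add_continuous.
  apply: cvgM; first exact: cvg_cst.
  by have := sqmodB_cvg (c := 0) (hz j); rewrite subr0; under eq_cvg do rewrite subr0.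
move=> l.
apply: (@le_trans _ _ (\int[muM]_z ((1 - q)^-1 ^+ 3 * \sum_(i < l.+1) (q ^+ i)^-1 ^+ 3 * E i z ^+ 2)%:E)%E).
  apply: int_le => //.
  - exact: measurable_funX.
  - by move=> z; exact: sqr_ge0.
  - apply: measurable_funM => //; apply: measurable_sum => i; apply: measurable_funM => //.
    exact: measurable_funX.
have mt i : measurable_fun setT (fun z => (q ^+ i)^-1 ^+ 3 * E i z ^+ 2).
  by apply: measurable_funM => //; exact: measurable_funX.
have t0 i z : 0 <= (q ^+ i)^-1 ^+ 3 * E i z ^+ 2.
  by rewrite mulr_ge0 ?sqr_ge0// exprn_ge0// invr_ge0 ltW.
rewrite int_geZ; last 3 first.
- by rewrite exprn_ge0.
- exact: measurable_sum.
- by move=> z; apply: sumr_ge0.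
have -> : C0 * \sum_(j < J) w j ^+ 2 = (1 - q)^-1 ^+ 3 * ((1 - q)^-1 * (C1 * \sum_(j < J) w j ^+ 2)).
  by rewrite /C0 exprSr !mulrA.
rewrite [in X in (_ <= X)%E]EFinM; apply: lee_wpmul2l; first by rewrite lee_fin exprn_ge0.
under eq_integral do rewrite -sumEFin.
rewrite ge0_integral_sum//; last 2 first.
- by move=> i; apply/measurable_EFinP; exact: mt.
- by move=> i z _; rewrite lee_fin.
apply: (@le_trans _ _ (\sum_(i < l.+1) (C1 * (\sum_(j < J) w j ^+ 2) * q ^+ i)%:E)%E).
  apply: lee_sum => i _; rewrite int_geZ//; last 3 first.
  - by rewrite exprn_ge0// invr_ge0 ltW.
  - exact: measurable_funX.
  - by move=> z; exact: sqr_ge0.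
  have := @block_energy_bound 0 i w J; rewrite normr0 => /(_ (ltW T00) w0) hb.
  apply: (le_trans (lee_wpmul2l _ hb)); first by rewrite lee_fin exprn_ge0// invr_ge0 ltW.
  rewrite -EFinM lee_fin; set W := \sum_(j < J) w j ^+ 2.
  have -> : (q ^+ i)^-1 ^+ 3 * (C1 * (q ^+ 8) ^+ i * W) = C1 * W * ((q ^+ 8) ^+ i * (q ^+ i)^-1 ^+ 3).
    by move: ((q ^+ i)^-1 ^+ 3) ((q ^+ 8) ^+ i) => x y; ring.
  apply: ler_wpM2l; first by rewrite mulr_ge0 ?lp_constant_ge0.
  rewrite exprVn -!exprM ler_pdivrMr ?exprn_gt0// -exprD; apply: ler_wiXn2l; [exact: ltW|exact: ltW|lia].
rewrite sumEFin lee_fin -mulr_sumr mulrC ler_wpM2r ?mulr_ge0 ?lp_constant_ge0//.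
exact: geometric_sum_le (ltW q0) q1.
Qed.

Lemma unit_cylinder_measurable (x0 : n.-tuple R) : measurable (unit_cylinder x0 : set position).
Proof.
have mh : measurable_fun setT (fun z : position => \sum_(i < n) (tnth z.1 i - tnth x0 i) ^+ 2).
  apply: measurable_sum => i; apply: measurable_funX; apply: measurable_funB => //.
  exact: (measurableT_comp (measurable_tnth i) measurable_fst).
have -> : unit_cylinder x0 = (fun z : position => \sum_(i < n) (tnth z.1 i - tnth x0 i) ^+ 2) @^-1` `]-oo, 1[%classic.
  by apply/seteqP; split=> z; rewrite /unit_cylinder /mkset/= in_itv/=.
by rewrite -[X in measurable X]setTI; apply: mh => //; exact: measurable_itv.
Qed.

Variable lambda : nat -> R.
Variable M : R.
Hypothesis lambdaM : forall J, \sum_(j < J) lambda j ^+ 2 <= M.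

Local Notation P := (partial_density lambda G).

Lemma measurable_partial_density J : measurable_fun setT (P J).
Proof.
by apply: measurable_sum => j; apply: measurable_funM => //; exact: measurable_sqmod (sqfun_cmeasurable _).
Qed.

(** [density_bound] with weights [|lambda k|] that vanish below [i]; the signs of the coefficients
    are lost to the triangle inequality only. *)
Lemma partial_density_increment i j : (i <= j)%N ->
  (\int[muM]_z ((P j z - P i z) ^+ 2)%:E <= (C0 * \sum_(i <= k < j) lambda k ^+ 2)%:E)%E.
Proof.
move=> ij; pose w k := `|lambda k| * (i <= k)%:R.
have w0 k : 0 <= w k by rewrite mulr_ge0.
have S (F : nat -> R) (G' : nat -> R) : (forall k, F k = (i <= k)%:R * G' k) -> \sum_(k < j) F k = \sum_(i <= k < j) G' k.
  move=> FG; rewrite -(big_mkord xpredT F) (@big_cat_nat _ _ _ i 0 j)//= big_nat_cond big1 => [|k].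
    rewrite add0r; apply: eq_big_nat => k /andP[ik _]; rewrite FG ik mul1r//.
  by rewrite andbT => /andP[_ ki]; rewrite FG leqNgt ki mul0r.
have := density_bound j w0.
rewrite (S (fun k => w k ^+ 2) (fun k => lambda k ^+ 2)) => [|k]; last first.
  by rewrite /w exprMn real_normK ?num_real// mulrC; case: leqP => _; rewrite ?expr1n ?expr0n.
apply: le_trans; apply: int_le.
- apply: measurable_funX; apply: measurable_funB; exact: measurable_partial_density.
- by move=> z; exact: sqr_ge0.
- apply: measurable_funX; apply: measurable_sum => k; apply: measurable_funM => //.
  exact: measurable_sqmod (sqfun_cmeasurable _).
move=> z; rewrite -(real_normK (num_real (P j z - P i z))) ler_pXn2r ?nnegrE//; last first.
  by apply: sumr_ge0 => k _; rewrite mulr_ge0// sqmod_ge0.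
rewrite /partial_density -!(big_mkord xpredT (fun k => lambda k * sqmod (L2repr (to_L2 (G k)) z))).
rewrite (@big_cat_nat _ _ _ i 0 j)//= addrAC subrr add0r.
rewrite (S (fun k => w k * sqmod (L2repr (to_L2 (G k)) z)) (fun k => `|lambda k| * sqmod (L2repr (to_L2 (G k)) z))) => [|k]; last by rewrite /w; ring.
apply: (le_trans (ler_norm_sum _ _ _)); apply: ler_sum => k _.
by rewrite normrM [X in _ * X]ger0_norm// sqmod_ge0.
Qed.

(** The partial densities are Cauchy in [L^2] of the whole space, and the restriction to the
    cylinder is made only at the end. The limit produced is complex-valued; its real part is the
    density. *)
Lemma density_limit (x0 : n.-tuple R) :
  (forall J, square_integrable_on (unit_cylinder x0) (P J)) /\
  exists2 rho, square_integrable_on (unit_cylinder x0) rho &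
    (\int[muM]_(z in unit_cylinder x0) ((P J z - rho z) ^+ 2)%:E)%E @[J --> \oo] --> 0%E.
Proof.
have mD := unit_cylinder_measurable x0; pose F J z := (P J z)%:C.
have mF J : cmeasurable (F J) by apply: cmeasurable_real; exact: measurable_partial_density.
have C0_ge0 : 0 <= C0.
  by rewrite mulr_ge0 ?lp_constant_ge0// exprn_ge0// invr_ge0 subr_ge0 ltW.
have incr i j : (i <= j)%N -> (N2 muM (fun z => (F j z - F i z)%R) <= (C0 * \sum_(i <= k < j) lambda k ^+ 2)%:E)%E.
  move=> ij; apply: le_trans (partial_density_increment ij).
  rewrite le_eqVlt; apply/orP; left; apply/eqP; apply: eq_integral => z _.
  by rewrite /F -rmorphB/= sqmod_real.
have F2 J : square_integrable muM (F J).
  split=> //; apply: (le_lt_trans _ (ltry (C0 * \sum_(0 <= k < J) lambda k ^+ 2))).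
  apply: le_trans (incr 0%N J (leq0n _)).
  rewrite le_eqVlt; apply/orP; left; apply/eqP; apply: eq_integral => z _.
  by congr (sqmod _)%:E; rewrite /F /partial_density big_ord0 subr0.
have cau (eps : R) : 0 < eps -> exists N, forall i j, (N <= i <= j)%N -> (N2 muM (fun z => (F j z - F i z)%R) <= eps%:E)%E.
  move=> e0; have c1 : 0 < C0 + 1 by lra.
  have [N hN] := bounded_sum_cauchy (fun j => sqr_ge0 (lambda j)) lambdaM (divr_gt0 e0 c1).
  exists N => i j Nij; have /andP[_ ij] := Nij; apply: (le_trans (incr _ _ ij)).
  rewrite lee_fin; apply: (@le_trans _ _ ((C0 + 1) * (eps / (C0 + 1)))).
    apply: ler_pM => //; [by apply: sumr_ge0 => k _; exact: sqr_ge0|by rewrite lerDl|by rewrite ltW// hN].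
  by rewrite mulrC divfK// gt_eqF.
have [v mv [vm _]] := riesz_fischer mF cau.
have v2 : square_integrable muM v := mean_limit_sqint F2 mv vm.
have mr : measurable_fun setT (fun z => Re (v z)) := mv.1.
have restr (h : position -> R) : measurable_fun setT h -> (\int[muM]_z (h z ^+ 2)%:E < +oo)%E -> square_integrable_on (unit_cylinder x0) h.
  move=> mh hoo; split; first exact: measurable_funTS.
  apply: le_lt_trans hoo; apply: ge0_subset_integral => //.
  - by apply/measurable_EFinP/measurable_funX.
  - by move=> z _; rewrite lee_fin sqr_ge0.
split.
  move=> J; apply: restr; first exact: measurable_partial_density.
  have := (F2 J).2; congr (_ < _)%E; apply: eq_integral => z _; by rewrite /F sqmod_real.
exists (fun z => Re (v z)).
  apply: restr => //; apply: le_lt_trans v2.2; apply: int_le => //.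
  - exact: measurable_funX.
  - by move=> z; exact: sqr_ge0.
  - exact: measurable_sqmod.
  - by move=> z; exact: Re_le_sqmod.
apply: (@squeeze_cvge _ _ _ _ (fun=> 0%E) _ (fun J => N2 muM (fun z => (F J z - v z)%R))).
- apply: nearW => J; rewrite integral_ge0/=; last by move=> z _; rewrite lee_fin sqr_ge0.
  have mi : measurable_fun setT (fun z => (P J z - Re (v z)) ^+ 2).
    by apply: measurable_funX; apply: measurable_funB => //; exact: measurable_partial_density.
  apply: (@le_trans _ _ (\int[muM]_z ((P J z - Re (v z)) ^+ 2)%:E)%E).
    apply: ge0_subset_integral => //; first exact/measurable_EFinP.
    by move=> z _; rewrite lee_fin sqr_ge0.
  apply: int_le => //.
  - by move=> z; exact: sqr_ge0.
  - exact: measurable_sqmod (cmeasurableB (mF J) mv).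
  - by move=> z; have := Re_le_sqmod (F J z - v z); rewrite cReB /F cRe_real.
- exact: cvg_cst.
- exact/mean_nullP.
Qed.

End Blocks.

(** * Pointwise convergence *)

Section Limits.
Context {R : realType}.

(** Connects the real description of complex limits with the topology of [R[i]^o] in which pointwise
    values are defined. *)
Lemma complex_cvgP (u : nat -> R[i]) (v : R[i]) : sqmod (u k - v) @[k --> \oo] --> (0 : R) ->
  (u : nat -> R[i]^o) k @[k --> \oo] --> (v : R[i]^o).
Proof.
move=> /cvgnP h; apply/cvgrPdist_lt => -[r r'] /=; rewrite ltcE/= => /andP[/eqP -> r0].
have [N hN] := h (r ^+ 2) (exprn_gt0 2 r0); exists N => // k /= Nk.
have := hN k Nk; rewrite subr0 ger0_norm ?sqmod_ge0// => uk.
rewrite distrC cmod_normE ltcR -(@ltr_pXn2r _ 2)// ?nnegrE ?cmod_ge0 ?ltW//.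
by rewrite cmod_sq.
Qed.

Lemma complex_cauchy_cvg (u : nat -> R[i]) (eps : nat -> R) : eps k @[k --> \oo] --> (0 : R) ->
  (forall i j, (i <= j)%N -> sqmod (u j - u i) <= eps i) ->
  exists2 v : R[i], (forall k, sqmod (u k - v) <= eps k) & (u : nat -> R[i]^o) k @[k --> \oo] --> (v : R[i]^o).
Proof.
move=> e0 ue; have comp (p : R[i] -> R) : (forall x y, p (x - y) = p x - p y) -> (forall x, p x ^+ 2 <= sqmod x) ->
    cvgn (fun k => p (u k)).
  move=> pB ple; apply: real_cauchy_cvg => c c0.
  have [N hN] := (cvgnP _ _).1 e0 (c ^+ 2) (exprn_gt0 2 c0); exists N => i j /andP[Ni ij].
  have := hN i Ni; rewrite subr0 => ei.
  rewrite -pB -(@ltr_pXn2r _ 2)// ?nnegrE ?ltW// real_normK ?num_real//.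
  apply: (le_lt_trans (ple _)); apply: (le_lt_trans (ue _ _ ij)); exact: le_lt_trans (ler_norm _) ei.
have /cvg_ex[/= a ha] := comp (fun z => Re z) (@cReB _) (@Re_le_sqmod _).
have /cvg_ex[/= b hb] := comp (fun z => Im z) (@cImB _) (@Im_le_sqmod _).
have uv : sqmod (u k - (a +i* b)) @[k --> \oo] --> (0 : R) := ccvgP (l := a +i* b) ha hb.
exists (a +i* b); last exact: complex_cvgP.
exact: (cauchy_subsequence (phi := id) (fun i j ij => ij) ue uv).
Qed.

(** For the path from a solution at time [t] to its truncation, to the truncation at time 0, and
    back to the full solution. *)
Lemma sqmod_path (a b c d : R[i]) :
  sqmod (a - d) <= 2 * sqmod (a - b) + 4 * sqmod (b - c) + 4 * sqmod (d - c).
Proof.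
have h1 := sqmodD_le (a - b) (b - d); have h2 := sqmodD_le (b - c) (c - d).
rewrite addrA subrK in h1; rewrite addrA subrK in h2; rewrite [sqmod (d - c)]sqmodBC.
move: (sqmod (a - d)) (sqmod (a - b)) (sqmod (b - d)) (sqmod (b - c)) (sqmod (c - d)) h1 h2 => *; lra.
Qed.

Lemma density_difference (w lambda : nat -> R) (x y : nat -> R[i]) (eta : R) J :
  0 < eta -> (forall j, `|lambda j| <= w j) ->
  `|\sum_(j < J) lambda j * sqmod (x j) - \sum_(j < J) lambda j * sqmod (y j)| <=
  eta * (\sum_(j < J) w j * sqmod (x j) + \sum_(j < J) w j * sqmod (y j)) +
  (1 + eta^-1) * \sum_(j < J) w j * sqmod (x j - y j).
Proof.
move=> eta0 lw; rewrite -sumrB; apply: (le_trans (ler_norm_sum _ _ _)).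
rewrite -big_split/= !mulr_sumr -big_split/=; apply: ler_sum => j _.
have w0 : 0 <= w j := le_trans (normr_ge0 _) (lw j).
rewrite -mulrBr normrM.
apply: (@le_trans _ _ (w j * `|sqmod (x j) - sqmod (y j)|)); first by rewrite ler_wpM2r.
apply: (le_trans (ler_wpM2l w0 (sqmodB_sqmod (x j) (y j) eta0))).
by move: (sqmod _) (sqmod _) (sqmod _) => a b c; rewrite le_eqVlt; apply/orP; left; apply/eqP; ring.
Qed.

(** Isolates what is needed at one point: weighted energies bounded uniformly in time, and
    continuity at 0 in the same weighted norm. Both are uniform in [J], so that they pass to the
    limit of the series. *)
Lemma density_series_continuous (w lambda : nat -> R) (V : R -> nat -> R[i]) (B T0 : R) :
  0 < T0 -> (forall j, `|lambda j| <= w j) ->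
  (forall t J, `|t| < T0 -> \sum_(j < J) w j * sqmod (V t j) <= B) ->
  (forall eps, 0 < eps -> exists2 delta, 0 < delta & forall t, `|t| < delta -> `|t| < T0 ->
    forall J, \sum_(j < J) w j * sqmod (V t j - V 0 j) <= eps) ->
  (forall t, `|t| < T0 -> cvgn (series (fun j => lambda j * sqmod (V t j)))) /\
  limn (series (fun j => lambda j * sqmod (V t j))) @[t --> (0 : R)^'] -->
    limn (series (fun j => lambda j * sqmod (V 0 j))).
Proof.
move=> T00 lw VB Vc.
have cvg t : `|t| < T0 -> cvgn (series (fun j => lambda j * sqmod (V t j))).
  move=> tT; apply: normed_cvg; apply: nondecreasing_is_cvgn.
    by apply: nondecreasing_series => j _ _; exact: normr_ge0.
  exists B => _ [J _ <-].
  rewrite -[X in X <= _]/(series (fun j => `|lambda j * sqmod (V t j)|) J) seriesEord; apply: le_trans (VB t J tT).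
  apply: ler_sum => j _; rewrite normrM [`|sqmod _|]ger0_norm ?sqmod_ge0//.
  by rewrite ler_wpM2r ?sqmod_ge0.
split=> //.
have T00' : `|0 : R| < T0 by rewrite normr0.
have B0 : 0 <= B by have := VB 0 0%N T00'; rewrite big_ord0.
apply/cvgrPdist_le => eps eps0.
(* The two energies, at most [B] each, cost [eta * (2 * B) <= eps / 2]; [c] is then chosen so that
   the remaining term is bounded by [eps / 2]. *)
pose eta := eps / (4 * B + 1).
have eta0 : 0 < eta by rewrite divr_gt0// ltr_wpDl// mulr_ge0.
pose c := eps / (2 * (1 + eta^-1)).
have i0 : 0 < 1 + eta^-1 by rewrite ltr_pwDl// invr_ge0 ltW.
have c0 : 0 < c by rewrite divr_gt0// mulr_gt0.
have [d dp hd] := Vc _ c0.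
have dT : 0 < Num.min d T0 by rewrite lt_min dp.
apply/nbhs_ballP; exists (Num.min d T0) => //= t; rewrite /ball/= sub0r normrN lt_min => /andP[td tT] _.
have cd : `|series (fun j => lambda j * sqmod (V t j)) J - series (fun j => lambda j * sqmod (V 0 j)) J| @[J --> \oo] -->
    `|limn (series (fun j => lambda j * sqmod (V t j))) - limn (series (fun j => lambda j * sqmod (V 0 j)))|.
  by apply: cvg_norm; apply: cvgB; exact: cvg.
rewrite distrC; apply: (cvgn_lec cd) => J; rewrite /= !seriesEord.
apply: (le_trans (density_difference (V t) (V 0) J eta0 lw)).
have := hd t td tT J; have := VB t J tT; have := VB 0 J T00'.
set x := \sum_(j < J) w j * sqmod (V 0 j); set y := \sum_(j < J) w j * sqmod (V t j); set v := \sum_(j < J) _.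
move: x y v => x y v hx hy hv.
apply: (@le_trans _ _ (eta * (B + B) + (1 + eta^-1) * c)).
  by apply: lerD; apply: ler_wpM2l => //; [exact: ltW|exact: lerD|exact: ltW].
have -> : (1 + eta^-1) * c = eps / 2.
  have E a : a != 0 -> a * (eps / (2 * a)) = eps / 2 by move=> a0; field.
  by apply: E; rewrite gt_eqF.
have : eta * (4 * B + 1) = eps by rewrite /eta divfK// gt_eqF// ltr_wpDl// mulr_ge0.
lra.
Qed.

End Limits.

(** [ae_bounded] applied to the increments, whose sums telescope. *)
Lemma monotone_ae_bounded d (T : measurableType d) (R : realType) (mu : {measure set T -> \bar R})
    (h : nat -> T -> R) (M : R) :
  (forall k, measurable_fun setT (h k)) -> (forall k x, 0 <= h k x) -> (forall k x, h k x <= h k.+1 x) ->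
  (forall k, \int[mu]_x (h k x)%:E <= M%:E)%E ->
  {ae mu, forall x, exists C : R, forall k, h k x <= C}.
Proof.
move=> mh h0 hS hM; pose a k x := h k.+1 x - h k x.
have a0 k x : 0 <= a k x by rewrite subr_ge0.
have ma k : measurable_fun setT (a k) by exact: measurable_funB.
have afin k : (\int[mu]_x (a k x)%:E)%E \is a fin_num.
  rewrite ge0_fin_numE; last exact: int_ge0.
  apply: le_lt_trans (ltry M); apply: le_trans (hM k.+1); apply: int_le => // x.
  by rewrite lerBlDr lerDl.
have tele n x : \sum_(k < n) a k x = h n x - h 0%N x.
  by rewrite -(big_mkord xpredT (fun k => a k x)) /a telescope_sumr.
have cM n : \sum_(k < n) fine (\int[mu]_x (a k x)%:E)%E <= M.
  rewrite -lee_fin -sumEFin; under eq_bigr do rewrite fineK//.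
  rewrite -ge0_integral_sum//; last 2 first.
  - by move=> k; exact/measurable_EFinP.
  - by move=> k x _; rewrite lee_fin.
  apply: le_trans (hM n); rewrite (eq_integral (fun x => (h n x - h 0%N x)%:E)) => [|x _].
    apply: int_le => //; last by move=> x; rewrite lerBlDr lerDl.
      exact: measurable_funB.
    by move=> x; rewrite -tele; apply: sumr_ge0.
  by rewrite sumEFin tele.
have H := @ae_bounded _ _ _ mu a (fun k => fine (\int[mu]_x (a k x)%:E)%E) M ma a0.
apply: filterS (H _ cM) => [x [C hC]|k]; last by rewrite fineK.
by exists (C + h 0%N x) => k; rewrite -lerBlDr -tele.
Qed.

Section Continuity.
Context {R : realType} {n m : nat}.
Local Notation position := (position R n m).
Local Notation frequency := (frequency R n m).
Local Notation muF := (frequency_measure R n m).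

Lemma sqmod_cis_sub (x y : R) : sqmod (cis x - cis y) = 2 - 2 * cos (2 * pi * (x - y)).
Proof.
rewrite /sqmod/= mulrBr cosB; have := cos2Dsin2 (2 * pi * x); have := cos2Dsin2 (2 * pi * y).
by move: (cos _) (sin _) (cos _) (sin _) => a b c d h1 h2; nra.
Qed.

Lemma cis_continuous (eps : R) : 0 < eps -> exists2 delta, 0 < delta &
  forall x y, `|x - y| < delta -> sqmod (cis x - cis y) < eps.
Proof.
move=> eps0; have e2 : 0 < eps / 2 by rewrite divr_gt0.
have /cvgrPdist_lt/(_ _ e2)[d /= d0 hd] := @continuous_cos R 0.
have p0 : 0 < 2 * pi :> R by rewrite mulr_gt0// pi_gt0.
exists (d / (2 * pi)) => [|x y xy]; first exact: divr_gt0.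
have /hd : ball 0 d (2 * pi * (x - y)).
  rewrite /ball/= sub0r normrN normrM (gtr0_norm p0) mulrC -ltr_pdivlMr//.
rewrite cos0 sqmod_cis_sub ltr_norml => /andP[_]; lra.
Qed.

Lemma frequency_sq_box N (x : frequency) : frequency_box N x -> frequency_sq x <= (n + m)%:R * (N%:R * N%:R).
Proof.
by move=> xN; have := frequency_dot_bound xN xN; rewrite frequency_dotss mulrA; apply: le_trans; exact: ler_norm.
Qed.

Variables (e : nat -> frequency -> R[i]) (phi : frequency -> R[i]) (beta : R) (N : nat).
Hypothesis e2 : forall j, square_integrable muF (e j).
Hypothesis eo : forall i j, cintegral muF (fun x => (e i x)^* * e j x) = (i == j)%:R.
Hypotheses (mphi : cmeasurable phi).
Hypothesis phib : forall x, cmod (phi x) <= beta * \1_(@frequency_box R n m N) x.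

(** The difference at two times is, up to conjugation, the pairing of [e j] with one function [u] of
    small norm, because frequencies are bounded on the box. Bessel's inequality makes the estimate
    uniform in [J], and nothing in it depends on [z]. *)
Lemma evolved_continuous (eps : R) : 0 < eps -> exists2 delta, 0 < delta &
  forall t t', `|t - t'| < delta -> forall z J,
    \sum_(j < J) sqmod (evolved e phi t j z - evolved e phi t' j z) <= eps.
Proof.
move=> eps0; pose B := @frequency_box R n m N.
have [mB fB] : measurable B /\ (muF B < +oo)%E by have [/(_ N)] := frequency_kernel R n m.
pose V := fine (muF B); have V0 : 0 <= V by exact/fine_ge0/measure_ge0.
(* Chosen so that [c * beta ^ 2 * V <= eps]; the added ones keep the denominator positive. *)
pose c := eps / ((beta ^+ 2 + 1) * (V + 1)).
have b1 : 0 < beta ^+ 2 + 1 by rewrite ltr_wpDl ?sqr_ge0.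
have c0 : 0 < c by rewrite divr_gt0// mulr_gt0// ltr_wpDl.
have [d d0 hd] := cis_continuous c0.
pose Y : R := (n + m)%:R * (N%:R * N%:R) + 1.
have Y0 : 0 < Y by rewrite ltr_wpDl ?mulr_ge0.
exists (d / Y) => [|t t' tt z J]; first exact: divr_gt0.
pose w tau x := cis (phase z x + tau * frequency_sq x).
have mw tau : cmeasurable (w tau).
  exact: (cmeasurable_pair1 z (cmeasurable_wave (t := fun=> tau) (measurable_cst tau))).
pose u x := ((w t x - w t' x) * phi x)^*.
have mu_ : cmeasurable u by apply: cmeasurable_conj; apply: cmeasurableM => //; exact: cmeasurableB.
have ub x : sqmod (u x) <= c * beta ^+ 2 * \1_B x.
  rewrite sqmod_conj sqmodM; have := phib x; rewrite indicE.
  have [xB|_] := boolP (x \in _); rewrite ?mulr1 ?mulr0 => hx; last by rewrite (cmod_le0 hx) sqmod0 mulr0.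
  have beta0 : 0 <= beta := le_trans (cmod_ge0 _) hx.
  apply: ler_pM; rewrite ?sqmod_ge0//; last by rewrite sqmod_le_sqr.
  apply/ltW/hd; rewrite opprD addrACA subrr add0r -mulrBl normrM.
  have xY : frequency_sq x < Y by rewrite /Y ltr_pwDr// frequency_sq_box//; exact: set_mem.
  rewrite (ger0_norm (frequency_sq_ge0 x)).
  apply: (@le_lt_trans _ _ (`|t - t'| * Y)); first by rewrite ler_wpM2l// ltW.
  by rewrite -ltr_pdivlMr.
have N2u : (N2 muF u <= eps%:E)%E.
  apply: (@le_trans _ _ (\int[muF]_x (c * beta ^+ 2 * \1_B x)%:E)%E).
    by apply: int_le => //; [exact: measurable_sqmod|move=> x; exact: sqmod_ge0|apply: measurable_funM].
  have cb0 : 0 <= c * beta ^+ 2 by rewrite mulr_ge0 ?sqr_ge0// ltW.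
  rewrite int_geZ//.
  rewrite integral_indic// setIT -(fineK (x := muF B)) ?ge0_fin_numE// -/V -EFinM lee_fin.
  have -> : eps = c * (beta ^+ 2 + 1) * (V + 1).
    by rewrite /c -mulrA divfK// gt_eqF// mulr_gt0// ltr_wpDl.
  by apply: ler_pM => //; [apply: ler_wpM2l; [exact: ltW|rewrite lerDl]|rewrite lerDl].
have u2 : square_integrable muF u by split=> //; exact: le_lt_trans N2u (ltry _).
have oE : orthonormal_seq (fun j => L2of muF (e j)) by move=> i j; rewrite (L2_innerof (e2 i) (e2 j)) eo.
apply: (@le_trans _ _ (nsq (L2of muF u))); last by rewrite -lee_fin nsq_L2of.
apply: le_trans (bessel_ineq (orthonormal_orthounit oE) (L2of muF u) J).
apply: ler_sum => j _; rewrite (L2_innerof (e2 j) u2) le_eqVlt; apply/orP; left; apply/eqP.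
have ip := piece_cintegrable e2 mphi phib j.
have iw tau : cintegrable muF (fun x => w tau x * piece e phi j x).
  apply: (cintegrable_le _ (cintegrable_cmod ip)) => [|x]; last by rewrite cmodM cmod_cis mul1r.
  by apply: cmeasurableM => //; exact: cintegrable_cmeasurable ip.
rewrite -[RHS]sqmod_conj -cintegral_conj; last exact: cintegrableJM (e2 j) u2.
rewrite /evolved -(cintegralB (iw t) (iw t')); congr sqmod; apply: eq_cintegral => x.
by rewrite /u -rmorphM/= conjCK /piece; ring.
Qed.

End Continuity.

(** * Bounds over all times and continuity at almost every point *)

Section Pointwise.
Context {R : realType} {n m : nat}.
Local Notation position := (position R n m).
Local Notation frequency := (frequency R n m).
Local Notation muM := (position_measure R n m).
Local Notation muF := (frequency_measure R n m).
Local Notation sobolev := (@sobolev R n m).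
Variables (eta1 : R -> R) (s T0 : R).
Hypotheses (smooth : smooth_cutoff eta1) (s0 : 0 < s) (d0 : (0 < n + m)%N).
Hypothesis sd : (n + m).+1%:R < 4 * s.
Hypothesis T00 : 0 < T0.
Hypothesis T0h : forall t', `|t'| <= T0 -> forall x, 0 <= x < 1 -> 1 / 2 <= cos (2 * pi * (- (t' * x))).
Variables (e : nat -> frequency -> R[i]).
Hypothesis e2 : forall j, square_integrable muF (e j).
Hypothesis eo : forall i j, cintegral muF (fun x => (e i x)^* * e j x) = (i == j)%:R.

Local Notation block := (block eta1 s e).
Local Notation q := (lp_ratio (n := n) (m := m) s).
Local Notation C1 := (lp_constant (n := n) (m := m) s).

Let q0 : 0 < q. Proof. exact: lp_ratio_gt0. Qed.
Let q1 : q < 1. Proof. exact: lp_ratio_lt1. Qed.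

Let phib i (x : frequency) := lp_symbol_bound smooth s0 i x.
Let mphi i := @cmeasurable_lp_symbol R n m eta1 s smooth i.
Let box_gt0 i : (0 < lp_box i)%N. Proof. by rewrite expn_gt0. Qed.

(* Strictly positive weights allow a coefficient of the density to vanish and still control each
   single function. *)
Variables (w : nat -> R) (W : R).
Hypotheses (w0 : forall j, 0 < w j) (wW : forall J, \sum_(j < J) w j ^+ 2 <= W).

Let W0 : 0 <= W. Proof. by have := wW 0; rewrite big_ord0. Qed.

Lemma weight_le j : w j <= W + 1.
Proof.
have : w j ^+ 2 <= W by apply: le_trans (wW j.+1); rewrite big_ord_recr/= lerDr; apply: sumr_ge0 => k _; exact: sqr_ge0.
by have := sqr_ge0 (w j - 1); rewrite sqrrB expr1n mulr1 => h1 h2; have := w0 j; lra.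
Qed.

(** Countably many times, dense in the interval, suffice by continuity of the blocks. Indices that
    decode to no rational, or to one outside the interval, are sent to the harmless time 0. *)
Definition rational_time (k : nat) : R :=
  if unpickle k is Some r then if `|ratr r : R| <= T0 then ratr r else 0 else 0.

Lemma rational_time_le k : `|rational_time k| <= T0.
Proof.
rewrite /rational_time; case: unpickle => [r|]; last by rewrite normr0 ltW.
by case: ifP => // _; rewrite normr0 ltW.
Qed.

Lemma rational_time_dense t delta : 0 < delta -> `|t| < T0 -> exists k, `|t - rational_time k| < delta.
Proof.
move=> dl tT; have [] := rat_in_itvoo (x := Num.max (t - delta) (- T0)) (y := Num.min (t + delta) T0).
  by move: tT; rewrite ltr_norml lt_min !gt_max => /andP[h1 h2]; apply/andP; split; apply/andP; split; lra.
move=> r; rewrite in_itv/= lt_min gt_max => /andP[/andP[r1 r2] /andP[r3 r4]].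
exists (pickle r); rewrite /rational_time pickleK ifT; first by rewrite ltr_norml; lra.
by rewrite ler_norml !ltW.
Qed.

(** The squares of the maximal energies of all blocks are divided by [q ^ (4 i)] and added up. The
    integrals still decay like [q ^ (4 i)], so that the sum is bounded, and it increases with [J];
    boundedness at almost every point follows. *)
Lemma energy_ae : {ae muM, forall z, exists C : R, forall k i J,
  \sum_(j < J) w j * sqmod (block (rational_time k) i j z) <= C * (q ^+ 2) ^+ i}.
Proof.
pose E i J z := maximal_energy e (lp_symbol eta1 s i) w rational_time J z.
have E0 i J z : 0 <= E i J z by apply: maximal_energy_ge0 => j; exact: ltW.
have q4 i : 0 < (q ^+ (4 * i))^-1 by rewrite invr_gt0 exprn_gt0.
pose h J z := \sum_(i < J) (q ^+ (4 * i))^-1 * E i J z ^+ 2.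
have mE i J : measurable_fun setT (E i J).
  exact: (measurable_maximal_energy e2 (mphi i) (phib i) w rational_time J).
have Emono i J z : E i J z <= E i J.+1 z.
  by apply: maximal_energy_mono => j; exact: ltW.
have t0 i J z : 0 <= (q ^+ (4 * i))^-1 * E i J z ^+ 2 by rewrite mulr_ge0 ?sqr_ge0// ltW.
have mt i J : measurable_fun setT (fun z => (q ^+ (4 * i))^-1 * E i J z ^+ 2).
  by apply: measurable_funM => //; exact: measurable_funX.
have hM J : (\int[muM]_z (h J z)%:E <= (C1 * W * (1 - q)^-1)%:E)%E.
  rewrite /h; under eq_integral do rewrite -sumEFin.
  rewrite ge0_integral_sum//; last 2 first.
  - by move=> i; apply/measurable_EFinP; exact: mt.
  - by move=> i z _; rewrite lee_fin.
  apply: (@le_trans _ _ (\sum_(i < J) (C1 * W * q ^+ i)%:E)%E).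
    apply: lee_sum => i _; rewrite int_geZ//; last 3 first.
    - exact: ltW.
    - exact: measurable_funX.
    - by move=> z; exact: sqr_ge0.
    have hb := maximal_bound T0h e2 eo (mphi i) (lp_size_gt0 s i) (box_gt0 i) d0 (phib i) (fun j => ltW (w0 j)) rational_time_le J.
    apply: (le_trans (lee_wpmul2l _ hb)); first by rewrite lee_fin ltW.
    rewrite -EFinM lee_fin lp_constantE; set S := \sum_(j < J) w j ^+ 2.
    have -> : (q ^+ (4 * i))^-1 * (C1 * (q ^+ 8) ^+ i * S) = C1 * S * ((q ^+ 8) ^+ i * (q ^+ (4 * i))^-1).
      by move: (q ^+ (4 * i))^-1 ((q ^+ 8) ^+ i) => x y; ring.
    have S0 : 0 <= S by apply: sumr_ge0 => j _; exact: sqr_ge0.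
    have C10 := @lp_constant_ge0 R n m s.
    apply: ler_pM; [by rewrite mulr_ge0| |by apply: ler_wpM2l => //; exact: wW|].
      by rewrite mulr_ge0 ?(ltW (q4 _))// !exprn_ge0// ltW.
    rewrite -!exprM ler_pdivrMr ?exprn_gt0// -exprD; apply: ler_wiXn2l; [exact: ltW|exact: ltW|lia].
  rewrite sumEFin lee_fin -mulr_sumr ler_wpM2l ?mulr_ge0 ?lp_constant_ge0//.
  exact: geometric_sum_le (ltW q0) q1.
have hS J z : h J z <= h J.+1 z.
  rewrite /h big_ord_recr/=; apply: (@le_trans _ _ (\sum_(i < J) (q ^+ (4 * i))^-1 * E i J.+1 z ^+ 2)); last first.
    by rewrite lerDl.
  apply: ler_sum => i _; apply: ler_wpM2l; first exact: ltW.
  by rewrite ler_pXn2r ?nnegrE.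
have mh J : measurable_fun setT (h J) by apply: measurable_sum => i; exact: mt.
have h0 J z : 0 <= h J z by apply: sumr_ge0 => i _; exact: t0.
have H := monotone_ae_bounded (mu := muM) mh h0 hS hM.
apply: filterS H => z [C hC]; exists (C + 1) => k i J.
(* In [h] one index limits functions, times and blocks together; [J'] is large enough for all
   three. *)
pose J' := (maxn J (maxn i k)).+1.
have iJ : (i < J')%N by rewrite /J' ltnS; lia.
have h1 : (q ^+ (4 * i))^-1 * E i J' z ^+ 2 <= C.
  by apply: le_trans (hC J'); rewrite /h (bigD1 (Ordinal iJ))//= lerDl; apply: sumr_ge0.
have C_ge0 : 0 <= C by apply: le_trans h1.
have h2 : E i J' z <= (C + 1) * (q ^+ 2) ^+ i.
  rewrite -(ler_pXn2r (n := 2))// ?nnegrE//; last by rewrite mulr_ge0 ?exprn_ge0 ?addr_ge0// ltW.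
  have -> : ((C + 1) * (q ^+ 2) ^+ i) ^+ 2 = (C + 1) ^+ 2 * q ^+ (4 * i).
    by rewrite exprMn -!exprM; congr (_ * q ^+ _); lia.
  move: h1; rewrite mulrC ler_pdivrMr ?exprn_gt0// => /le_trans; apply.
  by rewrite ler_wpM2r ?exprn_ge0 ?(ltW q0)// sqrrD expr1n mulr1; have := sqr_ge0 C; lra.
apply: le_trans h2; apply: (@le_trans _ _ (energy e (lp_symbol eta1 s i) w J' (rational_time k) z)).
  have JJ : (J <= J')%N by rewrite /J'; lia.
  rewrite /energy -!(big_mkord xpredT (fun j => w j * sqmod (evolved _ _ _ j z))) (@big_cat_nat _ _ _ J 0 J')//= lerDl.
  by apply: sumr_ge0 => j _; rewrite mulr_ge0 ?sqmod_ge0// ltW.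
by apply: maximal_energy_ge; rewrite /J'; lia.
Qed.

(** A rational time close enough to [t], depending on the block, changes the energy by at most
    [q ^ (2 i)]. The tolerance is divided by [2 (W + 1)] because the weights are at most [W + 1] and
    the square of a sum costs a factor 2. *)
Lemma energy_all_times z (C : R) :
  (forall k i J, \sum_(j < J) w j * sqmod (block (rational_time k) i j z) <= C * (q ^+ 2) ^+ i) ->
  forall t i J, `|t| < T0 -> \sum_(j < J) w j * sqmod (block t i j z) <= (2 * C + 1) * (q ^+ 2) ^+ i.
Proof.
move=> hC t i J tT; have Wp : 0 < 2 * (W + 1) by rewrite mulr_gt0// ltr_wpDl.
have p0 : 0 < (q ^+ 2) ^+ i by rewrite !exprn_gt0.
have [d dp hd] := evolved_continuous e2 eo (mphi i) (phib i) (divr_gt0 p0 Wp).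
have [k kt] := rational_time_dense dp tT.
apply: (@le_trans _ _ (2 * \sum_(j < J) w j * sqmod (block (rational_time k) i j z) +
    2 * (W + 1) * \sum_(j < J) sqmod (block t i j z - block (rational_time k) i j z))).
  rewrite !mulr_sumr -big_split/=; apply: ler_sum => j _.
  set x := block t i j z; set y := block _ i j z.
  have := sqmodD_le y (x - y); rewrite [y + _]addrC subrK => h.
  apply: (le_trans (ler_wpM2l (ltW (w0 j)) h)).
  have := ler_wpM2r (sqmod_ge0 (x - y)) (weight_le j).
  by move: (sqmod y) (sqmod (x - y)) => a b ab; lra.
have -> : (2 * C + 1) * (q ^+ 2) ^+ i = 2 * (C * (q ^+ 2) ^+ i) + (q ^+ 2) ^+ i by ring.
apply: lerD; first by apply: ler_wpM2l => //; exact: hC.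
by rewrite mulrC -ler_pdivlMr//; exact: hd.
Qed.

Section GoodPoint.
Variables (z : position) (C : R).
Hypothesis zC : forall t i J, `|t| < T0 -> \sum_(j < J) w j * sqmod (block t i j z) <= C * (q ^+ 2) ^+ i.

Local Notation U t l j := (\sum_(i < l.+1) block t i j z).
Let tau l := C * (q ^+ l.+1 / (1 - q)) ^+ 2.

Let tau_cvg0 : tau l @[l --> \oo] --> (0 : R).
Proof. by have := geometric_cvg0 q0 q1 C; rewrite -(cvg_shiftS (fun k => C * (q ^+ k / (1 - q)) ^+ 2)); exact. Qed.

Let C0 : 0 <= C.
Proof. by have := @zC 0 0%N 0%N; rewrite big_ord0 expr0 mulr1 normr0; apply. Qed.

Let tau0 l : 0 <= tau l. Proof. by rewrite mulr_ge0 ?sqr_ge0. Qed.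

Lemma partial_tail t J k l : `|t| < T0 -> (k <= l)%N -> \sum_(j < J) w j * sqmod (U t l j - U t k j) <= tau k.
Proof.
move=> tT kl; have H := @energy_tail _ _ q0 q1 w (fun i j => block t i j z) C J (fun j => ltW (w0 j)) (fun i => zC i J tT) k.+1 l.+1 kl.
apply: le_trans H; apply: ler_sum => j _; rewrite -!(big_mkord xpredT (fun i => block t i j z)).
by rewrite (@big_cat_nat _ _ _ k.+1 0 l.+1)//= addrAC subrr add0r.
Qed.

(** Coincides with [schrodinger_at] once the regularized values are rewritten as sums of blocks. *)
Definition good_limit t j : R[i] := limn ((fun l => U t l j) : nat -> R[i]^o).
Local Notation V := good_limit.

(** The tail of one function is at most the weighted tail divided by [w j]; here the weights have to
    be strictly positive. *)
Lemma good_limit_cvg t j : `|t| < T0 -> ((fun l => U t l j) : nat -> R[i]^o) l @[l --> \oo] --> (V t j : R[i]^o) /\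
  sqmod (U t l j - V t j) @[l --> \oo] --> (0 : R).
Proof.
move=> tT; have e0 : (tau k / w j) @[k --> \oo] --> (0 : R).
  by rewrite -(mul0r (w j)^-1); apply: cvgM => //; exact: cvg_cst.
have [|v hv cv] := complex_cauchy_cvg (u := fun l => U t l j) e0.
  move=> k l kl; rewrite ler_pdivlMr// mulrC; apply: le_trans (partial_tail j.+1 tT kl).
  rewrite [leRHS]big_ord_recr/= lerDr; apply: sumr_ge0 => i _.
  by rewrite mulr_ge0 ?sqmod_ge0// ltW.
have -> : V t j = v by exact: cvg_lim cv.
split=> //; apply: (cvg0_le _ e0) => l; rewrite ger0_norm ?sqmod_ge0//; exact: hv.
Qed.

Lemma good_tail t J l : `|t| < T0 -> \sum_(j < J) w j * sqmod (V t j - U t l j) <= tau l.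
Proof.
move=> tT; have c : \sum_(j < J) w j * sqmod (U t (l' + l)%N j - U t l j) @[l' --> \oo] --> \sum_(j < J) w j * sqmod (V t j - U t l j).
  apply: cvg_big => [|j _]; first exact: add_continuous.
  apply: cvgM; first exact: cvg_cst.
  apply: (sqmodB_cvg (u := fun l' => U t (l' + l)%N j)).
  by rewrite (cvg_shiftn l (fun l' => sqmod (U t l' j - V t j))); case: (good_limit_cvg j tT).
apply: (cvgn_lec c) => l'; apply: partial_tail => //; exact: leq_addl.
Qed.

Let B := 2 * (C + tau 0%N).

Lemma good_sum t J : `|t| < T0 -> \sum_(j < J) w j * sqmod (V t j) <= B.
Proof.
move=> tT; have h1 := good_tail J 0 tT; have := zC 0 J tT; rewrite expr0 mulr1 => h2.
apply: (@le_trans _ _ (2 * (\sum_(j < J) w j * sqmod (block t 0 j z) + \sum_(j < J) w j * sqmod (V t j - U t 0 j)))); last first.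
  by rewrite ler_wpM2l// lerD.
rewrite -big_split/= mulr_sumr; apply: ler_sum => j _; rewrite big_ord1.
set x := V t j; set y := block t 0 j z.
have := sqmodD_le y (x - y); rewrite [y + _]addrC subrK => /(ler_wpM2l (ltW (w0 j))).
by rewrite -mulrDr mulrCA.
Qed.

(** Induction on the number of blocks. Each block is continuous uniformly in [J], and boundedness of
    the weights turns the unweighted estimate into a weighted one. *)
Lemma partial_continuous l (eps : R) : 0 < eps -> exists2 delta, 0 < delta &
  forall t, `|t| < delta -> forall J, \sum_(j < J) w j * sqmod (U t l j - U 0 l j) <= eps.
Proof.
elim: l eps => [|l IH] eps eps0; have Wp : 0 < W + 1 by rewrite ltr_wpDl.
  have [d dp hd] := evolved_continuous e2 eo (mphi 0) (phib 0) (divr_gt0 eps0 Wp).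
  exists d => // t td J.
  have := hd t 0; rewrite subr0 => /(_ td z J); rewrite ler_pdivlMr// => /(le_trans _); apply.
  rewrite mulrC mulr_sumr; apply: ler_sum => j _; rewrite !big_ord1.
  by apply: ler_wpM2r; [exact: sqmod_ge0|exact: weight_le].
have e4 : 0 < eps / 4 by rewrite divr_gt0.
have [d1 d10 h1] := IH _ e4.
have [d2 d20 h2] := evolved_continuous e2 eo (mphi l.+1) (phib l.+1) (divr_gt0 e4 Wp).
exists (Num.min d1 d2) => [|t]; first by rewrite lt_min d10.
rewrite lt_min => /andP[td1 td2] J.
have H1 := h1 t td1 J; have H2 := h2 t 0; rewrite subr0 in H2.
have {}H2 := H2 td2 z J; rewrite ler_pdivlMr// in H2.
apply: (@le_trans _ _ (2 * (\sum_(j < J) w j * sqmod (U t l j - U 0 l j)) +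
  2 * ((\sum_(j < J) sqmod (block t l.+1 j z - block 0 l.+1 j z)) * (W + 1)))).
  rewrite mulr_suml !mulr_sumr -big_split/=; apply: ler_sum => j _.
  rewrite ![\sum_(i < l.+2) _]big_ord_recr/= opprD addrACA.
  set x := _ - U 0 l j; set y := _ - block 0 _ j z.
  have := ler_wpM2l (ltW (w0 j)) (sqmodD_le x y); move=> /le_trans; apply.
  have := ler_wpM2r (sqmod_ge0 y) (weight_le j).
  by move: (sqmod x) (sqmod y) => a b ab; lra.
move: H1 H2; set X := \sum_(j < J) _ * _; set Y := _ * (W + 1); rewrite -/Y; lra.
Qed.

Lemma good_continuous (eps : R) : 0 < eps -> exists2 delta, 0 < delta &
  forall t, `|t| < delta -> `|t| < T0 -> forall J, \sum_(j < J) w j * sqmod (V t j - V 0 j) <= eps.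
Proof.
(* The path from time [t] to time 0 has coefficients 2, 4 and 4, so that the three contributions add
   up to at most [10 / 16] of [eps]. *)
move=> eps0; have e16 : 0 < eps / 16 by rewrite divr_gt0.
have [N hN] := (cvgnP _ _).1 tau_cvg0 _ e16.
have := hN N (leqnn _); rewrite subr0 ger0_norm// => tN.
have [d d0' hd] := partial_continuous N e16.
exists d => // t td tT J; have T00' : `|0 : R| < T0 by rewrite normr0.
have H1 := good_tail J N tT; have H2 := good_tail J N T00'; have H3 := hd t td J.
apply: (@le_trans _ _ (2 * \sum_(j < J) w j * sqmod (V t j - U t N j) +
    4 * \sum_(j < J) w j * sqmod (U t N j - U 0 N j) + 4 * \sum_(j < J) w j * sqmod (V 0 j - U 0 N j))); last by lra.
rewrite !mulr_sumr -!big_split/=; apply: ler_sum => j _.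
apply: (le_trans (ler_wpM2l (ltW (w0 j)) (sqmod_path (V t j) (U t N j) (U 0 N j) (V 0 j)))).
move: (sqmod _) (sqmod _) (sqmod _) => a b c.
by rewrite le_eqVlt; apply/orP; left; apply/eqP; ring.
Qed.

Variable lambda : nat -> R.
Hypothesis lw : forall j, `|lambda j| <= w j.

Lemma good_density :
  (forall t, `|t| < T0 -> cvgn (series (fun j => lambda j * sqmod (V t j)))) /\
  limn (series (fun j => lambda j * sqmod (V t j))) @[t --> (0 : R)^'] -->
    limn (series (fun j => lambda j * sqmod (V 0 j))).
Proof. exact: (density_series_continuous T00 lw good_sum good_continuous). Qed.

End GoodPoint.

End Pointwise.

(** With [a = |lambda| ^ alpha], each [lambda ^ 2] is [a * a ^ (2 / alpha - 1)]; the exponent is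
    nonnegative and every [a j] is at most the total sum, so the second factor is bounded. *)
Lemma square_summable (R : realType) (lambda : nat -> R) (alpha : R) : 0 < alpha -> alpha < 2 ->
  (\sum_(j <oo) (`|lambda j| `^ alpha)%:E < +oo)%E ->
  exists M, forall J, \sum_(j < J) lambda j ^+ 2 <= M.
Proof.
move=> a0 a2 loo; pose a j := `|lambda j| `^ alpha.
have a_ge0 j : 0 <= a j by exact: powR_ge0.
have := nneseries_le_fine a_ge0 loo; set S := fine _ => aS.
have aj j : a j <= S.
  by apply: le_trans (aS j.+1); rewrite big_ord_recr/= lerDr; apply: sumr_ge0.
exists (S * S `^ (2 / alpha - 1)) => J; apply: (@le_trans _ _ (\sum_(j < J) a j * S `^ (2 / alpha - 1))).
  apply: ler_sum => j _.
  have -> : lambda j ^+ 2 = a j * (a j) `^ (2 / alpha - 1).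
    rewrite -(real_normK (num_real (lambda j))) /a; have [->|l0] := eqVneq `|lambda j| 0.
      by rewrite expr0n/= powR0 ?mul0r// gt_eqF.
    have lj : 0 < `|lambda j| by rewrite lt_neqAle eq_sym l0 normr_ge0.
    rewrite -{1}[_ `^ alpha]powRr1 ?powR_ge0// -powRD; last by apply/implyP => _; rewrite gt_eqF// powR_gt0.
    by rewrite addrC subrK -powRrM mulrC divfK ?gt_eqF// powR_mulrn.
  apply: ler_wpM2l => //; apply: ge0_ler_powR; rewrite ?nnegrE//; last exact: le_trans (aj j).
  by rewrite subr_ge0 ler_pdivlMr// mul1r ltW.
by rewrite -mulr_suml ler_wpM2r ?powR_ge0.
Qed.

(** * Application to the spectral family *)

Section Convergence.
Context {R : realType} {n m : nat}.
Local Notation position := (position R n m).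
Local Notation frequency := (frequency R n m).
Local Notation muM := (position_measure R n m).
Local Notation muF := (frequency_measure R n m).
Local Notation sobolev := (@sobolev R n m).
Variables (eta1 : R -> R) (s : R).
Hypotheses (smooth : smooth_cutoff eta1) (s0 : 0 < s) (d0 : (0 < n + m)%N).
Hypothesis sd : (n + m).+1%:R < 4 * s.
Variables (f : nat -> L2 muM) (lambda : nat -> R) (M : R).
Hypotheses (fo : orthonormal_seq f) (lambdaM : forall J, \sum_(j < J) lambda j ^+ 2 <= M).

Let e j (x : frequency) : R[i] := L2repr (fourier (f j)) x.

Let e2 j : square_integrable muF (e j).
Proof. exact: (sobolev0_sqint _).1 (sqfunP _). Qed.

Let eo i j : cintegral muF (fun x => (e i x)^* * e j x) = (i == j)%:R.
Proof. by rewrite -fo -fourier_inner L2_innerr sobolev0_cintegral. Qed.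

Let g j : sobolev s := bessel (- s) (fourier (f j)).

Let ge j : {ae muF, forall x, L2repr (g j) x = (japanese (- s) x)%:C * e j x}.
Proof. exact: bessel_ae (addNr s) _. Qed.

(** The evolved family is again orthonormal, so that the density at any time [t], even beyond [T0],
    is covered by the result for blocks at time 0. *)
Let et t j (x : frequency) : R[i] := cis (t * frequency_sq x) * e j x.

Let get t j : {ae muF, forall x, L2repr (schrodinger t (g j)) x = (japanese (- s) x)%:C * et t j x}.
Proof.
apply: filterS2 (schrodinger_ae t (g j)) (ge j) => x h1 h2; rewrite h1 h2 /et; ring.
Qed.

Let mcis t : cmeasurable (fun x : frequency => cis (t * frequency_sq x)).
Proof.
by apply: cmeasurable_cis; apply: measurable_funM => //; exact: measurable_frequency_sq.
Qed.

Let et2 t j : square_integrable muF (et t j).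
Proof.
have me : cmeasurable (et t j) by apply: cmeasurableM; [exact: mcis|case: (e2 j)].
by apply: (square_integrable_le me (e2 j)) => x; rewrite sqmodM sqmod_cis mul1r.
Qed.

Let eto t i j : cintegral muF (fun x => (et t i x)^* * et t j x) = (i == j)%:R.
Proof.
rewrite -eo; apply: eq_cintegral => x; rewrite /et rmorphM/= mulrACA conjM_sqmod sqmod_cis.
by rewrite mul1r.
Qed.

Lemma density_exists (x0 : n.-tuple R) :
  (forall J, square_integrable_on (unit_cylinder x0) (partial_density lambda g J)) /\
  exists2 rho, square_integrable_on (unit_cylinder x0) rho &
    (\int[muM]_(z in unit_cylinder x0) ((partial_density lambda g J z - rho z) ^+ 2)%:E)%E @[J --> \oo] --> 0%E.
Proof.
have [T0 T00 T0h] := @cos_half R.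
exact: (density_limit smooth s0 d0 sd T00 T0h e2 eo ge lambdaM).
Qed.

Lemma evolved_density_exists t (x0 : n.-tuple R) :
  (forall J, square_integrable_on (unit_cylinder x0) (partial_density lambda (fun j => schrodinger t (g j)) J)) /\
  exists2 rho, square_integrable_on (unit_cylinder x0) rho &
    (\int[muM]_(z in unit_cylinder x0)
      ((partial_density lambda (fun j => schrodinger t (g j)) J z - rho z) ^+ 2)%:E)%E @[J --> \oo] --> 0%E.
Proof.
have [T0 T00 T0h] := @cos_half R.
exact: (density_limit smooth s0 d0 sd T00 T0h (et2 t) (eto t) (get t) lambdaM).
Qed.

Lemma regularizedE t j z l : regularized_schrodinger eta1 t (g j) z l = \sum_(i < l.+1) block eta1 s e t i j z.
Proof.
have mc : cmeasurable (fun x => (product_cutoff eta1 (2 ^+ l) x)%:C * cis (phase z x + t * frequency_sq x)).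
  apply: cmeasurableM; first exact: cmeasurable_real (measurable_cutoff smooth l).
  exact: (cmeasurable_pair1 z (cmeasurable_wave (t := fun=> t) (measurable_cst t))).
rewrite -(phase_cutoff smooth s0 e2); apply: ae_eq_cintegral.
- by apply: cmeasurableM => //; exact: sqfun_cmeasurable.
- by apply: cmeasurableM => //; exact: (cmeasurableM (cmeasurable_real (measurable_japanese _)) (e2 j).1).
by apply: filterS (ge j) => x ->.
Qed.

Lemma density_converges : {ae muM, forall z,
  (\forall t \near (0 : R), density_exists_at eta1 lambda g t z) /\
  density_at eta1 lambda g t z @[t --> (0 : R)^'] --> density_at eta1 lambda g 0 z}.
Proof.
have [T0 T00 T0h] := @cos_half R.
(* The added geometric term makes the weights positive and keeps them square summable: as
   [2 ^ -j <= 1], the square of [w j] is at most [2 (lambda j ^ 2 + 2 ^ -j)]. *)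
pose w j := `|lambda j| + 2^-1 ^+ j.
have w0 j : 0 < w j by rewrite ltr_wpDl// exprn_gt0// invr_gt0.
have h1 : 2^-1 < 1 :> R by rewrite invf_lt1// ltr1n.
have wW J : \sum_(j < J) w j ^+ 2 <= 2 * (M + (1 - 2^-1)^-1).
  apply: (@le_trans _ _ (2 * (\sum_(j < J) lambda j ^+ 2 + \sum_(j < J) 2^-1 ^+ j))).
    rewrite -big_split/= mulr_sumr; apply: ler_sum => j _; rewrite /w -(real_normK (num_real (lambda j))).
    have p0 : 0 <= 2^-1 ^+ j :> R by rewrite exprn_ge0// invr_ge0.
    have p1 : 2^-1 ^+ j <= 1 :> R by rewrite exprn_ile1// ?invr_ge0// ltW.
    by move: (2^-1 ^+ j) p0 p1 `|lambda j| => p p0 p1 x; have := sqr_ge0 (x - p); nra.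
  by rewrite ler_wpM2l// lerD// geometric_sum_le// invr_ge0.
have lw j : `|lambda j| <= w j by rewrite lerDl exprn_ge0// invr_ge0.
have H := energy_ae smooth s0 d0 sd T00 T0h e2 eo w0 wW.
apply: filterS H => z [C hC].
have zC := energy_all_times smooth s0 e2 eo w0 wW hC.
have [dc dl] := good_density smooth s0 sd T00 e2 eo w0 wW zC lw.
have VE t j : schrodinger_at eta1 t (g j) z = good_limit eta1 s e z t j.
  by rewrite /schrodinger_at /good_limit; congr (limn (_ : nat -> R[i]^o)); apply/funext => l; exact: regularizedE.
have sE t : density_series eta1 lambda g t z = series (fun j => lambda j * sqmod (good_limit eta1 s e z t j)).
  by rewrite /density_series; congr series; apply/funext => j; rewrite VE.
split.
  apply/nbhs_ballP; exists T0 => //= t; rewrite /ball/= sub0r normrN => tT; split.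
    move=> j; have [cv _] := good_limit_cvg sd w0 zC j tT.
    rewrite (_ : regularized_schrodinger _ _ _ _ = fun l => \sum_(i < l.+1) block eta1 s e t i j z); last first.
      by apply/funext => l; exact: regularizedE.
    by apply/cvg_ex; exists (good_limit eta1 s e z t j).
  by rewrite sE; exact: dc.
rewrite /density_at sE; under eq_fun do rewrite sE; exact: dl.
Qed.

End Convergence.
Theorem corollary1p10 (R : realType) (n m : nat) (s alpha : R)
    (eta1 : R -> R) (gamma0 : sobolev n m (- s) -> sobolev n m s) :
  (1 <= n)%N -> (1 <= m)%N ->
  (n + m)%:R / 4 + (n + m)%:R / (2 * (n + m + 2)%:R) < s ->
  s < (n + m)%:R / 2 ->
  1 <= alpha -> alpha < 2 ->
  smooth_cutoff eta1 ->
  sobolev_schatten alpha gamma0 ->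
  self_adjoint gamma0 ->
  (exists lambda f, spectral_decomposition alpha gamma0 lambda f) /\
  forall (lambda : nat -> R) (f : nat -> L2 (position_measure R n m)),
    spectral_decomposition alpha gamma0 lambda f ->
    let g : nat -> sobolev n m s := fun j => bessel (- s) (fourier (f j)) in
    [/\ density_well_defined gamma0 lambda g,
        forall t : R, density_well_defined (evolution t gamma0) lambda
          (fun j => schrodinger t (g j)) &
        {ae position_measure R n m, forall z,
          (\forall t \near (0 : R), density_exists_at eta1 lambda g t z) /\
          density_at eta1 lambda g t z @[t --> (0 : R)^'] -->
            density_at eta1 lambda g 0 z}].

Proof.
move=> n1 m1 sl _ a1 a2 smooth sch sa.
have a0 : 0 < alpha by rewrite (lt_le_trans _ a1).
have d0 : (0 < n + m)%N by rewrite addn_gt0 n1.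
have d2 : 2 <= (n + m)%:R :> R by rewrite (ler_nat _ 2); lia.
(* For [d = n + m >= 2] the quantity [d / (2 (d + 2))] is at least [1 / 4], so that the assumed
   lower bound on [s] exceeds [(d + 1) / 4]. *)
have sd : (n + m).+1%:R < 4 * s.
  have : 1 / 2 * (1 / 2) <= (n + m)%:R / (2 * (n + m + 2)%:R) :> R.
    rewrite [(n + m + 2)%:R]natrD; set d := (n + m)%:R in d2 *; rewrite ler_pdivlMr; lra.
  rewrite -[(n + m).+1%:R]natr1; have key (d X : R) : d / 4 + X < s -> 1 / 2 * (1 / 2) <= X -> d + 1 < 4 * s by move=> *; lra.
  exact: key sl.
have s0 : 0 < s by have : 0 <= (n + m).+1%:R :> R by []; lra.
split; first exact: spectral_exists.
move=> lambda f sp g; have [loo fo _] := sp.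
have [M lM] := square_summable a0 a2 loo.
have st := spectral_strong sp.
split.
- split; first exact: st.
  exact: (density_exists smooth s0 d0 sd fo lM).
- move=> t; split; first exact: evolution_strong.
  exact: (evolved_density_exists smooth s0 d0 sd fo lM).
have := density_converges smooth s0 d0 sd fo lM. exact.
Qed.
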